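(* Let $\Omega\subset\mathbb{R}^2$ be a bounded domain and $L>0$ a constant, and let $E_\varepsilon$ be as in the context. Let $\{u_\varepsilon\}_{\varepsilon>0}\subset H^1(\Omega;\mathbb{R}^2)$ be a sequence (with $\varepsilon\to0$) such that $E_\varepsilon(u_\varepsilon)\le C$ with $C$ independent of $\varepsilon$. Then there exist a subsequence (still denoted $u_\varepsilon$) and a function $u\in H_{\mathrm{div}}(\Omega;\mathbb{S}^1\cup\{0\})$ with $|u|\in BV(\Omega;\{0,1\})$ such that $$u_\varepsilon\rightharpoonup u\ \text{ weakly in }H_{\mathrm{div}}(\Omega;\mathbb{R}^2)\qquad\text{and}\qquad u_\varepsilon\to u\ \text{ strongly in }L^2(\Omega;\mathbb{R}^2).$$
   Context: $E_\varepsilon(u):=\frac12\int_\Omega\big(\frac1\varepsilon W(u)+\varepsilon|\nabla u|^2+L(\operatorname{div}u)^2\big)\,dx$, where $W(u)=V(|u|)$ and $V:[0,\infty)\to[0,\infty)$ is continuous, vanishes only at $0$ and $1$, and satisfies, for some constant $c>0$, $\min(t^2,|1-t^2|)\le c\sqrt{V(t)}$ for all $t\ge0$. $H_{\mathrm{div}}(\Omega;\mathbb{R}^2)$ is the Hilbert space of $u\in L^2(\Omega;\mathbb{R}^2)$ with distributional divergence in $L^2(\Omega)$; $H_{\mathrm{div}}(\Omega;\mathbb{S}^1\cup\{0\})$ is its subset of fields with values a.e. in $\mathbb{S}^1\cup\{0\}$. *)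

(* Defs.v *)
(* Built on MathComp and MathComp-Analysis. *)
From HB Require Import structures.
From mathcomp Require Import all_boot all_order all_algebra.
From mathcomp Require Import all_classical all_reals all_analysis.

Set Implicit Arguments.
Unset Strict Implicit.
Unset Printing Implicit Defensive.

Import Order.TTheory GRing.Theory Num.Theory.
Import numFieldNormedType.Exports.

Local Open Scope classical_set_scope.
Local Open Scope ring_scope.

Section Defs.
Context {R : realType}.

Local Notation plane := (R * R)%type.

Definition leb2 : {measure set (measurableTypeR R * measurableTypeR R) -> \bar R} :=
  (@lebesgue_measure R \x @lebesgue_measure R)%E.

(* The library norm on [R * R] is the sup norm, so the Euclidean one is
   spelled out. *)
Definition enorm (z : plane) : R := Num.sqrt (z.1 ^+ 2 + z.2 ^+ 2).

Definition e1 : plane := (1, 0).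
Definition e2 : plane := (0, 1).

Fixpoint Ck (k : nat) (f : plane -> R) : Prop :=
  continuous f /\
  (if k is k'.+1 then
     [/\ forall x, derivable f x e1, forall x, derivable f x e2,
         Ck k' (fun x => 'D_e1 f x) & Ck k' (fun x => 'D_e2 f x)]
   else True).

(* Compactly supported functions on Omega are represented by their extension
   by zero to the whole plane. *)
Definition compact_support_in (Omega : set plane) (f : plane -> R) : Prop :=
  compact (closure [set x | f x != 0]) /\
  closure [set x | f x != 0] `<=` Omega.

Definition C1c (Omega : set plane) (f : plane -> R) : Prop :=
  Ck 1 f /\ compact_support_in Omega f.

Definition Cinfc (Omega : set plane) (f : plane -> R) : Prop :=
  (forall k, Ck k f) /\ compact_support_in Omega f.

(* Functions on Omega are total functions whose values outside Omega are
   irrelevant; [f \_ Omega] replaces these values by 0. *)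
Definition Lp (p : \bar R) (Omega : set plane) (f : plane -> R) : Prop :=
  (f \_ Omega) \in Lfun leb2 p.

Definition L2vec (Omega : set plane) (u : plane -> plane) : Prop :=
  Lp 2%:E Omega (fst \o u) /\ Lp 2%:E Omega (snd \o u).

Definition L2norm (Omega : set plane) (u : plane -> plane) : \bar R :=
  'N[leb2]_2%:E[EFin \o ((enorm \o u) \_ Omega)].

Definition is_weak_derive (Omega : set plane) (v : plane)
    (f g : plane -> R) : Prop :=
  Lp 2%:E Omega g /\
  forall phi, Cinfc Omega phi ->
    \int[leb2]_(x in Omega) (f x * 'D_v phi x) =
    - \int[leb2]_(x in Omega) (g x * phi x).

Definition is_weak_div (Omega : set plane)
    (u : plane -> plane) (g : plane -> R) : Prop :=
  Lp 2%:E Omega g /\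
  forall phi, Cinfc Omega phi ->
    \int[leb2]_(x in Omega)
       ((u x).1 * 'D_e1 phi x + (u x).2 * 'D_e2 phi x) =
    - \int[leb2]_(x in Omega) (g x * phi x).

(* A representative of the distributional derivative (resp. divergence) when
   it belongs to L^2; the junk value 0 otherwise. *)
Definition weak_derive (Omega : set plane) (v : plane) (f : plane -> R) :
  plane -> R := xget (cst 0) [set g | is_weak_derive Omega v f g].

Definition weak_div (Omega : set plane) (u : plane -> plane) : plane -> R :=
  xget (cst 0) [set g | is_weak_div Omega u g].

Definition H1 (Omega : set plane) (f : plane -> R) : Prop :=
  [/\ Lp 2%:E Omega f,
      exists g, is_weak_derive Omega e1 f g &
      exists g, is_weak_derive Omega e2 f g].

Definition H1vec (Omega : set plane) (u : plane -> plane) : Prop :=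
  H1 Omega (fst \o u) /\ H1 Omega (snd \o u).

Definition Hdiv (Omega : set plane) (u : plane -> plane) : Prop :=
  L2vec Omega u /\ exists g, is_weak_div Omega u g.

Definition Hdiv_inner (Omega : set plane) (u v : plane -> plane) : R :=
  \int[leb2]_(x in Omega)
    ((u x).1 * (v x).1 + (u x).2 * (v x).2
     + weak_div Omega u x * weak_div Omega v x).

Definition Hdiv_weak_cvg (Omega : set plane)
    (un : nat -> plane -> plane) (u : plane -> plane) : Prop :=
  forall v, Hdiv Omega v ->
    Hdiv_inner Omega (un n) v @[n --> \oo] --> Hdiv_inner Omega u v.

Definition L2_cvg (Omega : set plane)
    (un : nat -> plane -> plane) (u : plane -> plane) : Prop :=
  L2norm Omega (fun x => un n x - u x) @[n --> \oo] --> (0 : \bar R).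

Definition ae_valued_in (Omega : set plane) (T : Type)
    (f : plane -> T) (A : set T) : Prop :=
  {ae leb2, forall x, Omega x -> A (f x)}.

Definition circle0 : set plane := [set z | enorm z = 1] `|` [set 0].

Definition total_variation (Omega : set plane) (f : plane -> R) : \bar R :=
  ereal_sup [set t | exists phi : plane -> plane,
    [/\ C1c Omega (fst \o phi), C1c Omega (snd \o phi),
        forall x, enorm (phi x) <= 1 &
        t = (\int[leb2]_(x in Omega)
               (f x * ('D_e1 (fst \o phi) x + 'D_e2 (snd \o phi) x)))%:E]].

Definition BV (Omega : set plane) (f : plane -> R) : Prop :=
  Lp 1%:E Omega f /\ (total_variation Omega f < +oo)%E.

Definition grad_sq (Omega : set plane) (u : plane -> plane) (x : plane) : R :=
  weak_derive Omega e1 (fst \o u) x ^+ 2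
  + weak_derive Omega e2 (fst \o u) x ^+ 2
  + weak_derive Omega e1 (snd \o u) x ^+ 2
  + weak_derive Omega e2 (snd \o u) x ^+ 2.

Definition energy (V : R -> R) (L : R) (Omega : set plane) (eps : R)
    (u : plane -> plane) : \bar R :=
  ((2^-1)%:E * \int[leb2]_(x in Omega)
     (eps^-1 * V (enorm (u x)) + eps * grad_sq Omega u x
      + L * weak_div Omega u x ^+ 2)%:E)%E.

Definition admissible_potential (V : R -> R) : Prop :=
  [/\ {within `[0, +oo[, continuous V},
      forall t, 0 <= t -> 0 <= V t,
      forall t, 0 <= t -> (V t = 0 <-> t = 0 \/ t = 1) &
      exists2 c : R, 0 < c &
        forall t, 0 <= t ->
          Num.min (t ^+ 2) `|1 - t ^+ 2| <= c * Num.sqrt (V t)].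

Definition bounded_domain (Omega : set plane) : Prop :=
  [/\ open Omega, connected Omega, Omega !=set0 & bounded_set Omega].

End Defs.

(* Main.v *)
Require Import Defs.
From HB Require Import structures.
From mathcomp Require Import all_boot all_order all_algebra.
From mathcomp Require Import all_classical all_reals all_analysis.
From mathcomp Require Import measurable_realfun lebesgue_integral_under.
From mathcomp Require Import ring lra zify.
Import Order.TTheory GRing.Theory Num.Theory.
Import numFieldNormedType.Exports.
Local Open Scope classical_set_scope.
Local Open Scope ring_scope.

(** Proof idea. Convolve [u_n] at a scale so small that the resulting smooth
    fields [v_n] satisfy [int |v_n - u_n|^2 <= 2 eps_n]. Two vector fields [Phi]
    and [Psi] on the plane, extending the degree-three Jin-Kohn entropies from
    the circle, have a Jacobian which is a multiple of the identity up to an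
    error [om(|z|^2) = O(sqrt (V |z|))]. Hence [div Phi(v_n)] is bounded by
    [|div v_n|] plus [om |grad v_n| <= om^2 / eps_n + eps_n |grad v_n|^2], that
    is, in L1 by the energy, and likewise for [Psi]. Write [D] for the increment
    along a vector [h]. Differentiating [t |-> int chi det(Phi(v_n(x + t h)) -
    Phi(v_n(x)), D Psi(v_n))] and integrating by parts shows that
    [int chi det(D Phi(v_n), D Psi(v_n))] is [O(|h|)]. On [S^1 u {0}] this
    determinant dominates the fourth power of the increment, so the [v_n] are
    equicontinuous in local L2 up to a vanishing error, and their weak L2 limit
    is a strong one. As [|u|^2 <= 1 + m(u)], with [m(u)] going to 0 in L1, no mass
    concentrates at the boundary of [Omega], so the convergence is global. Finally
    a function [ramp] equal to [|.|] on [S^1 u {0}] has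
    [|grad (ramp v_n)| = O(om |grad v_n|)], bounded in L1, which makes [|u|] a BV
    function. *)

Set Implicit Arguments.
Unset Strict Implicit.
Unset Printing Implicit Defensive.

(** * Weak sequential compactness *)

(** The gradient is controlled only with the weight [eps n], so compactness has to come from
    functions of the field whose divergence is still bounded in L1. For a function [G] of [v] this
    asks that the Jacobian of [G] be scalar at the values [S^1 u {0}]: then [div G(v)] is a multiple
    of [div v] plus an error that the potential pays for. One such function is not enough, since
    what the argument produces is a determinant of two increments. The cubic pair gives
    [(9 |z - w|^2 - |z^3 - w^3|^2) / 256] on the circle, which is nonnegative because cubing is
    3-Lipschitz there. The value 0 is the new obstacle: the coefficients must also degenerate at the
    origin, fast enough for all errors to be bounded by [om], which vanishes at both 0 and 1. The
    chain rule is applied to smooth fields only, whence the convolution; its scale depends on [n]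
    because its squared error reappears divided by [eps n]. In the end weak convergence is upgraded
    at a fixed scale, where convolution turns it into strong convergence, and the bound on
    increments makes the passage back to scale 0 uniform in [n]. *)

Definition extraction (k : nat -> nat) := forall m n, (m < n)%N -> (k m < k n)%N.

Lemma extraction_ge k : extraction k -> forall n, (n <= k n)%N.
Proof. by move=> hk; elim=> [//|n IH]; exact: leq_ltn_trans (hk _ _ (ltnSn n)). Qed.

Lemma extraction_comp k l : extraction k -> extraction l -> extraction (k \o l).
Proof. by move=> hk hl m n mn /=; apply: hk; exact: hl. Qed.

Lemma extractionS k : (forall n, (k n < k n.+1)%N) -> extraction k.
Proof.
move=> hk m n; elim: n => // n IH; rewrite ltnS leq_eqVlt => /predU1P[->//|/IH h].
exact: ltn_trans h (hk n).
Qed.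

Lemma extraction_cvg (k : nat -> nat) : extraction k -> k n @[n --> \oo] --> \oo.
Proof.
move=> hk; apply/cvgnyPge => A; exists A => // n /= An.
exact: leq_trans An (extraction_ge hk n).
Qed.

Lemma cvg_extraction (T : topologicalType) (a : nat -> T) (l : T) k : extraction k ->
  a n @[n --> \oo] --> l -> a (k n) @[n --> \oo] --> l.
Proof. by move=> hk al; apply: (cvg_comp _ _ (extraction_cvg hk) al). Qed.

Lemma extraction_frequently (P : nat -> Prop) :
  (forall N, exists2 n, (N <= n)%N & P n) ->
  exists2 k, extraction k & forall n, P (k n).
Proof.
move=> freq.
have /choice [g hg] : forall N, exists n, (N <= n)%N /\ P n.
  by move=> N; have [n] := freq N; exists n.
have gN N : (N <= g N)%N by case: (hg N).
have Pg N : P (g N) by case: (hg N).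
pose k := fix k n := if n is n'.+1 then g (k n').+1 else g 0%N.
exists k; last by case=> [|n] /=; exact: Pg.
by apply: extractionS => n /=; exact: gN.
Qed.

(** * Bolzano-Weierstrass and diagonal extraction *)

Section bolzano.
Context {R : realType}.
Implicit Types a : nat -> R.

Lemma bolzano_weierstrass a C : (forall n, `|a n| <= C) ->
  exists2 k, extraction k & exists l : R, a (k n) @[n --> \oo] --> l.
Proof.
move=> aC.
have /(_ (a @ \oo)) : compact `[-C, C]%classic := @segment_compact R (- C) C.
case.
  by exists 0%N => // n _ /=; rewrite in_itv/= -ler_norml.
move=> l [_ lcl].
have freq (p : nat) N : exists2 n, (N <= n)%N & `|l - a n| < p.+1%:R^-1.
  have [] := lcl (a @` [set n | (N <= n)%N]) (ball l p.+1%:R^-1).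
  - by exists N => // n /= Nn; exists n.
  - exact: nbhsx_ballx.
  - by move=> _ [[n /= Nn <-] bl]; exists n.
have /choice [g hg] : forall pN : nat * nat, exists n, (pN.2 <= n)%N /\ `|l - a n| < pN.1.+1%:R^-1.
  by case=> p N; have [n ? ?] := freq p N; exists n.
pose k := fix k n := if n is n'.+1 then g (n'.+1, (k n').+1) else g (0%N, 0%N).
have kx : extraction k by apply: extractionS => n /=; case: (hg (n.+1, (k n).+1)).
exists k => //; exists l; apply/cvgrPdist_lt => e e0.
near=> n.
suff kn : forall n, `|l - a (k n)| < n.+1%:R^-1.
  apply: lt_trans (kn n) _.
  by near: n; exact: (near_infty_natSinv_lt (PosNum e0)).
by case=> [|q] /=; [case: (hg (0%N, 0%N))|case: (hg (q.+1, (k q).+1))].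
Unshelve. all: by end_near. Qed.

Lemma diagonal_extraction (a : nat -> nat -> R) (C : nat -> R) :
  (forall m n, `|a m n| <= C m) ->
  exists2 k, extraction k & forall m, exists l : R, a m (k n) @[n --> \oo] --> l.
Proof.
move=> aC.
have /choice [bw hbw] : forall p : nat * (nat -> nat), exists k, extraction k /\
    exists l : R, a p.1 (p.2 (k n)) @[n --> \oo] --> l.
  case=> m K; have [|k ? ?] := @bolzano_weierstrass (fun n => a m (K n)) (C m).
    by move=> n; exact: aC.
  by exists k.
pose K := fix K m := if m is m'.+1 then K m' \o bw (m', K m') else id.
have Kx m : extraction (K m).
  by elim: m => // m IH /=; apply: extraction_comp => //; case: (hbw (m, K m)).
have KS m : exists2 j, extraction j & K m.+1 = K m \o j.
  by exists (bw (m, K m)) => //; case: (hbw (m, K m)).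
have Kadd m p : exists2 j, extraction j & K (m + p)%N = K m \o j.
  elim: p => [|p [j xj Kj]]; first by exists id => //; rewrite addn0.
  have [j' xj' Kj'] := KS (m + p)%N.
  by exists (j \o j'); [exact: extraction_comp|rewrite addnS Kj' Kj].
exists (fun n => K n n).
  apply: extractionS => n; have [j xj ->] := KS n => /=.
  by apply: Kx; apply: leq_trans (extraction_ge xj n.+1).
move=> m; have [l al] : exists l : R, a m (K m.+1 n) @[n --> \oo] --> l.
  by case: (hbw (m, K m)).
exists l.
have /choice [j hj] : forall p, exists j, (p <= j)%N /\ K (m.+1 + p)%N p = K m.+1 j.
  move=> p; have [j xj ->] := Kadd m.+1 p; exists (j p); split => //.
  exact: extraction_ge.
(* From rank [m.+1] on the diagonal reads [K m.+1] at some index [i n >= n - m.+1], which tends to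
   infinity; below that rank [i n] is a mere filler. *)
have /choice [i hi] : forall n, exists i, (n - m.+1 <= i)%N /\ ((m.+1 <= n)%N -> K n n = K m.+1 i).
  move=> n; case: (leqP m.+1 n) => [mn|nm]; last by exists n; split => //; exact: leq_subr.
  have [q xq Kq] := Kadd m.+1 (n - m.+1)%N.
  exists (q n); split; first by rewrite (leq_trans (leq_subr _ _))// extraction_ge.
  by move=> _; rewrite -{1}(subnKC mn) Kq.
have io : i n @[n --> \oo] --> \oo.
  apply/cvgnyPge => A; exists (A + m.+1)%N => // n /= An.
  by case: (hi n) => + _; apply: leq_trans; lia.
apply: cvg_trans (cvg_comp _ _ io al).
apply: near_eq_cvg; near=> n => /=; case: (hi n) => _ ->//.
by near: n; exists m.+1.
Unshelve. all: by end_near. Qed.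

End bolzano.

Lemma cvg0_near_le (R : realType) (f : nat -> R) (d : R) : 0 < d -> f n @[n --> \oo] --> (0 : R) ->
  \forall n \near \oo, f n <= d.
Proof.
move=> d0 /cvgrPdist_le /(_ _ d0); apply: filterS => n.
by rewrite sub0r normrN; apply: le_trans; exact: ler_norm.
Qed.

(** The form may be degenerate and its laws are asked on the domain [D] only, so that square
    integrable functions can be used as they are, without passing to classes modulo null sets. *)
Record semi_inner (R : realType) (V : lmodType R) (D : V -> Prop)
    (ip : V -> V -> R) : Prop := SemiInner {
  siD : forall f g, D f -> D g -> D (f + g);
  siZ : forall a f, D f -> D (a *: f);
  ipC : forall f g, D f -> D g -> ip f g = ip g f;
  ipDl : forall f g h, D f -> D g -> D h -> ip (f + g) h = ip f h + ip g h;
  ipZl : forall a f h, D f -> D h -> ip (a *: f) h = a * ip f h;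
  ip_ge0 : forall f, D f -> 0 <= ip f f }.

(** * Weak compactness for a complete, possibly degenerate, inner product *)

Section hilbert.
Context {R : realType} {V : lmodType R} {D : V -> Prop} {ip : V -> V -> R}.
Hypothesis S : semi_inner D ip.

Lemma siN f : D f -> D (- f).
Proof. by move=> Df; rewrite -scaleN1r; exact: (siZ S). Qed.

Lemma siB f g : D f -> D g -> D (f - g).
Proof. by move=> Df Dg; apply: (siD S) => //; exact: siN. Qed.

Lemma ipNl f h : D f -> D h -> ip (- f) h = - ip f h.
Proof. by move=> Df Dh; rewrite -scaleN1r (ipZl S)// mulN1r. Qed.

Lemma ipBl f g h : D f -> D g -> D h -> ip (f - g) h = ip f h - ip g h.
Proof. by move=> Df Dg Dh; rewrite (ipDl S)// ?ipNl//; exact: siN. Qed.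

Lemma ipBr f g h : D f -> D g -> D h -> ip h (f - g) = ip h f - ip h g.
Proof.
by move=> *; rewrite !(ipC S (f:=h))// ?ipBl//; exact: siB.
Qed.

Lemma ipDr f g h : D f -> D g -> D h -> ip h (f + g) = ip h f + ip h g.
Proof.
by move=> *; rewrite !(ipC S (f:=h))// ?(ipDl S)//; exact: (siD S).
Qed.

Lemma ipZr a f h : D f -> D h -> ip h (a *: f) = a * ip h f.
Proof. by move=> *; rewrite !(ipC S (f:=h))// ?(ipZl S)//; exact: (siZ S). Qed.

Lemma ip_sqrB f g : D f -> D g ->
  ip (f - g) (f - g) = ip f f - 2 * ip f g + ip g g.
Proof.
move=> Df Dg; have Dfg := siB Df Dg.
by rewrite ipBl// !ipBr// (ipC S (f:=g) (g:=f))//; ring.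
Qed.

Lemma ip_sqrD f g : D f -> D g ->
  ip (f + g) (f + g) = ip f f + 2 * ip f g + ip g g.
Proof.
move=> Df Dg; have Dfg := siD S Df Dg.
by rewrite (ipDl S)// !ipDr// (ipC S (f:=g) (g:=f))//; ring.
Qed.

Lemma ip_CS f g : D f -> D g -> ip f g ^+ 2 <= ip f f * ip g g.
Proof.
move=> Df Dg.
have q t : 0 <= ip f f - 2 * (t * ip f g) + t ^+ 2 * ip g g.
  have Dt := siZ S t Dg.
  have := ip_ge0 S (siB Df Dt).
  by rewrite ip_sqrB// ipZr// (ipZl S)// ipZr//; lra.
have := ip_ge0 S Dg; rewrite le_eqVlt => /predU1P[g0|g0].
- rewrite -g0 mulr0; have [->|B0] := eqVneq (ip f g) 0; first by rewrite expr0n.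
  (* When [ip g g = 0] the quadratic is affine in [t]; this [t] would give it the negative value
     [- ip f f - 2]. *)
  have := q ((ip f f + 1) / ip f g); rewrite -g0 mulr0 addr0 divfK//.
  by have := ip_ge0 S Df; lra.
- have := q (ip f g / ip g g).
  rewrite -(pmulr_rge0 _ g0).
  set A := ip f f; set B := ip f g; set G := ip g g in g0 *.
  have -> : G * (A - 2 * (B / G * B) + (B / G) ^+ 2 * G) = A * G - B ^+ 2.
    by field; rewrite gt_eqF.
  by rewrite subr_ge0.
Qed.

Lemma cvg_ip (f : nat -> V) g h : (forall n, D (f n)) -> D g -> D h ->
  ip (f n - g) (f n - g) @[n --> \oo] --> 0 ->
  ip (f n) h @[n --> \oo] --> ip g h.
Proof.
move=> Df Dg Dh fg; apply/cvgrPdist_le => e e0.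
move/cvgrPdist_le : fg => /(_ (e ^+ 2 / (ip h h + 1))) []//.
  by rewrite divr_gt0// ?exprn_gt0// ltr_wpDl// (ip_ge0 S).
move=> N _ fN; exists N => // n /fN; rewrite /= sub0r normrN.
have Dfg := siB (Df n) Dg.
rewrite ger0_norm ?(ip_ge0 S)// ler_pdivlMr ?ltr_wpDl ?(ip_ge0 S)// => fn.
rewrite distrC -ipBl// -(@ler_pXn2r _ 2)// ?nnegrE ?normr_ge0 ?(ltW e0)//.
rewrite real_normK ?num_real//;  apply: le_trans (ip_CS Dfg Dh) _.
apply: le_trans fn; rewrite ler_wpM2l ?(ip_ge0 S)//; lra.
Qed.

(* Closing under midpoints is enough: the minimal norm argument uses no other
   convex combination. *)
Inductive midhull (f : nat -> V) (N : nat) : V -> Prop :=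
| midhull_base n : (N <= n)%N -> midhull f N (f n)
| midhull_mid g h : midhull f N g -> midhull f N h ->
    midhull f N (2^-1 *: (g + h)).

Lemma midhull_le f N M g : (N <= M)%N -> midhull f M g -> midhull f N g.
Proof.
move=> NM; elim=> [n Mn|? ? _ ? _ ?]; last exact: midhull_mid.
by apply: midhull_base; exact: leq_trans Mn.
Qed.

Lemma midhull_dom f N g : (forall n, D (f n)) -> midhull f N g -> D g.
Proof. by move=> Df; elim=> // *; apply: (siZ S); exact: (siD S). Qed.

Lemma midhull_near f N g h l e : (forall n, D (f n)) -> D h ->
  (forall n, (N <= n)%N -> `|l - ip (f n) h| <= e) ->
  midhull f N g -> `|l - ip g h| <= e.
Proof.
move=> Df Dh fe; elim=> [n|a b ha + hb]; first exact: fe.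
have Da := midhull_dom Df ha; have Db := midhull_dom Df hb.
rewrite (ipZl S)// ?(ipDl S)//; last exact: (siD S).
by rewrite !ler_norml => /andP[? ?] /andP[? ?]; apply/andP; split; lra.
Qed.

Hypothesis complete : forall f : nat -> V, (forall n, D (f n)) ->
  (forall e : R, 0 < e -> exists N, forall m n, (N <= m)%N -> (N <= n)%N ->
     ip (f m - f n) (f m - f n) <= e) ->
  exists2 g, D g & ip (f n - g) (f n - g) @[n --> \oo] --> 0.

(** The infimum [d N] of the squared norm over the hull of the tail from [N] on increases to a
    finite limit, which forces almost minimal elements of these nested hulls to be a Cauchy
    sequence. The strong limits of averages obtained here identify the weak limits later. *)
Lemma mazur (f : nat -> V) C : (forall n, D (f n)) ->
  (forall n, ip (f n) (f n) <= C) ->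
  exists y g, [/\ forall N, midhull f N (y N), D g &
     ip (y n - g) (y n - g) @[n --> \oo] --> 0].
Proof.
move=> Df fC.
have C0 : 0 <= C by apply: le_trans (ip_ge0 S (Df 0%N)) (fC 0%N).
pose E N := [set r | exists2 g, midhull f N g & r = ip g g].
have E0 N : E N !=set0 by exists (ip (f N) (f N)); exists (f N) => //; exact: midhull_base.
have lbE N : lbound (E N) 0.
  by move=> _ [g /(midhull_dom Df) Dg ->]; exact: (ip_ge0 S).
have hE N : has_inf (E N) by split => //; exists 0.
pose d N := inf (E N).
have dle N M : (N <= M)%N -> d N <= d M.
  move=> NM; apply: lb_le_inf => // _ [g hg ->].
  by apply: ge_inf; [exact: (hE N).2|exists g => //; exact: midhull_le hg].
have dC N : d N <= C.
  apply: le_trans (fC N); apply: ge_inf; first exact: (hE N).2.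
  by exists (f N) => //; exact: midhull_base.
have /choice [y hy] : forall N, exists g, midhull f N g /\ ip g g <= d N + N.+1%:R^-1.
  move=> N; have N0 : 0 < (N.+1%:R^-1 : R) by rewrite invr_gt0.
  by have [_ [g hg ->] /ltW] := inf_adherent N0 (hE N); exists g.
have Dy N : D (y N) by apply: (midhull_dom Df); exact: (hy N).1.
(* Parallelogram identity: the midpoint of [y N] and [y M] lies in the hull of the tail from [N], so
   its squared norm is at least [d N]. *)
have yy N M : (N <= M)%N ->
    ip (y N - y M) (y N - y M) <= 2 * (d M - d N) + 4 * N.+1%:R^-1.
  move=> NM; have [hN yN] := hy N; have [hM yM] := hy M.
  have hmid : midhull f N (2^-1 *: (y N + y M)).
    by apply: midhull_mid => //; exact: midhull_le hM.
  have : d N <= ip (2^-1 *: (y N + y M)) (2^-1 *: (y N + y M)).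
    by apply: ge_inf; [exact: (hE N).2|exists (2^-1 *: (y N + y M))].
  have DNM := siD S (Dy N) (Dy M).
  rewrite (ipZl S)//; last exact: (siZ S).
  rewrite ipZr// ip_sqrD// ip_sqrB//.
  have : (M.+1%:R^-1 : R) <= N.+1%:R^-1.
    by rewrite lef_pV2// ?posrE// ler_nat.
  move: yN yM; move: (N.+1%:R^-1) (M.+1%:R^-1) (d N) (d M) => rN rM dN dM.
  lra.
have [l dl] : exists l : R, d n @[n --> \oo] --> l.
  exists (limn d); apply: nondecreasing_is_cvgn; first by move=> n m; exact: dle.
  by exists C => _ [n _ <-].
have [g Dg yg] : exists2 g, D g & ip (y n - g) (y n - g) @[n --> \oo] --> 0.
  apply: complete => // e e0.
  have e8 : 0 < e / 8 by lra.
  have [N1 _ dN1] := (cvgrPdist_le _ _).1 dl _ e8.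
  have [N2 _ hN2] := @near_infty_natSinv_lt R (PosNum e8).
  pose N := (N1 + N2)%N.
  have key m n : (N <= m)%N -> (m <= n)%N -> ip (y m - y n) (y m - y n) <= e.
    move=> Nm mn; apply: le_trans (yy _ _ mn) _.
    have := dN1 m; rewrite /= ler_norml => /(_ (leq_trans (leq_addr _ _) Nm)) /andP[a1 a2].
    have := dN1 n; rewrite /= ler_norml => /(_ (leq_trans (leq_addr _ _) (leq_trans Nm mn))) /andP[a3 a4].
    have : m.+1%:R^-1 < e / 8 by exact: (hN2 m (leq_trans (leq_addl _ _) Nm)).
    move: a1 a2 a3 a4; move: (m.+1%:R^-1) (d m) (d n) => r dm dn; lra.
  exists N => m n Nm Nn; case: (leqP m n) => [|/ltnW] mn; first exact: key.
  have -> : ip (y m - y n) (y m - y n) = ip (y n - y m) (y n - y m).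
    by rewrite !ip_sqrB// (ipC S (f:=y m) (g:=y n))//; ring.
  exact: key.
exists y, g; split => //.
by move=> N; exact: (hy N).1.
Qed.

(** Separability is replaced by testing against the terms [f m] themselves. The limits attached to
    two subsequences pair alike with every [f m]; as both are strong limits of averages of the
    [f m], their difference pairs to 0 with itself. *)
Lemma weak_sequential_compactness (f : nat -> V) C : (forall n, D (f n)) ->
  (forall n, ip (f n) (f n) <= C) ->
  exists k g, [/\ extraction k, D g &
    forall h, D h -> ip (f (k n)) h @[n --> \oo] --> ip g h].
Proof.
move=> Df fC.
have C0 : 0 <= C by apply: le_trans (ip_ge0 S (Df 0%N)) (fC 0%N).
have bnd n h : D h -> `|ip (f n) h| <= C + ip h h.
  move=> Dh; have h0 := ip_ge0 S Dh; have n0 := ip_ge0 S (Df n).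
  rewrite -(@ler_pXn2r _ 2)// ?nnegrE ?addr_ge0//.
  rewrite real_normK ?num_real//; apply: le_trans (ip_CS (Df n) Dh) _.
  have := fC n; nra.
have [k xk kl] := @diagonal_extraction R (fun m n => ip (f n) (f m))
  (fun m => C + ip (f m) (f m)) (fun m n => bnd n _ (Df m)).
(* If [ip (f (j n)) h] converges, its limit must be the pairing of [h] with the one [g] attached to
   [j], because averages of late terms pair with [h] close to that limit. *)
have mz j : extraction j -> exists g, D g /\ (exists2 y, forall N, midhull f N (y N) &
    ip (y n - g) (y n - g) @[n --> \oo] --> 0) /\
    forall h l, D h -> ip (f (j n)) h @[n --> \oo] --> l -> ip g h = l.
  move=> xj; have [y [g [hy Dg yg]]] := @mazur (f \o j) C (fun n => Df _) (fun n => fC _).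
  have Dy N : D (y N) by apply: (@midhull_dom (f \o j) N) => // n; exact: Df.
  exists g; split => //; split.
    exists y => // N; elim: (hy N) => [n Nn|? ? _ ? _ ?]; last exact: midhull_mid.
    by apply: midhull_base; apply: leq_trans Nn (extraction_ge xj n).
  move=> h l Dh fl; have yl : ip (y n) h @[n --> \oo] --> l.
    apply/cvgrPdist_le => e e0; have [N _ fN] := (cvgrPdist_le _ _).1 fl _ e0.
    exists N => // n /= Nn; apply: (@midhull_near (f \o j) n) => //.
    - by move=> m; exact: Df.
    - by move=> m nm; apply: fN => /=; exact: leq_trans nm.
  apply: (@cvg_unique _ (@Rhausdorff R) (ip (y n) h @[n --> \oo])) => //.
  exact: cvg_ip.
have [g [Dg [[y hy yg] gl]]] := mz k xk.
exists k, g; split => // h Dh.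
apply: contrapT => ncv.
(* Were the pairings with [h] not to converge to [ip g h], a further subsequence would stay [e] away
   from it and yet converge; its own limit [g'] turns out to pair with [h] as [g] does. *)
have [e e0 fe] : exists2 e : R, 0 < e & forall N, exists2 n, (N <= n)%N & ~ (`|ip g h - ip (f (k n)) h| <= e).
  apply: contrapT => H; apply: ncv; apply/cvgrPdist_le => e e0.
  apply: contrapT => H'; apply: H; exists e => // N; apply: contrapT => H2.
  apply: H'; exists N => // n /= Nn; apply: contrapT => H3.
  by apply: H2; exists n.
have [j xj je] := extraction_frequently fe.
have [i xi [l il]] := @bolzano_weierstrass R (fun n => ip (f (k (j n))) h) (C + ip h h) (fun n => bnd _ _ Dh).
have xall : extraction (k \o (j \o i)) by do 2 apply: extraction_comp => //.
have [g' [Dg' [[y' hy' yg'] gl']]] := mz _ xall.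
have gg m : ip (g - g') (f m) = 0.
  have [lm klm] := kl m.
  rewrite ipBl// (gl _ _ (Df m) klm) (gl' _ lm (Df m)) ?subrr//.
  by apply: (cvg_extraction (extraction_comp xj xi) klm).
have Dd := siB Dg Dg'.
have gh v N : midhull f N v -> ip v (g - g') = 0.
  elim=> [n _|a b ha ea hb eb]; first by rewrite (ipC S)// gg.
  have Da := midhull_dom Df ha; have Db := midhull_dom Df hb.
  by rewrite (ipZl S)// ?(ipDl S)// ?ea ?eb ?addr0 ?mulr0//; exact: (siD S).
have lim0 v z : (forall N, midhull f N (v N)) -> D z ->
    ip (v n - z) (v n - z) @[n --> \oo] --> 0 -> ip z (g - g') = 0.
  move=> hv Dz vz.
  apply: (@cvg_unique _ (@Rhausdorff R) (ip (v n) (g - g') @[n --> \oo])) => //.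
    by apply: cvg_ip => // n; exact: midhull_dom (hv n).
  by apply: cvg_near_cst; apply: nearW => n; apply: gh (hv n).
have d0 : ip (g - g') (g - g') = 0.
  by rewrite [LHS]ipBl// (lim0 _ _ hy Dg yg) (lim0 _ _ hy' Dg' yg') subrr.
have dh : ip g h = ip g' h.
  apply/eqP; rewrite -subr_eq0 -ipBl// -sqrf_eq0; apply/eqP/le_anti.
  by rewrite sqr_ge0 andbT; apply: le_trans (ip_CS Dd Dh) _; rewrite d0 mul0r.
have lg : l = ip g h by rewrite dh; apply/esym/gl'.
have [N _ hN] := (cvgrPdist_le _ _).1 il _ e0.
by apply: (je (i N)); rewrite -lg; apply: (hN N); rewrite /=.
Qed.

End hilbert.

(** * Square integrable functions *)

Section integration_aux.
Context d (T : measurableType d) (R : realType) (mu : {measure set T -> \bar R}).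
Implicit Types f g h : T -> R.

Definition integ f := mu.-integrable setT (EFin \o f).

Lemma integ_measurable f : integ f -> measurable_fun setT f.
Proof. by move=> /integrableP[/measurable_EFinP]. Qed.

Lemma integ_EFin f : integ f -> (\int[mu]_x f x)%:E = (\int[mu]_x (f x)%:E)%E.
Proof. by move=> fi; rewrite fineK//; exact: integrable_fin_num. Qed.

Lemma le_integ f g : measurable_fun setT f -> (forall x, `|f x| <= g x) ->
  integ g -> integ f.
Proof.
move=> mf fg; apply: le_integrable => //; first exact/measurable_EFinP.
by move=> x _ /=; rewrite lee_fin (le_trans (fg x))// ler_norm.
Qed.

Lemma integD f g : integ f -> integ g -> integ (fun x => f x + g x).
Proof. by move=> fi gi; have := integrableD measurableT fi gi. Qed.

Lemma integZ a f : integ f -> integ (fun x => a * f x).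
Proof. by move=> fi; have := integrableZl measurableT a fi. Qed.

Lemma integN f : integ f -> integ (fun x => - f x).
Proof. by move=> fi; under eq_fun do rewrite -mulN1r; exact: integZ. Qed.

Lemma integB f g : integ f -> integ g -> integ (fun x => f x - g x).
Proof. by move=> fi gi; apply: integD => //; exact: integN. Qed.

Lemma integ_norm f : integ f -> integ (fun x => `|f x|).
Proof. by move=> fi; have := integrable_abse fi. Qed.

Lemma integ_ge0_lty f : measurable_fun setT f -> (forall x, 0 <= f x) ->
  (\int[mu]_x (f x)%:E < +oo)%E -> integ f.
Proof.
move=> mf f0 foo; apply/integrableP; split; first exact/measurable_EFinP.
by under eq_integral do rewrite /= ger0_norm//.
Qed.

Lemma Rintegral_ge0_le f C : measurable_fun setT f -> (forall x, 0 <= f x) ->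
  (\int[mu]_x (f x)%:E <= C%:E)%E -> integ f /\ \int[mu]_x f x <= C.
Proof.
move=> mf f0 fC; have fi : integ f.
  by apply: integ_ge0_lty => //; rewrite (le_lt_trans fC)// ltry.
by split => //; rewrite -lee_fin integ_EFin.
Qed.

Lemma RintegralDT f g : integ f -> integ g ->
  \int[mu]_x (f x + g x) = \int[mu]_x f x + \int[mu]_x g x.
Proof. by move=> *; rewrite RintegralD. Qed.

Lemma RintegralBT f g : integ f -> integ g ->
  \int[mu]_x (f x - g x) = \int[mu]_x f x - \int[mu]_x g x.
Proof. by move=> *; rewrite RintegralB. Qed.

Lemma RintegralZT a f : integ f -> \int[mu]_x (a * f x) = a * \int[mu]_x f x.
Proof. by move=> *; rewrite RintegralZl. Qed.

Lemma RintegralNT f : integ f -> \int[mu]_x (- f x) = - \int[mu]_x f x.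
Proof. by move=> fi; under eq_Rintegral do rewrite -mulN1r; rewrite RintegralZT// mulN1r. Qed.

Lemma le_RintegralT f g : integ f -> integ g -> (forall x, f x <= g x) ->
  \int[mu]_x f x <= \int[mu]_x g x.
Proof. by move=> fi gi fg; apply: le_Rintegral. Qed.

Lemma norm_RintegralT f : integ f -> `|\int[mu]_x f x| <= \int[mu]_x `|f x|.
Proof. by move=> fi; apply: le_normr_Rintegral. Qed.

Lemma Rintegral_ae f g : measurable_fun setT f -> measurable_fun setT g ->
  {ae mu, forall x, f x = g x} -> \int[mu]_x f x = \int[mu]_x g x.
Proof.
move=> mf mg fg; congr fine; apply: ae_eq_integral => //; try exact/measurable_EFinP.
by move: fg; apply: filterS => x /= ->.
Qed.

Lemma Rintegral_eq0_ae f : integ f -> (forall x, 0 <= f x) ->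
  \int[mu]_x f x = 0 -> {ae mu, forall x, f x = 0}.
Proof.
move=> fi f0 h; have : (\int[mu]_x `|(EFin \o f) x| = 0)%E.
  rewrite -[RHS]/(0%:E) -h integ_EFin//; apply: eq_integral => x _ /=.
  by rewrite ger0_norm.
move/(ae_eq_integral_abs _ measurableT (measurable_int _ fi)).
by apply: filterS => x /= /(_ I) [].
Qed.

Lemma fatou_Rintegral (h : nat -> T -> R) g C : (forall n, integ (h n)) ->
  (forall n x, 0 <= h n x) -> measurable_fun setT g -> (forall x, 0 <= g x) ->
  {ae mu, forall x, h n x @[n --> \oo] --> g x} ->
  (\forall n \near \oo, \int[mu]_x h n x <= C) ->
  integ g /\ \int[mu]_x g x <= C.
Proof.
move=> hi h0 mg g0 hg hC; apply: Rintegral_ge0_le => //.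
have mh n : measurable_fun setT (fun x => (h n x)%:E).
  by apply/measurable_EFinP; exact: integ_measurable.
have F := fatou mu measurableT mh (fun n x _ => h0 n x).
apply: le_trans (le_trans _ F) _.
- rewrite le_eqVlt; apply/orP; left; apply/eqP.
  apply: ge0_ae_eq_integral => //.
  + exact/measurable_EFinP.
  + rewrite /limn_einf; apply: measurableT_comp => //.
    by apply: measurable_fun_limn_esup => n; exact: measurableT_comp.
  + by move=> x _; rewrite lee_fin.
  + move=> x _; rewrite limn_einf_lim; apply: lime_ge; first exact: is_cvg_einfs.
    by apply: nearW => n; apply: le_ereal_inf_tmp => _ [m _ <-]; rewrite lee_fin.
  + move: hg; apply: filterS => x hx _ /=; apply/esym.
    have hx' : (h n x)%:E @[n --> \oo] --> (g x)%:E by apply: cvg_EFin => //; exact: nearW.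
    by rewrite is_cvg_limn_einfE; [exact/cvg_lim|exact: cvgP hx'].
- rewrite limn_einf_lim; apply: lime_le; first exact: is_cvg_einfs.
  apply: nearW => n; have [N _ hN] := hC.
  apply: (@le_trans _ _ (\int[mu]_x (h (n + N)%N x)%:E)%E).
    by apply: ereal_inf_lbound; exists (n + N)%N => //=; exact: leq_addr.
  by rewrite -integ_EFin// lee_fin; apply: hN => /=; exact: leq_addl.
Qed.


Lemma sqint_mul_le (a b : R) : `|a * b| <= a ^+ 2 + b ^+ 2.
Proof.
rewrite ler_norml; have := sqr_ge0 (a + b); have := sqr_ge0 (a - b).
rewrite sqrrB sqrrD; have := sqr_ge0 a; have := sqr_ge0 b.
by move=> *; apply/andP; split; lra.
Qed.

Definition sqint f := measurable_fun setT f /\ integ (fun x => f x ^+ 2).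

Lemma sqintM f g : sqint f -> sqint g -> integ (fun x => f x * g x).
Proof.
move=> [mf fi] [mg gi]; apply: (@le_integ _ (fun x => f x ^+ 2 + g x ^+ 2)).
- exact: measurable_funM.
- by move=> x; exact: sqint_mul_le.
- exact: integD.
Qed.

Lemma le_sqint f g : measurable_fun setT f -> (forall x, `|f x| <= `|g x|) ->
  sqint g -> sqint f.
Proof.
move=> mf fg [mg gi]; split => //; apply: le_integ gi.
  exact: measurable_funX.
by move=> x; rewrite normrX -[leRHS]real_normK ?num_real// ler_pXn2r// nnegrE.
Qed.

Lemma sqintZ a f : sqint f -> sqint (fun x => a * f x).
Proof.
move=> [mf fi]; split; first exact: measurable_funM.
by under eq_fun do rewrite exprMn; exact: integZ.
Qed.

Lemma sqintD f g : sqint f -> sqint g -> sqint (fun x => f x + g x).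
Proof.
move=> sf sg; split; first by apply: measurable_funD; [case: sf|case: sg].
under eq_fun do rewrite sqrrD.
apply: integD; last by case: sg.
apply: integD; first by case: sf.
by under eq_fun do rewrite -mulr_natl; apply: integZ; exact: sqintM.
Qed.

Lemma sqintN f : sqint f -> sqint (fun x => - f x).
Proof. by move=> sf; under eq_fun do rewrite -mulN1r; exact: sqintZ. Qed.

Lemma sqintB f g : sqint f -> sqint g -> sqint (fun x => f x - g x).
Proof. by move=> sf sg; apply: sqintD => //; exact: sqintN. Qed.

Lemma sqintP f : f \in Lfun mu 2%:E <-> sqint f.
Proof.
split.
  by move=> lf; split; [move: lf; rewrite inE => /andP[/[!inE]]|exact: Lfun2_integrable_sqr].
move=> [mf fi]; rewrite inE; apply/andP; split; rewrite inE//=.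
rewrite /finite_norm unlock /Lnorm/=; apply: poweR_lty.
under eq_integral do rewrite powR_mulrn// real_normK ?num_real//.
exact: integrable_lty.
Qed.

Definition ip2 f g : R := \int[mu]_x (f x * g x).

Lemma sqint_semi_inner : @semi_inner R (T -> R : lmodType R) sqint ip2.
Proof.
split.
- exact: sqintD.
- exact: sqintZ.
- by move=> f g _ _; apply: eq_Rintegral => x _; rewrite mulrC.
- move=> f g h sf sg sh; rewrite /ip2 -RintegralDT; try exact: sqintM.
  by apply: eq_Rintegral => x _; rewrite -mulrDl.
- move=> a f h sf sh; rewrite /ip2 -RintegralZT; try exact: sqintM.
  by apply: eq_Rintegral => x _; rewrite mulrA.
- by move=> f sf; apply: Rintegral_ge0 => x _; rewrite -expr2 sqr_ge0.
Qed.

Lemma ip2E f : ip2 f f = \int[mu]_x (f x ^+ 2).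
Proof. by apply: eq_Rintegral => x _; rewrite expr2. Qed.

Lemma fast_subsequence (a : nat -> nat -> R) (e : nat -> R) :
  (forall n, 0 < e n) ->
  (forall r, 0 < r -> exists N, forall m n, (N <= m)%N -> (N <= n)%N -> a m n <= r) ->
  exists2 k, extraction k & forall n, a (k n.+1) (k n) <= e n.
Proof.
move=> e0 ha.
have /choice [N hN] : forall i, exists N, forall m n, (N <= m)%N -> (N <= n)%N -> a m n <= e i.
  by move=> i; exact: ha.
pose k := fix k n := if n is n'.+1 then maxn (k n').+1 (N n'.+1) else N 0%N.
have kS n : (k n < k n.+1)%N by rewrite /= leq_max leqnn.
have kN n : (N n <= k n)%N by case: n => //= n; rewrite leq_max leqnn orbT.
exists k; first exact: extractionS.
by move=> n; apply: hN; [apply: leq_trans (kN n) (ltnW (kS n))|exact: kN].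
Qed.

(* The weights [2 ^+ n] turn the geometric decay of the L2 distances into the
   pointwise summability of [|f (k n.+1) x - f (k n) x|]. *)
Lemma sqint_ae_cvg (f : nat -> T -> R) : (forall n, sqint (f n)) ->
  (forall n, 2 ^+ n * \int[mu]_x ((f n.+1 x - f n x) ^+ 2) <=
     1 / (2 ^ (n + 1))%:R) ->
  {ae mu, forall x, cvgn (fun n => f n x)}.
Proof.
move=> sf hf.
pose a n x := 2 ^+ n * (f n.+1 x - f n x) ^+ 2.
have a0 n x : 0 <= a n x by rewrite mulr_ge0// ?sqr_ge0// exprn_ge0.
have ai n : integ (a n) by apply: integZ; exact: (sqintB (sf _) (sf _)).2.
have ma n : measurable_fun setT (fun x => (a n x)%:E).
  by apply/measurable_EFinP; exact: integ_measurable.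
have aI n : (\int[mu]_x (a n x)%:E <= (1 / (2 ^ (n + 1))%:R)%:E)%E.
  by rewrite -integ_EFin// lee_fin RintegralZT//; exact: (sqintB (sf _) (sf _)).2.
have mS : measurable_fun setT (fun x => \sum_(n <oo) (a n x)%:E)%E.
  by apply: ge0_emeasurable_sum => // n x _ _; rewrite lee_fin.
have S0 x : (0 <= \sum_(n <oo) (a n x)%:E)%E.
  by apply: nneseries_ge0 => n _ _; rewrite lee_fin.
have Si : mu.-integrable setT (fun x => \sum_(n <oo) (a n x)%:E)%E.
  apply/integrableP; split => //.
  under eq_integral do rewrite gee0_abs//.
  rewrite integral_nneseries//; last by move=> n x _; rewrite lee_fin.
  apply: (@le_lt_trans _ _ (\sum_(n <oo) (1 / (2 ^ (n + 1))%:R)%:E)%E).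
    by apply: lee_nneseries => n _ //=; rewrite integral_ge0// => x _; rewrite lee_fin.
  by rewrite (cvg_lim _ (@cvg_geometric_eseries_half R 1 0))// ltry.
have := integrable_ae measurableT Si; apply: filterS => x /(_ I) Sx.
pose w n := f n.+1 x - f n x.
have half n : \sum_(0 <= i < n) 2^-1 ^+ i = 2 - 2 * 2^-1 ^+ n :> R.
  elim: n => [|n IH]; first by rewrite big_nil expr0; lra.
  by rewrite big_nat_recr//= IH exprS; lra.
(* The arithmetic-geometric inequality for [2^-n] and [2^n w^2]; both right-hand terms are summable
   in [n]. *)
have dle n : `|w n| <= 2^-1 ^+ n + a n x.
  rewrite /a -/(w n); have p0 : 0 < 2 ^+ n :> R by rewrite exprn_gt0.
  rewrite exprVn; set p := 2 ^+ n in p0 *.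
  have -> : p^-1 + p * w n ^+ 2 = p^-1 * (1 + (p * w n) ^+ 2).
    by field; rewrite gt_eqF.
  rewrite ler_pdivlMl// -{1}(ger0_norm (ltW p0)) -normrM.
  by rewrite -(real_normK (num_real (p * w n))); have := sqr_ge0 (`|p * w n| - 1); rewrite sqrrB1; nra.
have asum n : \sum_(0 <= i < n) a i x <= fine (\sum_(n <oo) (a n x)%:E)%E.
  rewrite -lee_fin fineK// -sumEFin.
  by apply: nneseries_lim_ge => i _ _; rewrite lee_fin.
have cd : cvgn (series w).
  apply: normed_cvg; apply: nondecreasing_is_cvgn.
    by apply: nondecreasing_series => i _ _; exact: normr_ge0.
  exists (2 + fine (\sum_(n <oo) (a n x)%:E)%E) => _ [n _ <-].
  rewrite /series/=; apply: (@le_trans _ _ (\sum_(0 <= i < n) (2^-1 ^+ i + a i x))).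
    by apply: ler_sum => i _; exact: dle.
  rewrite big_split/= lerD// half lerBlDr lerDl mulr_ge0// exprn_ge0//; lra.
have -> : (fun n => f n x) = (fun n => series w n + f 0%N x).
  apply/funext => n; rewrite /series/= /w telescope_sumr//; ring.
by apply: is_cvgD => //; exact: is_cvg_cst.
Qed.

(** Riesz-Fischer: a fast subsequence converges off a null set, and Fatou's lemma with one index
    kept fixed bounds the distance of the whole sequence to the limit. *)
Lemma sqint_complete (f : nat -> T -> R) : (forall n, sqint (f n)) ->
  (forall e : R, 0 < e -> exists N, forall m n, (N <= m)%N -> (N <= n)%N ->
     ip2 (f m - f n) (f m - f n) <= e) ->
  exists2 g, sqint g & ip2 (f n - g) (f n - g) @[n --> \oo] --> 0.
Proof.
move=> sf cf.
have ipB g h : ip2 (g - h) (g - h) = \int[mu]_x ((g x - h x) ^+ 2).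
  by rewrite ip2E.
have [|k xk hk] := @fast_subsequence (fun m n => ip2 (f m - f n) (f m - f n))
    (fun n => (2 ^+ n)^-1 * (1 / (2 ^ (n + 1))%:R)) _ cf.
  by move=> n; rewrite mulr_gt0// ?invr_gt0 ?exprn_gt0// divr_gt0// ltr0n expn_gt0.
have /(@sqint_ae_cvg (f \o k) (fun n => sf _))[N [mN N0 NP]] n :
    2 ^+ n * \int[mu]_x ((f (k n.+1) x - f (k n) x) ^+ 2) <= 1 / (2 ^ (n + 1))%:R.
  by rewrite -ler_pdivlMl ?exprn_gt0// -ipB.
have Ncv x : ~ N x -> cvgn (fun n => f (k n) x).
  by move=> Nx; apply: contrapT => h; apply: Nx; apply: NP.
(* Set to 0 on the null set, the functions converge at every point, which makes the limit
   measurable. *)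
pose h n x := (f (k n) \_ (~` N)) x.
have mh n : measurable_fun setT (h n).
  apply/(measurable_restrictT _ _).1; first exact: measurableC.
  by apply: measurable_funTS; exact: (sf _).1.
pose g x := limn (h ^~ x).
have hg x : h n x @[n --> \oo] --> g x.
  rewrite /g /h /patch; case: (boolP (x \in ~` N)) => xN; last exact: is_cvg_cst.
  by apply: Ncv; move: xN; rewrite inE.
have mg : measurable_fun setT g by apply: measurable_fun_cvg => // x _; exact: hg.
have fg x : ~ N x -> f (k n) x @[n --> \oo] --> g x.
  move=> Nx; have := hg x; rewrite /h /patch; case: (boolP (x \in ~` N)) => // /negP H; by case: H; rewrite inE.
have key e : 0 < e -> exists M, forall m, (M <= m)%N ->
    integ (fun x => (f m x - g x) ^+ 2) /\ \int[mu]_x ((f m x - g x) ^+ 2) <= e.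
  move=> e0; have [M hM] := cf _ e0; exists M => m Mm.
  apply: (@fatou_Rintegral (fun n x => (f m x - f (k n) x) ^+ 2)).
  - by move=> n; exact: (sqintB (sf _) (sf _)).2.
  - by move=> n y; exact: sqr_ge0.
  - by apply: measurable_funX; apply: measurable_funB => //; exact: (sf _).1.
  - by move=> y; exact: sqr_ge0.
  - exists N; split => // y /= hx; apply: contrapT => Ny; apply: hx.
    have hy2 : f m y - f (k n) y @[n --> \oo] --> f m y - g y.
      by apply: cvgB; [exact: cvg_cst|exact: fg].
    by rewrite expr2; under eq_fun do rewrite expr2; exact: cvgM.
  - exists M => // n /= Mn; rewrite -ipB; apply: hM => //.
    exact: leq_trans Mn (extraction_ge xk n).
have sg : sqint g.
  have [M hM] := key 1 ltr01.
  have [hi _] := hM M (leqnn M).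
  have sB : sqint (fun x => f M x - g x).
    by split => //; apply: measurable_funB => //; exact: (sf _).1.
  have -> : g = (fun x => f M x - (f M x - g x)) by apply/funext => x; ring.
  exact: sqintB.
exists g => //; apply/cvgrPdist_le => e e0.
have [M hM] := key _ e0; exists M => // m /= /hM [_ hm].
rewrite sub0r normrN ipB ger0_norm//.
by apply: Rintegral_ge0 => x _; exact: sqr_ge0.
Qed.

Lemma sqint_weak_compact (f : nat -> T -> R) C : (forall n, sqint (f n)) ->
  (forall n, ip2 (f n) (f n) <= C) ->
  exists k g, [/\ extraction k, sqint g &
    forall h, sqint h -> ip2 (f (k n)) h @[n --> \oo] --> ip2 g h].
Proof. by move=> sf fC; exact: (weak_sequential_compactness sqint_semi_inner sqint_complete sf fC). Qed.

End integration_aux.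

(** * Lebesgue measure on the plane *)

Lemma mpres_integral d1 d2 (T1 : measurableType d1) (T2 : measurableType d2) (R : realType)
    (m1 : {measure set T1 -> \bar R}) (m2 : {measure set T2 -> \bar R}) (phi : T1 -> T2)
    (f : T2 -> \bar R) : measurable_fun setT phi ->
  (forall A, measurable A -> m2 A = m1 (phi @^-1` A)) ->
  measurable_fun setT f -> (forall x, 0 <= f x)%E ->
  (\int[m1]_x f (phi x) = \int[m2]_x f x)%E.
Proof.
move=> mphi pres mf f0.
rewrite [RHS](@eq_measure_integral _ _ _ _ (pushforward m1 phi)); last by move=> A mA _; exact: pres.
by rewrite [RHS]ge0_integral_pushforward.
Qed.

(** Presents the image measure as a bundled measure, the form in which the uniqueness of the
    Lebesgue and of the product measure is applied. *)
Lemma pushforward_measure d1 d2 (T1 : measurableType d1) (T2 : measurableType d2)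
    (R : realType) (m1 : {measure set T1 -> \bar R}) (phi : T1 -> T2) :
  measurable_fun setT phi ->
  exists m : {measure set T2 -> \bar R}, forall A, m A = m1 (phi @^-1` A).
Proof.
move=> mphi.
unshelve refine (ex_intro (fun m : {measure set T2 -> \bar R} =>
  forall A, m A = m1 (phi @^-1` A)) (pushforward m1 phi) (fun=> erefl)).
exact: mphi.
Qed.

Section mpres.
Context d (T : measurableType d) (R : realType) (mu : {measure set T -> \bar R}).
Variable phi : T -> T.
Hypothesis mphi : measurable_fun setT phi.
Hypothesis pres : forall A, measurable A -> mu A = mu (phi @^-1` A).

Lemma mpres_integ (f : T -> R) : integ mu f -> integ mu (f \o phi).
Proof.
move=> fi; have mf := integ_measurable fi; apply/integrableP; split.
  by apply/measurable_EFinP; exact: measurableT_comp.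
have /integrableP[_] := fi; apply: le_lt_trans.
rewrite (mpres_integral (m1 := mu) (m2 := mu) (phi := phi) (f := fun x => `|(f x)%:E|%E))//.
by apply: measurableT_comp => //; exact/measurable_EFinP.
Qed.

Lemma mpres_Rintegral (f : T -> R) : integ mu f ->
  \int[mu]_x f (phi x) = \int[mu]_x f x.
Proof.
move=> fi; congr fine.
rewrite [RHS](@eq_measure_integral _ _ _ _ (pushforward mu phi)); last by move=> A mA _; exact: pres.
rewrite (@integral_pushforward _ _ _ _ _ _ mphi mu setT (EFin \o f))//.
  exact/measurable_EFinP/(integ_measurable fi).
exact: mpres_integ.
Qed.

End mpres.

Section lebesgue_plane.
Context {R : realType}.
Local Notation plane := (R * R)%type.
Local Notation leb := (@lebesgue_measure R).
Local Notation mplane := (measurableTypeR R * measurableTypeR R)%type.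
Implicit Types (z h : plane).

(** The sign [s] treats at once the translations, used for increments, and the reflections, used to
    exchange [y] and [x - y] in convolutions. Uniqueness of the Lebesgue measure reduces the claim
    to half-open intervals. *)
Lemma leb_affine (s : bool) (a : R) (A : set R) : measurable A ->
  leb A = leb ((fun t => (-1) ^+ s * t + a) @^-1` A).
Proof.
move=> mA.
have mphi : measurable_fun setT (fun t : R => (-1) ^+ s * t + a).
  by apply: measurable_funD => //; exact: measurable_funM.
have [m mE] := @pushforward_measure _ _ _ (measurableTypeR R) R leb _ mphi; rewrite -mE.
apply: lebesgue_measure_unique => // _ [[x y] _ <-] /=; rewrite mE.
case: s mphi mE => mphi mE.
- rewrite (_ : _ @^-1` _ = `[a - y, a - x[%classic); last first.
    by apply/seteqP; split => t /=; rewrite !in_itv/= expr1 => /andP[? ?]; apply/andP; split; lra.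
  rewrite lebesgue_measure_itv [RHS]lebesgue_measure_itv/= !lte_fin ltrD2l ltrN2 -!EFinB.
  by congr (if _ then _ else _); congr EFin; ring.
- rewrite (_ : _ @^-1` _ = `]x - a, y - a]%classic); last first.
    by apply/seteqP; split => t /=; rewrite !in_itv/= expr0 => /andP[? ?]; apply/andP; split; lra.
  rewrite lebesgue_measure_itv [RHS]lebesgue_measure_itv/= !lte_fin ltrD2r -!EFinB.
  by congr (if _ then _ else _); congr EFin; ring.
Qed.

Definition affine2 (s : bool) (a z : plane) : plane :=
  ((-1) ^+ s * z.1 + a.1, (-1) ^+ s * z.2 + a.2).

Lemma measurable_affine2 s a :
  measurable_fun (setT : set mplane) (affine2 s a : mplane -> mplane).
Proof.
by apply: measurable_fun_pair; apply: measurable_funD => //;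
  apply: measurable_funM => //.
Qed.

Lemma leb2_affine s a (A : set mplane) : measurable A ->
  (@leb2 R) A = leb2 ((affine2 s a : mplane -> mplane) @^-1` A).
Proof.
move=> mA; have [m mE] := @pushforward_measure _ _ _ (measurableTypeR R * measurableTypeR R)%type R (@leb2 R) _ (measurable_affine2 s a).
rewrite -mE; apply: product_measure_unique => // A1 A2 mA1 mA2.
have mB c B : measurable B -> measurable ((fun t : R => (-1) ^+ s * t + c) @^-1` B).
  have mphi : measurable_fun setT (fun t : R => (-1) ^+ s * t + c).
    by apply: measurable_funD => //; exact: measurable_funM.
  by move=> mB; rewrite -[X in measurable X]setTI; exact: mphi.
rewrite mE; transitivity ((leb \x leb)%E
  (((fun t : R => (-1) ^+ s * t + a.1) @^-1` A1) `*` ((fun t : R => (-1) ^+ s * t + a.2) @^-1` A2))) => //.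
rewrite product_measure1E; [|exact: mB|exact: mB].
by congr (_ * _)%E; exact/esym/leb_affine.
Qed.

Lemma integ_shift h f : integ (@leb2 R) f -> integ (@leb2 R) (fun z => f (z + h)).
Proof.
move=> fi; have := mpres_integ (measurable_affine2 false h) (leb2_affine false h) fi.
by congr integ; apply/funext => z /=; rewrite /affine2 expr0 !mul1r.
Qed.

Lemma Rintegral_shift h f : integ (@leb2 R) f ->
  \int[@leb2 R]_z f (z + h) = \int[@leb2 R]_z f z.
Proof.
move=> fi; have := mpres_Rintegral (measurable_affine2 false h) (leb2_affine false h) fi.
by congr (_ = _); apply: eq_Rintegral => z _; rewrite /affine2 expr0 !mul1r.
Qed.

Lemma integ_reflect h f : integ (@leb2 R) f -> integ (@leb2 R) (fun z => f (h - z)).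
Proof.
move=> fi; have := mpres_integ (measurable_affine2 true h) (leb2_affine true h) fi.
by congr integ; apply/funext => z /=; rewrite /affine2 expr1 !mulN1r addrC [X in (_, X)]addrC.
Qed.

Lemma Rintegral_reflect h f : integ (@leb2 R) f ->
  \int[@leb2 R]_z f (h - z) = \int[@leb2 R]_z f z.
Proof.
move=> fi; have := mpres_Rintegral (measurable_affine2 true h) (leb2_affine true h) fi.
by congr (_ = _); apply: eq_Rintegral => z _; rewrite /affine2 expr1 !mulN1r addrC [X in (_, X)]addrC.
Qed.

Definition box (a b : plane) : set plane := `]a.1, b.1[ `*` `]a.2, b.2[.
Definition cbox (a b : plane) : set plane := `[a.1, b.1] `*` `[a.2, b.2].

Lemma measurable_box a b : measurable (box a b).
Proof. exact: measurableX. Qed.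

Lemma measurable_cbox a b : measurable (cbox a b).
Proof. exact: measurableX. Qed.

Lemma compact_cbox a b : compact (cbox a b).
Proof. by apply: compact_setX; exact: segment_compact. Qed.

Lemma box_subset_cbox a b : box a b `<=` cbox a b.
Proof. by move=> z [/= z1 z2]; split => /=; apply: subset_itv_oo_cc. Qed.

Definition qpt (q : rat * rat) : plane := (ratr q.1, ratr q.2).

(** The countable supply of boxes behind three facts: open sets are measurable, local null sets
    unite to a global one, and [Omega] is exhausted by a sequence of cutoffs. *)
Lemma open_rat_box (U : set plane) z : open U -> U z ->
  exists q : (rat * rat) * (rat * rat),
    box (qpt q.1) (qpt q.2) z /\ cbox (qpt q.1) (qpt q.2) `<=` U.
Proof.
move=> oU Uz; have /nbhs_ballP[e /= e0 eU] : nbhs z U by exact: open_nbhs_nbhs.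
have lo t : exists q, t - e < ratr q < t.
  have [|q] := @rat_in_itvoo R (t - e) t; first by rewrite ltrBlDr ltrDl.
  by rewrite in_itv; exists q.
have hi t : exists q, t < ratr q < t + e.
  have [|q] := @rat_in_itvoo R t (t + e); first by rewrite ltrDl.
  by rewrite in_itv; exists q.
have [a1 /andP[? ?]] := lo z.1; have [a2 /andP[? ?]] := lo z.2.
have [b1 /andP[? ?]] := hi z.1; have [b2 /andP[? ?]] := hi z.2.
exists ((a1, a2), (b1, b2)); split.
  by split; rewrite /= in_itv/=; apply/andP.
move=> w [/=]; rewrite !in_itv/= => /andP[? ?] /andP[? ?].
by apply: eU; split; rewrite /ball/= ltr_norml; apply/andP; split; lra.
Qed.

Lemma measurable_open (U : set plane) : open U -> measurable U.
Proof.
move=> oU.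
pose F (q : (rat * rat) * (rat * rat)) : set plane :=
  [set z | box (qpt q.1) (qpt q.2) z /\ cbox (qpt q.1) (qpt q.2) `<=` U].
have -> : U = \bigcup_n (if unpickle n is Some q then F q else set0).
  apply/seteqP; split => [z Uz|z [n _]].
    by have [q Fq] := open_rat_box oU Uz; exists (pickle q); [exact: I|rewrite pickleK; exact: Fq].
  case: unpickle => // q [bz]; apply; exact: box_subset_cbox.
apply: bigcupT_measurable => n; case: unpickle => // q.
have [sub|nsub] := pselect (cbox (qpt q.1) (qpt q.2) `<=` U).
  rewrite (_ : F q = box (qpt q.1) (qpt q.2)); first exact: measurable_box.
  by apply/seteqP; split => z //; case.
rewrite (_ : F q = set0) //.
by apply/seteqP; split => z //; case.
Qed.

Lemma measurable_continuous (f : plane -> R) : continuous f -> measurable_fun setT f.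
Proof.
move=> cf; apply: (measurability _ (RGenOpens.measurableE R)).
move=> _ [_ [a [b ->] <-]]; rewrite setTI; apply: measurable_open.
by move/continuousP : cf; apply; exact: interval_open.
Qed.

Lemma leb2_cbox_lty a b : (leb2 (cbox a b) < +oo)%E.
Proof.
have fin (i j : R) : (lebesgue_measure (`[i, j]%classic : set R) < +oo)%E.
  by rewrite lebesgue_measure_itv/=; case: ifP => // _; rewrite -EFinB ltry.
rewrite [X in (X < _)%E](@product_measure1E _ _ _ _ R leb leb)//.
by rewrite lte_mul_pinfty// ?fin// ge0_fin_numE// fin.
Qed.

Lemma integ_bounded_support (f : mplane -> R) a b C :
  measurable_fun setT f -> (forall z, `|f z| <= C) ->
  (forall z, ~ cbox a b z -> f z = 0) -> integ (@leb2 R) f.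
Proof.
move=> mf fC f0.
have ib : integ (@leb2 R) (\1_(cbox a b) : plane -> R).
  apply: integ_ge0_lty => //.
    by apply: measurable_indic; exact: measurable_cbox.
  rewrite integral_indic//; last exact: measurable_cbox.
  by rewrite setIT; exact: leb2_cbox_lty.
apply: (@le_integ _ _ _ _ _ (fun z : mplane => C * \1_(cbox a b) z)) => //.
- move=> z; rewrite indicE; have [zb|/negP zb] := boolP (z \in cbox a b).
    by rewrite mulr1.
  by rewrite f0 ?normr0 ?mulr0// => ?; apply: zb; rewrite inE.
- exact: integZ.
Qed.

End lebesgue_plane.

(** * Smooth bump functions *)

Section directional.
Context {R : realType} {V : normedModType R}.

(** The two difference quotients are the same function of the increment, so one-variable calculus
    applies to directional derivatives. *)
Lemma is_derive_lineE (f : V -> R) (z v : V) (t df : R) :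
  is_derive (t *: v + z) v f df <-> is_derive t 1 (fun s => f (s *: v + z)) df.
Proof.
have E : (fun h : R => h^-1 *: (f (h *: v + (t *: v + z)) - f (t *: v + z))) =
         (fun h : R => h^-1 *: ((fun s => f (s *: v + z)) (h *: (1 : R) + t) -
                          (fun s => f (s *: v + z)) t)).
  apply/funext => h; rewrite /= (_ : h *: (1 : R) = h); last exact: mulr1.
  by rewrite scalerDl addrA.
split=> -[h1 h2]; split.
- by move: h1; rewrite /derivable /= E.
- by rewrite -h2 /derive /= E.
- by move: h1; rewrite /derivable /= E.
- by rewrite -h2 /derive /= E.
Qed.

Lemma is_derive_line (f : V -> R) (z v : V) (df : R) :
  is_derive z v f df <-> is_derive (0 : R) 1 (fun s => f (s *: v + z)) df.
Proof. by rewrite -is_derive_lineE scale0r add0r. Qed.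

End directional.

Section plane_derivatives.
Context {R : realType}.
Local Notation plane := (R * R)%type.
Local Notation e1 := (@e1 R).
Local Notation e2 := (@e2 R).

Lemma is_derive_prod1 (a : R -> R) (c da : R) (z : plane) :
  is_derive z.1 1 a da -> is_derive z e1 (fun w => a w.1 * c) (da * c).
Proof.
move=> ha; apply/is_derive_line => /=.
have -> : (fun s : R => a (s *: e1 + z).1 * c) = (fun s => c *: a (s *: (1 : R) + z.1)).
  by apply/funext => s /=; rewrite /GRing.scale/= mulrC.
rewrite mulrC; apply: is_deriveZ.
by have /is_derive_line := ha.
Qed.

Lemma is_derive_prod2 (b : R -> R) (c db : R) (z : plane) :
  is_derive z.2 1 b db -> is_derive z e2 (fun w => c * b w.2) (c * db).
Proof.
move=> hb; apply/is_derive_line => /=.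
have -> : (fun s : R => c * b (s *: e2 + z).2) = (fun s => c *: b (s *: (1 : R) + z.2)).
  by apply/funext => s /=.
apply: is_deriveZ.
by have /is_derive_line := hb.
Qed.

Lemma is_derive_tensor1 (a b : R -> R) da (z : plane) : is_derive z.1 1 a da ->
  is_derive z e1 (fun w => a w.1 * b w.2) (da * b z.2).
Proof.
move=> /(is_derive_prod1 (b z.2)) /is_derive_line h; apply/is_derive_line.
congr (is_derive _ _ _ _): h; apply/funext => s /=.
by rewrite /GRing.scale/= mulr0 add0r.
Qed.

Lemma is_derive_tensor2 (a b : R -> R) db (z : plane) : is_derive z.2 1 b db ->
  is_derive z e2 (fun w => a w.1 * b w.2) (a z.1 * db).
Proof.
move=> /(is_derive_prod2 (a z.1)) /is_derive_line h; apply/is_derive_line.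
congr (is_derive _ _ _ _): h; apply/funext => s /=.
by rewrite /GRing.scale/= mulr0 add0r.
Qed.

End plane_derivatives.

Section smooth1.
Context {R : realType}.
Implicit Types f g : R -> R.

Fixpoint Dk (k : nat) f : Prop :=
  if k is k'.+1 then (forall x, derivable f x 1) /\ Dk k' (derive1 f) else True.

Definition smooth1 f := forall k, Dk k f.

Lemma smooth1_derivable f x : smooth1 f -> derivable f x 1.
Proof. by move=> /(_ 1%N)[]. Qed.

Lemma smooth1_derive f : smooth1 f -> smooth1 (derive1 f).
Proof. by move=> sf k; case: (sf k.+1). Qed.

Lemma Dk_pred k f : Dk k.+1 f -> Dk k f.
Proof. by elim: k f => // k IH f [? ?]; split => //; exact: IH. Qed.

Lemma derive1_eq f df : (forall x : R, is_derive x 1 f (df x)) -> (derive1 f) = df.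
Proof. by move=> h; apply/funext => x; rewrite derive1E; case: (h x). Qed.

Lemma DkD k f g : Dk k f -> Dk k g -> Dk k (fun x => f x + g x).
Proof.
elim: k f g => // k IH f g [df Df] [dg Dg].
have h (x : R) : is_derive x 1 (fun x => f x + g x) ((derive1 f) x + (derive1 g) x).
  by rewrite !derive1E; apply: is_deriveD; exact: derivableP.
by split; [move=> x; case: (h x)|rewrite (derive1_eq h); exact: IH].
Qed.

Lemma DkM k f g : Dk k f -> Dk k g -> Dk k (fun x => f x * g x).
Proof.
elim: k f g => // k IH f g Hf Hg; have [df Df] := Hf; have [dg Dg] := Hg.
have h (x : R) : is_derive x 1 (fun x => f x * g x) (f x * (derive1 g) x + g x * (derive1 f) x).
  by rewrite !derive1E; apply: is_deriveM; exact: derivableP.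
split; first by move=> x; case: (h x).
by rewrite (derive1_eq h); apply: DkD; apply: IH => //; exact: Dk_pred.
Qed.

Lemma Dk_affine k f c d : Dk k f -> Dk k (fun x => f (c * x + d)).
Proof.
elim: k f => // k IH f [df Df].
have h (x : R) : is_derive x 1 (fun x => f (c * x + d)) (c * (derive1 f) (c * x + d)).
  rewrite derive1E mulrC.
  apply: (@is_derive1_comp _ f (fun x => c * x + d)); first exact: derivableP.
  have -> : (fun x : R => c * x + d) = (c *: (@id R)) + cst d by [].
  by apply: is_derive_eq; rewrite addr0; exact: mulr1.
split; first by move=> x; case: (h x).
rewrite (derive1_eq h); apply: DkM; last exact: IH.
elim: (k) (c) => // j IHj c'; split => //.
rewrite (@derive1_eq _ (fun=> 0)); first exact: IHj.
Qed.

Lemma smooth1M f g : smooth1 f -> smooth1 g -> smooth1 (fun x => f x * g x).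
Proof. by move=> sf sg k; exact: DkM. Qed.

Lemma smooth1_affine f c d : smooth1 f -> smooth1 (fun x => f (c * x + d)).
Proof. by move=> sf k; exact: Dk_affine. Qed.

Lemma smooth1_continuous f : smooth1 f -> continuous f.
Proof.
move=> sf x; apply/differentiable_continuous/derivable1_diffP.
exact: smooth1_derivable.
Qed.

End smooth1.

Section tensor.
Context {R : realType}.
Local Notation plane := (R * R)%type.

Lemma Ck_continuous k (f : plane -> R) : Ck k f -> continuous f.
Proof. by case: k => [|k] []. Qed.

Lemma Ck_tensor k (a b : R -> R) : smooth1 a -> smooth1 b ->
  Ck k (fun z : plane => a z.1 * b z.2).
Proof.
elim: k a b => [|k IH] a b sa sb.
  split => // z; apply: cvgM.
    by apply: (@continuous_comp _ _ _ fst a); [exact: cvg_fst|exact: smooth1_continuous].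
  by apply: (@continuous_comp _ _ _ snd b); [exact: cvg_snd|exact: smooth1_continuous].
have ca := Ck_continuous (IH _ _ sa sb).
have h1 (z : plane) : is_derive z e1 (fun z : plane => a z.1 * b z.2) ((derive1 a) z.1 * b z.2).
  by rewrite derive1E; apply: is_derive_tensor1; apply: derivableP; exact: smooth1_derivable.
have h2 (z : plane) : is_derive z e2 (fun z : plane => a z.1 * b z.2) (a z.1 * (derive1 b) z.2).
  by rewrite derive1E; apply: is_derive_tensor2; apply: derivableP; exact: smooth1_derivable.
split => //; split.
- by move=> z; case: (h1 z).
- by move=> z; case: (h2 z).
- have -> : (fun z => 'D_e1 (fun z : plane => a z.1 * b z.2) z) = (fun z => (derive1 a) z.1 * b z.2).
    by apply/funext => z; case: (h1 z).
  by apply: IH => //; exact: smooth1_derive.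
- have -> : (fun z => 'D_e2 (fun z : plane => a z.1 * b z.2) z) = (fun z => a z.1 * (derive1 b) z.2).
    by apply/funext => z; case: (h2 z).
  by apply: IH => //; exact: smooth1_derive.
Qed.

End tensor.

Section flat.
Context {R : realType}.
Local Notation plane := (R * R)%type.

(** The family [P(1/t) exp(-1/t)] is stable under differentiation, [P] becoming [X^2 (P - P')];
    smoothness of [exp(-1/t)] follows by induction on the order. *)
Definition flatp (P : {poly R}) (t : R) : R :=
  if 0 < t then P.[t^-1] * expR (- t^-1) else 0.

(** The quadratic rate makes the difference quotient of [flatp P] at 0 vanish. It comes from
    [exp x >= x^(n+2) / (n+2)!] at [x = 1/h], two powers beyond the size [n] of [P]. *)
Lemma flatp_bound (P : {poly R}) :
  exists A, forall h, 0 < h -> h <= 1 -> `|flatp P h| <= A * h ^+ 2.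
Proof.
pose n := size P; pose S := \sum_(i < n) `|P`_i|.
have S0 : 0 <= S by apply: sumr_ge0.
exists (S * (n.+2)`!%:R) => h h0 h1; rewrite /flatp h0 normrM (ger0_norm (expR_ge0 _)).
have hV : 1 <= h^-1 by rewrite invf_ge1.
have hV0 : 0 < h^-1 by rewrite invr_gt0.
have Pb : `|P.[h^-1]| <= S * h^-1 ^+ n.
  rewrite horner_coef; apply: le_trans (ler_norm_sum _ _ _) _.
  rewrite mulr_suml; apply: ler_sum => i _; rewrite normrM ler_wpM2l//.
  by rewrite ger0_norm ?exprn_ge0// ?(ltW hV0)// ler_weXn2l// ltnW.
have F0 : 0 < (n.+2)`!%:R :> R by rewrite ltr0n fact_gt0.
have Eb : expR (- h^-1) <= (n.+2)`!%:R * h ^+ n.+2.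
  have H := expR_ge1Dxn n.+1 (ltW hV0).
  rewrite expRN -div1r ler_pdivrMr ?expR_gt0//.
  have B0 : 0 <= (n.+2)`!%:R * h ^+ n.+2 by rewrite mulr_ge0 ?exprn_ge0 ?(ltW F0) ?(ltW h0).
  apply: (@le_trans _ _ ((n.+2)`!%:R * h ^+ n.+2 * (h^-1 ^+ n.+2 / (n.+2)`!%:R))).
    rewrite exprVn (mulrC (h ^- _)) mulrACA divff ?gt_eqF// mul1r mulfV// gt_eqF// exprn_gt0//.
  by apply: ler_wpM2l => //; apply: le_trans H; rewrite lerDr.
apply: le_trans (ler_pM _ _ Pb Eb) _; rewrite ?normr_ge0 ?expR_ge0//.
rewrite -!mulrA ler_wpM2l// mulrCA ler_wpM2l ?(ltW F0)//.
rewrite -(addn2 n) exprD mulrA -exprMn mulVf ?gt_eqF// expr1n mul1r//.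
Qed.

Lemma is_derive_flatp (P : {poly R}) (t : R) :
  is_derive t 1 (flatp P) (flatp ('X^2 * (P - P^`())) t).
Proof.
have [t0|t0|t0] := ltgtP t 0.
- rewrite (_ : flatp (_ * _) t = 0); last by rewrite /flatp ltNge (ltW t0).
  apply: (@near_eq_is_derive _ _ _ (cst 0)).
  near=> s; rewrite /flatp ifF//; apply/negbTE; rewrite -leNgt ltW//.
  by near: s; exact: lt_nbhsl.
- rewrite [X in is_derive _ _ _ X]/flatp t0.
  refine (@near_eq_is_derive _ _ _ (fun s : R => P.[s^-1] * expR (- s^-1)) (flatp P) t 1 _ _ _).
    near=> s; rewrite /flatp ifT//.
    by near: s; exact: lt_nbhsr.
  have hV : is_derive t 1 (fun s : R => s^-1) (- t ^- 2 *: (1 : R)).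
    by apply: (@is_deriveV R id); rewrite gt_eqF.
  have hE : is_derive t 1 (fun s : R => expR (- s^-1)) (expR (- t^-1) * (- (- t ^- 2 *: (1 : R)))).
    exact: (@is_derive1_comp _ (@expR R) (fun s => - s^-1)).
  have hP : is_derive t 1 (fun s : R => P.[s^-1]) (P^`().[t^-1] * (- t ^- 2 *: (1 : R))).
    exact: (@is_derive1_comp _ (horner P) (fun s => s^-1)).
  apply: is_derive_eq (is_deriveM hP hE) _.
  have -> : ('X^2 * (P - P^`())).[t^-1] = t^-1 ^+ 2 * (P.[t^-1] - P^`().[t^-1]) by rewrite !hornerE.
  rewrite -[LHS]/(P.[t^-1] * (expR (- t^-1) * - (- t ^- 2 * 1)) +
    expR (- t^-1) * (P^`().[t^-1] * (- t ^- 2 * 1))) -exprVn; ring.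
- rewrite (_ : flatp (_ * _) t = 0); last by rewrite /flatp t0 ltxx.
  have [A hA] := flatp_bound P.
  have lim0 : h^-1 *: (flatp P (h *: 1 + 0) - flatp P 0) @[h --> 0^'] --> (0 : R).
    apply/cvgrPdist_le => e e0.
    have A1 : 0 < `|A| + 1 by rewrite ltr_wpDl.
    near=> h; rewrite sub0r normrN addr0 (_ : h *: (1 : R) = h); last exact: mulr1.
    rewrite {2}/flatp ltxx subr0.
    have [h0|h0] := leP h 0; first by rewrite /flatp ltNge h0/= scaler0 normr0 ltW.
    rewrite normrM normfV (gtr0_norm h0) mulrC ler_pdivrMr//.
    have h1 : h <= 1.
      apply: le_trans (ler_norm _) _; near: h; apply: dnbhs0_le; exact: ltr01.
    apply: le_trans (hA h h0 h1) _; rewrite expr2 mulrA ler_pM2r//.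
    have : `|h| <= e / (`|A| + 1).
      by near: h; apply: dnbhs0_le; rewrite divr_gt0.
    rewrite gtr0_norm// ler_pdivlMr// => H; apply: le_trans H; rewrite mulrC ler_pM2l//.
    by apply: le_trans (ler_norm A) _; rewrite lerDl.
  split; first by apply/cvg_ex; exists 0; rewrite t0.
  by rewrite t0; apply/cvg_lim.
Unshelve. all: by end_near. Qed.
End flat.

(** * Testing against bump functions *)

Section dct.
Context d (T : measurableType d) (R : realType) (mu : {measure set T -> \bar R}).

Lemma dominated_Rintegral (f : nat -> T -> R) (g h : T -> R) :
  (forall n, measurable_fun setT (f n)) -> (forall n x, `|f n x| <= h x) ->
  integ mu h -> (forall x, f n x @[n --> \oo] --> g x) ->
  integ mu g /\ \int[mu]_x f n x @[n --> \oo] --> \int[mu]_x g x.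
Proof.
move=> mf fh hi fg.
have mg : measurable_fun setT g by apply: measurable_fun_cvg => // x _; exact: fg.
have [] := @dominated_convergence _ T R mu setT measurableT (fun n x => (f n x)%:E)
  (fun x => (g x)%:E) (EFin \o h).
- by move=> n; exact/measurable_EFinP.
- exact/measurable_EFinP.
- by apply: aeW => x _; apply: cvg_EFin; [exact: nearW|exact: fg].
- exact: hi.
- by apply: aeW => x n _; rewrite lee_fin.
move=> gi _ cv; split => //.
by apply: fine_cvg; rewrite fineK//; exact: integrable_fin_num.
Qed.

End dct.

(** * Boxes generate the measurable sets of the plane *)

Section box_induction.
Context {R : realType}.
Local Notation plane := (R * R)%type.
Local Notation mplane := (measurableTypeR R * measurableTypeR R)%type.
Implicit Types a b c d : plane.

Definition boxes : set (set mplane) := [set A | exists a b, A = box a b].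

Definition bmax a c : plane := (Num.max a.1 c.1, Num.max a.2 c.2).
Definition bmin a c : plane := (Num.min a.1 c.1, Num.min a.2 c.2).

Lemma boxI a b c d : box a b `&` box c d = box (bmax a c) (bmin b d).
Proof.
apply/seteqP; split=> -[x y]; rewrite /box /=.
  rewrite !in_itv/= !gt_max !lt_min.
  by move=> [[/andP[-> ->] /andP[-> ->]] [/andP[-> ->] /andP[-> ->]]].
rewrite !in_itv/= !gt_max !lt_min.
by move=> [/andP[/andP[-> ->] /andP[-> ->]] /andP[/andP[-> ->] /andP[-> ->]]].
Qed.

Lemma cbox_bmax_subset a b c d : cbox (bmax a c) (bmin b d) `<=` cbox a b.
Proof.
move=> [x y] [/=]; rewrite !in_itv/= !ge_max !le_min.
move=> /andP[/andP[? ?] /andP[? ?]] /andP[/andP[? ?] /andP[? ?]].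
by split; rewrite /= in_itv/=; apply/andP.
Qed.

Lemma setI_closed_boxes : setI_closed boxes.
Proof.
by move=> _ _ [a [b ->]] [c [d ->]]; rewrite boxI; exists (bmax a c), (bmin b d).
Qed.

Lemma itvoo_bigcup (t : R) : exists n : nat, t \in `] - n%:R, n%:R[.
Proof.
exists (Num.bound `|t|); rewrite in_itv/= -ltr_norml.
exact: archi_boundP.
Qed.

Lemma measurable_boxesE : @measurable _ mplane = <<s boxes >>.
Proof.
apply/seteqP; split; last first.
  apply: smallest_sub; first exact: sigma_algebra_measurable.
  by move=> _ [a [b ->]]; exact: measurable_box.
have [S0 SC SU] := smallest_sigma_algebra (setT : set mplane) boxes.
apply: smallest_sub; first exact: smallest_sigma_algebra.
have gen (p : mplane -> R) :
    (forall x y : R, <<s boxes >> (p @^-1` `]x, y[%classic)) ->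
    forall A : set R, measurable A -> <<s boxes >> (p @^-1` A).
  move=> hp.
  suff h : (@ocitv R).-sigma.-measurable `<=` [set A | <<s boxes >> (p @^-1` A)].
    by move=> A /h.
  rewrite (RGenOpens.measurableE R); apply: smallest_sub.
    split => /=.
    - by rewrite preimage_set0.
    - by move=> A hA; rewrite setTD -preimage_setC -setTD; exact: SC.
    - by move=> F hF; rewrite preimage_bigcup; exact: SU.
  by move=> _ [x [y ->]] /=; exact: hp.
rewrite subUset; split.
- move=> _ [A mA <-]; rewrite setTI; apply: gen => // x y.
  rewrite (_ : _ @^-1` _ = \bigcup_n box (x, - n%:R) (y, n%:R)).
    apply: SU => n; apply: sub_sigma_algebra; exists (x, - n%:R), (y, n%:R); by [].
  apply/seteqP; split => [[u v] /= uxy|[u v] [n _] [] //].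
  by have [n hn] := itvoo_bigcup v; exists n.
- move=> _ [A mA <-]; rewrite setTI; apply: gen => // x y.
  rewrite (_ : _ @^-1` _ = \bigcup_n box (- n%:R, x) (n%:R, y)).
    apply: SU => n; apply: sub_sigma_algebra; exists (- n%:R, x), (n%:R, y); by [].
  apply/seteqP; split => [[u v] /= uxy|[u v] [n _] [] //].
  by have [n hn] := itvoo_bigcup u; exists n.
Qed.

Lemma integ_indic (g : mplane -> R) (A : set mplane) : measurable A ->
  integ leb2 g -> integ leb2 (fun z => g z * \1_A z).
Proof.
move=> mA gi; apply: (@le_integ _ _ _ _ _ (fun z => `|g z|)).
- by apply: measurable_funM; [exact: integ_measurable gi|exact: measurable_indic].
- by move=> z; rewrite normrM ler_piMr// indicE; case: (_ \in _); rewrite ?normr1 ?normr0.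
- exact: integ_norm.
Qed.

Lemma norm_indicM (g : mplane -> R) (A : set mplane) z : `|g z * \1_A z| <= `|g z|.
Proof.
by rewrite normrM ler_piMr// indicE; case: (_ \in _); rewrite ?normr1 ?normr0.
Qed.

(** Boxes are stable under intersection and generate the measurable sets, so by Dynkin's theorem [g]
    integrates to 0 over every measurable set. The plane itself, which is no box, is reached by
    exhaustion. *)
Lemma ae_eq0_boxes (g : mplane -> R) : integ leb2 g ->
  (forall a b, \int[leb2]_z (g z * \1_(box a b) z) = 0) ->
  {ae leb2, forall z, g z = 0}.
Proof.
move=> gi gb.
have gT : \int[leb2]_z g z = 0.
  have [||||_ cv] := @dominated_Rintegral _ _ _ leb2
      (fun n z => g z * \1_(box (- n%:R, - n%:R) (n%:R, n%:R)) z)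
      g (fun z => `|g z|).
  - by move=> n; apply: integ_measurable; apply: integ_indic gi; exact: measurable_box.
  - by move=> n x; exact: norm_indicM.
  - exact: integ_norm.
  - move=> z; apply: cvg_near_cst.
    have [n1 hn1] := itvoo_bigcup z.1; have [n2 hn2] := itvoo_bigcup z.2.
    exists (n1 + n2)%N => // n /= nn.
    rewrite indicE mem_set ?mulr1//; split; rewrite /= in_itv/=.
    + move: hn1; rewrite in_itv/= -!ltr_norml => /lt_le_trans; apply.
      by rewrite ler_nat (leq_trans _ nn)// leq_addr.
    + move: hn2; rewrite in_itv/= -!ltr_norml => /lt_le_trans; apply.
      by rewrite ler_nat (leq_trans _ nn)// leq_addl.
  apply: (@cvg_unique _ (@Rhausdorff R) _ _ _ _ cv).
  by apply: cvg_near_cst; apply: nearW => n; exact: gb.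
have H (A : set mplane) : measurable A -> \int[leb2]_z (g z * \1_A z) = 0.
  rewrite [X in X A -> _](measurable_boxesE); move: A.
  apply: (@dynkin_induction _ mplane boxes (fun A => \int[leb2]_z (g z * \1_A z) = 0)).
  - exact: measurable_boxesE.
  - exact: setI_closed_boxes.
  - by rewrite -[RHS]gT; apply: eq_Rintegral => z _; rewrite indicT mulr1.
  - by move=> _ [a [b ->]]; exact: gb.
  - move=> S mS gS.
    rewrite (_ : (fun z => g z * \1_(~` S) z) = (fun z => g z - g z * \1_S z)).
      by rewrite RintegralBT ?gT ?gS ?subrr//; exact: integ_indic.
    apply/funext => z; rewrite !indicE in_setC.
    by case: (z \in S); rewrite ?mulr1 ?mulr0 ?subrr ?subr0.
  - move=> F mF tF gF.
    have mU n : measurable (\big[setU/set0]_(k < n) F k) by exact: bigsetU_measurable.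
    have gU n : \int[leb2]_z (g z * \1_(\big[setU/set0]_(k < n) F k) z) = 0.
      elim: n => [|n IH].
        rewrite big_ord0; under eq_Rintegral do rewrite indic0 mulr0.
        by rewrite Rintegral_cst// mul0r.
      rewrite big_ord_recr/=.
      rewrite (_ : (fun z => _) = (fun z => g z * \1_(\big[setU/set0]_(k < n) F k) z + g z * \1_(F n) z)).
        by rewrite RintegralDT ?IH ?gF ?addr0//; exact: integ_indic.
      apply/funext => z; rewrite -mulrDr; congr (_ * _); rewrite !indicE in_setU.
      have [zF|zF] := boolP (z \in F n); last by rewrite orbF addr0.
      rewrite orbT (_ : (z \in _) = false) ?add0r//; apply/negbTE/negP.
      rewrite inE -bigcup_mkord => -[k /= kn Fk]; move: zF; rewrite inE => Fn.
      have kE : k = n := tF k n Logic.I Logic.I (ex_intro _ z (conj Fk Fn)).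
      by rewrite kE ltnn in kn.
    have [||||_ cv] := @dominated_Rintegral _ _ _ leb2
      (fun n z => g z * \1_(\big[setU/set0]_(k < n) F k) z)
      (fun z => g z * \1_(\bigcup_k F k) z) (fun z => `|g z|).
    + by move=> n; apply: integ_measurable; exact: integ_indic gi.
    + by move=> n x; exact: norm_indicM.
    + exact: integ_norm.
    + move=> z; apply: cvg_near_cst.
      have [zU|/negP zU] := boolP (z \in \bigcup_k F k).
        move: (zU); rewrite inE => -[n _ Fn].
        exists n.+1 => // m /= nm; congr (_ * _); rewrite !indicE zU mem_set//.
        by rewrite -bigcup_mkord; exists n.
      apply: nearW => n; congr (_ * _); rewrite !indicE; congr (nat_of_bool _)%:R.
      rewrite [RHS](_ : _ = false); last exact/negP.
      apply/negP; rewrite inE -bigcup_mkord => -[k _ Fk].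
      by apply: zU; rewrite inE; exists k.
    apply: (@cvg_unique _ (@Rhausdorff R) _ _ _ _ cv).
    by apply: cvg_near_cst; apply: nearW => n; exact: gU.
have : ae_eq leb2 setT (EFin \o g) (cst 0%E).
  apply: integral_ae_eq => // E _ mE.
  have gE : integ leb2 (g \_ E).
    rewrite (_ : g \_ E = (fun z => g z * \1_E z)); first exact: integ_indic.
    by apply/funext => z; rewrite /patch indicE; case: (_ \in _); rewrite ?mulr1 ?mulr0.
  rewrite integral0 integral_mkcond restrict_EFin -integ_EFin//; congr EFin.
  rewrite -[RHS](H E)//; apply: eq_Rintegral => z _.
  by rewrite /patch indicE; case: (_ \in _); rewrite ?mulr1 ?mulr0.
by apply: filterS => x /= /(_ I) [].
Qed.

End box_induction.

Section bump.
Context {R : realType}.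
Local Notation plane := (R * R)%type.
Local Notation mplane := (measurableTypeR R * measurableTypeR R)%type.

Lemma smooth1_flatp (P : {poly R}) : smooth1 (flatp P).
Proof.
move=> k; elim: k P => // k IH P; split; first by move=> x; case: (is_derive_flatp P x).
by rewrite (derive1_eq (is_derive_flatp P)).
Qed.

Definition flat : R -> R := flatp 1.

Lemma flatE t : flat t = if 0 < t then expR (- t^-1) else 0.
Proof. by rewrite /flat /flatp hornerC mul1r. Qed.

Lemma flat_gt0 (t : R) : 0 < t -> 0 < flat t.
Proof. by move=> t0; rewrite flatE t0 expR_gt0. Qed.

Lemma flat_eq0 (t : R) : t <= 0 -> flat t = 0.
Proof. by move=> t0; rewrite flatE ltNge t0. Qed.

Lemma flat_ge0 (t : R) : 0 <= flat t.
Proof. by rewrite flatE; case: ifP => // _; exact: expR_ge0. Qed.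

Lemma flat_le1 (t : R) : flat t <= 1.
Proof.
rewrite flatE; case: ifP => [t0|_]; last exact: ler01.
by rewrite expR_le1 oppr_le0 invr_ge0 ltW.
Qed.

Lemma flat_cvg1 (t : R) : 0 < t -> flat (n.+1%:R * t) @[n --> \oo] --> (1 : R).
Proof.
move=> t0.
have -> : (fun n => flat (n.+1%:R * t)) = (fun n : nat => expR (- (n.+1%:R^-1 * t^-1))).
  by apply/funext => n; rewrite flatE mulr_gt0// invfM.
rewrite -[X in _ --> X](@expR0 R).
have h0 : - (n.+1%:R^-1 * t^-1) @[n --> \oo] --> (0 : R).
  by rewrite -oppr0; apply: cvgN; rewrite -(mul0r t^-1); apply: cvgMr_tmp; exact: cvg_harmonic.
by apply: (continuous_cvg _ _ h0); exact: continuous_expR.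
Qed.

Definition bump1 (k a b t : R) : R := flat (k * (t - a)) * flat (k * (b - t)).

Lemma smooth1_bump1 (k a b : R) : smooth1 (bump1 k a b).
Proof.
apply: smooth1M.
  have -> : (fun t => flat (k * (t - a))) = (fun t => flat (k * t + - (k * a))).
    by apply/funext => t; congr flat; ring.
  by apply: smooth1_affine; exact: smooth1_flatp.
have -> : (fun t => flat (k * (b - t))) = (fun t => flat ((- k) * t + k * b)).
  by apply/funext => t; congr flat; ring.
by apply: smooth1_affine; exact: smooth1_flatp.
Qed.

Lemma bump1_ge0 (k a b t : R) : 0 <= bump1 k a b t.
Proof. by rewrite mulr_ge0// flat_ge0. Qed.

Lemma bump1_le1 (k a b t : R) : bump1 k a b t <= 1.
Proof. by rewrite mulr_ile1// ?flat_ge0 ?flat_le1. Qed.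

Lemma bump1_eq0 (k a b t : R) : 0 < k -> t \notin `]a, b[ -> bump1 k a b t = 0.
Proof.
move=> k0; rewrite in_itv/= negb_and -!leNgt => /orP[h|h].
  by rewrite /bump1 flat_eq0 ?mul0r// pmulr_rle0// subr_le0.
by rewrite /bump1 (@flat_eq0 (k * (b - t))) ?mulr0// pmulr_rle0// subr_le0.
Qed.

Lemma bump1_gt0 (k a b t : R) : 0 < k -> t \in `]a, b[ -> 0 < bump1 k a b t.
Proof.
move=> k0; rewrite in_itv/= => /andP[h1 h2].
by rewrite mulr_gt0// flat_gt0// mulr_gt0// subr_gt0.
Qed.

Lemma bump1_cvg (a b t : R) : bump1 n.+1%:R a b t @[n --> \oo] --> ((t \in `]a, b[)%:R : R).
Proof.
have [tab|tab] := boolP (t \in `]a, b[); last first.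
  by apply: cvg_near_cst; apply: nearW => n; exact: bump1_eq0.
move: tab; rewrite in_itv/= => /andP[h1 h2].
by rewrite -[X in _ --> X]mulr1; apply: cvgM; apply: flat_cvg1; rewrite subr_gt0.
Qed.

(** The steepness [k] serves two ends: along [k = n.+1] the bumps tend to the indicator of the open
    box, and with [k = 1] they are fixed smooth cutoffs. *)
Definition bump k (a b z : plane) : R :=
  bump1 k a.1 b.1 z.1 * bump1 k a.2 b.2 z.2.

Lemma Ck_bump m k a b : Ck m (bump k a b).
Proof. by apply: Ck_tensor; exact: smooth1_bump1. Qed.

Lemma bump_ge0 k a b z : 0 <= bump k a b z.
Proof. by rewrite mulr_ge0// bump1_ge0. Qed.

Lemma bump_le1 k a b z : bump k a b z <= 1.
Proof. by rewrite mulr_ile1// ?bump1_ge0 ?bump1_le1. Qed.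

Lemma bump_eq0 k a b z : 0 < k -> ~ box a b z -> bump k a b z = 0.
Proof.
move=> k0 nz; rewrite /bump.
have [h1|h1] := boolP (z.1 \in `]a.1, b.1[); last by rewrite bump1_eq0 ?mul0r.
have [h2|h2] := boolP (z.2 \in `]a.2, b.2[); last by rewrite (bump1_eq0 k0 h2) mulr0.
by case: nz; split.
Qed.

Lemma bump_gt0 k a b z : 0 < k -> box a b z -> 0 < bump k a b z.
Proof. by move=> k0 [h1 h2]; rewrite mulr_gt0// bump1_gt0. Qed.

Lemma bump_cvg a b z : bump n.+1%:R a b z @[n --> \oo] --> (\1_(box a b) z : R).
Proof.
rewrite indicE (_ : (z \in box a b) = (z.1 \in `]a.1, b.1[) && (z.2 \in `]a.2, b.2[)).
  by rewrite -mulnb natrM; apply: cvgM; exact: bump1_cvg.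
by apply/idP/andP; rewrite inE.
Qed.

Lemma compact_support_cbox (Omega : set plane) (f : plane -> R) a b :
  cbox a b `<=` Omega -> (forall z, ~ cbox a b z -> f z = 0) ->
  compact_support_in Omega f.
Proof.
move=> abO f0.
have cb : closure [set x | f x != 0] `<=` cbox a b.
  rewrite [X in _ `<=` X](_ : _ = closure (cbox a b)).
    apply: closure_subset => z /= fz; apply: contrapT => /f0 h.
    by rewrite h eqxx in fz.
  apply/closure_id; apply: compact_closed; last exact: compact_cbox.
  exact: norm_hausdorff.
split; last exact: subset_trans abO.
apply: subclosed_compact cb; last exact: compact_cbox.
exact: closed_closure.
Qed.

Lemma Cinfc_bump (Omega : set plane) k a b : 0 < k -> cbox a b `<=` Omega ->
  Cinfc Omega (bump k a b).
Proof.
move=> k0 abO; split; first by move=> m; exact: Ck_bump.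
apply: compact_support_cbox abO _ => z nz; apply: bump_eq0 => // hb.
exact/nz/box_subset_cbox.
Qed.

Lemma sqint_integ_cbox (w : mplane -> R) a b : sqint leb2 w ->
  integ leb2 (fun z => w z * \1_(cbox a b) z).
Proof.
move=> sw; apply: sqintM => //; split.
  by apply: measurable_indic; exact: measurable_cbox.
apply: (@integ_bounded_support R _ a b 1).
- by apply: measurable_funX; apply: measurable_indic; exact: measurable_cbox.
- by move=> z; rewrite indicE; case: (_ \in _); rewrite ?expr1n ?normr1 ?expr0n ?normr0.
- by move=> z nz; rewrite indicE memNset// expr0n.
Qed.

(** Inside a box whose closure lies in [Omega], ever steeper bumps turn the hypothesis into
    vanishing integrals over all smaller boxes, hence [w = 0] almost everywhere there; countably
    many such boxes cover [Omega]. *)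
Lemma fundamental_lemma (Omega : set plane) (w : mplane -> R) : open Omega ->
  sqint leb2 w ->
  (forall n a b, cbox a b `<=` Omega -> \int[leb2]_z (w z * bump n.+1%:R a b z) = 0) ->
  {ae leb2, forall z, Omega z -> w z = 0}.
Proof.
move=> oO sw hw.
have boxw a b : cbox a b `<=` Omega -> {ae leb2, forall z, box a b z -> w z = 0}.
  move=> abO.
  have bI c d : box c d `<=` cbox c d by exact: box_subset_cbox.
  have iw : integ leb2 (fun z => w z * \1_(box a b) z).
    rewrite (_ : (fun z => _) = (fun z => (w z * \1_(cbox a b) z) * \1_(box a b) z)).
      by apply: integ_indic; [exact: measurable_box|exact: sqint_integ_cbox].
    apply/funext => z; rewrite -mulrA; congr (_ * _); rewrite !indicE.
    have [zb|] := boolP (z \in box a b); last by rewrite mulr0.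
    by rewrite mulr1 mem_set//; apply: bI; move: zb; rewrite inE.
  have b0 c d : cbox c d `<=` Omega -> \int[leb2]_z (w z * \1_(box c d) z) = 0.
    move=> cdO.
    have [||||_ cv] := @dominated_Rintegral _ _ _ leb2
      (fun n z => w z * bump n.+1%:R c d z) (fun z => w z * \1_(box c d) z)
      (fun z => `|w z * \1_(cbox c d) z|).
    - move=> n; apply: measurable_funM; first by case: sw.
      by apply: measurable_continuous; apply: Ck_continuous (Ck_bump 0 _ _ _).
    - move=> n z; rewrite normrM [leRHS]normrM ler_wpM2l// indicE.
      have [zb|/negP zb] := boolP (z \in cbox c d).
        by rewrite normr1 ger0_norm ?bump_ge0// bump_le1.
      by rewrite bump_eq0// => h; apply: zb; rewrite inE; exact: bI.
    - by apply: integ_norm; exact: sqint_integ_cbox.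
    - move=> z; apply: cvgM; [exact: cvg_cst|exact: bump_cvg].
    apply: (@cvg_unique _ (@Rhausdorff R) _ _ _ _ cv).
    by apply: cvg_near_cst; apply: nearW => n; exact: hw.
  have : {ae leb2, forall z, w z * \1_(box a b) z = 0}.
    (* The product of two indicators of boxes is the indicator of a box, whose closed version still
       lies in [Omega]. *)
    apply: ae_eq0_boxes => // c d.
    rewrite -[RHS](b0 (bmax a c) (bmin b d)); last first.
      exact: subset_trans (@cbox_bmax_subset _ _ _ _ _) abO.
    apply: eq_Rintegral => z _; rewrite -mulrA; congr (_ * _).
    by rewrite -boxI !indicE in_setI -natrM mulnb.
  by apply: filterS => z + zb; rewrite indicE mem_set// mulr1.
(* Only rational boxes occur, so the exceptional null sets are countably many; an index that codes
   no box gets the whole plane. *)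
pose F (n : nat) : set mplane := if unpickle n is Some q then
  [set z | cbox (qpt (q : (rat * rat) * (rat * rat)).1) (qpt q.2) `<=` Omega -> box (qpt q.1) (qpt q.2) z -> w z = 0] else setT.
have : {ae (@leb2 R), forall z, forall n, F n z}.
  apply/ae_foralln => n; rewrite /F; case: unpickle => [q|]; last exact: aeW.
  have [sub|nsub] := pselect (cbox (qpt q.1) (qpt q.2) `<=` Omega).
    apply: (@filterS _ _ (ae_filter_ringOfSetsType (@leb2 R)) _ _ _ (boxw _ _ sub)).
    by move=> z hz _.
  by apply: aeW => z /= /nsub.
apply: filterS => z Fz Oz; have [q [bz sub]] := open_rat_box oO Oz.
have := Fz (pickle q); rewrite /F pickleK; exact.
Qed.

End bump.

(** * Mollification *)

Section plane_fubini.
Context {R : realType}.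
Local Notation plane := (R * R)%type.
Local Notation leb := (@lebesgue_measure R).
Local Notation mplane := (measurableTypeR R * measurableTypeR R)%type.

Lemma leb2_sigma_finite : sigma_finite setT (@leb2 R).
Proof.
exists (fun n => cbox (- n%:R, - n%:R) (n%:R, n%:R)).
  apply/seteqP; split => // z _.
  have [n1 hn1] := itvoo_bigcup z.1; have [n2 hn2] := itvoo_bigcup z.2.
  move: hn1 hn2; rewrite !in_itv/= -!ltr_norml => h1 h2.
  exists (n1 + n2)%N => //; split; rewrite /= in_itv/= -ler_norml ltW//.
    by apply: lt_le_trans h1 _; rewrite ler_nat leq_addr.
  by apply: lt_le_trans h2 _; rewrite ler_nat leq_addl.
by move=> n; split; [exact: measurable_cbox|exact: leb2_cbox_lty].
Qed.

(* [leb2] is declared as a mere measure, while Fubini needs sigma-finiteness. *)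
Definition leb2f : set mplane -> \bar R := @leb2 R.
HB.instance Definition _ := Measure.copy leb2f (@leb2 R).
HB.instance Definition _ := Measure_isSigmaFinite.Build _ _ _ leb2f leb2_sigma_finite.

Implicit Types F : mplane * mplane -> R.

Lemma tonelli_plane F : measurable_fun setT F -> (forall p, 0 <= F p) ->
  (\int[@leb2 R]_x \int[@leb2 R]_y (F (x, y))%:E =
   \int[@leb2 R]_y \int[@leb2 R]_x (F (x, y))%:E)%E.
Proof.
move=> mF F0.
have mF' : measurable_fun setT (fun p => (F p)%:E) by exact/measurable_EFinP.
exact: (@fubini_tonelli _ _ _ _ _ leb2f leb2f _ mF' (fun p => F0 p)).
Qed.

Lemma measurable_partial1 F y : measurable_fun setT F -> measurable_fun setT (fun x => F (x, y)).
Proof. by move=> mF; apply: measurableT_comp mF _; exact: measurable_pair2. Qed.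

Lemma measurable_partial2 F x : measurable_fun setT F -> measurable_fun setT (fun y => F (x, y)).
Proof. by move=> mF; apply: measurableT_comp mF _; exact: measurable_pair1. Qed.

Lemma tonelli_Rintegral F : measurable_fun setT F -> (forall p, 0 <= F p) ->
  (forall x, integ leb2 (fun y => F (x, y))) ->
  (forall y, integ leb2 (fun x => F (x, y))) ->
  integ leb2 (fun y => \int[leb2]_x F (x, y)) ->
  integ leb2 (fun x => \int[leb2]_y F (x, y)) /\
  \int[leb2]_x (\int[leb2]_y F (x, y)) = \int[leb2]_y (\int[leb2]_x F (x, y)).
Proof.
move=> mF F0 F1 F2 iF.
have E := tonelli_plane mF F0.
have mF' : measurable_fun setT (fun p => (F p)%:E) by exact/measurable_EFinP.
have E1 x : (\int[@leb2 R]_y (F (x, y))%:E = (\int[leb2]_y F (x, y))%:E)%E.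
  by rewrite integ_EFin.
have E2 y : (\int[@leb2 R]_x (F (x, y))%:E = (\int[leb2]_x F (x, y))%:E)%E.
  by rewrite integ_EFin.
have E3 : (\int[@leb2 R]_x (\int[leb2]_y F (x, y))%:E =
    \int[@leb2 R]_y (\int[leb2]_x F (x, y))%:E)%E.
  under eq_integral do rewrite -E1.
  by rewrite E; apply: eq_integral => y _; rewrite E2.
split; last by rewrite /Rintegral E3.
apply: integ_ge0_lty.
- have := @measurable_fun_fubini_tonelli_F _ _ _ _ _ leb2f _ mF' (fun p => F0 p).
  rewrite /fubini_F (_ : (fun x => _) = EFin \o (fun x => \int[leb2]_y F (x, y))); first by move/measurable_EFinP.
  by apply/funext => x /=; rewrite -E1.
- by move=> x; apply: Rintegral_ge0 => y _.
- by rewrite E3; exact: integrable_lty.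
Qed.

Lemma fubini_Rintegral F (G : mplane * mplane -> R) : measurable_fun setT F ->
  measurable_fun setT G -> (forall p, `|F p| <= G p) ->
  (forall x, integ leb2 (fun y => G (x, y))) ->
  (forall y, integ leb2 (fun x => G (x, y))) ->
  integ leb2 (fun y => \int[leb2]_x G (x, y)) ->
  \int[leb2]_x (\int[leb2]_y F (x, y)) = \int[leb2]_y (\int[leb2]_x F (x, y)).
Proof.
move=> mF mG FG G1 G2 iG.
have G0 p : 0 <= G p by apply: le_trans (FG p).
have mF' : measurable_fun setT (fun p => (F p)%:E) by exact/measurable_EFinP.
have iF : (leb2f \x leb2f)%E.-integrable setT (fun p => (F p)%:E).
  apply/integrable21ltyP => //.
  apply: (@le_lt_trans _ _ (\int[@leb2 R]_y (\int[leb2]_x G (x, y))%:E)%E).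
    apply: ge0_le_integral => //.
    - by move=> y _; apply: integral_ge0.
    - apply: (@measurable_fun_fubini_tonelli_G _ _ _ _ _ leb2f (fun p => `|(F p)%:E|%E)) => //.
      exact: measurableT_comp.
    - by apply/measurable_EFinP; exact: integ_measurable iG.
    - move=> y _; rewrite integ_EFin//; apply: ge0_le_integral => //.
      + apply: measurableT_comp => //; apply/measurable_EFinP; exact: measurable_partial1.
      + by apply/measurable_EFinP; exact: measurable_partial1.
      + by move=> x _; rewrite lee_fin.
  exact: integrable_lty.
have i1 x : integ leb2 (fun y => F (x, y)).
  by apply: le_integ (G1 x) => [|y]; [exact: measurable_partial2|exact: FG].
have i2 y : integ leb2 (fun x => F (x, y)).
  by apply: le_integ (G2 y) => [|x]; [exact: measurable_partial1|exact: FG].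
have E := Fubini iF; rewrite /Rintegral.
under eq_integral do rewrite -/(Rintegral _ _ _) integ_EFin//.
under [in RHS]eq_integral do rewrite -/(Rintegral _ _ _) integ_EFin//.
by rewrite E.
Qed.

End plane_fubini.

(** * Convolution with compactly supported kernels *)

Section kernels.
Context {R : realType}.
Local Notation plane := (R * R)%type.
Local Notation mplane := (measurableTypeR R * measurableTypeR R)%type.
Implicit Types (x y z v : plane) (f g : mplane -> R) (K : plane -> R).

Definition square x (r : R) : set plane :=
  cbox (x.1 - r, x.2 - r) (x.1 + r, x.2 + r).

Lemma squareE x r z : square x r z <-> `|z.1 - x.1| <= r /\ `|z.2 - x.2| <= r.
Proof.
rewrite /square /cbox /= !in_itv/= !ler_norml; split.
  by move=> [/andP[? ?] /andP[? ?]]; split; apply/andP; split; lra.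
by move=> [/andP[? ?] /andP[? ?]]; split; apply/andP; split; lra.
Qed.

Lemma square_norm x r z : square x r z <-> `|z - x| <= r.
Proof.
rewrite squareE prod_normE/= ge_max; split; first by move=> [-> ->].
by move=> /andP[-> ->].
Qed.

(** Dominated convergence speaks of sequences; this brings the continuity of integrals depending on
    a parameter into its reach. *)
Lemma seq_continuous (F : plane -> R) (p : plane) :
  (forall u : nat -> plane, (forall n, `|u n - p| < n.+1%:R^-1) ->
     F (u n) @[n --> \oo] --> F p) -> {for p, continuous F}.
Proof.
move=> H; apply: contrapT => nc.
have [e e0 he] : exists2 e : R, 0 < e &
    forall n : nat, exists z, `|z - p| < n.+1%:R^-1 /\ e <= `|F p - F z|.
  apply: contrapT => H1; apply: nc; apply/cvgrPdist_lt => e e0.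
  apply: contrapT => H2; apply: H1; exists e => // n.
  apply: contrapT => H3; apply: H2.
  have n0 : 0 < (n.+1%:R^-1 : R) by rewrite invr_gt0.
  have := @nbhsx_ballx _ _ p _ n0; apply: filterS => z pz.
  rewrite ltNge; apply/negP => ez; apply: H3; exists z; split => //.
  by move: pz; rewrite -ball_normE /= distrC.
have [u hu] := choice he.
have /cvgrPdist_lt/(_ _ e0) [N _ hN] := H u (fun n => (hu n).1).
have := hN N (leqnn N); rewrite /= ltNge => /negP; apply.
exact: (hu N).2.
Qed.

Lemma bounded_cbox K a b : continuous K -> (forall z, ~ cbox a b z -> K z = 0) ->
  exists2 C, 0 <= C & forall z, `|K z| <= C.
Proof.
move=> cK K0.
have : bounded_set (K @` cbox a b).
  apply: compact_bounded; apply: continuous_compact; last exact: compact_cbox.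
  exact: continuous_subspaceT.
move=> /pinfty_ex_gt0[C C0 hC]; exists C => [|z]; first exact: ltW.
have [zb|nz] := pselect (cbox a b z); last by rewrite K0// normr0 ltW.
by apply: hC; exists z.
Qed.

Lemma derive_support K a b v z : (forall z, ~ cbox a b z -> K z = 0) ->
  ~ cbox a b z -> 'D_v K z = 0.
Proof.
move=> K0 nz.
have oc : open (~` cbox a b).
  apply: closed_openC; apply: compact_closed; last exact: compact_cbox.
  exact: norm_hausdorff.
have nC : \forall w \near z, K w = (cst 0 : plane -> R) w.
  by apply: filterS (open_nbhs_nbhs (conj oc nz)) => w hw; exact: K0.
by rewrite (near_eq_derive _ nC) derive_cst.
Qed.

Record kernel K (r : R) : Prop := Kernel {
  kernel_cont : continuous K;
  kernel_supp : forall z, ~ square 0 r z -> K z = 0 }.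

Lemma kernel_bounded K r : kernel K r -> exists2 C, 0 <= C & forall z, `|K z| <= C.
Proof. by move=> [cK sK]; exact: bounded_cbox cK sK. Qed.

Lemma measurable_shiftK K x : continuous K -> measurable_fun setT (fun y : mplane => K (x - y)).
Proof.
move=> cK; apply: measurable_continuous => y; apply: continuous_comp; last exact: cK.
by apply: cvgB; [exact: cvg_cst|exact: cvg_id].
Qed.

Lemma kernel_shift0 K r x y : kernel K r -> ~ square x r y -> K (x - y) = 0.
Proof.
move=> kK ny; apply: (kernel_supp kK) => h; apply: ny; move: h.
by rewrite !square_norm subr0 distrC.
Qed.

Lemma kernel_sqint K r x : kernel K r -> sqint (@leb2 R) (fun y => K (x - y)).
Proof.
move=> kK; have [C C0 KC] := kernel_bounded kK.
have mK := measurable_shiftK x (kernel_cont kK).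
split => //; apply: (@integ_bounded_support R _ (x.1 - r, x.2 - r) (x.1 + r, x.2 + r) (C ^+ 2)).
- exact: measurable_funX.
- by move=> z; rewrite normrX ler_pXn2r// nnegrE.
- by move=> z nz; rewrite (kernel_shift0 kK nz) expr0n.
Qed.

Lemma kernel_integ K r x : kernel K r -> integ (@leb2 R) (fun y => K (x - y)).
Proof.
move=> kK; have [C C0 KC] := kernel_bounded kK.
apply: (@integ_bounded_support R _ (x.1 - r, x.2 - r) (x.1 + r, x.2 + r) C).
- exact: measurable_shiftK (kernel_cont kK).
- by move=> z.
- by move=> z nz; rewrite (kernel_shift0 kK nz).
Qed.

Definition conv f K x : R := \int[@leb2 R]_y (f y * K (x - y)).

Lemma conv_integ f K r x : sqint leb2 f -> kernel K r ->
  integ leb2 (fun y => f y * K (x - y)).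
Proof. by move=> sf kK; apply: sqintM => //; exact: kernel_sqint kK. Qed.

Lemma conv_bounded f K r : sqint leb2 f -> kernel K r ->
  exists2 C, 0 <= C & forall x, `|conv f K x| <= C.
Proof.
move=> sf kK.
pose A := ip2 leb2 f f; pose B := \int[@leb2 R]_y (K y ^+ 2).
have A0 : 0 <= A by exact: (ip_ge0 (sqint_semi_inner _) sf).
(* From [c ^+ 2 <= A * B] follows [|c| <= 1 + A * B], which avoids a square root. *)
exists (1 + A * B).
  by rewrite addr_ge0// mulr_ge0// Rintegral_ge0// => y _; exact: sqr_ge0.
move=> x.
have sK := kernel_sqint x kK.
have := ip_CS (sqint_semi_inner leb2) sf sK.
rewrite -/A [X in _ <= A * X]ip2E.
have iK2 : integ (@leb2 R) (fun y => K y ^+ 2).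
  have := integ_reflect 0 (kernel_sqint 0 kK).2.
  by congr integ; apply/funext => y; rewrite !sub0r opprK.
rewrite (Rintegral_reflect x iK2) -/B.
rewrite -[ip2 _ _ _]/(conv f K x) => h.
rewrite -(real_normK (num_real _)) in h.
have := normr_ge0 (conv f K x); nra.
Qed.

Lemma conv_continuous f K r : sqint leb2 f -> kernel K r -> continuous (conv f K).
Proof.
move=> sf kK p; apply: seq_continuous => u hu.
have [C C0 KC] := kernel_bounded kK.
(* Since [|u n - p| <= 1], all the shifted kernels are supported in the square of radius [r + 1]
   about [p], which gives one dominating function. *)
have [||||_ //] := @dominated_Rintegral _ _ _ (@leb2 R) (fun n y => f y * K (u n - y))
  (fun y => f y * K (p - y))
  (fun y => C * `|f y * \1_(cbox (p.1 - (r + 1), p.2 - (r + 1)) (p.1 + (r + 1), p.2 + (r + 1))) y|).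
- by move=> n; apply: integ_measurable; exact: conv_integ kK.
- move=> n y; rewrite indicE.
  have [yb|/negP yb] := boolP (y \in _).
    by rewrite mulr1 normrM mulrC ler_wpM2r.
  rewrite (kernel_shift0 kK) ?mulr0 ?normr0 ?mulr0// => h; apply: yb.
  rewrite inE; apply/(square_norm p (r + 1)); move: h; rewrite square_norm => h.
  rewrite -(subrKA (u n)); apply: le_trans (ler_normD _ _) _; apply: lerD => //.
  apply: le_trans (ltW (hu n)) _; rewrite invf_le1//; by rewrite ler1n.
- by apply: integZ; apply: integ_norm; exact: sqint_integ_cbox.
- move=> y; apply: cvgM; first exact: cvg_cst.
  have up : u n - y @[n --> \oo] --> p - y.
    apply: cvgB; last exact: cvg_cst.
    apply/cvgrPdist_lt => e e0; near=> n; rewrite distrC; apply: lt_trans (hu n) _.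
    by near: n; exact: (near_infty_natSinv_lt (PosNum e0)).
  by apply: (continuous_cvg _ _ up); exact: (kernel_cont kK).
Unshelve. all: by end_near. Qed.

Lemma conv_derive f K dK r v x : sqint leb2 f -> kernel K r -> kernel dK r ->
  `|v| <= 1 -> (forall z, is_derive z v K (dK z)) ->
  is_derive x v (conv f K) (conv f dK x).
Proof.
move=> sf kK kdK v1 hK.
have [C C0 dKC] := kernel_bounded kdK.
have r0 : 0 <= `|r| by [].
have hd t y : is_derive (t : R) 1 (fun s => f y * K (s *: v + x - y)) (f y * dK (t *: v + x - y)).
  apply: (@is_deriveZ _ _ _ (fun s : R => K (s *: v + x - y)) (f y)).
  have -> : (fun s : R => K (s *: v + x - y)) = (fun s => K (s *: v + (x - y))).
    by apply/funext => s; rewrite addrA.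
  have -> : t *: v + x - y = t *: v + (x - y) by rewrite addrA.
  exact: ((is_derive_lineE K (x - y) v t (dK (t *: v + (x - y)))).1 (hK _)).
apply/is_derive_line.
have h0 : (0 : R) \in `](-1), 1[ by rewrite in_itv/= ltrN10 ltr01.
pose F (t : R) (y : mplane) := f y * K (t *: v + x - y).
have hp t y : partial1of2 F t y = f y * dK (t *: v + x - y).
  by rewrite partial1of2E; case: (hd t y).
have iF t : integ leb2 (F t) by exact: conv_integ kK.
pose G y := C * `|f y * \1_(cbox (x.1 - (r + 1), x.2 - (r + 1)) (x.1 + (r + 1), x.2 + (r + 1))) y|.
have G0 y : 0 <= G y by rewrite mulr_ge0.
have iG : integ leb2 G by apply: integZ; apply: integ_norm; exact: sqint_integ_cbox.
(* For [|t| < 1] and [|v| <= 1] every kernel shifted along [t *: v] is supported in the square of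
   radius [r + 1] about [x], so the bound [G] is independent of [t]. *)
have FG t y : t \in `](-1), 1[ -> `|partial1of2 F t y| <= G y.
  rewrite in_itv/= -ltr_norml hp => t1; rewrite /G indicE.
  have [yb|/negP yb] := boolP (y \in _).
    by rewrite mulr1 normrM mulrC ler_wpM2r.
  rewrite (kernel_shift0 kdK) ?mulr0 ?normr0 ?mulr0// => h; apply: yb.
  rewrite inE; apply/(square_norm x (r + 1)); move: h; rewrite square_norm => h.
  rewrite -(subrKA (t *: v + x)); apply: le_trans (ler_normD _ _) _; apply: lerD => //.
  by rewrite addrK normrZ mulr_ile1// ltW.
have dF t y : derivable (F ^~ y) t 1 by case: (hd t y).
have D := @differentiation_under_integral R _ mplane (@leb2 R) F setT measurableT 0 (-1) 1 h0
  (fun t _ => iF t) (fun t y _ _ => dF t y) G G0 iG (fun t y h _ => FG t y h).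
have D2 := @derivable_under_integral R _ mplane (@leb2 R) F setT measurableT 0 (-1) 1 h0
  (fun t _ => iF t) (fun t y _ _ => dF t y) G G0 iG (fun t y h _ => FG t y h).
split; first exact: D2.
rewrite -derive1E [LHS]D; apply: eq_Rintegral => y _; rewrite hp.
by rewrite scale0r add0r.
Qed.

End kernels.

(** * The mollifier and its pointwise properties *)

Section mollifier.
Context {R : realType}.
Local Notation plane := (R * R)%type.
Local Notation mplane := (measurableTypeR R * measurableTypeR R)%type.
Implicit Types (x y z v : plane) (f g : mplane -> R) (r : R).

Definition rho0 r : plane -> R := bump 1 (- r, - r) (r, r).
Definition rho_mass r : R := \int[@leb2 R]_z rho0 r z.
Definition rho r z : R := (rho_mass r)^-1 * rho0 r z.
Definition drho r v z : R := 'D_v (rho r) z.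
Definition moll r f : plane -> R := conv f (rho r).

Lemma square0 r : square (0 : plane) r = cbox (- r, - r) (r, r).
Proof. by rewrite /square /= !sub0r !add0r. Qed.

Lemma rho0_kernel r : kernel (rho0 r) r.
Proof.
split; first exact: Ck_continuous (Ck_bump 0 _ _ _).
move=> z; rewrite square0 => nz; apply: bump_eq0; first exact: ltr01.
by move=> h; apply: nz; exact: box_subset_cbox.
Qed.

Lemma rho0_integ r : integ (@leb2 R) (rho0 r).
Proof.
have := integ_reflect 0 (kernel_integ 0 (rho0_kernel r)).
by congr integ; apply/funext => y; rewrite !sub0r opprK.
Qed.

Lemma rho_mass_gt0 r : 0 < r -> 0 < rho_mass r.
Proof.
move=> r0; rewrite lt_neqAle Rintegral_ge0 ?andbT; last by move=> z _; exact: bump_ge0.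
apply/negP => /eqP/esym h0.
have [N [mN N0 sub]] := Rintegral_eq0_ae (rho0_integ r) (fun z => bump_ge0 _ _ _ _) h0.
have bN : box (- r, - r) (r, r) `<=` N.
  by move=> z /(bump_gt0 ltr01) bz; apply: sub => /= h; move: bz; rewrite -/(rho0 r z) h ltxx.
have Nb : (@leb2 R (box (- r, - r)%R (r, r)%R) <= 0)%E.
  by rewrite -N0; apply: le_measure => //; rewrite inE//; exact: measurable_box.
have E : @leb2 R (box (- r, - r) (r, r)) = (@lebesgue_measure R (`](- r)%R, r[%classic : set R) *
    @lebesgue_measure R (`](- r)%R, r[%classic : set R))%E.
  exact: product_measure1E.
move: Nb; rewrite E lebesgue_measure_itv/= lte_fin (_ : - r < r); last lra.
by rewrite -EFinB -EFinM lee_fin leNgt mulr_gt0//; lra.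
Qed.

Lemma rho_ge0 r z : 0 <= rho r z.
Proof.
rewrite mulr_ge0 ?bump_ge0// invr_ge0 Rintegral_ge0// => w _; exact: bump_ge0.
Qed.

Lemma Ck_scale k (c : R) (F : plane -> R) : Ck k F -> Ck k (fun z => c * F z).
Proof.
elim: k F => [|k IH] F.
  by move=> [cF _]; split => // z; apply: cvgM; [exact: cvg_cst|exact: cF].
move=> [cF [d1 d2 c1 c2]].
have h v z : derivable F z v -> is_derive z v (fun z => c * F z) (c * 'D_v F z).
  by move=> /derivableP dF; exact: is_deriveZ.
split; first by move=> z; apply: cvgM; [exact: cvg_cst|exact: cF].
split.
- by move=> z; case: (h e1 z (d1 z)).
- by move=> z; case: (h e2 z (d2 z)).
- rewrite (_ : (fun z => _) = (fun z => c * 'D_e1 F z)); first exact: IH.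
  by apply/funext => z; case: (h e1 z (d1 z)).
- rewrite (_ : (fun z => _) = (fun z => c * 'D_e2 F z)); first exact: IH.
  by apply/funext => z; case: (h e2 z (d2 z)).
Qed.

Lemma Ck_rho k r : Ck k (rho r).
Proof. by apply: Ck_scale; exact: Ck_bump. Qed.

Lemma rho_kernel r : kernel (rho r) r.
Proof.
split; first exact: Ck_continuous (Ck_rho 0 r).
by move=> z nz; rewrite /rho (kernel_supp (rho0_kernel r) nz) mulr0.
Qed.

Lemma drho1_kernel r : kernel (drho r e1) r.
Proof.
split; first by have [_ [_ _ c _]] := Ck_rho 1 r; exact: (@Ck_continuous _ 0 _ c).
move=> z; rewrite square0 => nz; apply: derive_support nz => w; rewrite -square0.
exact: (kernel_supp (rho_kernel r)).
Qed.

Lemma drho2_kernel r : kernel (drho r e2) r.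
Proof.
split; first by have [_ [_ _ _ c]] := Ck_rho 1 r; exact: (@Ck_continuous _ 0 _ c).
move=> z; rewrite square0 => nz; apply: derive_support nz => w; rewrite -square0.
exact: (kernel_supp (rho_kernel r)).
Qed.

Lemma rho_even r z : rho r (- z) = rho r z.
Proof.
rewrite /rho /rho0 /bump /bump1 /=; congr (_ * _).
by rewrite !mul1r !opprK (addrC (- z.1)) (addrC (- z.2)) (addrC r z.1) (addrC r z.2); ring.
Qed.

Lemma rhoC r x y : rho r (x - y) = rho r (y - x).
Proof. by rewrite -rho_even opprB. Qed.

Lemma rho_mass1 r x : 0 < r -> \int[@leb2 R]_y rho r (x - y) = 1.
Proof.
move=> r0; have h := rho0_integ r.
have := Rintegral_reflect x (integZ (rho_mass r)^-1 h) => ->.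
by rewrite RintegralZT// mulVf// gt_eqF// rho_mass_gt0.
Qed.

Lemma rho_integ r x : integ (@leb2 R) (fun y => rho r (x - y)).
Proof. exact: kernel_integ (rho_kernel r). Qed.

Lemma rho_integC r y : integ (@leb2 R) (fun x => rho r (x - y)).
Proof. by under eq_fun do rewrite rhoC; exact: rho_integ. Qed.

Lemma rho_mass1C r y : 0 < r -> \int[@leb2 R]_x rho r (x - y) = 1.
Proof. by move=> r0; under eq_Rintegral do rewrite rhoC; exact: rho_mass1. Qed.

Lemma e1_norm : `|e1 : plane| <= 1.
Proof. by rewrite prod_normE/= normr1 normr0 ge_max lexx ler01. Qed.

Lemma e2_norm : `|e2 : plane| <= 1.
Proof. by rewrite prod_normE/= normr1 normr0 ge_max lexx ler01. Qed.

Lemma is_derive_moll1 r f x : sqint leb2 f ->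
  is_derive x e1 (moll r f) (conv f (drho r e1) x).
Proof.
move=> sf; apply: (conv_derive _ sf (rho_kernel r) (drho1_kernel r) e1_norm) => z.
by apply: derivableP; have [_ [d _ _ _]] := Ck_rho 1 r.
Qed.

Lemma is_derive_moll2 r f x : sqint leb2 f ->
  is_derive x e2 (moll r f) (conv f (drho r e2) x).
Proof.
move=> sf; apply: (conv_derive _ sf (rho_kernel r) (drho2_kernel r) e2_norm) => z.
by apply: derivableP; have [_ [_ d _ _]] := Ck_rho 1 r.
Qed.

(** The class in which all the calculus takes place: it contains every mollified L2 function and is
    closed under sums, products, shifts, and inverses of functions that are at least 1. *)
Definition C1b (F : plane -> R) : Prop := Ck 1 F /\
  exists C, forall z, [/\ `|F z| <= C, `|'D_e1 F z| <= C & `|'D_e2 F z| <= C].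

Lemma C1b_moll r f : sqint leb2 f -> C1b (moll r f).
Proof.
move=> sf; have E1 : (fun z => 'D_e1 (moll r f) z) = conv f (drho r e1).
  by apply/funext => z; case: (is_derive_moll1 r z sf).
have E2 : (fun z => 'D_e2 (moll r f) z) = conv f (drho r e2).
  by apply/funext => z; case: (is_derive_moll2 r z sf).
split.
  split; first exact: conv_continuous sf (rho_kernel r).
  split.
  - by move=> z; case: (is_derive_moll1 r z sf).
  - by move=> z; case: (is_derive_moll2 r z sf).
  - by rewrite E1; split => //; exact: conv_continuous sf (drho1_kernel r).
  - by rewrite E2; split => //; exact: conv_continuous sf (drho2_kernel r).
have [A A0 hA] := conv_bounded sf (rho_kernel r).
have [B B0 hB] := conv_bounded sf (drho1_kernel r).
have [C C0 hC] := conv_bounded sf (drho2_kernel r).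
exists (A + B + C) => z; split.
- by apply: le_trans (hA z) _; lra.
- by have -> := congr1 (@^~ z) E1; apply: le_trans (hB z) _; lra.
- by have -> := congr1 (@^~ z) E2; apply: le_trans (hC z) _; lra.
Qed.

End mollifier.

(** * Mollification as a self-adjoint contraction of L2 *)

Section mollifier_L2.
Context {R : realType}.
Local Notation plane := (R * R)%type.
Local Notation mplane := (measurableTypeR R * measurableTypeR R)%type.
Implicit Types (x y z v : plane) (f g : mplane -> R) (r : R).

Lemma measurable_rho2 r :
  measurable_fun setT (fun p : mplane * mplane => rho r (p.1 - p.2)).
Proof.
have m1 : measurable_fun setT (rho r : mplane -> R).
  by apply: measurable_continuous; exact: Ck_continuous (Ck_rho 0 r).
have m2 : measurable_fun setT (fun p : mplane * mplane => (p.1 - p.2 : mplane)).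
  apply: measurable_fun_pair.
  - apply: (@measurable_funB _ _ _ _ (fun p : mplane * mplane => p.1.1) (fun p => p.2.1)).
      exact: measurableT_comp.
    exact: measurableT_comp.
  - apply: (@measurable_funB _ _ _ _ (fun p : mplane * mplane => p.1.2) (fun p => p.2.2)).
      exact: measurableT_comp.
    exact: measurableT_comp.
exact: (measurableT_comp m1 m2).
Qed.

Lemma integ_Mrho r f x : measurable_fun setT f -> integ leb2 f -> 
  integ leb2 (fun y => f y * rho r (x - y)).
Proof.
move=> mf fi; have [C C0 KC] := kernel_bounded (rho_kernel r).
apply: (@le_integ _ _ _ _ _ (fun y : mplane => C * `|f y|)).
- by apply: measurable_funM => //; apply: integ_measurable (rho_integ r x).
- by move=> y; rewrite normrM mulrC ler_wpM2r.
- by apply: integZ; exact: integ_norm.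
Qed.

Lemma tonelli_rho r f : 0 < r -> integ leb2 f -> (forall y, 0 <= f y) ->
  integ leb2 (fun x => \int[@leb2 R]_y (f y * rho r (x - y))) /\
  \int[@leb2 R]_x (\int[@leb2 R]_y (f y * rho r (x - y))) = \int[@leb2 R]_y f y.
Proof.
move=> r0 fi f0; have mf := integ_measurable fi.
have E y : \int[@leb2 R]_x (f y * rho r (x - y)) = f y.
  by rewrite RintegralZT ?rho_mass1C ?mulr1//; exact: rho_integC.
have [|||||i E2] := @tonelli_Rintegral R (fun p => f p.2 * rho r (p.1 - p.2)).
- by apply: measurable_funM; [exact: measurableT_comp|exact: measurable_rho2].
- by move=> p; rewrite mulr_ge0// rho_ge0.
- by move=> x /=; exact: integ_Mrho.
- by move=> y /=; apply: integZ; exact: rho_integC.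
- by rewrite /=; under eq_fun do rewrite E.
split; first exact: i.
by rewrite [LHS]E2; apply: eq_Rintegral => y _; exact: E.
Qed.

(** The variance of [f] under the probability density [rho r (x - y)] in [y] is nonnegative. *)
Lemma jensen_rho r f x : 0 < r -> sqint leb2 f ->
  moll r f x ^+ 2 <= \int[@leb2 R]_y (f y ^+ 2 * rho r (x - y)).
Proof.
move=> r0 [mf fi]; set m := moll r f x.
have i1 := integ_Mrho r x (measurable_funX 2 mf) fi.
have i2 : integ leb2 (fun y => f y * rho r (x - y)) by apply: conv_integ (rho_kernel r).
have i3 := rho_integ r x.
have : 0 <= \int[@leb2 R]_y ((f y - m) ^+ 2 * rho r (x - y)).
  by apply: Rintegral_ge0 => y _; rewrite mulr_ge0 ?sqr_ge0// rho_ge0.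
rewrite (_ : (fun y => _) = (fun y => (f y ^+ 2 * rho r (x - y) -
   (2 * m) * (f y * rho r (x - y))) + m ^+ 2 * rho r (x - y))); last first.
  by apply/funext => y; ring.
rewrite RintegralDT; [|by apply: integB => //; exact: integZ|exact: integZ].
rewrite RintegralBT//; last exact: integZ.
rewrite RintegralZT// RintegralZT// rho_mass1// -[X in _ - 2 * m * X]/m.
by move=> h; rewrite -subr_ge0; apply: le_trans h _; rewrite le_eqVlt; apply/orP; left; apply/eqP; ring.
Qed.

Lemma measurable_moll r f : sqint leb2 f -> measurable_fun setT (moll r f : mplane -> R).
Proof.
by move=> sf; apply: measurable_continuous; exact: conv_continuous sf (rho_kernel r).
Qed.

Lemma sqint_moll r f : 0 < r -> sqint leb2 f -> sqint leb2 (moll r f).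
Proof.
move=> r0 sf; have [i E] := tonelli_rho r0 sf.2 (fun y => sqr_ge0 _).
split; first exact: measurable_moll.
apply: le_integ i; first by apply: measurable_funX; exact: measurable_moll.
by move=> x; rewrite ger0_norm ?sqr_ge0//; exact: jensen_rho.
Qed.

Lemma moll_contract r f : 0 < r -> sqint leb2 f ->
  \int[@leb2 R]_x (moll r f x ^+ 2) <= \int[@leb2 R]_x (f x ^+ 2).
Proof.
move=> r0 sf; have [i <-] := tonelli_rho r0 sf.2 (fun y => sqr_ge0 _).
apply: le_RintegralT => //; first by case: (sqint_moll r0 sf).
by move=> x; exact: jensen_rho.
Qed.

(** Fubini's theorem with the majorant [(f y ^+ 2 + g x ^+ 2) * rho r (x - y)], integrable because
    [rho] has mass 1; the kernel is symmetric because [rho] is even. *)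
Lemma moll_adjoint r f g : 0 < r -> sqint leb2 f -> sqint leb2 g ->
  ip2 leb2 (moll r f) g = ip2 leb2 f (moll r g).
Proof.
move=> r0 sf sg; have [mf fi] := sf; have [mg gi] := sg.
have E y : \int[@leb2 R]_x (f y ^+ 2 * rho r (x - y) + g x ^+ 2 * rho r (x - y)) =
    f y ^+ 2 + \int[@leb2 R]_x (g x ^+ 2 * rho r (y - x)).
  rewrite RintegralDT; first last.
  - by under eq_fun do rewrite rhoC; apply: integ_Mrho => //; exact: measurable_funX.
  - by apply: integZ; exact: rho_integC.
  rewrite (RintegralZT (f y ^+ 2) (rho_integC r y)) (rho_mass1C y r0) mulr1.
  by congr (_ + _); apply: eq_Rintegral => x _; rewrite rhoC.
have F : \int[@leb2 R]_x \int[@leb2 R]_y (f y * rho r (x - y) * g x) =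
         \int[@leb2 R]_y \int[@leb2 R]_x (f y * rho r (x - y) * g x).
  apply: (@fubini_Rintegral R (fun p => (f p.2 * rho r (p.1 - p.2)) * g p.1)
    (fun p => f p.2 ^+ 2 * rho r (p.1 - p.2) + g p.1 ^+ 2 * rho r (p.1 - p.2))).
- apply: measurable_funM; last exact: measurableT_comp.
  by apply: measurable_funM; [exact: measurableT_comp|exact: measurable_rho2].
- apply: measurable_funD; apply: measurable_funM; try exact: measurable_rho2.
    by apply: measurable_funX; exact: measurableT_comp.
  by apply: measurable_funX; exact: measurableT_comp.
- move=> p /=; rewrite mulrAC -mulrDl normrM (ger0_norm (rho_ge0 _ _)).
  by rewrite ler_wpM2r ?rho_ge0// sqint_mul_le.
- move=> x /=; apply: integD.
    by apply: integ_Mrho => //; exact: measurable_funX.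
  by apply: integZ; exact: rho_integ.
- move=> y /=; apply: integD; first by apply: integZ; exact: rho_integC.
  by under eq_fun do rewrite rhoC; apply: integ_Mrho => //; exact: measurable_funX.
- rewrite /=; under eq_fun do rewrite E; apply: integD => //.
  by case: (tonelli_rho r0 gi (fun y => sqr_ge0 _)).
rewrite /ip2; transitivity (\int[@leb2 R]_x \int[@leb2 R]_y (f y * rho r (x - y) * g x)).
  apply: eq_Rintegral => x _; under [RHS]eq_Rintegral do rewrite mulrC.
  rewrite RintegralZT; last exact: conv_integ sf (rho_kernel r).
  exact: mulrC.
rewrite F; apply: eq_Rintegral => y _; rewrite -RintegralZT; last exact: conv_integ sg (rho_kernel r).
by apply: eq_Rintegral => x _; rewrite rhoC; ring.
Qed.

Lemma moll_square r f x b : 0 < r -> sqint leb2 f ->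
  (forall y, square x r y -> `|f y - f x| <= b) -> `|moll r f x - f x| <= b.
Proof.
move=> r0 sf fb.
have i2 : integ leb2 (fun y => f y * rho r (x - y)) by apply: conv_integ (rho_kernel r).
have i3 := rho_integ r x.
have -> : moll r f x - f x = \int[@leb2 R]_y ((f y - f x) * rho r (x - y)).
  under eq_Rintegral do rewrite mulrBl.
  rewrite RintegralBT; [|exact: i2|exact: integZ].
  by rewrite RintegralZT// rho_mass1// mulr1.
have i4 : integ leb2 (fun y => (f y - f x) * rho r (x - y)).
  by under eq_fun do rewrite mulrBl; apply: integB => //; exact: integZ.
apply: le_trans (norm_RintegralT i4) _.
rewrite -[leRHS]mulr1 -(rho_mass1 x r0) -RintegralZT//.
apply: le_RintegralT; [exact: integ_norm|exact: integZ|move=> y].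
rewrite normrM (ger0_norm (rho_ge0 _ _)).
have [/fb h|ns] := pselect (square x r y); first by rewrite ler_wpM2r ?rho_ge0.
by rewrite (kernel_shift0 (rho_kernel r) ns) !mulr0.
Qed.

End mollifier_L2.

Lemma ae_mono d (T : measurableType d) (R : realType) (mu : {measure set T -> \bar R})
    (P Q : T -> Prop) : (forall x, P x -> Q x) ->
  {ae mu, forall x, P x} -> {ae mu, forall x, Q x}.
Proof. by move=> PQ; apply: (@filterS _ _ (ae_filter_ringOfSetsType mu)). Qed.

(** * L2 convergence of mollifications *)

Section mollifier_convergence.
Context {R : realType}.
Local Notation plane := (R * R)%type.
Local Notation mplane := (measurableTypeR R * measurableTypeR R)%type.
Implicit Types (x y z v : plane) (f g : mplane -> R) (r : R).

Lemma sqint_bump (k : R) (a b : plane) : 0 < k -> sqint (@leb2 R) (bump k a b).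
Proof.
move=> k0; have mb : measurable_fun setT (bump k a b : mplane -> R).
  by apply: measurable_continuous; exact: Ck_continuous (Ck_bump 0 _ _ _).
split => //; apply: (@integ_bounded_support R _ a b 1).
- exact: measurable_funX.
- by move=> z; rewrite ger0_norm ?sqr_ge0// expr_le1 ?bump_ge0 ?bump_le1.
- move=> z nz; rewrite bump_eq0 ?expr0n// => h; apply: nz; exact: box_subset_cbox.
Qed.

Lemma moll_le1 r f x : 0 < r -> sqint leb2 f -> (forall y, 0 <= f y <= 1) ->
  `|moll r f x| <= 1.
Proof.
move=> r0 sf f01; have i2 := conv_integ x sf (rho_kernel r).
apply: le_trans (norm_RintegralT i2) _; rewrite -[leRHS](rho_mass1 x r0).
apply: le_RintegralT; [exact: integ_norm|exact: rho_integ|move=> y].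
have /andP[h0 h1] := f01 y.
rewrite normrM (ger0_norm h0) (ger0_norm (rho_ge0 _ _)).
by apply: ler_piMl => //; exact: rho_ge0.
Qed.

Lemma moll_bump_cvg (rn : nat -> R) (k : R) a b f : 0 < k ->
  (forall n, 0 < rn n <= 1) -> rn n @[n --> \oo] --> (0 : R) -> sqint leb2 f ->
  ip2 leb2 f (moll (rn n) (bump k a b)) @[n --> \oo] --> ip2 leb2 f (bump k a b).
Proof.
move=> k0 rn01 rn0 sf; pose phi : mplane -> R := bump k a b.
have sphi : sqint leb2 phi := sqint_bump a b k0.
have cphi : continuous (phi : plane -> R) := Ck_continuous (Ck_bump 0 k a b).
have r0 n : 0 < rn n by case/andP: (rn01 n).
have [||||_ //] := @dominated_Rintegral _ _ _ (@leb2 R)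
  (fun n y => f y * moll (rn n) phi y) (fun y => f y * phi y)
  (fun y => `|f y * \1_(cbox (a.1 - 1, a.2 - 1) (b.1 + 1, b.2 + 1)) y|).
- by move=> n; apply: measurable_funM; [case: sf|exact: measurable_moll].
- move=> n x; rewrite normrM [leRHS]normrM ler_wpM2l// indicE.
  have [xb|/negP xb] := boolP (x \in _).
    rewrite normr1; apply: moll_le1 => // y.
    by rewrite bump_ge0 bump_le1.
  have phi0 y : square x (rn n) y -> phi y = 0.
    rewrite squareE => -[h1 h2]; apply: bump_eq0 => // -[]; rewrite /= !in_itv/= => /andP[? ?] /andP[? ?].
    apply: xb; rewrite inE; move: h1 h2; rewrite !ler_norml => /andP[? ?] /andP[? ?].
    have /andP[_ ?] := rn01 n.
    by split; rewrite /= in_itv/=; apply/andP; split; lra.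
  have px : phi x = 0.
    by apply: phi0; rewrite squareE !subrr normr0; split; exact: ltW.
  have := @moll_square R (rn n) phi x 0 (r0 n) sphi; rewrite px subr0 => h.
  rewrite normr0; apply: h => y /phi0 ->; by rewrite subr0 normr0.
- by apply: integ_norm; exact: sqint_integ_cbox.
- move=> x; apply: cvgM; first exact: cvg_cst.
  apply/cvgrPdist_le => e e0.
  have /cvgrPdist_le/(_ _ e0) := cphi x; move=> /nbhs_ballP [d /= d0 hd].
  have d2 : 0 < d / 2 by rewrite divr_gt0.
  near=> n.
  rewrite distrC; apply: moll_square => // y; rewrite square_norm => xy.
  rewrite distrC; apply: hd; rewrite -ball_normE /= distrC.
  apply: le_lt_trans xy _.
  have : `|0 - rn n| < d / 2 by near: n; move: d2; move/cvgrPdist_lt : rn0; exact.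
  rewrite sub0r normrN gtr0_norm// => h; apply: lt_trans h _; lra.
Unshelve. all: by end_near. Qed.

(** By contraction the squared L2 distance is at most [2 * (ip2 leb2 f f - ip2 leb2 (moll (rn n) f)
    f)], so convergence of this pairing is enough. A subsequence violating it would have a weak
    limit, which bumps identify as [f]. *)
Lemma moll_cvg (rn : nat -> R) f : (forall n, 0 < rn n <= 1) ->
  rn n @[n --> \oo] --> (0 : R) -> sqint leb2 f ->
  \int[@leb2 R]_x ((moll (rn n) f x - f x) ^+ 2) @[n --> \oo] --> (0 : R).
Proof.
move=> rn01 rn0 sf.
have SI := sqint_semi_inner (@leb2 R).
have r0 n : 0 < rn n by case/andP: (rn01 n).
have sm n : sqint leb2 (moll (rn n) f) by exact: sqint_moll.
have mC n : ip2 leb2 (moll (rn n) f) (moll (rn n) f) <= ip2 leb2 f f.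
  by rewrite !ip2E; exact: moll_contract.
suff W : ip2 leb2 (moll (rn n) f) f @[n --> \oo] --> ip2 leb2 f f.
  apply/cvgrPdist_le => e e0; have e2 : 0 < e / 2 by rewrite divr_gt0.
  have [N _ hN] := (cvgrPdist_le _ _).1 W _ e2.
  exists N => // n /hN /= h; rewrite sub0r normrN ger0_norm; last first.
    by apply: Rintegral_ge0 => x _; exact: sqr_ge0.
  move: h; rewrite ler_norml => /andP[_ h].
  have := mC n; have := ip_sqrB SI (sm n) sf; rewrite [X in X = _ -> _]ip2E => ->.
  by move: h; lra.
apply: contrapT => ncv.
have [e e0 fe] : exists2 e : R, 0 < e & forall N, exists2 n, (N <= n)%N & ~ (`|ip2 leb2 f f - ip2 leb2 (moll (rn n) f) f| <= e).
  apply: contrapT => H; apply: ncv; apply/cvgrPdist_le => e e0.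
  apply: contrapT => H'; apply: H; exists e => // N; apply: contrapT => H2.
  apply: H'; exists N => // n /= Nn; apply: contrapT => H3.
  by apply: H2; exists n.
have [j xj je] := extraction_frequently fe.
have [i [g [xi sg ig]]] := sqint_weak_compact (fun n => sm (j n)) (fun n => mC (j n)).
have xji := extraction_comp xj xi.
have sgf := sqintB sg sf.
(* Self-adjointness moves the mollifier onto the bump, a fixed smooth function, on which its
   convergence is known. *)
have gf : {ae (@leb2 R), forall z, setT z -> g z - f z = 0}.
  apply: fundamental_lemma => //; first exact: openT.
  move=> n a b _.
  have n0 : 0 < (n.+1%:R : R) by rewrite ltr0n.
  have sb := sqint_bump a b n0.
  rewrite -[LHS]/(ip2 leb2 (g - f) (bump n.+1%:R a b)) (ipBl SI)//.
  apply/eqP; rewrite subr_eq0; apply/eqP.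
  apply: (@cvg_unique _ (@Rhausdorff R) _ _ _ _ (ig _ sb)).
  have -> : (fun m => ip2 leb2 (moll (rn (j (i m))) f) (bump n.+1%:R a b)) =
            (fun m => ip2 leb2 f (moll (rn (j (i m))) (bump n.+1%:R a b))).
    by apply/funext => m; rewrite moll_adjoint.
  apply: (cvg_extraction xji (a := fun n0 => ip2 leb2 f (moll (rn n0) (bump n.+1%:R a b)))).
  exact: moll_bump_cvg.
have E : ip2 leb2 g f = ip2 leb2 f f.
  apply: Rintegral_ae.
  - by apply: measurable_funM; [case: sg|case: sf].
  - by apply: measurable_funM; case: sf.
  - by apply: ae_mono gf => z /(_ Logic.I) /eqP; rewrite subr_eq0 => /eqP ->.
have [N _ hN] := (cvgrPdist_le _ _).1 (ig f sf) _ e0.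
by apply: (je (i N)); rewrite -E; apply: (hN N); rewrite /=.
Qed.

End mollifier_convergence.

(** * Weak derivatives and translations under mollification *)

Section weak_derivatives.
Context {R : realType}.
Local Notation plane := (R * R)%type.
Local Notation mplane := (measurableTypeR R * measurableTypeR R)%type.
Implicit Types (x y z v : plane) (f g : mplane -> R) (r : R).

Lemma is_derive_translate (F : plane -> R) x y v (d : R) :
  is_derive (y - x) v F d -> is_derive y v (fun w => F (w - x)) d.
Proof.
move=> /is_derive_line h; apply/is_derive_line.
congr (is_derive _ _ _ _): h; apply/funext => s /=.
by rewrite addrA.
Qed.

Lemma derive_even (F : plane -> R) z v : (forall w, F (- w) = F w) ->
  derivable F z v -> 'D_v F (- z) = - 'D_v F z.
Proof.
move=> Fe /derivableP /is_derive_line dF.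
suff : is_derive (- z) v F (- 'D_v F z) by case.
apply/is_derive_line.
have -> : (fun s : R => F (s *: v + - z)) = (fun s => F ((- s) *: v + z)).
  by apply/funext => s; rewrite -Fe opprD opprK scaleNr.
rewrite -mulrN1.
apply: (@is_derive1_comp _ (fun s : R => F (s *: v + z)) (-%R)).
by rewrite oppr0.
Qed.

(** Integrals run over the whole plane: the functions are meant to be extended by 0 outside [Omega],
    while the test functions are supported in it. *)
Definition weak_D (Omega : set plane) v f g : Prop := forall phi, Cinfc Omega phi ->
  \int[@leb2 R]_y (f y * 'D_v phi y) = - \int[@leb2 R]_y (g y * phi y).

Definition weak_dv (Omega : set plane) f1 f2 g : Prop := forall phi, Cinfc Omega phi ->
  \int[@leb2 R]_y (f1 y * 'D_e1 phi y + f2 y * 'D_e2 phi y) = - \int[@leb2 R]_y (g y * phi y).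

Lemma rho_shiftE r x y : rho r (y - x) =
  (rho_mass r)^-1 * bump 1 (x.1 - r, x.2 - r) (x.1 + r, x.2 + r) y.
Proof.
rewrite /rho /rho0 /bump /bump1 /=; congr (_ * _).
congr (flat _ * flat _ * (flat _ * flat _)); ring.
Qed.

Lemma Cinfc_rho (Omega : set plane) r x : square x r `<=` Omega ->
  Cinfc Omega (fun y => rho r (y - x)).
Proof.
move=> xO; have -> : (fun y => rho r (y - x)) = (fun y => (rho_mass r)^-1 *
    bump 1 (x.1 - r, x.2 - r) (x.1 + r, x.2 + r) y).
  by apply/funext => y; exact: rho_shiftE.
split; first by move=> k; apply: Ck_scale; exact: Ck_bump.
apply: compact_support_cbox xO _ => z nz; rewrite bump_eq0 ?mulr0//.
by move=> h; apply: nz; exact: box_subset_cbox.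
Qed.

Lemma derive_rho_shift r x y : 
  'D_e1 (fun w => rho r (w - x)) y = - drho r e1 (x - y) /\
  'D_e2 (fun w => rho r (w - x)) y = - drho r e2 (x - y).
Proof.
have [_ [d1 d2 _ _]] := Ck_rho 1 r.
have h1 : is_derive (y - x) e1 (rho r) ('D_e1 (rho r) (y - x)) by exact: derivableP.
have h2 : is_derive (y - x) e2 (rho r) ('D_e2 (rho r) (y - x)) by exact: derivableP.
split.
- rewrite (@derive_val _ _ _ _ _ _ _ (is_derive_translate h1)).
  by rewrite -(opprB x y) derive_even//; exact: rho_even.
- rewrite (@derive_val _ _ _ _ _ _ _ (is_derive_translate h2)).
  by rewrite -(opprB x y) derive_even//; exact: rho_even.
Qed.

(** The function [rho r (y - x)] of [y] is a legitimate test function as soon as its supporting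
    square about [x] lies in [Omega]. *)
Lemma moll_weak_D1 (Omega : set plane) f g r x : sqint leb2 f -> sqint leb2 g ->
  weak_D Omega e1 f g -> square x r `<=` Omega ->
  'D_e1 (moll r f) x = moll r g x.
Proof.
move=> sf sg W xO; have := W _ (Cinfc_rho xO).
rewrite (@derive_val _ _ _ _ _ _ _ (is_derive_moll1 r x sf)).
under eq_Rintegral do rewrite (derive_rho_shift r x _).1 mulrN.
rewrite RintegralNT; last exact: conv_integ sf (drho1_kernel r).
move=> /oppr_inj H; apply: (etrans H).
by apply: eq_Rintegral => y _; rewrite rhoC.
Qed.

Lemma moll_weak_D2 (Omega : set plane) f g r x : sqint leb2 f -> sqint leb2 g ->
  weak_D Omega e2 f g -> square x r `<=` Omega ->
  'D_e2 (moll r f) x = moll r g x.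
Proof.
move=> sf sg W xO; have := W _ (Cinfc_rho xO).
rewrite (@derive_val _ _ _ _ _ _ _ (is_derive_moll2 r x sf)).
under eq_Rintegral do rewrite (derive_rho_shift r x _).2 mulrN.
rewrite RintegralNT; last exact: conv_integ sf (drho2_kernel r).
move=> /oppr_inj H; apply: (etrans H).
by apply: eq_Rintegral => y _; rewrite rhoC.
Qed.

Lemma moll_weak_dv (Omega : set plane) f1 f2 g r x : sqint leb2 f1 -> sqint leb2 f2 ->
  sqint leb2 g -> weak_dv Omega f1 f2 g -> square x r `<=` Omega ->
  'D_e1 (moll r f1) x + 'D_e2 (moll r f2) x = moll r g x.
Proof.
move=> sf1 sf2 sg W xO; have := W _ (Cinfc_rho xO).
rewrite (@derive_val _ _ _ _ _ _ _ (is_derive_moll1 r x sf1)).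
rewrite (@derive_val _ _ _ _ _ _ _ (is_derive_moll2 r x sf2)).
under eq_Rintegral do rewrite (derive_rho_shift r x _).1 (derive_rho_shift r x _).2 !mulrN -opprD.
have i1 := conv_integ x sf1 (drho1_kernel r).
have i2 := conv_integ x sf2 (drho2_kernel r).
rewrite (RintegralNT (integD i1 i2)) (RintegralDT i1 i2).
move=> /oppr_inj H; apply: (etrans H).
by apply: eq_Rintegral => y _; rewrite rhoC.
Qed.

Lemma jensen_kernel r x (h : mplane -> R) : 0 < r ->
  integ leb2 (fun y => h y * rho r (x - y)) ->
  integ leb2 (fun y => h y ^+ 2 * rho r (x - y)) ->
  (\int[@leb2 R]_y (h y * rho r (x - y))) ^+ 2 <=
  \int[@leb2 R]_y (h y ^+ 2 * rho r (x - y)).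
Proof.
move=> r0 i2 i1; set m := Rintegral _ _ _.
have i3 := rho_integ r x.
have : 0 <= \int[@leb2 R]_y ((h y - m) ^+ 2 * rho r (x - y)).
  by apply: Rintegral_ge0 => y _; rewrite mulr_ge0 ?sqr_ge0// rho_ge0.
rewrite (_ : (fun y => _) = (fun y => (h y ^+ 2 * rho r (x - y) -
   (2 * m) * (h y * rho r (x - y))) + m ^+ 2 * rho r (x - y))); last first.
  by apply/funext => y; ring.
rewrite RintegralDT; [|by apply: integB => //; exact: integZ|exact: integZ].
rewrite RintegralBT//; last exact: integZ.
rewrite RintegralZT// RintegralZT// rho_mass1// -[X in _ - 2 * m * X]/m.
by move=> H; rewrite -subr_ge0; apply: le_trans H _; rewrite le_eqVlt; apply/orP; left; apply/eqP; ring.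
Qed.

Lemma sqint_shift f z : sqint leb2 f -> sqint leb2 (fun x : mplane => f (x + z)).
Proof.
move=> [mf fi]; split; last exact: integ_shift fi.
have := measurableT_comp mf (measurable_affine2 false z).
by congr measurable_fun; apply/funext => x /=; rewrite /affine2 expr0 !mul1r.
Qed.

Lemma measurable_addp :
  measurable_fun setT (fun p : mplane * mplane => (p.1 + p.2 : mplane)).
Proof.
apply: measurable_fun_pair.
- apply: (@measurable_funD _ _ _ _ (fun p : mplane * mplane => p.1.1) (fun p => p.2.1)).
    exact: measurableT_comp.
  exact: measurableT_comp.
- apply: (@measurable_funD _ _ _ _ (fun p : mplane * mplane => p.1.2) (fun p => p.2.2)).
    exact: measurableT_comp.
  exact: measurableT_comp.
Qed.

(** [moll r f x - f x] is an average of the increments [f (x + z) - f x] over small [z]; Jensen and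
    Tonelli bound it by the worst single shift. This converts bounds on increments into a rate for
    mollification. *)
Lemma moll_variation (chi : mplane -> R) f r S : 0 < r -> sqint leb2 f ->
  measurable_fun setT chi -> (forall x, 0 <= chi x <= 1) ->
  (forall z, square 0 r z -> \int[@leb2 R]_x (chi x * (f (x + z) - f x) ^+ 2) <= S) ->
  integ leb2 (fun x => chi x * (moll r f x - f x) ^+ 2) /\
  \int[@leb2 R]_x (chi x * (moll r f x - f x) ^+ 2) <= S.
Proof.
move=> r0 sf mchi chi01 hS.
have mf : measurable_fun setT f by case: sf.
have chi0 x : 0 <= chi x by case/andP: (chi01 x).
have S0 : 0 <= S.
  apply: le_trans (hS 0 _); first by apply: Rintegral_ge0 => x _; rewrite mulr_ge0 ?sqr_ge0.
  by rewrite square_norm subrr normr0 ltW.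
(* With [z = y - x] as second variable the weight is [rho r z] alone, independent of [x], and the
   order of integration can be exchanged. *)
pose F (p : mplane * mplane) := chi p.1 * (f (p.1 + p.2) - f p.1) ^+ 2 * rho r p.2.
have mF : measurable_fun setT F.
  apply: measurable_funM; last first.
    apply: (@measurableT_comp _ _ _ _ _ _ (rho r : mplane -> R)) => //.
    by apply: measurable_continuous; exact: Ck_continuous (Ck_rho 0 r).
  apply: measurable_funM; first exact: measurableT_comp.
  apply: measurable_funX; apply: measurable_funB; last exact: measurableT_comp.
  exact: (measurableT_comp mf measurable_addp).
have F0 p : 0 <= F p by rewrite mulr_ge0 ?rho_ge0// mulr_ge0// sqr_ge0.
have i2 x := conv_integ x sf (rho_kernel r).
have i1 x := integ_Mrho r x (measurable_funX 2 mf) sf.2.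
have i3 := rho_integ r.
have ih x : integ leb2 (fun y => (f y - f x) * rho r (x - y)).
  by under eq_fun do rewrite mulrBl; apply: integB => //; exact: integZ.
have ih2 x : integ leb2 (fun y => (f y - f x) ^+ 2 * rho r (x - y)).
  rewrite (_ : (fun y => _) = (fun y => (f y ^+ 2 * rho r (x - y) -
    (2 * f x) * (f y * rho r (x - y))) + f x ^+ 2 * rho r (x - y))).
    by apply: integD; [apply: integB => //; exact: integZ|exact: integZ].
  by apply/funext => y; ring.
have mollE x : moll r f x - f x = \int[@leb2 R]_y ((f y - f x) * rho r (x - y)).
  under [RHS]eq_Rintegral do rewrite mulrBl.
  rewrite RintegralBT; [|exact: i2|exact: integZ].
  by rewrite RintegralZT// rho_mass1// mulr1.
have shiftE x y : (f (y + x) - f x) ^+ 2 * rho r (x - (y + x)) = (f (x + y) - f x) ^+ 2 * rho r y.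
  by rewrite (addrC y x) opprD addrA subrr sub0r rho_even.
have iF x : integ leb2 (fun z => F (x, z)).
  have := integZ (chi x) (integ_shift x (ih2 x)).
  by congr integ; apply/funext => y; rewrite shiftE /F /=; ring.
have FE x : \int[@leb2 R]_z F (x, z) = chi x * \int[@leb2 R]_y ((f y - f x) ^+ 2 * rho r (x - y)).
  rewrite -(Rintegral_shift x (ih2 x)) -RintegralZT; last exact: integ_shift (ih2 x).
  by apply: eq_Rintegral => y _; rewrite shiftE /F /=; ring.
apply: Rintegral_ge0_le.
- apply: measurable_funM => //; apply: measurable_funX.
  by apply: measurable_funB => //; exact: measurable_moll.
- by move=> x; rewrite mulr_ge0 ?sqr_ge0.
apply: (@le_trans _ _ (\int[@leb2 R]_x \int[@leb2 R]_z (F (x, z))%:E)%E).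
  apply: ge0_le_integral => //.
  - by move=> x _; rewrite lee_fin mulr_ge0 ?sqr_ge0.
  - apply/measurable_EFinP; apply: measurable_funM => //; apply: measurable_funX.
    by apply: measurable_funB => //; exact: measurable_moll.
  - by apply: (@measurable_fun_fubini_tonelli_F _ _ _ _ _ leb2f (fun p => (F p)%:E)) => //; exact/measurable_EFinP.
  - move=> x _; rewrite -integ_EFin// FE lee_fin ler_wpM2l// mollE.
    exact: jensen_kernel.
rewrite tonelli_plane//.
apply: (@le_trans _ _ (\int[@leb2 R]_z (S * rho r (0 - z))%:E)%E); last first.
  by rewrite -(integ_EFin (integZ S (i3 0))) (RintegralZT S (i3 0)) rho_mass1// mulr1.
apply: ge0_le_integral => //.
- by move=> z _; apply: integral_ge0 => x _; rewrite lee_fin.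
- by apply: (@measurable_fun_fubini_tonelli_G _ _ _ _ _ leb2f (fun p => (F p)%:E)) => //; exact/measurable_EFinP.
- by apply/measurable_EFinP; apply: integ_measurable; exact: integZ (i3 0).
move=> z _; rewrite sub0r rho_even.
have iz : integ leb2 (fun x => chi x * (f (x + z) - f x) ^+ 2).
  have sd := sqintB (sqint_shift z sf) sf.
  apply: le_integ sd.2; first by apply: measurable_funM => //; apply: measurable_funX; case: sd.
  by move=> x; rewrite normrM (ger0_norm (sqr_ge0 _)) ler_piMl ?sqr_ge0// ger0_norm//; case/andP: (chi01 x).
have -> : (\int[@leb2 R]_x (F (x, z))%:E = (rho r z * \int[@leb2 R]_x (chi x * (f (x + z) - f x) ^+ 2))%:E)%E.
  rewrite -RintegralZT// integ_EFin; last exact: integZ.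
  by apply: eq_integral => x _; rewrite /F /= mulrC.
rewrite lee_fin mulrC; have [sz|nz] := pselect (square 0 r z).
  by rewrite ler_wpM2r ?rho_ge0// hS.
by rewrite (kernel_supp (rho_kernel r) nz) !mulr0.
Qed.

End weak_derivatives.

(** * Differential calculus on the plane *)

Section C1b_calculus.
Context {R : realType}.
Local Notation plane := (R * R)%type.
Local Notation mplane := (measurableTypeR R * measurableTypeR R)%type.
Implicit Types (x y z h : plane) (F G : plane -> R).

Definition C1bd F F1 F2 : Prop := [/\ continuous F, continuous F1, continuous F2,
  (forall z, is_derive z e1 F (F1 z)) /\ (forall z, is_derive z e2 F (F2 z)) &
  exists C, forall z, [/\ `|F z| <= C, `|F1 z| <= C & `|F2 z| <= C]].

Lemma C1bd_C1b F F1 F2 : C1bd F F1 F2 -> C1b F.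
Proof.
move=> [c c1 c2 [d1 d2] [C hC]].
have E1 : (fun z => 'D_e1 F z) = F1 by apply/funext => z; case: (d1 z).
have E2 : (fun z => 'D_e2 F z) = F2 by apply/funext => z; case: (d2 z).
split.
  split => //; split.
  - by move=> z; case: (d1 z).
  - by move=> z; case: (d2 z).
  - by rewrite E1.
  - by rewrite E2.
exists C => z; have [? ? ?] := hC z; split => //.
- by have -> := congr1 (@^~ z) E1.
- by have -> := congr1 (@^~ z) E2.
Qed.

Lemma C1b_C1bd F : C1b F -> C1bd F (fun z => 'D_e1 F z) (fun z => 'D_e2 F z).
Proof.
by move=> [[c [d1 d2 [c1 _] [c2 _]]] bC]; split => //; split => z; exact: derivableP.
Qed.

Lemma C1b_is_derive1 F z : C1b F -> is_derive z e1 F ('D_e1 F z).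
Proof. by move=> /C1b_C1bd[_ _ _ []]. Qed.

Lemma C1b_is_derive2 F z : C1b F -> is_derive z e2 F ('D_e2 F z).
Proof. by move=> /C1b_C1bd[_ _ _ []]. Qed.

Lemma C1b_continuous F : C1b F -> continuous F.
Proof. by move=> /C1b_C1bd[]. Qed.

Lemma C1b_continuous1 F : C1b F -> continuous (fun z => 'D_e1 F z).
Proof. by move=> /C1b_C1bd[_ c1 _ _ _]; exact: c1. Qed.

Lemma C1b_continuous2 F : C1b F -> continuous (fun z => 'D_e2 F z).
Proof. by move=> /C1b_C1bd[_ _ c2 _ _]; exact: c2. Qed.

Lemma continuousMf F G : continuous F -> continuous G -> continuous (fun z => F z * G z).
Proof. by move=> cF cG z; apply: cvgM; [exact: cF|exact: cG]. Qed.

Lemma continuousDf F G : continuous F -> continuous G -> continuous (fun z => F z + G z).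
Proof. by move=> cF cG z; apply: cvgD; [exact: cF|exact: cG]. Qed.

Lemma C1bD F G : C1b F -> C1b G -> C1b (fun z => F z + G z).
Proof.
move=> /C1b_C1bd [cF cF1 cF2 [dF1 dF2] [A hA]] /C1b_C1bd [cG cG1 cG2 [dG1 dG2] [B hB]].
apply: (@C1bd_C1b _ (fun z => 'D_e1 F z + 'D_e1 G z) (fun z => 'D_e2 F z + 'D_e2 G z)).
split; [exact: continuousDf|exact: continuousDf|exact: continuousDf| |].
  by split => z; apply: is_deriveD.
exists (A + B) => z; have [? ? ?] := hA z; have [? ? ?] := hB z.
by split; [apply: le_trans (ler_normD _ _) (lerD _ _) ..].
Qed.

Lemma C1bM F G : C1b F -> C1b G -> C1b (fun z => F z * G z).
Proof.
move=> /C1b_C1bd [cF cF1 cF2 [dF1 dF2] [A hA]] /C1b_C1bd [cG cG1 cG2 [dG1 dG2] [B hB]].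
apply: (@C1bd_C1b _ (fun z => F z * 'D_e1 G z + G z * 'D_e1 F z)
  (fun z => F z * 'D_e2 G z + G z * 'D_e2 F z)).
split; [exact: continuousMf| | | |].
- by apply: continuousDf; exact: continuousMf.
- by apply: continuousDf; exact: continuousMf.
- by split => z; apply: is_deriveM.
exists (A * B + B * A) => z; have [a0 a1 a2] := hA z; have [b0 b1 b2] := hB z.
have A0 : 0 <= A by apply: le_trans a0.
have B0 : 0 <= B by apply: le_trans b0.
have AB : 0 <= A * B by rewrite mulr_ge0.
have BA : 0 <= B * A by rewrite mulr_ge0.
split.
- by rewrite normrM; apply: (@le_trans _ _ (A * B)); [exact: ler_pM|rewrite lerDl].
- apply: le_trans (ler_normD _ _) _; rewrite (normrM (F z)) (normrM (G z)).
  by apply: lerD; exact: ler_pM.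
- apply: le_trans (ler_normD _ _) _; rewrite (normrM (F z)) (normrM (G z)).
  by apply: lerD; exact: ler_pM.
Qed.

Lemma C1b_cst (c : R) : C1b (fun _ : plane => c).
Proof.
apply: (@C1bd_C1b _ (fun=> 0) (fun=> 0)); split; try by move=> z; exact: cvg_cst.
  by split => z; exact: is_derive_cst.
by exists `|c| => z; rewrite normr0; split.
Qed.

Lemma C1bZ (c : R) F : C1b F -> C1b (fun z => c * F z).
Proof. by move=> hF; apply: C1bM => //; exact: C1b_cst. Qed.

Lemma C1bN F : C1b F -> C1b (fun z => - F z).
Proof. by move=> hF; under eq_fun do rewrite -mulN1r; exact: C1bZ. Qed.

Lemma C1bB F G : C1b F -> C1b G -> C1b (fun z => F z - G z).
Proof. by move=> hF hG; apply: C1bD => //; exact: C1bN. Qed.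

Lemma C1bX F n : C1b F -> C1b (fun z => F z ^+ n).
Proof.
move=> hF; elim: n => [|n IH]; first by under eq_fun do rewrite expr0; exact: C1b_cst.
by under eq_fun do rewrite exprS; exact: C1bM.
Qed.

Lemma C1bV F : C1b F -> (forall z, 1 <= F z) -> C1b (fun z => (F z)^-1).
Proof.
move=> /C1b_C1bd [cF cF1 cF2 [dF1 dF2] [A hA]] F1.
have F0 z : 0 < F z by exact: lt_le_trans ltr01 (F1 z).
have Fn z : F z != 0 by rewrite gt_eqF.
have cV : continuous (fun z => (F z)^-1) by move=> z; apply: cvgV => //; exact: cF.
have Vle z : 0 <= (F z)^-1 <= 1 by rewrite invr_ge0 (ltW (F0 z))/= (invf_le1 (F0 z)).
apply: (@C1bd_C1b _ (fun z => - (((F z)^-1 * (F z)^-1) * 'D_e1 F z))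
  (fun z => - (((F z)^-1 * (F z)^-1) * 'D_e2 F z))).
split => //.
- by move=> z; apply: cvgN; apply: (continuousMf (continuousMf cV cV) cF1).
- by move=> z; apply: cvgN; apply: (continuousMf (continuousMf cV cV) cF2).
- split => z.
    have [dd _] := dF1 z; split; first exact: derivableV.
    by rewrite deriveV// /GRing.scale/= -expr2 exprVn mulNr.
  have [dd _] := dF2 z; split; first exact: derivableV.
  by rewrite deriveV// /GRing.scale/= -expr2 exprVn mulNr.
exists (1 + A) => z; have [a0 a1 a2] := hA z.
have A0 : 0 <= A by apply: le_trans a0.
have /andP[v0 v1] := Vle z.
have vv : (F z)^-1 * (F z)^-1 <= 1 by rewrite mulr_ile1.
have vv0 : 0 <= (F z)^-1 * (F z)^-1 by rewrite mulr_ge0.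
split.
- by rewrite (ger0_norm v0); apply: le_trans v1 _; rewrite lerDl.
- rewrite normrN normrM (ger0_norm vv0); apply: le_trans (ler_piMl (normr_ge0 _) vv) _.
  by apply: le_trans a1 _; rewrite lerDr.
- rewrite normrN normrM (ger0_norm vv0); apply: le_trans (ler_piMl (normr_ge0 _) vv) _.
  by apply: le_trans a2 _; rewrite lerDr.
Qed.

Lemma C1b_shift F h : C1b F -> C1b (fun z => F (z + h)) /\
  forall z, 'D_e1 (fun z => F (z + h)) z = 'D_e1 F (z + h) /\
            'D_e2 (fun z => F (z + h)) z = 'D_e2 F (z + h).
Proof.
move=> /C1b_C1bd [cF cF1 cF2 [dF1 dF2] [A hA]].
have cs : continuous (fun z => z + h).
  by move=> z; apply: cvgD; [exact: cvg_id|exact: cvg_cst].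
have h1 z : is_derive z e1 (fun z => F (z + h)) ('D_e1 F (z + h)).
  have := dF1 (z - (- h)) => /is_derive_translate; by rewrite opprK.
have h2 z : is_derive z e2 (fun z => F (z + h)) ('D_e2 F (z + h)).
  have := dF2 (z - (- h)) => /is_derive_translate; by rewrite opprK.
split; last by move=> z; split; [case: (h1 z)|case: (h2 z)].
apply: (@C1bd_C1b _ (fun z => 'D_e1 F (z + h)) (fun z => 'D_e2 F (z + h))); split.
- by move=> z; apply: (@continuous_comp _ _ _ (fun z => z + h) F); [exact: cs|exact: cF].
- by move=> z; apply: (@continuous_comp _ _ _ (fun z => z + h) (fun z => 'D_e1 F z)); [exact: cs|exact: cF1].
- by move=> z; apply: (@continuous_comp _ _ _ (fun z => z + h) (fun z => 'D_e2 F z)); [exact: cs|exact: cF2].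
- by split.
- by exists A => z; exact: hA.
Qed.

Lemma mean_value1 (f df : R -> R) (a b : R) : (forall t : R, is_derive t 1 f (df t)) ->
  exists2 c, `|c - a| <= `|b - a| & f b - f a = df c * (b - a).
Proof.
move=> hf.
have cf c d : {within `[c, d], continuous f}.
  apply: derivable_within_continuous => t _; by case: (hf t).
have [ab|ba] := leP a b.
  have [c cab E] := MVT_segment ab (fun t _ => hf t) (cf a b).
  exists c => //; move: cab; rewrite in_itv/= => /andP[? ?].
  by rewrite !ger0_norm; lra.
have [c cab E] := MVT_segment (ltW ba) (fun t _ => hf t) (cf b a).
exists c; last by lra.
move: cab; rewrite in_itv/= => /andP[? ?].
by rewrite !ler0_norm; lra.
Qed.

Lemma axis_decomposition (t : R) h z :
  t *: h + z = (t * h.2) *: e2 + ((t * h.1) *: e1 + z).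
Proof.
case: h z => [h1 h2] [z1 z2]; congr pair; rewrite /= /GRing.scale/=; ring.
Qed.

(** Regularity is known along the axes only. The increment along [t *: h] is one step along [e1] and
    one along [e2], each treated by the mean value theorem; continuity of the partial derivatives
    removes the intermediate points. *)
Lemma C1b_directional F z h : C1b F ->
  is_derive z h F (h.1 * 'D_e1 F z + h.2 * 'D_e2 F z).
Proof.
move=> /C1b_C1bd [cF cF1 cF2 [dF1 dF2] _].
suff L : t^-1 *: (F (t *: h + z) - F z) @[t --> 0^'] --> h.1 * 'D_e1 F z + h.2 * 'D_e2 F z.
  split; first by apply/cvg_ex; exists (h.1 * 'D_e1 F z + h.2 * 'D_e2 F z).
  exact/cvg_lim.
apply/cvgrPdist_le => e e0.
(* Both intermediate points lie within [|t| * M] of [z]; the summand 1 keeps [M] positive when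
   [h = 0]. *)
pose M := `|h.1| + `|h.2| + 1.
have M0 : 0 < M by rewrite ltr_wpDl// addr_ge0.
have eM : 0 < e / M by rewrite divr_gt0.
have /cvgrPdist_le/(_ _ eM)/nbhs_ballP [d1 /= d10 hd1] := cF1 z.
have /cvgrPdist_le/(_ _ eM)/nbhs_ballP [d2 /= d20 hd2] := cF2 z.
have tM (d : R) : 0 < d -> \forall s \near (0 : R)^', `|s| < d / M.
  by move=> d0; apply: dnbhs0_lt; rewrite divr_gt0.
near=> t.
have t0 : t != 0 by near: t; exact: nbhs_dnbhs_neq.
have t1 : `|t| < d1 / M by near: t; apply: tM.
have t2 : `|t| < d2 / M by near: t; apply: tM.
have [c1 hc1 E1] := @mean_value1 (fun s => F (s *: e1 + z)) _ 0 (t * h.1)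
  (fun s => (is_derive_lineE F z e1 s _).1 (dF1 _)).
have [c2 hc2 E2] := @mean_value1 (fun s => F (s *: e2 + ((t * h.1) *: e1 + z))) _ 0 (t * h.2)
  (fun s => (is_derive_lineE F _ e2 s _).1 (dF2 _)).
have -> : F (t *: h + z) - F z = 'D_e2 F (c2 *: e2 + ((t * h.1) *: e1 + z)) * (t * h.2)
    + 'D_e1 F (c1 *: e1 + z) * (t * h.1).
  move: E1 E2; rewrite !subr0 !scale0r !add0r => <- <-.
  rewrite -axis_decomposition; ring.
rewrite (_ : t^-1 *: _ = 'D_e2 F (c2 *: e2 + ((t * h.1) *: e1 + z)) * h.2
    + 'D_e1 F (c1 *: e1 + z) * h.1); last first.
  by rewrite /GRing.scale/=; field.
have h1M : `|t| * `|h.1| <= `|t| * M by rewrite ler_wpM2l// /M; have := normr_ge0 h.2; lra.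
have h12M : `|t| * `|h.2| + `|t| * `|h.1| <= `|t| * M by rewrite -mulrDr ler_wpM2l// /M; lra.
move: t1 t2; rewrite !ltr_pdivlMr// => t1 t2.
have B1 : `|'D_e1 F z - 'D_e1 F (c1 *: e1 + z)| <= e / M.
  apply: hd1; rewrite -ball_normE /= opprD addrCA subrr addr0 normrN normrZ.
  move: hc1; rewrite !subr0 normrM => hc1.
  apply: le_lt_trans (ler_piMr _ e1_norm) _ => //.
  exact: le_lt_trans (le_trans hc1 h1M) t1.
have B2 : `|'D_e2 F z - 'D_e2 F (c2 *: e2 + ((t * h.1) *: e1 + z))| <= e / M.
  apply: hd2; rewrite -ball_normE /= addrA opprD addrCA subrr addr0 normrN.
  apply: le_lt_trans (ler_normD _ _) _.
  move: hc2; rewrite !subr0 normrM => hc2.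
  apply: le_lt_trans t2; apply: le_trans h12M; apply: lerD.
    by rewrite normrZ; apply: le_trans (ler_piMr _ e2_norm) _.
  by rewrite normrZ normrM; apply: le_trans (ler_piMr _ e1_norm) _ => //; rewrite mulr_ge0.
set a1 := 'D_e1 F (c1 *: e1 + z) in B1 *; set a2 := 'D_e2 F (_ + (_ + z)) in B2 *.
rewrite (_ : _ - _ = h.1 * ('D_e1 F z - a1) + h.2 * ('D_e2 F z - a2)); last by ring.
apply: le_trans (ler_normD _ _) _; rewrite !normrM.
apply: (@le_trans _ _ (`|h.1| * (e / M) + `|h.2| * (e / M))).
  by apply: lerD; rewrite ler_wpM2l.
rewrite -mulrDl mulrC -mulrA ler_piMr ?(ltW e0)// ler_pdivrMl// mulr1 /M; lra.
Unshelve. all: by end_near. Qed.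

End C1b_calculus.

(** * Integration by parts and integrals depending on a parameter *)

Section integration_by_parts.
Context {R : realType}.
Local Notation plane := (R * R)%type.
Local Notation mplane := (measurableTypeR R * measurableTypeR R)%type.
Implicit Types (x y z h v : plane) (F G p q : plane -> R) (r : R).

Definition supp_in r F := forall z, ~ square 0 r z -> F z = 0.

Lemma supp_in_derive r F v : supp_in r F -> supp_in r (fun z => 'D_v F z).
Proof. by move=> sF z nz; apply: derive_support nz => w nw; exact: sF. Qed.

Lemma integ_supp r F : continuous F -> supp_in r F -> integ (@leb2 R) F.
Proof.
move=> cF sF; have := integ_reflect 0 (kernel_integ 0 (Kernel cF sF)).
by congr integ; apply/funext => y; rewrite !sub0r opprK.
Qed.

Lemma sqint_indic_square x r : sqint (@leb2 R) (\1_(square x r) : mplane -> R).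
Proof.
have mI : measurable_fun setT (\1_(square x r) : mplane -> R).
  by apply: measurable_indic; exact: measurable_cbox.
split => //.
apply: (@integ_bounded_support R _ (x.1 - r, x.2 - r) (x.1 + r, x.2 + r) 1).
- exact: measurable_funX.
- by move=> z; rewrite indicE; case: (_ \in _); rewrite ?expr1n ?normr1 ?expr0n ?normr0.
- by move=> z nz; rewrite indicE memNset// expr0n.
Qed.

(** Near 0 the convolution of [G] with the indicator of the square of radius [r + 1] is constant,
    equal to the integral of [G], because that square contains all the reflected and shifted
    supports. Its derivative at 0 is the integral of [dG]. *)
Lemma Rintegral_derive0 G dG r v : `|v| <= 1 -> continuous G -> continuous dG ->
  (forall z, is_derive z v G (dG z)) -> supp_in r G -> supp_in r dG ->
  \int[@leb2 R]_x dG x = 0.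
Proof.
move=> v1 cG cdG dGv sG sdG.
pose f : mplane -> R := \1_(square (0 : plane) (r + 1)).
have sf : sqint leb2 f by exact: sqint_indic_square.
have D := conv_derive 0 sf (Kernel cG sG) (Kernel cdG sdG) v1 dGv.
have convE K x : supp_in r K -> `|x| <= 1 ->
    conv f K x = \int[@leb2 R]_y K (x - y).
  move=> sK x1; apply: eq_Rintegral => y _; rewrite /f indicE.
  have [yb|/negP yb] := boolP (y \in _); first by rewrite mul1r.
  rewrite sK ?mulr0// => h; apply: yb; rewrite inE; move: h.
  rewrite !square_norm !subr0 => h; rewrite -(subKr x y) addrC.
  by apply: le_trans (ler_normD _ _) _; rewrite normrN; apply: lerD.
have near0 : \forall x \near (0 : plane), cst (\int[@leb2 R]_y G y) x = conv f G x.
  have := @nbhsx_ballx _ _ (0 : plane) 1 ltr01; apply: filterS => x x1.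
  rewrite convE//; last by move: x1; rewrite -ball_normE /= sub0r normrN; exact: ltW.
  by rewrite Rintegral_reflect//; exact: integ_supp cG sG.
have := near_eq_is_derive near0 (is_derive_cst (\int[@leb2 R]_y G y) 0 v).
case=> _; have [_ ->] := D; rewrite convE//; last by rewrite normr0.
by rewrite Rintegral_reflect//; exact: integ_supp cdG sdG.
Qed.

Lemma by_parts1 p q r : C1b p -> C1b q -> supp_in r q ->
  \int[@leb2 R]_x ('D_e1 p x * q x) = - \int[@leb2 R]_x (p x * 'D_e1 q x).
Proof.
move=> hp hq sq; have sdq := supp_in_derive e1 sq.
have cp := C1b_continuous hp; have cq := C1b_continuous hq.
have cp1 := C1b_continuous1 hp; have cq1 := C1b_continuous1 hq.
have i1 : integ (@leb2 R) (fun x => p x * 'D_e1 q x).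
  by apply: (@integ_supp r); [exact: continuousMf|move=> z /sdq ->; rewrite mulr0].
have i2 : integ (@leb2 R) (fun x => 'D_e1 p x * q x).
  by apply: (@integ_supp r); [exact: continuousMf|move=> z /sq ->; rewrite mulr0].
apply/eqP; rewrite -addr_eq0 -RintegralDT//; apply/eqP.
apply: (@Rintegral_derive0 (fun x => p x * q x) _ r e1 e1_norm).
- exact: continuousMf.
- by apply: continuousDf; exact: continuousMf.
- move=> z; apply: is_derive_eq (is_deriveM (C1b_is_derive1 z hp) (C1b_is_derive1 z hq)) _.
  by rewrite addrC; congr (_ + _); exact: mulrC.
- by move=> z /sq ->; rewrite mulr0.
- by move=> z nz; rewrite sq// sdq// !mulr0 addr0.
Qed.

Lemma by_parts2 p q r : C1b p -> C1b q -> supp_in r q ->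
  \int[@leb2 R]_x ('D_e2 p x * q x) = - \int[@leb2 R]_x (p x * 'D_e2 q x).
Proof.
move=> hp hq sq; have sdq := supp_in_derive e2 sq.
have cp := C1b_continuous hp; have cq := C1b_continuous hq.
have cp1 := C1b_continuous2 hp; have cq1 := C1b_continuous2 hq.
have i1 : integ (@leb2 R) (fun x => p x * 'D_e2 q x).
  by apply: (@integ_supp r); [exact: continuousMf|move=> z /sdq ->; rewrite mulr0].
have i2 : integ (@leb2 R) (fun x => 'D_e2 p x * q x).
  by apply: (@integ_supp r); [exact: continuousMf|move=> z /sq ->; rewrite mulr0].
apply/eqP; rewrite -addr_eq0 -RintegralDT//; apply/eqP.
apply: (@Rintegral_derive0 (fun x => p x * q x) _ r e2 e2_norm).
- exact: continuousMf.
- by apply: continuousDf; exact: continuousMf.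
- move=> z; apply: is_derive_eq (is_deriveM (C1b_is_derive2 z hp) (C1b_is_derive2 z hq)) _.
  by rewrite addrC; congr (_ + _); exact: mulrC.
- by move=> z /sq ->; rewrite mulr0.
- by move=> z nz; rewrite sq// sdq// !mulr0 addr0.
Qed.

Lemma Rintegral_derive_param (chi : plane -> R) (E dE : R -> plane -> R) (r C : R) (t : R) :
  continuous chi -> supp_in r chi ->
  (forall s, continuous (E s)) -> (forall s x, `|dE s x| <= C) ->
  (forall (s : R) x, is_derive s 1 (E^~ x) (dE s x)) ->
  is_derive t 1 (fun s => \int[@leb2 R]_x (chi x * E s x)) (\int[@leb2 R]_x (chi x * dE t x)).
Proof.
move=> cchi schi cE dEC hE.
pose f s x := chi x * E s x.
have h0 : t \in `](t - 1), (t + 1)[ by rewrite in_itv/=; apply/andP; split; lra.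
have hd (s : R) x : is_derive s 1 (f^~ x) (chi x * dE s x).
  by apply: (@is_deriveZ _ _ _ (E^~ x) (chi x)); exact: hE.
have hp s x : partial1of2 f s x = chi x * dE s x by rewrite partial1of2E; case: (hd s x).
have iF s : integ leb2 (f s).
  by apply: (@integ_supp r); [exact: continuousMf|move=> z /schi; rewrite /f => ->; rewrite mul0r].
have iG : integ leb2 (fun x => C * `|chi x|).
  by apply: integZ; apply: integ_norm; exact: integ_supp cchi schi.
have C0 : 0 <= C by apply: le_trans (dEC 0 0).
have G0 x : 0 <= C * `|chi x| by rewrite mulr_ge0.
have FG s x : `|partial1of2 f s x| <= C * `|chi x|.
  by rewrite hp normrM mulrC ler_wpM2r.
have dF s x : derivable (f ^~ x) s 1 by case: (hd s x).
have D := @differentiation_under_integral R _ mplane (@leb2 R) f setT measurableT t _ _ h0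
  (fun s _ => iF s) (fun s y _ _ => dF s y) _ G0 iG (fun s y _ _ => FG s y).
have D2 := @derivable_under_integral R _ mplane (@leb2 R) f setT measurableT t _ _ h0
  (fun s _ => iF s) (fun s y _ _ => dF s y) _ G0 iG (fun s y _ _ => FG s y).
split; first exact: D2.
by rewrite -derive1E [LHS]D; apply: eq_Rintegral => y _; rewrite hp.
Qed.

End integration_by_parts.

(** * The interaction identity *)

Section interaction.
Context {R : realType}.
Local Notation plane := (R * R)%type.
Local Notation mplane := (measurableTypeR R * measurableTypeR R)%type.
Implicit Types (x y z h v : plane) (F G p q : plane -> R) (r : R).

Definition divf (U1 U2 : plane -> R) z : R := 'D_e1 U1 z + 'D_e2 U2 z.
Definition incr h F z : R := F (z + h) - F z.

Lemma continuous_divf U1 U2 : C1b U1 -> C1b U2 -> continuous (divf U1 U2).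
Proof.
by move=> h1 h2; apply: continuousDf; [exact: C1b_continuous1|exact: C1b_continuous2].
Qed.

Lemma integ_on_cbox F a b : continuous F ->
  integ (@leb2 R) (fun x => `|F x| * \1_(cbox a b) x).
Proof.
move=> cF.
have [C C0 hC] : exists2 C, 0 <= C & forall z, cbox a b z -> `|F z| <= C.
  have : bounded_set (F @` cbox a b).
    apply: compact_bounded; apply: continuous_compact; last exact: compact_cbox.
    exact: continuous_subspaceT.
  move=> /pinfty_ex_gt0[C C0 hC]; exists C => [|z zb]; first exact: ltW.
  by apply: hC; exists z.
apply: (@integ_bounded_support R _ a b C).
- apply: measurable_funM; last by apply: measurable_indic; exact: measurable_cbox.
  by apply: measurableT_comp => //; exact: measurable_continuous.
- move=> z; rewrite indicE; have [zb|_] := boolP (z \in cbox a b).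
    by rewrite mulr1 normr_id; apply: hC; move: zb; rewrite inE.
  by rewrite mulr0 normr0.
- by move=> z nz; rewrite indicE memNset// mulr0.
Qed.

Lemma C1b_incr h F : C1b F -> C1b (incr h F).
Proof. by move=> hF; apply: C1bB => //; case: (C1b_shift h hF). Qed.

Lemma derive_incr h F z : C1b F ->
  'D_e1 (incr h F) z = incr h (fun z => 'D_e1 F z) z /\
  'D_e2 (incr h F) z = incr h (fun z => 'D_e2 F z) z.
Proof.
move=> hF; have [hS /(_ z)[S1 S2]] := C1b_shift h hF.
have := is_deriveB (C1b_is_derive1 z hS) (C1b_is_derive1 z hF).
have := is_deriveB (C1b_is_derive2 z hS) (C1b_is_derive2 z hF).
by rewrite S1 S2 => -[_ E2] -[_ E1]; split; [exact: E1|exact: E2].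
Qed.

Variables (U1 U2 W1 W2 chi : plane -> R) (M B D r : R) (h a b : plane).
Hypotheses (hU1 : C1b U1) (hU2 : C1b U2) (hW1 : C1b W1) (hW2 : C1b W2)
  (hchi : C1b chi) (schi : supp_in r chi) (chi01 : forall z, 0 <= chi z <= 1).
Hypotheses (bU1 : forall z, `|U1 z| <= M) (bU2 : forall z, `|U2 z| <= M)
  (bW1 : forall z, `|W1 z| <= M) (bW2 : forall z, `|W2 z| <= M).
Hypothesis nbh : forall x z, chi x != 0 -> `|z| <= `|h| -> cbox a b (x + z).
Hypotheses
  (BU : \int[@leb2 R]_x (`|divf U1 U2 x| * \1_(cbox a b) x) <= B)
  (BW : \int[@leb2 R]_x (`|divf W1 W2 x| * \1_(cbox a b) x) <= B)
  (Bchi : \int[@leb2 R]_x (`|'D_e1 chi x| + `|'D_e2 chi x|) <= D).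

Let F1 := incr h W1.
Let F2 := incr h W2.

Let hF1 : C1b F1. Proof. exact: C1b_incr. Qed.
Let hF2 : C1b F2. Proof. exact: C1b_incr. Qed.

Let M0 : 0 <= M. Proof. exact: le_trans (bU1 0). Qed.

Let incr_le F z : (forall z, `|F z| <= M) -> `|incr h F z| <= 2 * M.
Proof.
move=> bF; apply: le_trans (ler_normB _ _) _.
by have := bF (z + h); have := bF z; lra.
Qed.

Let chi_ge0 z : 0 <= chi z. Proof. by case/andP: (chi01 z). Qed.

Let chi_indic (g : plane -> R) x z : `|z| <= `|h| ->
  chi x * `|g (x + z)| <= `|g (x + z)| * \1_(cbox a b) (x + z).
Proof.
move=> zh; have [->|nx] := eqVneq (chi x) 0; first by rewrite mul0r mulr_ge0.
rewrite indicE mem_set ?mulr1; last exact: nbh.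
by rewrite ler_piMl//; case/andP: (chi01 x).
Qed.

Let integ_shift_ind (g : plane -> R) z : continuous g ->
  integ (@leb2 R) (fun x => `|g (x + z)| * \1_(cbox a b) (x + z)).
Proof. by move=> cg; exact: (integ_shift z (integ_on_cbox a b cg)). Qed.

Let Rintegral_shift_ind (g : plane -> R) z : continuous g ->
  \int[@leb2 R]_x (`|g (x + z)| * \1_(cbox a b) (x + z)) =
  \int[@leb2 R]_x (`|g x| * \1_(cbox a b) x).
Proof. by move=> cg; exact: (Rintegral_shift z (integ_on_cbox a b cg)). Qed.

Let dU F z := h.1 * 'D_e1 F z + h.2 * 'D_e2 F z.

Let h1 : `|h.1| <= `|h|.
Proof. by rewrite [leRHS]prod_normE/= le_max lexx. Qed.
Let h2 : `|h.2| <= `|h|.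
Proof. by rewrite [leRHS]prod_normE/= le_max lexx orbT. Qed.

(** This is [det(U, h)]: its gradient carries the part of the derivative of [U] along [h] that is
    not the divergence of [U]. *)
Let k z : R := h.2 * U1 z - h.1 * U2 z.

Let hk : C1b k. Proof. by apply: C1bB; exact: C1bZ. Qed.

Let dk z : 'D_e1 k z = h.2 * 'D_e1 U1 z - h.1 * 'D_e1 U2 z /\
           'D_e2 k z = h.2 * 'D_e2 U1 z - h.1 * 'D_e2 U2 z.
Proof.
have := is_deriveB (is_deriveZ h.2 (C1b_is_derive1 z hU1)) (is_deriveZ h.1 (C1b_is_derive1 z hU2)).
have := is_deriveB (is_deriveZ h.2 (C1b_is_derive2 z hU1)) (is_deriveZ h.1 (C1b_is_derive2 z hU2)).
by move=> [_ E2] [_ E1]; split; [exact: E1|exact: E2].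
Qed.

Let bk z : `|k z| <= 2 * M * `|h|.
Proof.
apply: le_trans (ler_normB _ _) _; rewrite !normrM.
have := ler_pM (normr_ge0 _) (normr_ge0 _) h2 (bU1 z).
have := ler_pM (normr_ge0 _) (normr_ge0 _) h1 (bU2 z); lra.
Qed.

(** Only the L1 norm of the divergence is available, so it is paired with a bounded factor: [F1] and
    [F2] are at most [2 M], and [|h|] comes from the coefficients. *)
Let T1_bound w : `|w| <= `|h| ->
  `| \int[@leb2 R]_x (chi x * (divf U1 U2 (x + w) * (h.1 * F2 x - h.2 * F1 x))) | <= `|h| * (4 * M * B).
Proof.
move=> wh; have cg := continuous_divf hU1 hU2.
have cgw : continuous (fun x => divf U1 U2 (x + w)).
  move=> x; apply: (@continuous_comp _ _ _ (fun z => z + w)); last exact: cg.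
  by apply: cvgD; [exact: cvg_id|exact: cvg_cst].
have i1 : integ (@leb2 R) (fun x => chi x * (divf U1 U2 (x + w) * (h.1 * F2 x - h.2 * F1 x))).
  apply: (@integ_supp _ r); last by move=> z /schi ->; rewrite mul0r.
  apply: continuousMf; first exact: C1b_continuous.
  apply: continuousMf => //; apply: C1b_continuous; apply: C1bB; exact: C1bZ.
apply: le_trans (norm_RintegralT i1) _.
apply: (@le_trans _ _ (\int[@leb2 R]_x ((4 * M * `|h|) * (`|divf U1 U2 (x + w)| * \1_(cbox a b) (x + w))))).
  apply: le_RintegralT; [exact: integ_norm|by apply: integZ; exact: integ_shift_ind|move=> x].
  rewrite normrM (ger0_norm (chi_ge0 x)) normrM mulrA.
  have bF : `|h.1 * F2 x - h.2 * F1 x| <= 4 * M * `|h|.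
    apply: le_trans (ler_normB _ _) _; rewrite !normrM.
    have := ler_pM (normr_ge0 _) (normr_ge0 _) h1 (incr_le x bW2).
    have := ler_pM (normr_ge0 _) (normr_ge0 _) h2 (incr_le x bW1); rewrite -/F1 -/F2; lra.
  rewrite [leRHS]mulrC; apply: ler_pM => //; first by rewrite mulr_ge0.
  exact: chi_indic.
rewrite RintegralZT ?Rintegral_shift_ind//; last exact: integ_shift_ind.
apply: (@le_trans _ _ ((4 * M * `|h|) * B)); last by rewrite le_eqVlt; apply/orP; left; apply/eqP; ring.
apply: ler_wpM2l BU; apply: mulr_ge0; last exact: normr_ge0.
by apply: mulr_ge0; [exact: ler0n|exact: M0].
Qed.

Let derive_chiF x : 'D_e1 (fun x => chi x * F1 x) x + 'D_e2 (fun x => chi x * F2 x) x =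
  F1 x * 'D_e1 chi x + F2 x * 'D_e2 chi x + chi x * (divf W1 W2 (x + h) - divf W1 W2 x).
Proof.
have [_ ->] := is_deriveM (C1b_is_derive1 x hchi) (C1b_is_derive1 x hF1).
have [_ ->] := is_deriveM (C1b_is_derive2 x hchi) (C1b_is_derive2 x hF2).
rewrite /F1 /F2 (derive_incr h x hW1).1 (derive_incr h x hW2).2 /incr /divf.
rewrite /GRing.scale/=; ring.
Qed.

(** The derivatives move from [k], of size [2 M |h|], to [chi F]. The divergence of [F] is an
    increment of [divf W1 W2], hence costs [2 B]; the derivatives of [chi] cost [2 M D]. *)
Let T2_bound w : `|w| <= `|h| ->
  `| \int[@leb2 R]_x (chi x * (F1 x * 'D_e1 k (x + w) + F2 x * 'D_e2 k (x + w))) | <=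
  `|h| * (4 * M ^+ 2 * D + 4 * M * B).
Proof.
move=> wh; have [hkw dkw] := C1b_shift w hk.
pose q1 x := chi x * F1 x; pose q2 x := chi x * F2 x.
have hq1 : C1b q1 by exact: C1bM. have hq2 : C1b q2 by exact: C1bM.
have sq1 : supp_in r q1 by move=> z /schi; rewrite /q1 => ->; rewrite mul0r.
have sq2 : supp_in r q2 by move=> z /schi; rewrite /q2 => ->; rewrite mul0r.
have P1 := by_parts1 hkw hq1 sq1; have P2 := by_parts2 hkw hq2 sq2.
have ckw := C1b_continuous hkw.
have j1 : integ (@leb2 R) (fun x => 'D_e1 (fun z => k (z + w)) x * q1 x).
  apply: (@integ_supp _ r); last by move=> z /sq1 ->; rewrite mulr0.
  by apply: continuousMf; [exact: C1b_continuous1|exact: C1b_continuous].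
have j2 : integ (@leb2 R) (fun x => 'D_e2 (fun z => k (z + w)) x * q2 x).
  apply: (@integ_supp _ r); last by move=> z /sq2 ->; rewrite mulr0.
  by apply: continuousMf; [exact: C1b_continuous2|exact: C1b_continuous].
have j3 : integ (@leb2 R) (fun x => k (x + w) * 'D_e1 q1 x).
  apply: (@integ_supp _ r); last by move=> z /(supp_in_derive e1 sq1) ->; rewrite mulr0.
  by apply: continuousMf; [exact: C1b_continuous|exact: C1b_continuous1].
have j4 : integ (@leb2 R) (fun x => k (x + w) * 'D_e2 q2 x).
  apply: (@integ_supp _ r); last by move=> z /(supp_in_derive e2 sq2) ->; rewrite mulr0.
  by apply: continuousMf; [exact: C1b_continuous|exact: C1b_continuous2].
have -> : \int[@leb2 R]_x (chi x * (F1 x * 'D_e1 k (x + w) + F2 x * 'D_e2 k (x + w))) =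
   - \int[@leb2 R]_x (k (x + w) * ('D_e1 q1 x + 'D_e2 q2 x)).
  transitivity (\int[@leb2 R]_x ('D_e1 (fun z => k (z + w)) x * q1 x + 'D_e2 (fun z => k (z + w)) x * q2 x)).
    by apply: eq_Rintegral => x _; rewrite (dkw x).1 (dkw x).2 /q1 /q2; ring.
  rewrite RintegralDT// P1 P2 -opprD -RintegralDT//; congr (- _).
  by apply: eq_Rintegral => x _; rewrite mulrDr.
rewrite normrN.
have j5 : integ (@leb2 R) (fun x => k (x + w) * ('D_e1 q1 x + 'D_e2 q2 x)).
  by under eq_fun do rewrite mulrDr; exact: integD.
apply: le_trans (norm_RintegralT j5) _.
have cW := continuous_divf hW1 hW2.
have i1 := integ_shift_ind h cW; have i0 := integ_on_cbox a b cW.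
have ichi : integ (@leb2 R) (fun x => `|'D_e1 chi x| + `|'D_e2 chi x|).
  apply: integD; apply: integ_norm; apply: (@integ_supp _ r).
  - exact: C1b_continuous1.
  - exact: supp_in_derive.
  - exact: C1b_continuous2.
  - exact: supp_in_derive.
pose A x : R := `|divf W1 W2 (x + h)| * \1_(cbox a b) (x + h).
pose A0 x : R := `|divf W1 W2 x| * \1_(cbox a b) x.
apply: (@le_trans _ _ (\int[@leb2 R]_x ((2 * M * `|h|) *
  (2 * M * (`|'D_e1 chi x| + `|'D_e2 chi x|) + (A x + A0 x))))).
  apply: le_RintegralT; first exact: integ_norm.
    by apply: integZ; apply: integD; [exact: integZ|exact: integD].
  move=> x; rewrite normrM; apply: ler_pM => //.
  rewrite /q1 /q2 derive_chiF.
  apply: le_trans (ler_normD _ _) _; apply: lerD.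
    apply: le_trans (ler_normD _ _) _; rewrite (normrM (F1 x)) (normrM (F2 x)).
    rewrite mulrDr; apply: lerD.
      by apply: ler_wpM2r; [exact: normr_ge0|exact: (incr_le x bW1)].
    by apply: ler_wpM2r; [exact: normr_ge0|exact: (incr_le x bW2)].
  rewrite normrM (ger0_norm (chi_ge0 x)).
  apply: le_trans (ler_wpM2l (chi_ge0 x) (ler_normB _ _)) _; rewrite mulrDr.
  apply: lerD; first exact: chi_indic.
  by have := @chi_indic (divf W1 W2) x 0; rewrite addr0; apply; rewrite normr0.
rewrite RintegralZT; last by apply: integD; [exact: integZ|exact: integD].
rewrite RintegralDT; [|exact: integZ|exact: integD].
rewrite RintegralZT// RintegralDT// /A /A0 Rintegral_shift_ind//.
have c0 : 0 <= 2 * M * `|h| by rewrite mulr_ge0// mulr_ge0.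
apply: (@le_trans _ _ ((2 * M * `|h|) * (2 * M * D + (B + B)))).
  rewrite ler_wpM2l//; apply: lerD; last exact: lerD.
  by rewrite ler_wpM2l// mulr_ge0.
by rewrite le_eqVlt; apply/orP; left; apply/eqP; ring.
Qed.

(* For a path [t *: h] the derivative of the cross product is a divergence
   term plus the directional derivative of the stream function [k] along the
   increment of [W]; the latter is integrated by parts. *)
Lemma interaction :
  `| \int[@leb2 R]_x (chi x * (incr h U1 x * incr h W2 x - incr h U2 x * incr h W1 x)) |
  <= `|h| * (4 * M ^+ 2 * D + 8 * M * B).
Proof.
pose E t x := (U1 (t *: h + x) - U1 x) * F2 x - (U2 (t *: h + x) - U2 x) * F1 x.
pose dE t x := dU U1 (t *: h + x) * F2 x - dU U2 (t *: h + x) * F1 x.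
have [C1 [bC1]] : exists C, (forall z, `|dU U1 z| <= C) /\ (forall z, `|dU U2 z| <= C).
  have [_ [C hC]] := hU1; have [_ [C' hC']] := hU2.
  exists (`|h| * C + `|h| * C + (`|h| * C' + `|h| * C')).
  have C0 : 0 <= C by have [+ _ _] := hC 0; exact: le_trans.
  have C0' : 0 <= C' by have [+ _ _] := hC' 0; exact: le_trans.
  have hC0 : 0 <= `|h| * C by rewrite mulr_ge0.
  have hC0' : 0 <= `|h| * C' by rewrite mulr_ge0.
  split => z.
    have [_ c1 c2] := hC z; apply: le_trans (ler_normD _ _) _; rewrite !normrM.
    have := lerD (ler_pM (normr_ge0 _) (normr_ge0 _) h1 c1) (ler_pM (normr_ge0 _) (normr_ge0 _) h2 c2).
    by move/le_trans; apply; rewrite lerDl addr_ge0.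
  have [_ c1 c2] := hC' z; apply: le_trans (ler_normD _ _) _; rewrite !normrM.
  have := lerD (ler_pM (normr_ge0 _) (normr_ge0 _) h1 c1) (ler_pM (normr_ge0 _) (normr_ge0 _) h2 c2).
  by move/le_trans; apply; rewrite lerDr addr_ge0.
move=> bC2.
have C10 : 0 <= C1 by apply: le_trans (bC1 0).
have bF1 x : `|F1 x| <= 2 * M by exact: incr_le.
have bF2 x : `|F2 x| <= 2 * M by exact: incr_le.
have dEC s x : `|dE s x| <= C1 * (2 * M) + C1 * (2 * M).
  apply: le_trans (ler_normB _ _) _; rewrite !normrM.
  by apply: lerD; exact: ler_pM.
have hE (s : R) x : is_derive s 1 (E^~ x) (dE s x).
  have d1 : is_derive s 1 (fun s : R => U1 (s *: h + x)) (dU U1 (s *: h + x)).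
    exact: ((is_derive_lineE U1 x h s _).1 (C1b_directional _ h hU1)).
  have d2 : is_derive s 1 (fun s : R => U2 (s *: h + x)) (dU U2 (s *: h + x)).
    exact: ((is_derive_lineE U2 x h s _).1 (C1b_directional _ h hU2)).
  have -> : E^~ x = (F2 x *: ((fun s : R => U1 (s *: h + x)) - cst (U1 x)) -
                     F1 x *: ((fun s : R => U2 (s *: h + x)) - cst (U2 x))).
    by apply/funext => t; rewrite /E [RHS]/(_ - _) mulrC [X in _ - X]mulrC.
  apply: is_derive_eq.
  by rewrite !subr0 /dE mulrC [X in _ - X]mulrC.
have cE s : continuous (E s).
  have cs F : C1b F -> C1b (fun x => F (s *: h + x)).
    by move=> hF; under eq_fun do rewrite addrC; case: (C1b_shift (s *: h) hF).
  apply: C1b_continuous; apply: C1bB.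
    exact: C1bM (C1bB (cs _ hU1) hU1) hF2.
  exact: C1bM (C1bB (cs _ hU2) hU2) hF1.
have dJ t := Rintegral_derive_param t (C1b_continuous hchi) schi cE dEC hE.
(* At [t = 0] the integrand vanishes and at [t = 1] it is the one of the claim, so a single
   intermediate derivative remains to be bounded. *)
have [c c1] := @mean_value1 R _ _ 0 1 dJ.
rewrite !subr0 normr1 mulr1 in c1 *.
have -> : \int[@leb2 R]_x (chi x * E 0 x) = 0.
  have E0 x : chi x * E 0 x = 0.
    by rewrite /E scale0r add0r !subrr !mul0r subrr mulr0.
  by under eq_Rintegral do rewrite E0; rewrite Rintegral_cst// mul0r.
rewrite subr0.
have -> : \int[@leb2 R]_x (chi x * E 1 x) =
  \int[@leb2 R]_x (chi x * (incr h U1 x * incr h W2 x - incr h U2 x * incr h W1 x)).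
  by apply: eq_Rintegral => x _; rewrite /E scale1r (addrC h).
move=> ->.
have wh : `|c *: h| <= `|h| by rewrite normrZ ler_piMl.
have := T1_bound wh; have := T2_bound wh.
set T2 := Rintegral _ _ _; set T1 := Rintegral _ _ _ => b2 b1.
(* With [U] and [k] at [x + c *: h] and [F] at [x]: the derivatives along [h] satisfy [dU U1 F2 - dU
   U2 F1 = div U (h.1 F2 - h.2 F1) + F . grad k]. *)
have -> : \int[@leb2 R]_x (chi x * dE c x) = T1 + T2.
  rewrite -RintegralDT.
  - apply: eq_Rintegral => x _; rewrite /dE /dU (dk _).1 (dk _).2 (addrC (c *: h)) /divf; ring.
  - apply: (@integ_supp _ r); last by move=> z /schi ->; rewrite mul0r.
    apply: continuousMf; first exact: C1b_continuous.
    apply: continuousMf; last by apply: C1b_continuous; apply: C1bB; exact: C1bZ.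
    move=> x; apply: (@continuous_comp _ _ _ (fun z => z + c *: h)); last exact: continuous_divf.
    by apply: cvgD; [exact: cvg_id|exact: cvg_cst].
  - apply: (@integ_supp _ r); last by move=> z /schi ->; rewrite mul0r.
    apply: continuousMf; first exact: C1b_continuous.
    have cs F : continuous F -> continuous (fun x => F (x + c *: h)).
      move=> cF x; apply: (@continuous_comp _ _ _ (fun z => z + c *: h)); last exact: cF.
      by apply: cvgD; [exact: cvg_id|exact: cvg_cst].
    apply: continuousDf; apply: continuousMf.
    + exact: C1b_continuous hF1.
    + exact: (cs (fun z => 'D_e1 k z) (C1b_continuous1 hk)).
    + exact: C1b_continuous hF2.
    + exact: (cs (fun z => 'D_e2 k z) (C1b_continuous2 hk)).
apply: le_trans (ler_normD _ _) _; apply: le_trans (lerD b1 b2) _.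
by rewrite -mulrDr; rewrite le_eqVlt; apply/orP; left; apply/eqP; ring.
Qed.

End interaction.

(** * The entropies *)

Section entropies.
Context {R : realType}.
Implicit Types (a b s : R).

Definition nrm2 a b : R := a ^+ 2 + b ^+ 2.
Definition cut s : R := (1 + s)^-1.
Definition om s : R := s * `|1 - s| * cut s ^+ 2.
(** [F = s^2 / (1 + s)^4] is invariant under [s -> 1/s], so [F'] vanishes at 1; moreover
    [s G = - 3 F]. Hence the derivative of [F z^3 + G conj(z)] in [conj(z)] is [F' (z^4 - 3)], which
    vanishes on the circle. *)
Definition entF s : R := s ^+ 2 * cut s ^+ 4.
Definition entG s : R := - 3 * s * cut s ^+ 4.
Definition re3 a b : R := a ^+ 3 - 3 * a * b ^+ 2.
Definition im3 a b : R := 3 * a ^+ 2 * b - b ^+ 3.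

(* With z = a + i b and s = |z|^2, (Phi1, Phi2) is F z^3 + G conj(z) and
   (Psi1, Psi2) is - i (F z^3 - G conj(z)). On the unit circle these are the
   Jin-Kohn entropies (z^3 - 3 conj(z)) / 16 and - i (z^3 + 3 conj(z)) / 16; the
   factors in s make their Jacobians conformal on the circle and O(s) at 0. *)
Definition Phi1 a b : R := entF (nrm2 a b) * re3 a b + entG (nrm2 a b) * a.
Definition Phi2 a b : R := entF (nrm2 a b) * im3 a b - entG (nrm2 a b) * b.
Definition Psi1 a b : R := entF (nrm2 a b) * im3 a b + entG (nrm2 a b) * b.
Definition Psi2 a b : R := entG (nrm2 a b) * a - entF (nrm2 a b) * re3 a b.
(** The factor 16 is the inverse of [entF 1]. As [F' = 2 s (1 - s) / (1 + s)^5], the gradient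
    vanishes both on the circle and at 0 and is bounded by a multiple of [om]. *)
Definition ramp a b : R := 16 * entF (nrm2 a b).
(** A signed [om]: it is differentiable across the circle and Lipschitz, which lets its L2 bound
    pass from a field to its mollification. *)
Definition kap a b : R := nrm2 a b * (1 - nrm2 a b) * cut (nrm2 a b) ^+ 2.

Lemma nrm2_ge0 a b : 0 <= nrm2 a b.
Proof. by rewrite addr_ge0// sqr_ge0. Qed.

Lemma cut_bnd s : 0 <= s -> 0 < cut s <= 1.
Proof.
move=> s0; rewrite /cut invr_gt0 invf_le1; last by rewrite ltr_wpDr.
by rewrite ltr_wpDr//= lerDl.
Qed.

Lemma cutE s : 0 <= s -> (1 + s) * cut s = 1.
Proof. by move=> s0; rewrite divff// gt_eqF// ltr_wpDr. Qed.

Lemma om_ge0 s : 0 <= s -> 0 <= om s.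
Proof. by move=> s0; rewrite mulr_ge0 ?sqr_ge0// mulr_ge0. Qed.

(** Over the denominator [(1 + s)^5] of [F'] all coefficients of the Jacobians have polynomial
    numerators, so that [ring] can compare them. *)
Lemma entF5 s : 0 <= s -> entF s = s ^+ 2 * (1 + s) * cut s ^+ 5.
Proof.
by move=> s0; rewrite (exprS _ 4) mulrA -(mulrA (s ^+ 2)) cutE// mulr1.
Qed.

Lemma entG5 s : 0 <= s -> entG s = - 3 * s * (1 + s) * cut s ^+ 5.
Proof.
by move=> s0; rewrite (exprS _ 4) mulrA -(mulrA (- 3 * s)) cutE// mulr1.
Qed.

(** [F' = 2 s * wgt s]. Every deviation of the Jacobians from a scalar matrix carries this factor,
    which vanishes on the circle. *)
Definition wgt s : R := (1 - s) * cut s ^+ 5.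

Lemma wgt_bound s c (K : R) : 0 <= s -> 0 <= K -> `|c| <= K * (s * (1 + s) ^+ 2) ->
  `|wgt s * c| <= K * om s.
Proof.
move=> s0 K0 hc; have /andP[q0 q1] := cut_bnd s0.
rewrite normrM {1}/wgt (normrM (1 - s)) (ger0_norm (exprn_ge0 _ (ltW q0))).
apply: (@le_trans _ _ (`|1 - s| * cut s ^+ 5 * (K * (s * (1 + s) ^+ 2)))).
  by rewrite ler_wpM2l// mulr_ge0// exprn_ge0// ltW.
rewrite (_ : _ * _ * _ = K * om s * (((1 + s) * cut s) ^+ 2 * cut s)); last first.
  by rewrite /om; ring.
by rewrite cutE// expr1n mul1r ler_piMr// mulr_ge0// om_ge0.
Qed.

Section jacobian.
Context {V : normedModType R}.
Variables (x v : V) (f g : V -> R) (df dg : R).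
Hypotheses (hf : is_derive x v f df) (hg : is_derive x v g dg).

Lemma is_derive_mul (F G : V -> R) dF dG : is_derive x v F dF -> is_derive x v G dG ->
  is_derive x v (fun w => F w * G w) (F x * dG + G x * dF).
Proof. by move=> ? ?; exact: is_deriveM. Qed.

Lemma is_derive_add (F G : V -> R) dF dG : is_derive x v F dF -> is_derive x v G dG ->
  is_derive x v (fun w => F w + G w) (dF + dG).
Proof. by move=> ? ?; exact: is_deriveD. Qed.

Lemma is_derive_sub (F G : V -> R) dF dG : is_derive x v F dF -> is_derive x v G dG ->
  is_derive x v (fun w => F w - G w) (dF - dG).
Proof. by move=> ? ?; exact: is_deriveB. Qed.

Lemma is_derive_scal (F : V -> R) dF (c : R) : is_derive x v F dF ->
  is_derive x v (fun w => c * F w) (c * dF).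
Proof. by move=> ?; exact: is_deriveZ. Qed.

Lemma is_derive_pow (F : V -> R) dF n : is_derive x v F dF ->
  is_derive x v (fun w => F w ^+ n.+1) (n.+1%:R * F x ^+ n * dF).
Proof.
move=> hF; elim: n => [|n IH]; first by rewrite expr0 mul1r mul1r; under eq_fun do rewrite expr1.
under eq_fun do rewrite exprS.
by apply: is_derive_eq (is_derive_mul hF IH) _; rewrite exprS -(natr1 n.+1); ring.
Qed.

Let N w := nrm2 (f w) (g w).
Let n0 := N x.
Let dN := 2 * f x * df + 2 * g x * dg.

Let N0 w : 0 <= N w. Proof. exact: nrm2_ge0. Qed.

Lemma is_derive_nrm2 : is_derive x v N dN.
Proof.
apply: is_derive_eq (is_derive_add (is_derive_pow 1 hf) (is_derive_pow 1 hg)) _.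
by rewrite /dN !expr1.
Qed.

Lemma is_derive_cut : is_derive x v (fun w => cut (N w)) (- cut n0 ^+ 2 * dN).
Proof.
have n1 : 1 + N x != 0 by rewrite gt_eqF// ltr_wpDr.
have h := is_derive_add (is_derive_cst (1 : R) x v) is_derive_nrm2.
have := @derive_val _ _ _ _ _ _ _ h => hv; have dd := @ex_derive _ _ _ _ _ _ _ h.
split; first exact: derivableV.
by rewrite deriveV// hv add0r /GRing.scale/= /cut exprVn.
Qed.

Lemma is_derive_entF : is_derive x v (fun w => entF (N w)) (2 * n0 * wgt n0 * dN).
Proof.
apply: is_derive_eq (is_derive_mul (is_derive_pow 1 is_derive_nrm2) (is_derive_pow 3 is_derive_cut)) _.
have E : cut (N x) ^+ 4 = (1 + n0) * cut n0 ^+ 5 by rewrite (exprS _ 4) mulrA cutE ?mul1r//; exact: N0.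
by rewrite E /wgt -/n0; ring.
Qed.

Lemma is_derive_entG :
  is_derive x v (fun w => entG (N w)) (- 3 * (1 - 3 * n0) * cut n0 ^+ 5 * dN).
Proof.
apply: is_derive_eq (is_derive_mul (is_derive_scal (- 3) is_derive_nrm2) (is_derive_pow 3 is_derive_cut)) _.
have E : cut (N x) ^+ 4 = (1 + n0) * cut n0 ^+ 5 by rewrite (exprS _ 4) mulrA cutE ?mul1r//; exact: N0.
by rewrite E -/n0; ring.
Qed.

Lemma is_derive_re3 : is_derive x v (fun w => re3 (f w) (g w))
  (3 * (f x ^+ 2 - g x ^+ 2) * df - 6 * f x * g x * dg).
Proof.
apply: is_derive_eq (is_derive_sub (is_derive_pow 2 hf)
  (is_derive_mul (is_derive_scal 3 hf) (is_derive_pow 1 hg))) _.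
by rewrite expr1; ring.
Qed.

Lemma is_derive_im3 : is_derive x v (fun w => im3 (f w) (g w))
  (6 * f x * g x * df + 3 * (f x ^+ 2 - g x ^+ 2) * dg).
Proof.
apply: is_derive_eq (is_derive_sub (is_derive_mul (is_derive_scal 3 (is_derive_pow 1 hf)) hg)
  (is_derive_pow 2 hg)) _.
by rewrite expr1; ring.
Qed.

Let p := f x ^+ 2 - g x ^+ 2.
Let m := 2 * f x * g x.

(** With [p + i m = z^2] these are [6 F p] and [6 F m]. The same value sits in both diagonal entries
    of the Jacobian, so in the divergence of the composed field it multiplies only the divergence of
    the field. *)
Definition gam1 a b : R := 6 * entF (nrm2 a b) * (a ^+ 2 - b ^+ 2).
Definition gam2 a b : R := 12 * entF (nrm2 a b) * a * b.

Let E5F : entF n0 = n0 ^+ 2 * (1 + n0) * cut n0 ^+ 5. Proof. by apply: entF5; exact: N0. Qed.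
Let E5G : entG n0 = - 3 * n0 * (1 + n0) * cut n0 ^+ 5. Proof. by apply: entG5; exact: N0. Qed.

Lemma is_derive_Phi1 : is_derive x v (fun w => Phi1 (f w) (g w))
  ((gam1 (f x) (g x) + wgt n0 * ((5 * n0 ^+ 2 + 6 * n0 - 3) * p + 2 * n0 * (p ^+ 2 - m ^+ 2 - 3))) * df
   + wgt n0 * (- (m * (3 - 6 * n0 - n0 ^+ 2)) + 4 * n0 * m * p) * dg).
Proof.
apply: is_derive_eq (is_derive_add (is_derive_mul is_derive_entF is_derive_re3)
  (is_derive_mul is_derive_entG hf)) _.
rewrite /gam1 -/(N x) -/n0 E5F E5G /wgt; move: (cut n0) => q.
rewrite /p /m /dN /re3 /n0 /N /nrm2; ring.
Qed.

Lemma is_derive_Phi2 : is_derive x v (fun w => Phi2 (f w) (g w))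
  (wgt n0 * (m * (3 - 6 * n0 - n0 ^+ 2) + 4 * n0 * m * p) * df
   + (gam1 (f x) (g x) + wgt n0 * ((5 * n0 ^+ 2 + 6 * n0 - 3) * p - 2 * n0 * (p ^+ 2 - m ^+ 2 - 3))) * dg).
Proof.
apply: is_derive_eq (is_derive_sub (is_derive_mul is_derive_entF is_derive_im3)
  (is_derive_mul is_derive_entG hg)) _.
rewrite /gam1 -/(N x) -/n0 E5F E5G /wgt; move: (cut n0) => q.
rewrite /p /m /dN /im3 /n0 /N /nrm2; ring.
Qed.

Lemma is_derive_Psi1 : is_derive x v (fun w => Psi1 (f w) (g w))
  ((gam2 (f x) (g x) + wgt n0 * ((5 * n0 ^+ 2 + 6 * n0 - 3) * m + 4 * n0 * m * p)) * df
   + wgt n0 * ((3 - 6 * n0 - n0 ^+ 2) * p - 2 * n0 * (p ^+ 2 - m ^+ 2 + 3)) * dg).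
Proof.
apply: is_derive_eq (is_derive_add (is_derive_mul is_derive_entF is_derive_im3)
  (is_derive_mul is_derive_entG hg)) _.
rewrite /gam2 -/(N x) -/n0 E5F E5G /wgt; move: (cut n0) => q.
rewrite /p /m /dN /im3 /n0 /N /nrm2; ring.
Qed.

Lemma is_derive_Psi2 : is_derive x v (fun w => Psi2 (f w) (g w))
  (wgt n0 * (- ((3 - 6 * n0 - n0 ^+ 2) * p) - 2 * n0 * (p ^+ 2 - m ^+ 2 + 3)) * df
   + (gam2 (f x) (g x) + wgt n0 * ((5 * n0 ^+ 2 + 6 * n0 - 3) * m - 4 * n0 * m * p)) * dg).
Proof.
apply: is_derive_eq (is_derive_sub (is_derive_mul is_derive_entG hf)
  (is_derive_mul is_derive_entF is_derive_re3)) _.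
rewrite /gam2 -/(N x) -/n0 E5F E5G /wgt; move: (cut n0) => q.
rewrite /p /m /dN /re3 /n0 /N /nrm2; ring.
Qed.

Lemma is_derive_ramp : is_derive x v (fun w => ramp (f w) (g w))
  (wgt n0 * (64 * n0 * f x) * df + wgt n0 * (64 * n0 * g x) * dg).
Proof.
apply: is_derive_eq (is_derive_scal 16 is_derive_entF) _.
by rewrite /dN; ring.
Qed.

Lemma is_derive_kap : is_derive x v (fun w => kap (f w) (g w))
  ((1 - 3 * n0) * cut n0 ^+ 3 * (2 * f x) * df + (1 - 3 * n0) * cut n0 ^+ 3 * (2 * g x) * dg).
Proof.
apply: is_derive_eq (is_derive_mul (is_derive_mul is_derive_nrm2
  (is_derive_sub (is_derive_cst (1 : R) x v) is_derive_nrm2)) (is_derive_pow 1 is_derive_cut)) _.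
have E : cut (N x) ^+ 2 = (1 + n0) * cut n0 ^+ 3 by rewrite (exprS _ 2) mulrA cutE ?mul1r//; exact: N0.
by rewrite [X in _ + X * _ = _]E -/n0 /dN expr1 sub0r /=; ring.
Qed.

End jacobian.

Lemma nrm2_parts a b : let p := a ^+ 2 - b ^+ 2 in let m := 2 * a * b in
  [/\ `|p| <= nrm2 a b, `|m| <= nrm2 a b & p ^+ 2 + m ^+ 2 = nrm2 a b ^+ 2].
Proof.
have a2 := sqr_ge0 a; have b2 := sqr_ge0 b.
split; rewrite /nrm2 ?ler_norml.
- by apply/andP; split; lra.
- by have := sqr_ge0 (a + b); have := sqr_ge0 (a - b);
    rewrite sqrrB sqrrD; move=> *; apply/andP; split; lra.
- ring.
Qed.

(** Brings all error coefficients of the Jacobians to the single form [6 s (1 + s)^2] that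
    [wgt_bound] turns into a multiple of [om]. *)
Lemma poly_bounds a b : let s := nrm2 a b in
  let p := a ^+ 2 - b ^+ 2 in let m := 2 * a * b in
  [/\ `|(5 * s ^+ 2 + 6 * s - 3) * p| <= 6 * (s * (1 + s) ^+ 2),
      `|(5 * s ^+ 2 + 6 * s - 3) * m| <= 6 * (s * (1 + s) ^+ 2),
      `|(3 - 6 * s - s ^+ 2) * p| <= 6 * (s * (1 + s) ^+ 2) &
      `|(3 - 6 * s - s ^+ 2) * m| <= 6 * (s * (1 + s) ^+ 2)] /\
  [/\ `|2 * s * (p ^+ 2 - m ^+ 2 - 3)| <= 6 * (s * (1 + s) ^+ 2),
      `|2 * s * (p ^+ 2 - m ^+ 2 + 3)| <= 6 * (s * (1 + s) ^+ 2) &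
      `|4 * s * m * p| <= 6 * (s * (1 + s) ^+ 2)].
Proof.
move=> s p m; have [pb mb E] := nrm2_parts a b; have s0 := nrm2_ge0 a b.
rewrite -/s -/p -/m in pb mb E s0; clearbody s p m.
have s2 := sqr_ge0 s; have s3 : 0 <= s * s ^+ 2 by rewrite mulr_ge0.
have Q : (1 + s) ^+ 2 = 1 + 2 * s + s ^+ 2 by ring.
have B1 : `|5 * s ^+ 2 + 6 * s - 3| <= 6 * (1 + s) ^+ 2.
  by rewrite ler_norml; apply/andP; split; rewrite Q; lra.
have B2 : `|3 - 6 * s - s ^+ 2| <= 6 * (1 + s) ^+ 2.
  by rewrite ler_norml; apply/andP; split; rewrite Q; lra.
have c1 c t : `|c| <= 6 * (1 + s) ^+ 2 -> `|t| <= s -> `|c * t| <= 6 * (s * (1 + s) ^+ 2).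
  move=> hc ht; rewrite normrM; apply: le_trans (ler_pM _ _ hc ht) _ => //.
  by rewrite le_eqVlt; apply/orP; left; apply/eqP; ring.
have p2 := sqr_ge0 p; have m2 := sqr_ge0 m.
have B3 : `|2 * (p ^+ 2 - m ^+ 2 - 3)| <= 6 * (1 + s) ^+ 2.
  by rewrite ler_norml; apply/andP; split; rewrite Q; lra.
have B4 : `|2 * (p ^+ 2 - m ^+ 2 + 3)| <= 6 * (1 + s) ^+ 2.
  by rewrite ler_norml; apply/andP; split; rewrite Q; lra.
have B5 : `|4 * m * p| <= 6 * (1 + s) ^+ 2.
  have := sqr_ge0 (m + p); have := sqr_ge0 (m - p); rewrite sqrrB sqrrD.
  by move=> *; rewrite ler_norml; apply/andP; split; rewrite Q; lra.
have ss : `|s| <= s by rewrite ger0_norm.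
split; split; try exact: c1.
- by rewrite mulrAC; exact: c1.
- by rewrite mulrAC; exact: c1.
- by rewrite (_ : 4 * s * m * p = 4 * m * p * s); [exact: c1|ring].
Qed.

Lemma gam_bound a b : `|gam1 a b| <= 6 /\ `|gam2 a b| <= 6.
Proof.
have [pb mb _] := nrm2_parts a b; have s0 := nrm2_ge0 a b.
set s := nrm2 a b in pb mb s0 *.
have /andP[q0 q1] := cut_bnd s0.
have F0 : 0 <= entF s by rewrite mulr_ge0 ?exprn_ge0// ltW.
have Fs : entF s * s <= 1.
  rewrite /entF (_ : _ * _ * _ = (s * cut s) ^+ 3 * cut s); last ring.
  have sc : 0 <= s * cut s <= 1.
    have := cutE s0; rewrite mulrDl mul1r => E.
    by rewrite mulr_ge0 ?(ltW q0)//=; lra.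
  have /andP[? ?] := sc.
  by rewrite mulr_ile1 ?exprn_ge0 ?exprn_ile1 ?(ltW q0).
have K t : `|t| <= s -> `|6 * entF s * t| <= 6.
  move=> ht; rewrite -mulrA normrM (@ger0_norm _ 6)// -[leRHS]mulr1 ler_wpM2l//.
  rewrite normrM ger0_norm//; apply: le_trans Fs; exact: ler_wpM2l.
split; first exact: K.
rewrite /gam2 -/s (_ : _ * _ * _ * _ = 6 * entF s * (2 * a * b)); last ring.
exact: K.
Qed.

Lemma ent_bound a b :
  [/\ `|Phi1 a b| <= 6, `|Phi2 a b| <= 6, `|Psi1 a b| <= 6 & `|Psi2 a b| <= 6].
Proof.
have s0 := nrm2_ge0 a b; set s := nrm2 a b in s0 *.
have /andP[q0 q1] := cut_bnd s0; have cE := cutE s0.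
have a2 := sqr_ge0 a; have b2 := sqr_ge0 b.
have sE : s = a ^+ 2 + b ^+ 2 by [].
have a1 : `|a| <= 1 + s.
  by rewrite ler_norml; have := sqr_ge0 (a - 1); have := sqr_ge0 (a + 1);
    rewrite sqrrB1 sqrrD1 => *; rewrite ?sE; apply/andP; split; lra.
have b1 : `|b| <= 1 + s.
  by rewrite ler_norml; have := sqr_ge0 (b - 1); have := sqr_ge0 (b + 1);
    rewrite sqrrB1 sqrrD1 => *; rewrite ?sE; apply/andP; split; lra.
have r3 : `|re3 a b| <= 3 * s * (1 + s).
  rewrite /re3 (_ : _ - _ = (a ^+ 2 - 3 * b ^+ 2) * a); last ring.
  rewrite normrM; apply: ler_pM => //; rewrite ler_norml; apply/andP; split; lra.
have i3 : `|im3 a b| <= 3 * s * (1 + s).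
  rewrite /im3 (_ : _ - _ = (3 * a ^+ 2 - b ^+ 2) * b); last ring.
  rewrite normrM; apply: ler_pM => //; rewrite ler_norml; apply/andP; split; lra.
have F0 : 0 <= entF s by rewrite mulr_ge0 ?exprn_ge0// ltW.
have sc1 : s * cut s <= 1 by move: cE; rewrite mulrDl mul1r; lra.
have sc0 : 0 <= s * cut s by rewrite mulr_ge0// ltW.
have FB t : `|t| <= 3 * s * (1 + s) -> `|entF s * t| <= 3.
  move=> ht; rewrite normrM ger0_norm//.
  apply: le_trans (ler_wpM2l F0 ht) _.
  rewrite /entF [X in X <= _](_ : _ = 3 * ((s * cut s) ^+ 3 * ((1 + s) * cut s))); last ring.
  by rewrite cE mulr1 -[leRHS]mulr1 ler_wpM2l// exprn_ile1.
have GB t : `|t| <= 1 + s -> `|entG s * t| <= 3.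
  have c0 : 0 <= 3 * s * cut s ^+ 4.
    by apply: mulr_ge0; [exact: mulr_ge0|apply: exprn_ge0; exact: ltW].
  move=> ht; rewrite (_ : entG s * t = - (3 * s * cut s ^+ 4 * t)); last by rewrite /entG; ring.
  rewrite normrN normrM (ger0_norm c0).
  apply: le_trans (ler_wpM2l c0 ht) _.
  rewrite [X in X <= _](_ : _ = 3 * (s * cut s * (cut s ^+ 2 * ((1 + s) * cut s)))); last ring.
  rewrite cE mulr1 -[leRHS]mulr1 ler_wpM2l// mulr_ile1// ?exprn_ge0 ?exprn_ile1 ?(ltW q0)//.
have T (u v : R) : `|u| <= 3 -> `|v| <= 3 -> `|u + v| <= 6 /\ `|u - v| <= 6.
  by move=> *; split; [apply: le_trans (ler_normD _ _) _|apply: le_trans (ler_normB _ _) _]; lra.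
have [h1 _] := T _ _ (FB _ r3) (GB _ a1).
have [_ h2] := T _ _ (FB _ i3) (GB _ b1).
have [h3 _] := T _ _ (FB _ i3) (GB _ b1).
have [_ h4] := T _ _ (GB _ a1) (FB _ r3).
by split.
Qed.

End entropies.

(** * Coercivity of the determinant on the circle and the origin *)

Section coercivity.
Context {R : realType}.
Local Notation plane := (R * R)%type.
Implicit Types (a b s : R) (z w p : plane).

Definition nrmp z : R := nrm2 z.1 z.2.
Definition det2 z w : R :=
  (Phi1 z.1 z.2 - Phi1 w.1 w.2) * (Psi2 z.1 z.2 - Psi2 w.1 w.2) -
  (Phi2 z.1 z.2 - Phi2 w.1 w.2) * (Psi1 z.1 z.2 - Psi1 w.1 w.2).
Definition ideal z : Prop := nrmp z = 0 \/ nrmp z = 1.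

Lemma nrmp_eq0 z : nrmp z = 0 -> z.1 = 0 /\ z.2 = 0.
Proof.
rewrite /nrmp /nrm2 => h; have a2 := sqr_ge0 z.1; have b2 := sqr_ge0 z.2.
have /eqP : z.1 ^+ 2 = 0 by lra.
have /eqP : z.2 ^+ 2 = 0 by lra.
by rewrite !sqrf_eq0 => /eqP -> /eqP ->.
Qed.

Lemma ent_circle a b : nrm2 a b = 1 ->
  [/\ Phi1 a b = (re3 a b - 3 * a) / 16, Phi2 a b = (im3 a b + 3 * b) / 16,
      Psi1 a b = (im3 a b - 3 * b) / 16 & Psi2 a b = - (re3 a b + 3 * a) / 16].
Proof.
move=> n1; rewrite /Phi1 /Phi2 /Psi1 /Psi2 n1 /entF /entG.
have -> : cut (1 : R) = 1 / 2 by rewrite /cut div1r.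
by split; rewrite !expr1n; lra.
Qed.

Lemma ent_zero a b : nrm2 a b = 0 ->
  [/\ Phi1 a b = 0, Phi2 a b = 0, Psi1 a b = 0 & Psi2 a b = 0].
Proof.
move=> n1; rewrite /Phi1 /Phi2 /Psi1 /Psi2 n1 /entF /entG; split; ring.
Qed.

Lemma cube_circle a b : nrm2 a b = 1 -> re3 a b ^+ 2 + im3 a b ^+ 2 = 1.
Proof.
move=> n1; transitivity (nrm2 a b ^+ 3); last by rewrite n1 expr1n.
by rewrite /re3 /im3 /nrm2; ring.
Qed.

(* On the unit circle the determinant is (9 |z - w|^2 - |z^3 - w^3|^2) / 256,
   which with c = z . w equals (1 - c)^2 (2 + c) / 32. *)
Lemma det2_coercive z w : ideal z -> ideal w ->
  nrmp (z - w) ^+ 2 <= 128 * det2 z w.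
Proof.
case: z w => [a b] [c d]; rewrite /ideal /nrmp /det2 /= => -[h0|h1] [k0|k1].
- have [-> -> -> ->] := ent_zero h0; have [-> -> -> ->] := ent_zero k0.
  have [/= -> ->] := @nrmp_eq0 (a, b) h0; have [/= -> ->] := @nrmp_eq0 (c, d) k0.
  by rewrite /nrm2 !subr0 !mulr0 expr0n/= addr0 expr0n/= subr0 mulr0.
- have [-> -> -> ->] := ent_zero h0; have [-> -> -> ->] := ent_circle k1.
  have [/= -> ->] := @nrmp_eq0 (a, b) h0.
  have -> : nrm2 (0 - c) (0 - d) = 1 by rewrite -k1 /nrm2 !sub0r !sqrrN.
  have C := cube_circle k1; rewrite /nrm2 in k1.
  (* With one point at the origin the determinant is [(9 - 1) / 256], so the right side is 4 against
     1. *)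
  rewrite !sub0r expr1n (_ : _ * (_ - _) = 128 / 256 * (9 * (c ^+ 2 + d ^+ 2) - (re3 c d ^+ 2 + im3 c d ^+ 2))); last by field.
  by rewrite C k1; lra.
- have [-> -> -> ->] := ent_circle h1; have [-> -> -> ->] := ent_zero k0.
  have [/= -> ->] := @nrmp_eq0 (c, d) k0.
  have -> : nrm2 (a - 0) (b - 0) = 1 by rewrite -h1 !subr0.
  have C := cube_circle h1; rewrite /nrm2 in h1.
  rewrite !subr0 expr1n (_ : _ * (_ - _) = 128 / 256 * (9 * (a ^+ 2 + b ^+ 2) - (re3 a b ^+ 2 + im3 a b ^+ 2))); last by field.
  by rewrite C h1; lra.
- have [-> -> -> ->] := ent_circle h1; have [-> -> -> ->] := ent_circle k1.
  have C1 := cube_circle h1; have C2 := cube_circle k1.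
  pose e := a * c + b * d; pose f := a * d - b * c.
  have ef : e ^+ 2 + f ^+ 2 = 1.
    transitivity (nrm2 a b * nrm2 c d); last by rewrite h1 k1 mulr1.
    by rewrite /e /f /nrm2; ring.
  (* Triple-angle formula: [e] and [f] are the cosine and the sine of the angle between the two
     points. *)
  have cross : re3 a b * re3 c d + im3 a b * im3 c d = 4 * e ^+ 3 - 3 * e.
    transitivity (e ^+ 3 - 3 * e * f ^+ 2); first by rewrite /re3 /im3 /e /f; ring.
    have -> : f ^+ 2 = 1 - e ^+ 2 by lra.
    ring.
  have N : nrm2 (a - c) (b - d) = 2 - 2 * e.
    transitivity (nrm2 a b + nrm2 c d - 2 * e); last by rewrite h1 k1; ring.
    by rewrite /e /nrm2; ring.
  have D : 128 * (((re3 a b - 3 * a) / 16 - (re3 c d - 3 * c) / 16) *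
      (- (re3 a b + 3 * a) / 16 - - (re3 c d + 3 * c) / 16) -
      ((im3 a b + 3 * b) / 16 - (im3 c d + 3 * d) / 16) *
      ((im3 a b - 3 * b) / 16 - (im3 c d - 3 * d) / 16)) = 4 * (1 - e) ^+ 2 * (2 + e).
    transitivity (128 / 256 * (9 * nrm2 (a - c) (b - d) - ((re3 a b ^+ 2 + im3 a b ^+ 2) +
      (re3 c d ^+ 2 + im3 c d ^+ 2) - 2 * (re3 a b * re3 c d + im3 a b * im3 c d)))).
      by rewrite /nrm2; field.
    by rewrite C1 C2 cross N; field.
  rewrite D N (_ : (2 - 2 * e) ^+ 2 = 4 * (1 - e) ^+ 2); last by ring.
  (* What is left is [1 <= 2 + e], that is, a cosine is at least -1. *)
  rewrite ler_peMr//; first by rewrite mulr_ge0// sqr_ge0.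
  have e1 : -1 <= e by have := sqr_ge0 f; nra.
  lra.
Qed.

Definition euclid z : R := Num.sqrt (nrmp z).
(* The squared distance from z to the union of the unit circle and the origin. *)
Definition dsq z : R := Num.min (nrmp z) ((euclid z - 1) ^+ 2).

Lemma nrmp_ge0 z : 0 <= nrmp z. Proof. exact: nrm2_ge0. Qed.

Lemma euclid_sq z : euclid z ^+ 2 = nrmp z.
Proof. by rewrite sqr_sqrtr// nrmp_ge0. Qed.

Lemma euclid_ge0 z : 0 <= euclid z. Proof. exact: sqrtr_ge0. Qed.

Lemma dsq_ge0 z : 0 <= dsq z.
Proof. by rewrite le_min nrmp_ge0 sqr_ge0. Qed.

(** The nearest point is the origin or the radial projection [z / |z|]; the latter is used only when
    [z] is closer to the circle, hence nonzero. *)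
Lemma nearest_ideal z : exists2 p, ideal p & nrmp (z - p) = dsq z.
Proof.
rewrite /dsq; have [h|h] := leP (nrmp z) ((euclid z - 1) ^+ 2).
  exists 0; last by rewrite subr0.
  by left; rewrite /nrmp /nrm2 /= !expr0n addr0.
have z0 : 0 < euclid z.
  rewrite lt_neqAle euclid_ge0 andbT; apply/negP => /eqP e0.
  move: h; rewrite -e0 -euclid_sq -e0 expr0n sub0r sqrrN expr1n /=.
  by rewrite ltNge ler01.
have zn := euclid_sq z; rewrite /nrmp /nrm2 in zn.
exists (z.1 / euclid z, z.2 / euclid z).
  right; rewrite /nrmp /nrm2 /= !exprMn -mulrDl -zn -exprMn divff ?expr1n//.
  by rewrite gt_eqF.
transitivity ((z.1 ^+ 2 + z.2 ^+ 2) * (1 - (euclid z)^-1) ^+ 2).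
  by rewrite /nrmp /nrm2 /=; ring.
by rewrite -zn; field; rewrite gt_eqF.
Qed.

Lemma dsq_le z p : ideal p -> dsq z <= nrmp (z - p).
Proof.
case=> hp; rewrite /dsq ge_min; apply/orP.
  by left; have [p1 p2] := nrmp_eq0 hp; rewrite /nrmp /= p1 p2 !subr0.
right; rewrite sqrrB1 euclid_sq.
have cs : z.1 * p.1 + z.2 * p.2 <= euclid z.
  apply: le_trans (ler_norm _) _; rewrite -(@ler_pXn2r _ 2)// ?nnegrE ?euclid_ge0//.
  rewrite real_normK ?num_real// euclid_sq -[leRHS]mulr1 -hp /nrmp /nrm2.
  by have := sqr_ge0 (z.1 * p.2 - z.2 * p.1); rewrite sqrrB; lra.
move: hp; rewrite /nrmp /nrm2 /= => hp.
rewrite (_ : (z.1 - p.1) ^+ 2 + _ = z.1 ^+ 2 + z.2 ^+ 2 - 2 * (z.1 * p.1 + z.2 * p.2) + (p.1 ^+ 2 + p.2 ^+ 2)); last by ring.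
rewrite hp; lra.
Qed.

Lemma nrmpD z w : nrmp (z + w) <= 2 * nrmp z + 2 * nrmp w.
Proof.
rewrite /nrmp /nrm2 /=; have := sqr_ge0 (z.1 - w.1); have := sqr_ge0 (z.2 - w.2).
by rewrite !sqrrB !sqrrD; lra.
Qed.

Lemma dsq_approx z w : dsq z <= 2 * dsq w + 2 * nrmp (z - w).
Proof.
have [p hp <-] := nearest_ideal w.
apply: le_trans (dsq_le z hp) _.
rewrite (_ : z - p = (w - p) + (z - w)); first exact: nrmpD.
by rewrite [RHS]addrC addrA subrK.
Qed.

(** At [s = t ^+ 2] this is the quantity that the growth condition on the potential controls. *)
Definition mdist s : R := Num.min s `|1 - s|.

Lemma dsq_le_mdist z : dsq z <= mdist (nrmp z).
Proof.
rewrite /mdist le_min; apply/andP; split; first by rewrite ge_min lexx.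
rewrite /dsq ge_min; apply/orP; right.
rewrite -euclid_sq (_ : 1 - _ = (1 - euclid z) * (1 + euclid z)); last by ring.
have e0 := euclid_ge0 z.
rewrite normrM -real_normK ?num_real// expr2 distrC ler_wpM2l//.
by rewrite ger0_norm ?addr_ge0// ler_norml; apply/andP; split; lra.
Qed.

Lemma om_le_mdist s : 0 <= s -> om s <= mdist s.
Proof.
move=> s0; have /andP[q0 q1] := cut_bnd s0; have E := cutE s0.
have sc1 : s * cut s <= 1 by move: E; rewrite mulrDl mul1r; lra.
have sc0 : 0 <= s * cut s by rewrite mulr_ge0// ltW.
have nc : `|1 - s| * cut s <= 1.
  have : `|1 - s| <= 1 + s by rewrite ler_norml; apply/andP; split; lra.
  by move=> h; apply: le_trans (ler_wpM2r (ltW q0) h) _; rewrite E.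
rewrite le_min; apply/andP; split.
  rewrite /om (_ : _ * _ * _ = s * (`|1 - s| * cut s * cut s)); last by ring.
  by rewrite ler_piMr// mulr_ile1 ?mulr_ge0// ltW.
rewrite /om (_ : _ * _ * _ = `|1 - s| * (s * cut s * cut s)); last by ring.
by rewrite ler_piMr// mulr_ile1// ltW.
Qed.

Lemma om_le1 s : 0 <= s -> om s <= 1.
Proof.
move=> s0; have /andP[q0 q1] := cut_bnd s0; have E := cutE s0.
have sc1 : s * cut s <= 1 by move: E; rewrite mulrDl mul1r; lra.
have sc0 : 0 <= s * cut s by rewrite mulr_ge0// ltW.
have nc : `|1 - s| * cut s <= 1.
  have : `|1 - s| <= 1 + s by rewrite ler_norml; apply/andP; split; lra.
  by move=> h; apply: le_trans (ler_wpM2r (ltW q0) h) _; rewrite E.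
rewrite /om (_ : _ * _ * _ = (s * cut s) * (`|1 - s| * cut s)); last by ring.
by rewrite mulr_ile1// mulr_ge0// ltW.
Qed.

End coercivity.

(** * Lipschitz bounds and the increment inequality *)

Section lipschitz.
Context {R : realType}.
Local Notation plane := (R * R)%type.
Implicit Types (a b s : R) (z w p q : plane).

Definition nrm1 z : R := `|z.1| + `|z.2|.

Lemma nrm1_ge0 z : 0 <= nrm1 z. Proof. by rewrite addr_ge0. Qed.

Lemma nrm1_sq z : nrm1 z ^+ 2 <= 2 * nrmp z.
Proof.
rewrite /nrmp /nrm2 /nrm1 -(real_normK (num_real z.1)) -(real_normK (num_real z.2)).
by have := sqr_ge0 (`|z.1| - `|z.2|); rewrite sqrrB sqrrD; lra.
Qed.

(** The hypothesis is a chain rule along arbitrary curves, the form that the Jacobian lemmas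
    deliver; it is applied to the segment from [w] to [z]. *)
Lemma lipschitz_of_derive (P : R -> R -> R) (K : R) :
  (forall (f g : R -> R) (t df dg : R), is_derive t 1 f df -> is_derive t 1 g dg ->
    exists A B, [/\ `|A| <= K, `|B| <= K &
      is_derive t 1 (fun s => P (f s) (g s)) (A * df + B * dg)]) ->
  forall z w, `|P z.1 z.2 - P w.1 w.2| <= K * nrm1 (z - w).
Proof.
move=> hP z w.
pose l (x y s : R) := y + s * (x - y).
have dl x y (t : R) : is_derive t 1 (l x y) (x - y).
  rewrite /l; apply: (is_derive_eq (is_deriveD (is_derive_cst y t 1)
    (is_deriveM (is_derive_id t 1) (is_derive_cst (x - y) t 1)))).
  by rewrite scaler0 add0r add0r /GRing.scale/= mulr1.
have h (t : R) := hP _ _ t _ _ (dl z.1 w.1 t) (dl z.2 w.2 t).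
have [AB hAB] := choice h.
have {}hAB (t : R) : exists B, [/\ `|AB t| <= K, `|B| <= K &
  is_derive t 1 (fun s => P (l z.1 w.1 s) (l z.2 w.2 s)) (AB t * (z.1 - w.1) + B * (z.2 - w.2))].
  exact: hAB.
have [BB hB] := choice hAB.
have dP (t : R) : is_derive t 1 (fun s => P (l z.1 w.1 s) (l z.2 w.2 s))
  (AB t * (z.1 - w.1) + BB t * (z.2 - w.2)) by have [] := hB t.
have [c _] := mean_value1 0 1 dP.
rewrite /l !mul1r !mul0r !addr0 subr0 mulr1 !(addrC w.1) !(addrC w.2) !subrK => ->.
have [hA hB' _] := hB c.
apply: le_trans (ler_normD _ _) _; rewrite !normrM /nrm1 mulrDr.
by apply: lerD; apply: ler_wpM2r.
Qed.

Let omc a b : 0 <= om (nrm2 a b) <= 1.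
Proof. by rewrite om_ge0 ?om_le1// nrm2_ge0. Qed.

Let duo (x y K : R) : `|x| <= 6 * K -> `|y| <= 6 * K -> `|x + y| <= 12 * K.
Proof. by move=> hx hy; apply: le_trans (ler_normD _ _) _; lra. Qed.


Section jacobians.
Context {V : normedModType R}.
Variables (x v : V) (f g : V -> R) (df dg : R).
Hypotheses (hf : is_derive x v f df) (hg : is_derive x v g dg).
Let o := om (nrm2 (f x) (g x)).

Let wb c : `|c| <= 6 * (nrm2 (f x) (g x) * (1 + nrm2 (f x) (g x)) ^+ 2) ->
  `|wgt (nrm2 (f x) (g x)) * c| <= 6 * o.
Proof. by apply: wgt_bound => //; exact: nrm2_ge0. Qed.

Let wb2 c d : `|c| <= 6 * (nrm2 (f x) (g x) * (1 + nrm2 (f x) (g x)) ^+ 2) ->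
  `|d| <= 6 * (nrm2 (f x) (g x) * (1 + nrm2 (f x) (g x)) ^+ 2) ->
  `|wgt (nrm2 (f x) (g x)) * (c + d)| <= 12 * o /\
  `|wgt (nrm2 (f x) (g x)) * (c - d)| <= 12 * o.
Proof.
move=> hc hd; split; first by rewrite mulrDr; apply: duo; exact: wb.
by rewrite mulrBr; apply: duo; [|rewrite normrN]; exact: wb.
Qed.

(** Only the scalar part and the size of the remainder are retained from the explicit Jacobian; 12
    adds up two polynomials bounded with constant 6 each. *)
Lemma jacobian_Phi1 : exists A B, [/\ `|A| <= 12 * o, `|B| <= 12 * o &
  is_derive x v (fun y => Phi1 (f y) (g y)) ((gam1 (f x) (g x) + A) * df + B * dg)].
Proof.
have [[b1 b2 b3 b4] [b5 b6 b7]] := poly_bounds (f x) (g x).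
do 2 eexists; split; last exact: is_derive_Phi1 hf hg.
  exact: (wb2 _ _).1.
by apply: (wb2 _ _).1 => //; rewrite normrN mulrC.
Qed.

Lemma jacobian_Phi2 : exists A B, [/\ `|A| <= 12 * o, `|B| <= 12 * o &
  is_derive x v (fun y => Phi2 (f y) (g y)) (A * df + (gam1 (f x) (g x) + B) * dg)].
Proof.
have [[b1 b2 b3 b4] [b5 b6 b7]] := poly_bounds (f x) (g x).
do 2 eexists; split; last exact: is_derive_Phi2 hf hg.
  by apply: (wb2 _ _).1 => //; rewrite mulrC.
exact: (wb2 _ _).2.
Qed.

Lemma jacobian_Psi1 : exists A B, [/\ `|A| <= 12 * o, `|B| <= 12 * o &
  is_derive x v (fun y => Psi1 (f y) (g y)) ((gam2 (f x) (g x) + A) * df + B * dg)].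
Proof.
have [[b1 b2 b3 b4] [b5 b6 b7]] := poly_bounds (f x) (g x).
do 2 eexists; split; last exact: is_derive_Psi1 hf hg.
  exact: (wb2 _ _).1.
exact: (wb2 _ _).2.
Qed.

Lemma jacobian_Psi2 : exists A B, [/\ `|A| <= 12 * o, `|B| <= 12 * o &
  is_derive x v (fun y => Psi2 (f y) (g y)) (A * df + (gam2 (f x) (g x) + B) * dg)].
Proof.
have [[b1 b2 b3 b4] [b5 b6 b7]] := poly_bounds (f x) (g x).
do 2 eexists; split; last exact: is_derive_Psi2 hf hg.
  by apply: (wb2 _ _).2 => //; rewrite normrN.
exact: (wb2 _ _).2.
Qed.

Lemma jacobian_ramp : exists A B, [/\ `|A| <= 64 * o, `|B| <= 64 * o &
  is_derive x v (fun y => ramp (f y) (g y)) (A * df + B * dg)].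
Proof.
have s0 := nrm2_ge0 (f x) (g x).
have sE : nrm2 (f x) (g x) = f x ^+ 2 + g x ^+ 2 by [].
have S c : c ^+ 2 <= nrm2 (f x) (g x) -> `|64 * nrm2 (f x) (g x) * c| <=
    64 * (nrm2 (f x) (g x) * (1 + nrm2 (f x) (g x)) ^+ 2).
  move: (nrm2 _ _) s0 => s s0 hc.
  rewrite normrM ger0_norm; last by apply: mulr_ge0.
  rewrite -mulrA; apply: ler_wpM2l => //; apply: ler_wpM2l => //.
  have : (1 + s) ^+ 2 = 1 + 2 * s + s ^+ 2 by ring.
  have := sqr_ge0 s.
  rewrite ler_norml; have := sqr_ge0 (c - 1); have := sqr_ge0 (c + 1).
  by rewrite sqrrB1 sqrrD1 => *; apply/andP; split; lra.
do 2 eexists; split; last exact: is_derive_ramp hf hg.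
  by apply: wgt_bound => //; apply: S; rewrite sE lerDl sqr_ge0.
by apply: wgt_bound => //; apply: S; rewrite sE lerDr sqr_ge0.
Qed.

Lemma jacobian_kap : exists A B, [/\ `|A| <= 6, `|B| <= 6 &
  is_derive x v (fun y => kap (f y) (g y)) (A * df + B * dg)].
Proof.
have s0 := nrm2_ge0 (f x) (g x).
have sE : nrm2 (f x) (g x) = f x ^+ 2 + g x ^+ 2 by [].
have S c : c ^+ 2 <= nrm2 (f x) (g x) ->
    `|(1 - 3 * nrm2 (f x) (g x)) * cut (nrm2 (f x) (g x)) ^+ 3 * (2 * c)| <= 6.
  move: (nrm2 _ _) s0 => s s0 hc.
  have /andP[q0 q1] := cut_bnd s0; have E := cutE s0.
  rewrite normrM normrM (normrM 2) (ger0_norm (exprn_ge0 _ (ltW q0))) (@ger0_norm _ 2)//.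
  have h1 : `|1 - 3 * s| <= 3 * (1 + s) by rewrite ler_norml; apply/andP; split; lra.
  have h2 : `|c| <= 1 + s.
    rewrite ler_norml; have := sqr_ge0 (c - 1); have := sqr_ge0 (c + 1).
    by rewrite sqrrB1 sqrrD1 => *; apply/andP; split; lra.
  apply: (@le_trans _ _ (3 * (1 + s) * cut s ^+ 3 * (2 * (1 + s)))).
    apply: ler_pM; [by apply: mulr_ge0 => //; apply: exprn_ge0; exact: ltW|by apply: mulr_ge0| |].
      by apply: ler_wpM2r => //; apply: exprn_ge0; exact: ltW.
    exact: ler_wpM2l.
  rewrite [leLHS](_ : _ = 6 * (((1 + s) * cut s) ^+ 2 * cut s)); last by ring.
  by rewrite E expr1n mul1r; lra.
do 2 eexists; split; last exact: is_derive_kap hf hg.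
  by apply: S; rewrite sE lerDl sqr_ge0.
by apply: S; rewrite sE lerDr sqr_ge0.
Qed.

End jacobians.

Lemma lip_ent z w : [/\ `|Phi1 z.1 z.2 - Phi1 w.1 w.2| <= 18 * nrm1 (z - w),
  `|Phi2 z.1 z.2 - Phi2 w.1 w.2| <= 18 * nrm1 (z - w),
  `|Psi1 z.1 z.2 - Psi1 w.1 w.2| <= 18 * nrm1 (z - w) &
  `|Psi2 z.1 z.2 - Psi2 w.1 w.2| <= 18 * nrm1 (z - w)].
Proof.
have L (f g : R -> R) (t : R) : om (nrm2 (f t) (g t)) <= 1 by have /andP[] := omc (f t) (g t).
have G (g A K : R) : `|g| <= 6 -> `|A| <= 12 * K -> K <= 1 -> `|g + A| <= 18.
  by move=> *; apply: le_trans (ler_normD _ _) _; lra.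
have B (A K : R) : `|A| <= 12 * K -> K <= 1 -> `|A| <= 18 by move=> *; lra.
split; apply: lipschitz_of_derive => f g t df dg hf hg; have [g1 g2] := gam_bound (f t) (g t).
- have [A [A' [a a' d]]] := jacobian_Phi1 hf hg.
  exists (gam1 (f t) (g t) + A), A'; split => //; [exact: G a _|exact: B a' _].
- have [A [A' [a a' d]]] := jacobian_Phi2 hf hg.
  exists A, (gam1 (f t) (g t) + A'); split => //; [exact: B a _|exact: G a' _].
- have [A [A' [a a' d]]] := jacobian_Psi1 hf hg.
  exists (gam2 (f t) (g t) + A), A'; split => //; [exact: G a _|exact: B a' _].
- have [A [A' [a a' d]]] := jacobian_Psi2 hf hg.
  exists A, (gam2 (f t) (g t) + A'); split => //; [exact: B a _|exact: G a' _].
Qed.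

Lemma lip_ramp z w : `|ramp z.1 z.2 - ramp w.1 w.2| <= 64 * nrm1 (z - w).
Proof.
apply: lipschitz_of_derive => f g t df dg hf hg.
have /andP[_ o1] := omc (f t) (g t).
have [A [A' [a a' d]]] := jacobian_ramp hf hg.
by exists A, A'; split => //; lra.
Qed.

Lemma lip_kap z w : `|kap z.1 z.2 - kap w.1 w.2| <= 6 * nrm1 (z - w).
Proof. by apply: lipschitz_of_derive => f g t df dg hf hg; exact: jacobian_kap. Qed.


(** The entropies are bounded by 6 and Lipschitz with constant [18 = 6 + 12], so each of the two
    products moves by at most [2 * 12 * 18] times the total displacement. *)
Lemma det2_stable z w p q : `|det2 p q - det2 z w| <= 864 * (nrm1 (z - p) + nrm1 (w - q)).
Proof.
set N := nrm1 (z - p) + nrm1 (w - q).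
have M (a b a' b' : R) : `|a| <= 12 -> `|b'| <= 12 -> `|a - a'| <= 18 * N ->
    `|b - b'| <= 18 * N -> `|a * b - a' * b'| <= 432 * N.
  move=> ha hb haa hbb.
  rewrite (_ : _ - _ = a * (b - b') + (a - a') * b'); last by ring.
  apply: le_trans (ler_normD _ _) _; rewrite !normrM.
  have := ler_pM (normr_ge0 _) (normr_ge0 _) ha hbb.
  have := ler_pM (normr_ge0 _) (normr_ge0 _) haa hb.
  lra.
have B (P : R -> R -> R) z' w' : (forall a b, `|P a b| <= 6) ->
    `|P z'.1 z'.2 - P w'.1 w'.2| <= 12.
  move=> hP; apply: le_trans (ler_normB _ _) _.
  by have := hP z'.1 z'.2; have := hP w'.1 w'.2; lra.
have D (P : R -> R -> R) : (forall z w, `|P z.1 z.2 - P w.1 w.2| <= 18 * nrm1 (z - w)) ->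
    `|(P p.1 p.2 - P q.1 q.2) - (P z.1 z.2 - P w.1 w.2)| <= 18 * N.
  move=> hP; rewrite (_ : _ - _ - _ = (P w.1 w.2 - P q.1 q.2) - (P z.1 z.2 - P p.1 p.2)); last by ring.
  apply: le_trans (ler_normB _ _) _; rewrite /N mulrDr addrC.
  by apply: lerD; exact: hP.
rewrite /det2 (_ : forall a b c d : R, a - b - (c - d) = (a - c) - (b - d)); last by move=> *; ring.
apply: le_trans (ler_normB _ _) _.
rewrite (_ : 864 * N = 432 * N + 432 * N); last by ring.
apply: lerD; apply: M.
- by apply: (B Phi1) => a b; have [] := ent_bound a b.
- by apply: (B Psi2) => a b; have [] := ent_bound a b.
- by apply: (D Phi1) => a b; have [] := lip_ent a b.
- by apply: (D Psi2) => a b; have [] := lip_ent a b.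
- by apply: (B Phi2) => a b; have [] := ent_bound a b.
- by apply: (B Psi1) => a b; have [] := ent_bound a b.
- by apply: (D Phi2) => a b; have [] := lip_ent a b.
- by apply: (D Psi1) => a b; have [] := lip_ent a b.
Qed.

Lemma nrmpN z : nrmp (- z) = nrmp z.
Proof. by rewrite /nrmp /nrm2 /= !sqrrN. Qed.

Lemma nrmp3 (x y z : plane) : nrmp (x + y + z) <= 3 * (nrmp x + nrmp y + nrmp z).
Proof.
rewrite /nrmp /nrm2 /=.
have T (a b c : R) : (a + b + c) ^+ 2 <= 3 * (a ^+ 2 + b ^+ 2 + c ^+ 2).
  rewrite -subr_ge0 (_ : _ - _ = (a - b) ^+ 2 + (b - c) ^+ 2 + (a - c) ^+ 2); last by ring.
  by rewrite !addr_ge0// sqr_ge0.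
by have := T x.1 y.1 z.1; have := T x.2 y.2 z.2; lra.
Qed.

(** The points are replaced by nearest ideal ones, where the determinant controls a fourth power.
    Young's inequality with a free [eta] lowers it to a square; the displacement, by then divided by
    [eta], is raised to its square by a second use, whence [eta ^+ 3]. *)
Lemma increment_bound : exists K L : R, [/\ 0 < K, 0 < L & forall z w eta, 0 < eta <= 1 ->
  nrmp (z - w) <= K * (eta + (dsq z + dsq w) / eta ^+ 3) + L / eta * det2 z w].
Proof.
exists (5 * 3 * 128 * 864), 384; split; [by lra|by lra|].
move=> z w eta /andP[e0 e1].
have [p hp pz] := nearest_ideal z; have [q hq qw] := nearest_ideal w.
have S : nrmp (z - w) <= 3 * (dsq z + nrmp (p - q) + dsq w).
  rewrite -pz -qw (_ : z - w = (z - p) + (p - q) + (- (w - q))).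
    by rewrite -(nrmpN (w - q)); exact: nrmp3.
  by rewrite opprB !addrA !subrK.
have {}S : nrmp (z - w) <= 3 * ((dsq z + dsq w) + nrmp (p - q)) by lra.
have C := det2_coercive hp hq.
set N := nrm1 (z - p) + nrm1 (w - q).
have dd : det2 p q <= det2 z w + 864 * N.
  by have := det2_stable z w p q; rewrite ler_norml => /andP[_]; rewrite -/N; lra.
have N2 : N ^+ 2 <= 4 * (dsq z + dsq w).
  have := nrm1_sq (z - p); have := nrm1_sq (w - q); rewrite pz qw /N.
  move: (nrm1 _) (nrm1 _) => x y hx hy.
  have : (y + x) ^+ 2 = 2 * y ^+ 2 + 2 * x ^+ 2 - (y - x) ^+ 2 by ring.
  by have := sqr_ge0 (y - x); rewrite !(addrC x); lra.
have dz := dsq_ge0 z; have dw := dsq_ge0 w.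
have N0 : 0 <= N by rewrite addr_ge0 ?nrm1_ge0.
clearbody N.
have V0 : 0 < eta^-1 by rewrite invr_gt0.
have V1 : 1 <= eta^-1 by rewrite -invr1 lef_pV2// posrE.
have Ee : eta * eta^-1 = 1 by rewrite mulfV// gt_eqF.
rewrite -exprVn; move: (eta^-1) V0 V1 Ee => i i0 i1 ei.
(* [t <= eta + t^2 / eta] for [t = |p - q|^2], whose square the determinant controls. *)
have P : nrmp (p - q) <= eta + 128 * i * (det2 z w + 864 * N).
  apply: (@le_trans _ _ (eta + i * nrmp (p - q) ^+ 2)).
    move: (nrmp (p - q)) (nrmp_ge0 (p - q)) => t t0.
    have := mulr_ge0 (ltW i0) (sqr_ge0 (eta - t)).
    rewrite (_ : i * (eta - t) ^+ 2 = (eta * i) * eta - 2 * (eta * i) * t + i * t ^+ 2); last by ring.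
    by rewrite ei; lra.
  rewrite lerD2l (_ : 128 * i * _ = i * (128 * (det2 z w + 864 * N))); last by ring.
  apply: ler_wpM2l; first exact: ltW.
  by apply: le_trans C _; apply: ler_wpM2l.
(* [N / eta <= eta + N^2 / eta^3]: it is [N^2], not [N], that compares with the squared distances
   [dsq]. *)
have Q : i * N <= eta + i ^+ 3 * (4 * (dsq z + dsq w)).
  apply: (@le_trans _ _ (eta + i ^+ 3 * N ^+ 2)); last first.
    by rewrite lerD2l; apply: ler_wpM2l => //; apply: exprn_ge0; exact: ltW.
  have := mulr_ge0 (ltW i0) (sqr_ge0 (eta - i * N)).
  rewrite (_ : i * (eta - i * N) ^+ 2 = (eta * i) * eta - 2 * (eta * i) * (i * N) + i ^+ 3 * N ^+ 2); last by ring.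
  have : 0 <= i * N by apply: mulr_ge0; first exact: ltW.
  by rewrite ei; lra.
have e_0 := ltW e0.
have i3 : 1 <= i ^+ 3 by apply: exprn_ege1.
have X : dsq z + dsq w <= (dsq z + dsq w) * i ^+ 3 by rewrite ler_peMr// addr_ge0.
rewrite (_ : 384 * i * det2 z w = 3 * (128 * i * det2 z w)); last by ring.
move: P; rewrite mulrDr (_ : 128 * i * (864 * N) = 128 * 864 * (i * N)); last by ring.
rewrite [i ^+ 3 * _]mulrC -mulrA in Q.
move: Q X; rewrite mulrDr.
have := addr_ge0 dz dw; move: (i * N) (dsq z + dsq w) S => iN dzw S dzw0.
by move: (dzw * i ^+ 3) (128 * i * det2 z w) => y1 y2; lra.
Qed.

End lipschitz.

(** * Divergences of the entropies of a smooth field *)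

Section entropy_fields.
Context {R : realType}.
Local Notation plane := (R * R)%type.
Implicit Types (x y z : plane) (e : R).

Lemma kap_om (a b : R) : `|kap a b| = om (nrm2 a b).
Proof.
have /andP[q0 q1] := cut_bnd (nrm2_ge0 a b).
by rewrite /kap /om !normrM (ger0_norm (nrm2_ge0 a b)) (gtr0_norm q0).
Qed.

Variables v1 v2 : plane -> R.
Hypotheses (hv1 : C1b v1) (hv2 : C1b v2).
Let N z := nrm2 (v1 z) (v2 z).

Lemma C1b_nrm2 : C1b N.
Proof. by apply: C1bD; exact: C1bX. Qed.

Lemma C1b_cut : C1b (fun z => cut (N z)).
Proof.
apply: C1bV => [|z]; first exact: C1bD (C1b_cst 1) C1b_nrm2.
by rewrite lerDl nrm2_ge0.
Qed.

Lemma C1b_entF : C1b (fun z => entF (N z)).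
Proof. exact: C1bM (C1bX 2 C1b_nrm2) (C1bX 4 C1b_cut). Qed.

Lemma C1b_entG : C1b (fun z => entG (N z)).
Proof. exact: C1bM (C1bZ _ C1b_nrm2) (C1bX 4 C1b_cut). Qed.

Lemma C1b_re3 : C1b (fun z => re3 (v1 z) (v2 z)).
Proof. exact: C1bB (C1bX 3 hv1) (C1bM (C1bZ 3 hv1) (C1bX 2 hv2)). Qed.

Lemma C1b_im3 : C1b (fun z => im3 (v1 z) (v2 z)).
Proof. exact: C1bB (C1bM (C1bZ 3 (C1bX 2 hv1)) hv2) (C1bX 3 hv2). Qed.

Lemma C1b_Phi1 : C1b (fun z => Phi1 (v1 z) (v2 z)).
Proof. exact: C1bD (C1bM C1b_entF C1b_re3) (C1bM C1b_entG hv1). Qed.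

Lemma C1b_Phi2 : C1b (fun z => Phi2 (v1 z) (v2 z)).
Proof. exact: C1bB (C1bM C1b_entF C1b_im3) (C1bM C1b_entG hv2). Qed.

Lemma C1b_Psi1 : C1b (fun z => Psi1 (v1 z) (v2 z)).
Proof. exact: C1bD (C1bM C1b_entF C1b_im3) (C1bM C1b_entG hv2). Qed.

Lemma C1b_Psi2 : C1b (fun z => Psi2 (v1 z) (v2 z)).
Proof. exact: C1bB (C1bM C1b_entG hv1) (C1bM C1b_entF C1b_re3). Qed.

Lemma C1b_ramp : C1b (fun z => ramp (v1 z) (v2 z)).
Proof. exact: C1bZ _ C1b_entF. Qed.

Definition gradsq z : R := 'D_e1 v1 z ^+ 2 + 'D_e2 v1 z ^+ 2 +
  'D_e1 v2 z ^+ 2 + 'D_e2 v2 z ^+ 2.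

Let young (o A d e K : R) : 0 < e -> 0 <= K -> `|A| <= K * o ->
  `|A * d| <= K * (o ^+ 2 / e + e * d ^+ 2).
Proof.
move=> e0 K0 hA; rewrite normrM.
apply: (@le_trans _ _ (K * (o * `|d|))); first by rewrite mulrA ler_wpM2r.
apply: ler_wpM2l => //; rewrite -(real_normK (num_real d)).
have Ee : e^-1 * e = 1 by rewrite mulVf// gt_eqF.
have i0 : 0 < e^-1 by rewrite invr_gt0.
have := mulr_ge0 (ltW i0) (sqr_ge0 (o - e * `|d|)).
rewrite (_ : e^-1 * _ = o ^+ 2 / e - 2 * (e^-1 * e) * (o * `|d|) + (e^-1 * e) * (e * `|d| ^+ 2)); last by ring.
rewrite Ee; have := mulr_ge0 (ltW i0) (sqr_ge0 o); rewrite [e^-1 * _]mulrC.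
have := mulr_ge0 (ltW e0) (sqr_ge0 `|d|).
lra.
Qed.

Let dval (f : plane -> R) z v d : is_derive z v f d -> 'D_v f z = d.
Proof. by case. Qed.

(** The scalar part enters as [g * (d1 + d4)], a bounded multiple of the divergence. Each of the
    four error terms is split by Young's inequality with weight [e], whence [48 = 4 * 12]. *)
Let assemble (g k A B A' B' d1 d2 d3 d4 e : R) : 0 < e -> `|g| <= 6 ->
  `|A| <= 12 * `|k| -> `|B| <= 12 * `|k| -> `|A'| <= 12 * `|k| -> `|B'| <= 12 * `|k| ->
  `|(g + A) * d1 + B * d3 + (A' * d2 + (g + B') * d4)| <=
  6 * (1 + (d1 + d4) ^+ 2) + 48 * (k ^+ 2 / e + e * (d1 ^+ 2 + d2 ^+ 2 + d3 ^+ 2 + d4 ^+ 2)).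
Proof.
move=> e0 hg hA hB hA' hB'.
have y1 := @young _ _ d1 _ 12 e0 (ler0n _ _) hA.
have y2 := @young _ _ d3 _ 12 e0 (ler0n _ _) hB.
have y3 := @young _ _ d2 _ 12 e0 (ler0n _ _) hA'.
have y4 := @young _ _ d4 _ 12 e0 (ler0n _ _) hB'.
have G : `|g * (d1 + d4)| <= 6 * (1 + (d1 + d4) ^+ 2).
  rewrite normrM; apply: ler_pM => //.
  rewrite ler_norml; have := sqr_ge0 (d1 + d4 - 1); have := sqr_ge0 (d1 + d4 + 1).
  by rewrite sqrrB1 sqrrD1 => *; apply/andP; split; lra.
rewrite (_ : _ + _ = g * (d1 + d4) + (A * d1 + B * d3 + (A' * d2 + B' * d4))); last by ring.
apply: le_trans (ler_normD _ _) _; apply: lerD => //.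
apply: le_trans (ler_normD _ _) _.
have := ler_normD (A * d1) (B * d3); have := ler_normD (A' * d2) (B' * d4).
rewrite real_normK ?num_real// in y1 y2 y3 y4.
move: y1 y2 y3 y4; rewrite !mulrDr.
have e1 := mulr_ge0 (ltW e0) (sqr_ge0 d1); have e2 := mulr_ge0 (ltW e0) (sqr_ge0 d2).
have e3 := mulr_ge0 (ltW e0) (sqr_ge0 d3); have e4 := mulr_ge0 (ltW e0) (sqr_ge0 d4).
move: e1 e2 e3 e4; move: (k ^+ 2 / e) (e * d1 ^+ 2) (e * d2 ^+ 2) (e * d3 ^+ 2) (e * d4 ^+ 2).
by move=> *; lra.
Qed.

Lemma divf_Phi_le z e : 0 < e ->
  `|divf (fun z => Phi1 (v1 z) (v2 z)) (fun z => Phi2 (v1 z) (v2 z)) z| <=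
  6 * (1 + divf v1 v2 z ^+ 2) + 48 * (kap (v1 z) (v2 z) ^+ 2 / e + e * gradsq z).
Proof.
move=> e0.
have [A [B]] := jacobian_Phi1 (C1b_is_derive1 z hv1) (C1b_is_derive1 z hv2).
have [A' [B']] := jacobian_Phi2 (C1b_is_derive2 z hv1) (C1b_is_derive2 z hv2).
rewrite -kap_om => -[a' b' /dval d'] [a b /dval d].
rewrite /divf d d'; apply: assemble => //.
by have [] := gam_bound (v1 z) (v2 z).
Qed.

Lemma divf_Psi_le z e : 0 < e ->
  `|divf (fun z => Psi1 (v1 z) (v2 z)) (fun z => Psi2 (v1 z) (v2 z)) z| <=
  6 * (1 + divf v1 v2 z ^+ 2) + 48 * (kap (v1 z) (v2 z) ^+ 2 / e + e * gradsq z).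
Proof.
move=> e0.
have [A [B]] := jacobian_Psi1 (C1b_is_derive1 z hv1) (C1b_is_derive1 z hv2).
have [A' [B']] := jacobian_Psi2 (C1b_is_derive2 z hv1) (C1b_is_derive2 z hv2).
rewrite -kap_om => -[a' b' /dval d'] [a b /dval d].
rewrite /divf d d'; apply: assemble => //.
by have [] := gam_bound (v1 z) (v2 z).
Qed.

Lemma grad_ramp_le z e : 0 < e ->
  `|'D_e1 (fun z => ramp (v1 z) (v2 z)) z| + `|'D_e2 (fun z => ramp (v1 z) (v2 z)) z| <=
  256 * (kap (v1 z) (v2 z) ^+ 2 / e + e * gradsq z).
Proof.
move=> e0.
have [A [B]] := jacobian_ramp (C1b_is_derive1 z hv1) (C1b_is_derive1 z hv2).
have [A' [B']] := jacobian_ramp (C1b_is_derive2 z hv1) (C1b_is_derive2 z hv2).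
rewrite -kap_om => -[a' b' /dval d'] [a b /dval d].
rewrite d d' /gradsq; clear d d'; move: (kap _ _) a b a' b' => k.
move: ('D_e1 v1 z) ('D_e1 v2 z) ('D_e2 v1 z) ('D_e2 v2 z) => d1 d3 d2 d4 hA hB hA' hB'.
have y1 := @young _ _ d1 _ 64 e0 (ler0n _ _) hA.
have y2 := @young _ _ d3 _ 64 e0 (ler0n _ _) hB.
have y3 := @young _ _ d2 _ 64 e0 (ler0n _ _) hA'.
have y4 := @young _ _ d4 _ 64 e0 (ler0n _ _) hB'.
apply: le_trans (lerD (ler_normD _ _) (ler_normD _ _)) _.
rewrite real_normK ?num_real// in y1 y2 y3 y4.
have e1 := mulr_ge0 (ltW e0) (sqr_ge0 d1); have e2 := mulr_ge0 (ltW e0) (sqr_ge0 d2).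
have e3 := mulr_ge0 (ltW e0) (sqr_ge0 d3); have e4 := mulr_ge0 (ltW e0) (sqr_ge0 d4).
rewrite !(mulrDr e).
move: e1 e2 e3 e4 y1 y2 y3 y4; move: (k ^+ 2 / e) (e * d1 ^+ 2) (e * d2 ^+ 2) (e * d3 ^+ 2) (e * d4 ^+ 2).
by move=> *; lra.
Qed.

End entropy_fields.

Section continuity.
Context {R : realType}.
Local Notation plane := (R * R)%type.
Local Notation mplane := (measurableTypeR R * measurableTypeR R)%type.
Implicit Types (x y z w : plane).

Lemma nrm1_norm z : nrm1 z <= 2 * `|z|.
Proof.
rewrite /nrm1 prod_normE /= (_ : 2 * _ = Num.max `|z.1| `|z.2| + Num.max `|z.1| `|z.2|); last by ring.
by apply: lerD; rewrite le_max lexx ?orbT.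
Qed.

Lemma lipschitz_continuous (P : plane -> R) K : 0 < K ->
  (forall z w, `|P z - P w| <= K * nrm1 (z - w)) -> continuous P.
Proof.
move=> K0 hP z; apply/cvgrPdist_le => e e0.
near=> w.
apply: le_trans (hP _ _) _.
rewrite -ler_pdivlMl//; apply: le_trans (nrm1_norm _) _.
rewrite -ler_pdivlMl//.
near: w; apply: cvgr_dist_le; first exact: cvg_id.
by rewrite !mulr_gt0// invr_gt0.
Unshelve. all: by end_near.
Qed.

(** A Lebesgue number: compactness is used as a covering property along the filter of radii tending
    to 0 from the right. *)
Lemma compact_square (K Omega : set plane) : compact K -> open Omega -> K `<=` Omega ->
  exists2 r : R, 0 < r & forall x, K x -> square x r `<=` Omega.
Proof.
move=> cK oO sub.
have /compact_near_coveringP/(_ _ (0 : R)^'+ (fun r x => square x r `<=` Omega)) H := cK.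
have : \forall r \near (0 : R)^'+, forall x, K x -> square x r `<=` Omega.
  apply: H => x Kx.
  have /nbhs_ballP [s /= s0 hs] : nbhs x Omega by exact: oO _ (sub _ Kx).
  have s2 : 0 < s / 2 by exact: divr_gt0.
  exists (ball x (s / 2), [set r | r < s / 2]); first split => /=.
  - exact: nbhsx_ballx.
  - exact: nbhs_right_lt.
  move=> [y r] /= [xy rs] z /square_norm yz; apply: hs.
  rewrite -ball_normE /= in xy *.
  rewrite (_ : x - z = (x - y) - (z - y)); last by rewrite opprB addrA subrK.
  by apply: le_lt_trans (ler_normB _ _) _; lra.
move=> H'; near (0 : R)^'+ => r; exists r => //.
by near: r.
Unshelve. all: by end_near.
Qed.

Lemma continuous_nrmp : continuous (@nrmp R).
Proof.
by apply: continuousDf; apply: continuousMf => z; (exact: cvg_fst || exact: cvg_snd).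
Qed.

Lemma continuous_euclid : continuous (@euclid R).
Proof.
by move=> z; apply: continuous_comp; [exact: continuous_nrmp|exact: sqrt_continuous].
Qed.

Lemma continuous_dsq : continuous (@dsq R).
Proof.
move=> z; apply: (@continuous_min _ _ (@nrmp R) (fun z => (euclid z - 1) ^+ 2)); first exact: continuous_nrmp.
have h : continuous (fun z : plane => euclid z - 1).
  by apply: continuousDf; [exact: continuous_euclid|move=> y; exact: cvg_cst].
by apply: (@continuousMf _ (fun z => euclid z - 1) (fun z => euclid z - 1)).
Qed.

Lemma continuous_mdist : continuous (fun z : plane => mdist (nrmp z)).
Proof.
move=> z; apply: (@continuous_min _ _ (@nrmp R) (fun z => `|1 - nrmp z|)); first exact: continuous_nrmp.
apply: continuous_comp; last exact: norm_continuous.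
apply: cvgB; [exact: cvg_cst|exact: continuous_nrmp].
Qed.

Lemma continuous_kap : continuous (fun z : plane => kap z.1 z.2).
Proof. by apply: (@lipschitz_continuous _ 6) => // z w; exact: lip_kap. Qed.

Lemma continuous_ramp : continuous (fun z : plane => ramp z.1 z.2).
Proof. by apply: (@lipschitz_continuous _ 64) => // z w; exact: lip_ramp. Qed.

Lemma measurable_comp2 (P : plane -> R) (f g : mplane -> R) : continuous P ->
  measurable_fun setT f -> measurable_fun setT g ->
  measurable_fun setT (fun x : mplane => P (f x, g x)).
Proof.
move=> cP mf mg; apply: (@measurableT_comp _ _ _ _ _ _ (P : mplane -> R) _ (fun x => (f x, g x))).
  exact: measurable_continuous.
exact: measurable_fun_pair.
Qed.

End continuity.

(** * Strong compactness *)

Section approximation.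
Context {R : realType}.
Local Notation plane := (R * R)%type.
Local Notation mplane := (measurableTypeR R * measurableTypeR R)%type.
Implicit Types (x y z : plane).

(** The squared error has to be of order [e], later [eps n], and not merely small, because
    [kap ^+ 2] of the mollified field is going to be divided by [eps n]. *)
Lemma exists_scale (u1 u2 : mplane -> R) (e : R) : 0 < e ->
  sqint leb2 u1 -> sqint leb2 u2 ->
  exists d, [/\ 0 < d <= 1, d <= e, \int[@leb2 R]_x ((moll d u1 x - u1 x) ^+ 2) <= e &
    \int[@leb2 R]_x ((moll d u2 x - u2 x) ^+ 2) <= e].
Proof.
move=> e0 s1 s2; pose rn n : R := n.+1%:R^-1.
have r01 n : 0 < rn n <= 1 by rewrite invr_gt0 ltr0n /= invf_le1 ?ltr0n// ler1n.
have rc : rn n @[n --> \oo] --> (0 : R) by exact: cvg_harmonic.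
have H f : sqint leb2 f -> \forall n \near \oo, \int[@leb2 R]_x ((moll (rn n) f x - f x) ^+ 2) <= e.
  by move=> sf; apply: cvg0_near_le => //; exact: moll_cvg.
have [n [h0 h1 h2]] : exists n, [/\ rn n <= e,
    \int[@leb2 R]_x ((moll (rn n) u1 x - u1 x) ^+ 2) <= e &
    \int[@leb2 R]_x ((moll (rn n) u2 x - u2 x) ^+ 2) <= e].
  near \oo => n; exists n; split.
  - by near: n; exact: cvg0_near_le rc.
  - by near: n; exact: H.
  - by near: n; exact: H.
by exists (rn n); split.
Unshelve. all: by end_near.
Qed.

Lemma le_Rintegral_bound (f h : mplane -> R) : measurable_fun setT f ->
  (forall x, 0 <= f x <= h x) -> integ leb2 h ->
  integ leb2 f /\ \int[@leb2 R]_x f x <= \int[@leb2 R]_x h x.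
Proof.
move=> mf fh ih.
have i : integ leb2 f.
  by apply: le_integ ih => // x; have /andP[f0 ?] := fh x; rewrite ger0_norm.
by split => //; apply: le_RintegralT => // x; have /andP[] := fh x.
Qed.

Variables (Omega : set plane) (C rd : R) (eps theta delta : nat -> R).
Variables (u1 u2 g d1 d2 d3 d4 : nat -> mplane -> R).
Hypotheses (eps0 : forall n, 0 < eps n).
Hypotheses (su1 : forall n, sqint leb2 (u1 n)) (su2 : forall n, sqint leb2 (u2 n))
  (sg : forall n, sqint leb2 (g n)).
Hypotheses (sd1 : forall n, sqint leb2 (d1 n)) (sd2 : forall n, sqint leb2 (d2 n))
  (sd3 : forall n, sqint leb2 (d3 n)) (sd4 : forall n, sqint leb2 (d4 n)).
Hypotheses (wd1 : forall n, weak_D Omega e1 (u1 n) (d1 n))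
  (wd2 : forall n, weak_D Omega e2 (u1 n) (d2 n))
  (wd3 : forall n, weak_D Omega e1 (u2 n) (d3 n))
  (wd4 : forall n, weak_D Omega e2 (u2 n) (d4 n))
  (wg : forall n, weak_dv Omega (u1 n) (u2 n) (g n)).
Hypothesis kapE : forall n, integ leb2 (fun x => kap (u1 n x) (u2 n x) ^+ 2) /\
  \int[@leb2 R]_x (kap (u1 n x) (u2 n x) ^+ 2) <= C * eps n.
Hypothesis mdE : forall n, integ leb2 (fun x => mdist (nrm2 (u1 n x) (u2 n x))) /\
  \int[@leb2 R]_x (mdist (nrm2 (u1 n x) (u2 n x))) <= theta n.
Hypotheses (dE1 : forall n, eps n * \int[@leb2 R]_x (d1 n x ^+ 2) <= C)
  (dE2 : forall n, eps n * \int[@leb2 R]_x (d2 n x ^+ 2) <= C)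
  (dE3 : forall n, eps n * \int[@leb2 R]_x (d3 n x ^+ 2) <= C)
  (dE4 : forall n, eps n * \int[@leb2 R]_x (d4 n x ^+ 2) <= C)
  (gE : forall n, \int[@leb2 R]_x (g n x ^+ 2) <= C).
Hypothesis hdelta : forall n, [/\ 0 < delta n <= 1, delta n <= eps n,
  \int[@leb2 R]_x ((moll (delta n) (u1 n) x - u1 n x) ^+ 2) <= eps n &
  \int[@leb2 R]_x ((moll (delta n) (u2 n) x - u2 n x) ^+ 2) <= eps n].

Definition v1 n : plane -> R := moll (delta n) (u1 n).
Definition v2 n : plane -> R := moll (delta n) (u2 n).

Lemma delta_gt0 n : 0 < delta n. Proof. by have [/andP[]] := hdelta n. Qed.

Lemma sqint_v1 n : sqint leb2 (v1 n). Proof. exact: (sqint_moll (delta_gt0 n)). Qed.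
Lemma sqint_v2 n : sqint leb2 (v2 n). Proof. exact: (sqint_moll (delta_gt0 n)). Qed.

Definition err n x : R := nrmp ((v1 n x, v2 n x) - (u1 n x, u2 n x)).

Lemma err_integ n : integ leb2 (err n : mplane -> R) /\ \int[@leb2 R]_x err n x <= 2 * eps n.
Proof.
have [_ i1] := sqintB (sqint_v1 n) (su1 n); have [_ i2] := sqintB (sqint_v2 n) (su2 n).
have [_ _ e1 e2] := hdelta n.
split; first exact: integD i1 i2.
rewrite /err /nrmp /nrm2 /= (RintegralDT i1 i2).
by rewrite mulr_natl mulr2n; apply: lerD.
Qed.

Lemma kap_v n : integ leb2 (fun x => kap (v1 n x) (v2 n x) ^+ 2) /\
  \int[@leb2 R]_x (kap (v1 n x) (v2 n x) ^+ 2) <= (2 * C + 288) * eps n.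
Proof.
have [ie le] := err_integ n; have [ik lk] := kapE n.
have m : measurable_fun setT (fun x : mplane => kap (v1 n x) (v2 n x) ^+ 2).
  apply: measurable_funX.
  exact: (measurable_comp2 continuous_kap (sqint_v1 n).1 (sqint_v2 n).1).
have I := integD (integZ 2 ik) (integZ 144 ie).
(* [144 = 2 * 6^2 * 2]: twice the squared Lipschitz constant of [kap], then
   [nrm1 ^+ 2 <= 2 * nrmp]. *)
suff H x : 0 <= kap (v1 n x) (v2 n x) ^+ 2 <= 2 * kap (u1 n x) (u2 n x) ^+ 2 + 144 * err n x.
  have [i l] := le_Rintegral_bound m H I; split => //; apply: le_trans l _.
  rewrite (RintegralDT (integZ 2 ik) (integZ 144 ie)) (RintegralZT 2 ik) (RintegralZT 144 ie).
  lra.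
rewrite sqr_ge0 /=.
have L := lip_kap (v1 n x, v2 n x) (u1 n x, u2 n x); rewrite /= in L.
have N := nrm1_sq ((v1 n x, v2 n x) - (u1 n x, u2 n x)).
rewrite -/(err n x) in N.
move: (nrm1 _) (err n x) L N => t e L N.
move: (kap (v1 n x) (v2 n x)) (kap (u1 n x) (u2 n x)) L => a b L.
have L2 : (a - b) ^+ 2 <= (6 * t) ^+ 2.
  have t0 : 0 <= 6 * t := le_trans (normr_ge0 _) L.
  by rewrite -(real_normK (num_real (a - b))) ler_pXn2r.
rewrite exprMn in L2.
have -> : a ^+ 2 = 2 * b ^+ 2 + 2 * (a - b) ^+ 2 - (a - 2 * b) ^+ 2 by ring.
have := sqr_ge0 (a - 2 * b); lra.
Qed.

Lemma dsq_v n : integ leb2 (fun x => dsq (v1 n x, v2 n x)) /\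
  \int[@leb2 R]_x dsq (v1 n x, v2 n x) <= 2 * theta n + 4 * eps n.
Proof.
have [ie le] := err_integ n; have [ik lk] := mdE n.
have m := measurable_comp2 continuous_dsq (sqint_v1 n).1 (sqint_v2 n).1.
have I := integD (integZ 2 ik) (integZ 2 ie).
suff H x : 0 <= dsq (v1 n x, v2 n x) <= 2 * mdist (nrm2 (u1 n x) (u2 n x)) + 2 * err n x.
  have [i l] := le_Rintegral_bound m H I; split => //; apply: le_trans l _.
  rewrite (RintegralDT (integZ 2 ik) (integZ 2 ie)) (RintegralZT 2 ik) (RintegralZT 2 ie).
  lra.
rewrite dsq_ge0 /=.
apply: le_trans (dsq_approx _ (u1 n x, u2 n x)) _.
by rewrite lerD2r; apply: ler_wpM2l => //; exact: (dsq_le_mdist (u1 n x, u2 n x)).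
Qed.

(** Built from mollified weak derivatives, it is integrable over the whole plane; it equals the
    energy density of [(v1, v2)] wherever the square of radius [delta n] lies in [Omega]. *)
Definition density n x : R := kap (v1 n x) (v2 n x) ^+ 2 / eps n +
  eps n * (moll (delta n) (d1 n) x ^+ 2 + moll (delta n) (d2 n) x ^+ 2 +
           moll (delta n) (d3 n) x ^+ 2 + moll (delta n) (d4 n) x ^+ 2).

Lemma density_ge0 n x : 0 <= density n x.
Proof.
have e0 := ltW (eps0 n).
rewrite /density; apply: addr_ge0; first by apply: mulr_ge0; rewrite ?sqr_ge0 ?invr_ge0.
apply: mulr_ge0 => //.
by rewrite !addr_ge0// sqr_ge0.
Qed.

Lemma density_integ n : integ leb2 (density n : mplane -> R) /\
  \int[@leb2 R]_x density n x <= 6 * C + 288.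
Proof.
have [ik lk] := kap_v n; have d0 := delta_gt0 n; have e0 := eps0 n.
have i1 := (sqint_moll d0 (sd1 n)).2; have i2 := (sqint_moll d0 (sd2 n)).2.
have i3 := (sqint_moll d0 (sd3 n)).2; have i4 := (sqint_moll d0 (sd4 n)).2.
have j2 := integD i1 i2; have j3 := integD j2 i3; have j4 := integD j3 i4.
have jj := integZ (eps n) j4.
have kk : integ leb2 (fun x => kap (v1 n x) (v2 n x) ^+ 2 / eps n).
  by under eq_fun do rewrite mulrC; exact: integZ.
split; first exact: integD kk jj.
rewrite (RintegralDT kk jj) (RintegralZT (eps n) j4) (RintegralDT j3 i4)
  (RintegralDT j2 i3) (RintegralDT i1 i2).
have -> : \int[@leb2 R]_x (kap (v1 n x) (v2 n x) ^+ 2 / eps n) =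
    (eps n)^-1 * \int[@leb2 R]_x (kap (v1 n x) (v2 n x) ^+ 2).
  by rewrite -(RintegralZT (eps n)^-1 ik); congr (Rintegral _ _ _); apply/funext => x; rewrite mulrC.
have K : (eps n)^-1 * \int[@leb2 R]_x (kap (v1 n x) (v2 n x) ^+ 2) <= 2 * C + 288.
  by rewrite ler_pdivrMl// mulrC.
have E (f : mplane -> R) : sqint leb2 f -> eps n * \int[@leb2 R]_x (f x ^+ 2) <= C ->
    eps n * \int[@leb2 R]_x (moll (delta n) f x ^+ 2) <= C.
  move=> sf; apply: le_trans; apply: ler_wpM2l; [exact: ltW|exact: moll_contract].
rewrite (_ : 6 * C + 288 = (2 * C + 288) + (C + C + C + C)); last by ring.
apply: lerD K _; rewrite !mulrDr.
exact: lerD (lerD (lerD (E _ (sd1 n) (dE1 n)) (E _ (sd2 n) (dE2 n))) (E _ (sd3 n) (dE3 n)))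
  (E _ (sd4 n) (dE4 n)).
Qed.

Lemma densityE n x : square x (delta n) `<=` Omega ->
  kap (v1 n x) (v2 n x) ^+ 2 / eps n + eps n * gradsq (v1 n) (v2 n) x = density n x.
Proof.
move=> sq; rewrite /density /gradsq.
rewrite (moll_weak_D1 (su1 n) (sd1 n) (wd1 n) sq) (moll_weak_D2 (su1 n) (sd2 n) (wd2 n) sq).
by rewrite (moll_weak_D1 (su2 n) (sd3 n) (wd3 n) sq) (moll_weak_D2 (su2 n) (sd4 n) (wd4 n) sq).
Qed.

Lemma divf_v n x : square x (delta n) `<=` Omega -> divf (v1 n) (v2 n) x = moll (delta n) (g n) x.
Proof. by move=> sq; exact: (moll_weak_dv (su1 n) (su2 n) (sg n) (wg n) sq). Qed.

End approximation.

(** * Uniform bound on local increments *)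

Section local_increments.
Context {R : realType}.
Local Notation plane := (R * R)%type.
Local Notation mplane := (measurableTypeR R * measurableTypeR R)%type.
Implicit Types (x y z h a b : plane).

Lemma C1b_supp r (F : plane -> R) : Ck 1 F -> supp_in r F -> C1b F.
Proof.
move=> CF sF; split => //.
have [cF [d1 d2 [c1 _] [c2 _]]] := CF.
have sb (G : plane -> R) : supp_in r G -> forall z, ~ cbox (- r, - r) (r, r) z -> G z = 0.
  by move=> sG z; rewrite -square0; exact: sG.
have [A A0 hA] := bounded_cbox cF (sb _ sF).
have [B B0 hB] := bounded_cbox c1 (sb _ (@supp_in_derive _ r F e1 sF)).
have [D D0 hD] := bounded_cbox c2 (sb _ (@supp_in_derive _ r F e2 sF)).
exists (A + B + D) => z; have := hA z; have := hB z; have := hD z.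
by move=> hD' hB' hA'; split; [apply: le_trans hA' _|apply: le_trans hB' _|apply: le_trans hD' _]; rewrite ?lerDl ?lerDr ?addr_ge0//; lra.
Qed.

Lemma supp_in_cbox a b (F : plane -> R) : (forall z, ~ cbox a b z -> F z = 0) ->
  supp_in (`|a| + `|b|) F.
Proof.
move=> h z nz; apply: h => -[]; rewrite /= !in_itv/= => /andP[a1 b1] /andP[a2 b2].
apply: nz; apply/squareE; rewrite !subr0.
have := (nrm1_norm a); have n (c : plane) : `|c.1| <= `|c| /\ `|c.2| <= `|c|.
  by rewrite prod_normE !le_max !lexx orbT.
have [p1 p2] := n a; have [q1 q2] := n b; move=> _.
move: p1 p2 q1 q2; rewrite !ler_norml => /andP[? ?] /andP[? ?] /andP[? ?] /andP[? ?].
by split; apply/andP; split; lra.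
Qed.

Definition enlarge_lo a (r : R) : plane := (a.1 - r, a.2 - r).
Definition enlarge_hi b (r : R) : plane := (b.1 + r, b.2 + r).

Lemma enlarge_shift a b r x z : cbox a b x -> `|z| <= r ->
  cbox (enlarge_lo a r) (enlarge_hi b r) (x + z).
Proof.
move=> [/=]; rewrite !in_itv/= => /andP[a1 b1] /andP[a2 b2]; rewrite prod_normE ge_max.
rewrite !ler_norml => /andP[/andP[? ?] /andP[? ?]].
by split; rewrite /= in_itv/=; apply/andP; split; lra.
Qed.

Lemma enlarge_sub (Omega : set plane) a b r : a.1 <= b.1 -> a.2 <= b.2 -> 0 < r ->
  (forall x, cbox a b x -> square x r `<=` Omega) ->
  cbox (enlarge_lo a r) (enlarge_hi b r) `<=` Omega.
Proof.
move=> ab1 ab2 r0 h y [/=]; rewrite !in_itv/= => /andP[a1 b1] /andP[a2 b2].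
have clamp (s t c : R) : s <= t -> s - r <= c -> c <= t + r ->
    exists m, [/\ s <= m, m <= t & `|c - m| <= r].
  move=> st sc ct; have [cs|cs] := leP c s.
    by exists s; split => //; rewrite ler_norml; apply/andP; split; lra.
  have [tc|tc] := leP t c.
    by exists t; split => //; rewrite ler_norml; apply/andP; split; lra.
  by exists c; split; rewrite ?subrr ?normr0 ?(ltW r0) ?(ltW cs) ?(ltW tc).
have [m1 [? ? ?]] := clamp _ _ _ ab1 a1 b1; have [m2 [? ? ?]] := clamp _ _ _ ab2 a2 b2.
apply: (h (m1, m2)); last by apply/squareE.
by split; rewrite /= in_itv/=; apply/andP; split.
Qed.

Lemma square_mono x (r s : R) : r <= s -> square x r `<=` square x s.
Proof. by move=> rs z /square_norm h; apply/square_norm; exact: le_trans rs. Qed.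

Lemma bump_supp a b : supp_in (`|a| + `|b|) (bump 1 a b).
Proof.
apply: supp_in_cbox => z nz; apply: bump_eq0 => // bz; apply: nz.
exact: box_subset_cbox bz.
Qed.

Lemma C1b_bump a b : C1b (bump 1 a b).
Proof. apply: (@C1b_supp (`|a| + `|b|)); [exact: Ck_bump|exact: bump_supp]. Qed.

Variables (Omega : set plane) (K : R) (eps theta delta : nat -> R).
Variables (v1 v2 : nat -> plane -> R) (G dens : nat -> mplane -> R).
Hypotheses (oOmega : open Omega) (eps0 : forall n, 0 < eps n).
Hypothesis (delta_cvg : delta n @[n --> \oo] --> (0 : R)).
Hypotheses (c1 : forall n, C1b (v1 n)) (c2 : forall n, C1b (v2 n)).
Hypotheses (s1 : forall n, sqint leb2 (v1 n)) (s2 : forall n, sqint leb2 (v2 n)).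
Hypothesis dsqE : forall n, integ leb2 (fun x => dsq (v1 n x, v2 n x)) /\
  \int[@leb2 R]_x dsq (v1 n x, v2 n x) <= theta n.
Hypotheses (dens_ge0 : forall n x, 0 <= dens n x)
  (densI : forall n, integ leb2 (dens n) /\ \int[@leb2 R]_x dens n x <= K)
  (densE : forall n x, square x (delta n) `<=` Omega ->
    kap (v1 n x) (v2 n x) ^+ 2 / eps n + eps n * gradsq (v1 n) (v2 n) x = dens n x).
Hypotheses (GI : forall n, sqint leb2 (G n) /\ \int[@leb2 R]_x (G n x ^+ 2) <= K)
  (GE : forall n x, square x (delta n) `<=` Omega -> divf (v1 n) (v2 n) x = G n x).

Lemma integ_bumpM a b (F : plane -> R) : continuous F ->
  integ leb2 (fun x => bump 1 a b x * F x).
Proof.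
move=> cF; apply: (@integ_supp _ (`|a| + `|b|)).
  by apply: continuousMf => //; exact: C1b_continuous (C1b_bump a b).
by move=> z hz; rewrite (bump_supp hz) mul0r.
Qed.

Lemma bump_integ a b : integ leb2 (bump 1 a b : mplane -> R).
Proof.
have -> : bump 1 a b = (fun x => bump 1 a b x * 1) by apply/funext => x; rewrite mulr1.
by apply: (@integ_bumpM a b (fun=> 1)) => x; exact: cvg_cst.
Qed.

Lemma divf_bound n a b (U1 U2 : plane -> R) :
  (forall x, cbox a b x -> square x (delta n) `<=` Omega) ->
  C1b U1 -> C1b U2 ->
  (forall x, `|divf U1 U2 x| <= 6 * (1 + divf (v1 n) (v2 n) x ^+ 2) +
     48 * (kap (v1 n x) (v2 n x) ^+ 2 / eps n + eps n * gradsq (v1 n) (v2 n) x)) ->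
  \int[@leb2 R]_x (`|divf U1 U2 x| * \1_(cbox a b) x) <=
  6 * \int[@leb2 R]_x (\1_(cbox a b) x) + 54 * K.
Proof.
move=> sq hU1 hU2 le.
have i1 : integ leb2 (\1_(cbox a b) : mplane -> R).
  have -> : (\1_(cbox a b) : mplane -> R) = (fun x => `|1| * \1_(cbox a b) x).
    by apply/funext => x; rewrite normr1 mul1r.
  by apply: (@integ_on_cbox _ (fun=> 1)) => x; exact: cvg_cst.
have [[_ i2] l2] := GI n; have [i3 l3] := densI n.
have j12 := integD (integZ 6 i1) (integZ 6 i2); have j := integD j12 (integZ 48 i3).
apply: le_trans (le_RintegralT (integ_on_cbox a b (continuous_divf hU1 hU2)) j _) _; last first.
  rewrite (RintegralDT j12 (integZ 48 i3)) (RintegralDT (integZ 6 i1) (integZ 6 i2)).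
  rewrite (RintegralZT 6 i1) (RintegralZT 6 i2) (RintegralZT 48 i3).
  by move: l2 l3; move: (Rintegral _ _ _) (Rintegral _ _ _) (Rintegral _ _ _) => p q r; lra.
move=> x; have g0 := sqr_ge0 (G n x); have d0 := dens_ge0 n x.
rewrite indicE; case: (pselect (cbox a b x)) => [/[dup] cx /mem_set ->|nx].
  rewrite mulr1; apply: le_trans (le x) _; rewrite (GE (sq _ cx)) (densE (sq _ cx)).
  by rewrite mulrDr.
by rewrite memNset// !mulr0 add0r addr_ge0// mulr_ge0.
Qed.

(** [increment_bound] is integrated against a cutoff: the distances to the ideal set give [theta n],
    and the determinant is handed to [interaction]. The parameter [eta] stays free, to be fixed
    before [h] and [n]. *)
Lemma local_increments a b : a.1 <= b.1 -> a.2 <= b.2 -> cbox a b `<=` Omega ->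
  exists r A : R, [/\ 0 < r, 0 < A & \forall n \near \oo, forall h eta, `|h| <= r -> 0 < eta <= 1 ->
    \int[@leb2 R]_x (bump 1 a b x * nrmp ((v1 n (x + h), v2 n (x + h)) - (v1 n x, v2 n x))) <=
    A * (eta + theta n / eta ^+ 3 + `|h| / eta)].
Proof.
move=> ab1 ab2 sub.
(* This radius leaves room in [Omega] for the shifts by [h]. *)
have [r r0 hr] := compact_square (@compact_cbox R a b) oOmega sub.
pose a' := enlarge_lo a r; pose b' := enlarge_hi b r.
have sub' : cbox a' b' `<=` Omega by exact: enlarge_sub.
(* This radius leaves room around the enlarged box for the mollification, once [delta n <= r1]. *)
have [r1 r10 hr1] := compact_square (@compact_cbox R a' b') oOmega sub'.
have [K0 [K1 [K00 K10 inc]]] := @increment_bound R.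
pose X := \int[@leb2 R]_x bump 1 a b x.
pose D := \int[@leb2 R]_x (`|'D_e1 (bump 1 a b) x| + `|'D_e2 (bump 1 a b) x|).
pose B := 6 * \int[@leb2 R]_x (\1_(cbox a' b') x) + 54 * K.
pose S := 4 * 6 ^+ 2 * D + 8 * 6 * B.
(* The sum of the three coefficients obtained below; absolute values make the unwanted cross terms
   nonnegative. *)
exists r, (K0 * `|X| + 2 * K0 + K1 * `|S|); split => //.
  rewrite -addrA ltr_wpDl//; first by apply: mulr_ge0 => //; exact: ltW.
  by rewrite ltr_pwDl ?mulr_gt0//; apply: mulr_ge0 => //; exact: ltW.
have near1 : \forall n \near \oo, delta n <= r1 by exact: cvg0_near_le.
near=> n => h eta hh /andP[e0 e1].
have sq x : cbox a' b' x -> square x (delta n) `<=` Omega.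
  move=> cx; apply: subset_trans (hr1 _ cx); apply: square_mono.
  by near: n.
pose U1 x := Phi1 (v1 n x) (v2 n x); pose U2 x := Phi2 (v1 n x) (v2 n x).
pose W1 x := Psi1 (v1 n x) (v2 n x); pose W2 x := Psi2 (v1 n x) (v2 n x).
have hU1 : C1b U1 by exact: C1b_Phi1.
have hU2 : C1b U2 by exact: C1b_Phi2.
have hW1 : C1b W1 by exact: C1b_Psi1.
have hW2 : C1b W2 by exact: C1b_Psi2.
have chi01 z : 0 <= bump 1 a b z <= 1 by rewrite bump_ge0 bump_le1.
have nbh x z : bump 1 a b x != 0 -> `|z| <= `|h| -> cbox a' b' (x + z).
  move=> /eqP bx zh; apply: enlarge_shift; last exact: le_trans zh hh.
  by apply: contrapT => nx; apply: bx; apply: bump_eq0 => // /box_subset_cbox.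
have BU : \int[@leb2 R]_x (`|divf U1 U2 x| * \1_(cbox a' b') x) <= B.
  by apply: (@divf_bound n) => // x; exact: divf_Phi_le.
have BW : \int[@leb2 R]_x (`|divf W1 W2 x| * \1_(cbox a' b') x) <= B.
  by apply: (@divf_bound n) => // x; exact: divf_Psi_le.
have bd x : [/\ `|U1 x| <= 6, `|U2 x| <= 6, `|W1 x| <= 6 & `|W2 x| <= 6] by exact: ent_bound.
(* The entropies are bounded by [M = 6], and both divergences share the bound [B] coming from the
   energy. *)
have I := @interaction _ U1 U2 W1 W2 (bump 1 a b) 6 B D _ h a' b' hU1 hU2 hW1 hW2
  (C1b_bump a b) (bump_supp (b := b)) chi01
  (fun z => let: And4 p _ _ _ := bd z in p) (fun z => let: And4 _ p _ _ := bd z in p)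
  (fun z => let: And4 _ _ p _ := bd z in p) (fun z => let: And4 _ _ _ p := bd z in p)
  nbh BU BW (lexx _).
rewrite -/S in I.
have cv : continuous (fun x => nrmp ((v1 n (x + h), v2 n (x + h)) - (v1 n x, v2 n x))).
  have d1 := C1b_continuous (C1b_incr h (c1 n)); have d2 := C1b_continuous (C1b_incr h (c2 n)).
  exact: continuousDf (continuousMf d1 d1) (continuousMf d2 d2).
have ichi : integ leb2 (bump 1 a b : mplane -> R) by exact: bump_integ.
have cdet : continuous (fun x => incr h U1 x * incr h W2 x - incr h U2 x * incr h W1 x).
  have cP (P Q : plane -> R) : C1b P -> C1b Q -> C1b (fun x => incr h P x * incr h Q x).
    by move=> cP cQ; apply: C1bM; exact: C1b_incr.
  exact: C1b_continuous (C1bB (cP _ _ hU1 hW2) (cP _ _ hU2 hW1)).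
have idet := integ_bumpM a b cdet.
have [id ld] := dsqE n; have ids := integ_shift h id.
have i2 := integD ids id.
have e3 : 0 < eta ^+ 3 by rewrite exprn_gt0.
have j1 := integZ (K0 * eta) ichi; have j2 := integZ (K0 / eta ^+ 3) i2.
have j3 := integZ (K1 / eta) idet.
apply: le_trans (le_RintegralT (integ_bumpM a b cv) (integD (integD j1 j2) j3) _) _.
  move=> x; have /andP[b0 b1] := chi01 x.
  have := inc (v1 n (x + h), v2 n (x + h)) (v1 n x, v2 n x) eta; rewrite e0 e1 => /(_ isT) H.
  apply: le_trans (ler_wpM2l b0 H) _.
  rewrite [det2 _ _](_ : _ = incr h U1 x * incr h W2 x - incr h U2 x * incr h W1 x) //.
  have dz := dsq_ge0 (v1 n (x + h), v2 n (x + h)); have dw := dsq_ge0 (v1 n x, v2 n x).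
  move: (dsq _) (dsq _) (incr h U1 x * incr h W2 x - _) dz dw => p q d dz dw.
  have F : bump 1 a b x * ((K0 / eta ^+ 3) * (p + q)) <= (K0 / eta ^+ 3) * (p + q).
    by rewrite ler_piMl// mulr_ge0 ?addr_ge0// divr_ge0 ?ltW.
  rewrite [leLHS](_ : _ = K0 * eta * bump 1 a b x + bump 1 a b x * (K0 / eta ^+ 3 * (p + q)) +
    K1 / eta * (bump 1 a b x * d)); last by ring.
  by rewrite (addrC q) lerD2r lerD2l.
rewrite (RintegralDT (integD j1 j2) j3) (RintegralDT j1 j2) (RintegralZT _ ichi)
  (RintegralZT _ i2) (RintegralZT _ idet) (RintegralDT ids id) (Rintegral_shift h id) -/X.
have {}I : \int[@leb2 R]_x (bump 1 a b x * (incr h U1 x * incr h W2 x - incr h U2 x * incr h W1 x)) <= `|h| * `|S|.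
  apply: le_trans (ler_norm _) _; apply: le_trans I _.
  by apply: ler_wpM2l => //; exact: ler_norm.
have t0 : 0 <= theta n.
  by apply: le_trans ld; apply: Rintegral_ge0 => x _; exact: dsq_ge0.
move: (\int[@leb2 R]_x dsq _) (\int[@leb2 R]_x (bump 1 a b x * _)) ld I => Id Iw ld I.
have h1 : K0 * eta * X <= K0 * `|X| * eta.
  by rewrite mulrAC; apply: ler_wpM2r; [exact: ltW|apply: ler_wpM2l; [exact: ltW|exact: ler_norm]].
have h2 : K0 / eta ^+ 3 * (Id + Id) <= 2 * K0 * (theta n / eta ^+ 3).
  rewrite (_ : 2 * K0 * _ = K0 / eta ^+ 3 * (theta n + theta n)); last by ring.
  by apply: ler_wpM2l; [rewrite divr_ge0 ?ltW|exact: lerD].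
have h3 : K1 / eta * Iw <= K1 * `|S| * (`|h| / eta).
  rewrite (_ : K1 * `|S| * _ = K1 / eta * (`|h| * `|S|)); last by ring.
  have c0 : 0 <= K1 / eta by apply: divr_ge0; [exact: ltW|exact: ltW].
  exact: (ler_wpM2l c0 I).
have T0 : 0 <= theta n / eta ^+ 3 by apply: divr_ge0 => //; exact: ltW.
have H0 : 0 <= `|h| / eta by apply: divr_ge0 => //; exact: ltW.
have X0 := normr_ge0 X; have S0 := normr_ge0 S; have e_0 := ltW e0; have K_0 := ltW K00.
apply: le_trans (lerD (lerD h1 h2) h3) _.
have g1 := mulr_ge0 K_0 X0.
have g2 : 0 <= K1 * `|S| by apply: mulr_ge0; [exact: ltW|exact: S0].
move: (K0 * `|X|) (theta n / eta ^+ 3) (K1 * `|S|) (`|h| / eta) g1 g2 T0 H0 => x1 x2 x3 x4 g1 g2 T0 H0.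
have g0 : 0 <= 2 * K0 by apply: mulr_ge0.
have k2 := mulr_ge0 g0 e_0; have k4 := mulr_ge0 g0 H0.
have l2 := mulr_ge0 g1 T0; have l4 := mulr_ge0 g1 H0.
have m2 := mulr_ge0 g2 e_0; have m4 := mulr_ge0 g2 T0.
rewrite (_ : (x1 + _ + _) * _ = x1 * eta + 2 * K0 * x2 + x3 * x4 + (x1 * x2 + x1 * x4 +
  2 * K0 * eta + 2 * K0 * x4 + x3 * eta + x3 * x2)); last by ring.
by rewrite lerDl !addr_ge0.
Unshelve. all: by end_near.
Qed.

End local_increments.

(** * From weak to strong convergence, locally *)

Section local_convergence.
Context {R : realType}.
Local Notation plane := (R * R)%type.
Local Notation mplane := (measurableTypeR R * measurableTypeR R)%type.
Implicit Types (x y z h a b : plane).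

Lemma moll_sup r (f : mplane -> R) (B C : R) x : 0 < r -> sqint leb2 f ->
  (forall z, rho r z <= B) -> \int[@leb2 R]_y (f y ^+ 2) <= C -> moll r f x ^+ 2 <= B * C.
Proof.
move=> r0 sf hB hC; have B0 : 0 <= B := le_trans (rho_ge0 r 0) (hB 0).
apply: le_trans (jensen_rho x r0 sf) _.
apply: (@le_trans _ _ (B * \int[@leb2 R]_y (f y ^+ 2))); last exact: ler_wpM2l.
rewrite -(RintegralZT B sf.2); apply: le_RintegralT.
- exact: (integ_Mrho _ _ (integ_measurable sf.2) sf.2).
- exact: integZ sf.2.
- by move=> y; rewrite mulrC; apply: ler_wpM2r; rewrite ?sqr_ge0.
Qed.

(** At a fixed scale the mollification at [x] is a pairing with one L2 function, so weak convergence
    gives pointwise convergence; the bound on L2 norms gives a uniform bound, hence domination on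
    the support of the bump. *)
Lemma weak_moll_cvg (s : R) (v : nat -> mplane -> R) (w : mplane -> R) (M : R) a b : 0 < s ->
  (forall n, sqint leb2 (v n)) -> sqint leb2 w ->
  (forall n, \int[@leb2 R]_x (v n x ^+ 2) <= M) ->
  (forall f : mplane -> R, sqint leb2 f -> ip2 leb2 (v n) f @[n --> \oo] --> ip2 leb2 w f) ->
  \int[@leb2 R]_x (bump 1 a b x * (moll s (v n) x - moll s w x) ^+ 2) @[n --> \oo] --> (0 : R).
Proof.
move=> s0 sv sw hM weak.
have [B B0 hB] := kernel_bounded (rho_kernel s : kernel (rho s) s).
have hB' z : rho s z <= B by apply: le_trans (hB z); exact: ler_norm.
pose N := M + \int[@leb2 R]_x (w x ^+ 2).
have w0 : 0 <= \int[@leb2 R]_x (w x ^+ 2) by apply: Rintegral_ge0 => x _; exact: sqr_ge0.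
have M0 : 0 <= M by apply: le_trans (hM 0%N); apply: Rintegral_ge0 => x _; exact: sqr_ge0.
have ichi := @bump_integ R a b.
have mm f : sqint leb2 f -> measurable_fun setT (moll s f : mplane -> R) by exact: measurable_moll.
have := @dominated_Rintegral _ mplane R (@leb2 R)
  (fun n x => bump 1 a b x * (moll s (v n) x - moll s w x) ^+ 2) (fun=> 0)
  (fun x => 4 * (B * N) * bump 1 a b x).
case.
- move=> n; apply: measurable_funM; first exact: integ_measurable ichi.
  by apply: measurable_funX; apply: measurable_funB; apply: mm.
- move=> n x; have b0 := bump_ge0 1 a b x.
  rewrite normrM ger0_norm// ger0_norm ?sqr_ge0// mulrC; apply: ler_wpM2r => //.
  have p1 : moll s (v n) x ^+ 2 <= B * N.
    by apply: moll_sup => //; rewrite /N; apply: le_trans (hM n) _; rewrite lerDl.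
  have p2 : moll s w x ^+ 2 <= B * N by apply: moll_sup => //; rewrite /N lerDr.
  move: (moll s (v n) x) (moll s w x) p1 p2 => p q p1 p2.
  by have := sqr_ge0 (p + q); rewrite sqrrB sqrrD; lra.
- exact: integZ ichi.
- move=> x; rewrite -[X in _ --> X](mulr0 (bump 1 a b x)).
  apply: cvgMl_tmp => //.
  have h : (moll s (v n) x - moll s w x) @[n --> \oo] --> (0 : R).
    rewrite -[X in _ --> X](subrr (moll s w x)); apply: cvgB; last exact: cvg_cst.
    exact: weak (kernel_sqint x (rho_kernel s)).
  rewrite -[X in _ --> X](mulr0 (0 : R)); exact: (cvgM h h).
by rewrite Rintegral_cst//= mul0r.
Qed.

(** Three parts: the increments control [v n - moll s (v n)], weak convergence controls
    [moll s (v n) - moll s w], and [moll s w - w] is small. The order of choice is [eta], then the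
    scale [s], then [n]. *)
Lemma local_convergence (v : nat -> mplane -> R) (w : mplane -> R) (theta : nat -> R)
    (M r A : R) a b : 0 < r -> 0 < A ->
  (forall n, sqint leb2 (v n)) -> sqint leb2 w ->
  (forall n, \int[@leb2 R]_x (v n x ^+ 2) <= M) ->
  (forall f : mplane -> R, sqint leb2 f -> ip2 leb2 (v n) f @[n --> \oo] --> ip2 leb2 w f) ->
  theta n @[n --> \oo] --> (0 : R) ->
  (\forall n \near \oo, forall h eta, `|h| <= r -> 0 < eta <= 1 ->
    \int[@leb2 R]_x (bump 1 a b x * (v n (x + h) - v n x) ^+ 2) <=
    A * (eta + theta n / eta ^+ 3 + `|h| / eta)) ->
  \int[@leb2 R]_x (bump 1 a b x * (v n x - w x) ^+ 2) @[n --> \oo] --> (0 : R).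
Proof.
move=> r0 A0 sv sw hM weak th inc; apply/cvgrPdist_le => e e0.
have mchi : measurable_fun setT (bump 1 a b : mplane -> R) := integ_measurable (bump_integ a b).
have chi01 x : 0 <= bump 1 a b x <= 1 by rewrite bump_ge0 bump_le1.
(* Squaring a sum of three parts costs a factor 3, so each may use [e / 9]; the first is again a sum
   of three, whence 27. *)
pose eta := Num.min 1 (e / (27 * A)).
have d0 : 0 < e / (27 * A) by rewrite divr_gt0// mulr_gt0.
have eta01 : 0 < eta <= 1 by rewrite lt_min ltr01 d0 ge_min lexx.
have /andP[eta0 _] := eta01.
have Aeta : A * eta <= e / 27.
  apply: (@le_trans _ _ (A * (e / (27 * A)))).
    by apply: ler_wpM2l; [exact: ltW|rewrite ge_min lexx orbT].
  by rewrite le_eqVlt; apply/orP; left; apply/eqP; field; rewrite gt_eqF.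
pose rn n : R := n.+1%:R^-1.
have r01 n : 0 < rn n <= 1 by rewrite invr_gt0 ltr0n /= invf_le1 ?ltr0n// ler1n.
have rc : rn n @[n --> \oo] --> (0 : R) by exact: cvg_harmonic.
have e9 : 0 < e / 9 by rewrite divr_gt0.
have [m [hm1 hm2 hm3]] : exists m, [/\ rn m <= r, rn m <= e / 27 * eta / A &
    \int[@leb2 R]_x ((moll (rn m) w x - w x) ^+ 2) <= e / 9].
  near \oo => m; exists m; split.
  - by near: m; exact: cvg0_near_le.
  - by near: m; apply: cvg0_near_le rc; rewrite !mulr_gt0// invr_gt0.
  - by near: m; apply: cvg0_near_le => //; exact: moll_cvg.
have /andP[s0 _] := r01 m; set s := rn m in hm1 hm2 hm3 s0.
have As : A * (s / eta) <= e / 27.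
  rewrite mulrA ler_pdivrMr// mulrC -ler_pdivlMr//.
near=> n.
have th3 : A * (theta n / eta ^+ 3) <= e / 27.
  have E3 : 0 < eta ^+ 3 by rewrite exprn_gt0.
  rewrite mulrA ler_pdivrMr// mulrC -ler_pdivlMr//.
  near: n; apply: cvg0_near_le th.
  by rewrite !mulr_gt0// invr_gt0.
have incn : forall h eta, `|h| <= r -> 0 < eta <= 1 ->
    \int[@leb2 R]_x (bump 1 a b x * (v n (x + h) - v n x) ^+ 2) <=
    A * (eta + theta n / eta ^+ 3 + `|h| / eta) by near: n.
have inc9 z : square 0 s z ->
    \int[@leb2 R]_x (bump 1 a b x * (v n (x + z) - v n x) ^+ 2) <= e / 9.
  move=> /square_norm; rewrite subr0 => hz.
  apply: le_trans (incn z eta (le_trans hz hm1) eta01) _.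
  have hs : A * (`|z| / eta) <= A * (s / eta).
    by apply: ler_wpM2l; [exact: ltW|apply: ler_wpM2r => //; rewrite invr_ge0 ltW].
  rewrite !mulrDr; lra.
have [i1 l1] := moll_variation s0 (sv n) mchi chi01 inc9.
have l2 : \int[@leb2 R]_x (bump 1 a b x * (moll s (v n) x - moll s w x) ^+ 2) <= e / 9.
  by near: n; apply: cvg0_near_le => //; exact: (weak_moll_cvg a b s0 sv sw hM weak).
have smw := sqintB (sqint_moll s0 sw) sw; have smv := sqint_moll s0 (sv n).
have smm := sqintB smv (sqint_moll s0 sw).
have bnd (f : mplane -> R) : sqint leb2 f -> integ leb2 (fun x => bump 1 a b x * f x ^+ 2) /\
    \int[@leb2 R]_x (bump 1 a b x * f x ^+ 2) <= \int[@leb2 R]_x (f x ^+ 2).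
  move=> sf; apply: le_Rintegral_bound; last exact: sf.2.
    by apply: measurable_funM => //; apply: integ_measurable; exact: sf.2.
  move=> x; have /andP[c0 c1] := chi01 x.
  by rewrite mulr_ge0 ?sqr_ge0//= ler_piMl// sqr_ge0.
have [i2 _] := bnd _ smm; have [i3 l3] := bnd _ smw.
have [i4 _] := bnd _ (sqintB (sv n) sw).
rewrite sub0r normrN ger0_norm; last first.
  apply: Rintegral_ge0 => x _; apply: mulr_ge0; last exact: sqr_ge0.
  exact: bump_ge0.
have j12 := integD i1 i2; have j := integZ 3 (integD j12 i3).
apply: le_trans (le_RintegralT i4 j _) _; last first.
  rewrite (RintegralZT 3 (integD j12 i3)) (RintegralDT j12 i3) (RintegralDT i1 i2).
  have l4 := le_trans l3 hm3.
  by apply: le_trans (ler_wpM2l (ler0n _ 3) (lerD (lerD l1 l2) l4)) _; lra.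
move=> x; have /andP[c0 _] := chi01 x.
rewrite -!mulrDr (_ : 3 * _ = bump 1 a b x * (3 * ((moll s (v n) x - v n x) ^+ 2 +
  (moll s (v n) x - moll s w x) ^+ 2 + (moll s w x - w x) ^+ 2))); last by ring.
apply: ler_wpM2l => //.
move: (moll s (v n) x) (moll s w x) (v n x) (w x) => p q f g.
rewrite -subr_ge0 (_ : _ - _ = (p - f + (p - q)) ^+ 2 + (p - q - (q - g)) ^+ 2 + (p - f + (q - g)) ^+ 2); last by ring.
by rewrite !addr_ge0// sqr_ge0.
Unshelve. all: by end_near.
Qed.

End local_convergence.

(** * From local to global convergence *)

Section global_convergence.
Context {R : realType}.
Local Notation plane := (R * R)%type.
Local Notation mplane := (measurableTypeR R * measurableTypeR R)%type.
Implicit Types (x y z h a b : plane).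
Variables (Omega : set plane) (rd : R).
Hypotheses (oOmega : open Omega) (bOmega : Omega `<=` square 0 rd).

(** A closed box not contained in [Omega] gets the zero function, so that every index yields an
    admissible cutoff. *)
Definition cell (q : (rat * rat) * (rat * rat)) : mplane -> R :=
  if `[< cbox (qpt q.1) (qpt q.2) `<=` Omega >] then bump 1 (qpt q.1) (qpt q.2) else fun=> 0.
Definition cells (j : nat) : mplane -> R :=
  if unpickle j is Some q then cell q else fun=> 0.

Lemma cellsP j : cells j = (fun=> 0) \/
  exists a b, cbox a b `<=` Omega /\ cells j = bump 1 a b.
Proof.
rewrite /cells; case: (unpickle j) => [q|]; last by left.
rewrite /cell; case: asboolP => h; last by left.
by right; exists (qpt q.1), (qpt q.2).
Qed.

Lemma cells01 j x : 0 <= cells j x <= 1.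
Proof.
case: (cellsP j) => [->|[a [b [_ ->]]]]; first by rewrite lexx ler01.
by rewrite bump_ge0 bump_le1.
Qed.

Lemma cells_out j x : ~ Omega x -> cells j x = 0.
Proof.
case: (cellsP j) => [->|[a [b [h ->]]]] // nx; apply: bump_eq0 => //.
by move=> /box_subset_cbox /h.
Qed.

Lemma cells_gt0 x : Omega x -> exists j, 0 < cells j x.
Proof.
move=> /(open_rat_box oOmega) [q [hq sub]]; exists (pickle q).
rewrite /cells pickleK /cell (asboolT sub).
exact: bump_gt0.
Qed.

Lemma measurable_cells j : measurable_fun setT (cells j).
Proof.
case: (cellsP j) => [->|[a [b [_ ->]]]]; first exact: measurable_cst.
exact: integ_measurable (bump_integ a b).
Qed.

Definition pou (J : nat) x : R := \sum_(j < J) cells j x.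
(** The factor [J] makes it equal to 1 from some [J] on at each point of [Omega], the truncation
    keeps it a cutoff, and the bound by [J%:R * pou J x] transfers local convergence to it. *)
Definition level (J : nat) x : R := Num.min 1 (J%:R * pou J x).

Lemma pou_ge0 J x : 0 <= pou J x.
Proof. by apply: sumr_ge0 => j _; have /andP[] := cells01 j x. Qed.

Lemma measurable_pou J : measurable_fun setT (pou J : mplane -> R).
Proof. by apply: measurable_sum => j; exact: measurable_cells. Qed.

Lemma measurable_level J : measurable_fun setT (level J : mplane -> R).
Proof.
apply: measurable_minr; first exact: measurable_cst.
by apply: measurable_funM; [exact: measurable_cst|exact: measurable_pou].
Qed.

Lemma level01 J x : 0 <= level J x <= 1.
Proof. by rewrite le_min ler01 mulr_ge0 ?pou_ge0//= ge_min lexx. Qed.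

Lemma level_out J x : ~ Omega x -> level J x = 0.
Proof.
move=> nx; rewrite /level /pou big1 => [|j _]; last exact: cells_out.
by rewrite mulr0 min_r.
Qed.

Lemma level_in J x : level J x <= \1_Omega x.
Proof.
rewrite indicE; case: (pselect (Omega x)) => [/mem_set ->|nx].
  by have /andP[] := level01 J x.
by rewrite level_out// memNset.
Qed.

Lemma level_cvg x : level J x @[J --> \oo] --> (\1_Omega x : R).
Proof.
case: (pselect (Omega x)) => [ox|nx]; last first.
  rewrite indicE memNset//; apply: cvg_near_cst; apply: nearW => J; exact: level_out.
rewrite indicE mem_set//; have [j hj] := cells_gt0 ox.
apply: cvg_near_cst.
have [N hN] : exists N : nat, 1 <= N%:R * cells j x.
  exists (Num.bound (cells j x)^-1); rewrite -ler_pdivrMr// div1r.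
  apply: ltW; apply: le_lt_trans (archi_boundP _); first exact: lexx.
  by rewrite invr_ge0 ltW.
exists (maxn N j.+1) => // J /=; rewrite geq_max => /andP[NJ jJ].
apply: min_l; apply: le_trans hN _.
apply: ler_pM; rewrite ?(ltW hj)// ?ler_nat//.
rewrite /pou (bigD1 (Ordinal jJ))//= lerDl.
by apply: sumr_ge0 => i _; have /andP[] := cells01 i x.
Qed.

Lemma indic_integ : integ leb2 (\1_Omega : mplane -> R).
Proof.
apply: (@integ_bounded_support _ _ (- rd, - rd) (rd, rd) 1).
- by apply: measurable_indic; exact: measurable_open.
- by move=> z; rewrite indicE ger0_norm// lern1 leq_b1.
- move=> z nz; rewrite indicE memNset// => /bOmega; rewrite square0; exact: nz.
Qed.

Lemma level_defect (f : mplane -> R) : integ leb2 f -> (forall x, 0 <= f x) ->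
  \int[@leb2 R]_x ((\1_Omega x - level J x) * f x) @[J --> \oo] --> (0 : R).
Proof.
move=> fi f0.
have := @dominated_Rintegral _ mplane R (@leb2 R)
  (fun J x => (\1_Omega x - level J x) * f x) (fun=> 0) f.
case.
- move=> J; apply: measurable_funM; last exact: integ_measurable fi.
  by apply: measurable_funB; [exact: integ_measurable indic_integ|exact: measurable_level].
- move=> J x; rewrite normrM (ger0_norm (f0 x)) ler_piMl//.
  have /andP[l0 _] := level01 J x.
  have i1 : \1_Omega x <= 1 :> R by rewrite indicE lern1 leq_b1.
  by rewrite ger0_norm ?subr_ge0 ?level_in//; lra.
- exact: fi.
- move=> x; rewrite -[X in _ --> X](mul0r (f x)); apply: cvgMr_tmp => //.
  rewrite -[X in _ --> X](subrr (\1_Omega x : R)).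
  by apply: cvgB; [exact: cvg_cst|exact: level_cvg].
by rewrite Rintegral_cst//= mul0r.
Qed.

Variables (u m : nat -> mplane -> R) (w : mplane -> R) (theta : nat -> R).
Hypotheses (su : forall n, sqint leb2 (u n)) (sw : sqint leb2 w).
Hypotheses (u_out : forall n x, ~ Omega x -> u n x = 0) (w_out : forall x, ~ Omega x -> w x = 0).
Hypotheses (m0 : forall n x, 0 <= m n x) (um : forall n x, u n x ^+ 2 <= 1 + m n x).
Hypotheses (mI : forall n, integ leb2 (m n) /\ \int[@leb2 R]_x m n x <= theta n)
  (theta_cvg : theta n @[n --> \oo] --> (0 : R)).
Hypothesis local : forall a b, cbox a b `<=` Omega ->
  \int[@leb2 R]_x (bump 1 a b x * (u n x - w x) ^+ 2) @[n --> \oo] --> (0 : R).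

Lemma pou_cvg J : (forall n, integ leb2 (fun x => pou J x * (u n x - w x) ^+ 2)) /\
  \int[@leb2 R]_x (pou J x * (u n x - w x) ^+ 2) @[n --> \oo] --> (0 : R).
Proof.
have d2 n := (sqintB (su n) sw).2.
have ci j n : integ leb2 (fun x => cells j x * (u n x - w x) ^+ 2).
  apply: le_integ (d2 n).
    by apply: measurable_funM; [exact: measurable_cells|exact: integ_measurable (d2 n)].
  move=> x; have /andP[c0 c1] := cells01 j x.
  have q := sqr_ge0 (u n x - w x); by rewrite ger0_norm; [exact: ler_piMl|exact: mulr_ge0].
have cc j : \int[@leb2 R]_x (cells j x * (u n x - w x) ^+ 2) @[n --> \oo] --> (0 : R).
  case: (cellsP j) => [->|[a [b [sub ->]]]]; last exact: local.
  apply: cvg_near_cst; apply: nearW => n.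
  by under eq_Rintegral => x _ do rewrite mul0r; rewrite Rintegral_cst//= mul0r.
elim: J => [|J [IH1 IH2]].
  have E n : (fun x => pou 0 x * (u n x - w x) ^+ 2) = (fun=> 0).
    by apply/funext => x; rewrite /pou big_ord0 mul0r.
  split; first by move=> n; rewrite E; apply: integrable0.
  by apply: cvg_near_cst; apply: nearW => n; rewrite E Rintegral_cst//= mul0r.
have E n : (fun x => pou J.+1 x * (u n x - w x) ^+ 2) =
    (fun x => pou J x * (u n x - w x) ^+ 2 + cells J x * (u n x - w x) ^+ 2).
  by apply/funext => x; rewrite /pou big_ord_recr /= mulrDl.
split; first by move=> n; rewrite E; exact: integD.
under eq_fun => n do rewrite E (RintegralDT (IH1 n) (ci J n)).
have := cvgD IH2 (cc J); rewrite addr0; exact.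
Qed.

(** [J] is fixed first, from the two defects that do not involve [n]; for that [J] only finitely
    many bumps are in play, and their local convergence fixes [n]. *)
Lemma global_convergence : \int[@leb2 R]_x ((u n x - w x) ^+ 2) @[n --> \oo] --> (0 : R).
Proof.
have d2 n := (sqintB (su n) sw).2.
apply/cvgrPdist_le => e e0.
(* Seven eighths are spent: one on the local part, and twice three on the defects of 1 and of
   [w ^+ 2] and on [m n]. *)
have e8 : 0 < e / 8 by rewrite divr_gt0.
have [J [hJ1 hJ2]] : exists J, \int[@leb2 R]_x ((\1_Omega x - level J x) * \1_Omega x) <= e / 8 /\
    \int[@leb2 R]_x ((\1_Omega x - level J x) * (w x ^+ 2)) <= e / 8.
  near \oo => J; exists J; split; near: J; apply: cvg0_near_le => //; apply: level_defect.
  - exact: indic_integ.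
  - by move=> x; rewrite indicE.
  - exact: sw.2.
  - by move=> x; exact: sqr_ge0.
have [pI pC] := pou_cvg J.
have J1 : 0 < J%:R + 1 :> R by rewrite ltr_wpDl.
near=> n.
have hp : \int[@leb2 R]_x (pou J x * (u n x - w x) ^+ 2) <= e / 8 / (J%:R + 1).
  by near: n; apply: cvg0_near_le pC; rewrite divr_gt0.
have ht : theta n <= e / 8 by near: n; exact: cvg0_near_le theta_cvg.
rewrite sub0r normrN ger0_norm; last by apply: Rintegral_ge0 => x _; exact: sqr_ge0.
have mdef : measurable_fun setT (fun x : mplane => \1_Omega x - level J x).
  by apply: measurable_funB; [exact: integ_measurable indic_integ|exact: measurable_level].
have def01 x : 0 <= \1_Omega x - level J x <= 1.
  have /andP[l0 _] := level01 J x; rewrite subr_ge0 level_in /=.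
  have i1 : \1_Omega x <= 1 :> R by rewrite indicE lern1 leq_b1.
  lra.
have di (f : mplane -> R) : integ leb2 f -> (forall x, 0 <= f x) ->
    integ leb2 (fun x => (\1_Omega x - level J x) * f x).
  move=> fi f0; apply: le_integ (fi); first by apply: measurable_funM => //; exact: integ_measurable fi.
  by move=> x; have /andP[c0 c1] := def01 x; rewrite ger0_norm ?mulr_ge0 ?f0//; apply: ler_piMl.
have I1 := integZ J%:R (pI n).
have I2 := di _ indic_integ (fun x => ltac:(by rewrite indicE)).
have I3 := di _ sw.2 (fun x => sqr_ge0 _).
have [I4 l4] := mI n.
have K3 := integD (integD I2 I4) I3.
have K := integD I1 (integZ 2 K3).
apply: le_trans (le_RintegralT (d2 n) K _) _; last first.
  rewrite (RintegralDT I1 (integZ 2 K3)) (RintegralZT _ (pI n)) (RintegralZT 2 K3)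
    (RintegralDT (integD I2 I4) I3) (RintegralDT I2 I4).
  have hJ : J%:R * \int[@leb2 R]_x (pou J x * (u n x - w x) ^+ 2) <= e / 8.
    apply: le_trans (ler_wpM2l (ler0n _ _) hp) _.
    rewrite mulrA ler_pdivrMr// mulrC; apply: ler_wpM2l; first exact: ltW.
    by rewrite lerDl.
  apply: le_trans (lerD hJ (ler_wpM2l (ler0n _ 2) (lerD (lerD hJ1 (le_trans l4 ht)) hJ2))) _.
  lra.
move=> x; case: (pselect (Omega x)) => ox; last first.
  rewrite (u_out n ox) (w_out ox) subrr expr0n /= indicE memNset// level_out// subrr !mul0r add0r addr0.
  apply: addr_ge0; last by apply: mulr_ge0.
  by apply: mulr_ge0 => //; apply: mulr_ge0; rewrite ?pou_ge0.
rewrite indicE mem_set//= mulr1.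
have /andP[l0 l1] := level01 J x.
have lp : level J x <= J%:R * pou J x by rewrite ge_min lexx orbT.
have h1 := um n x; have mm := m0 n x.
move: (level J x) (pou J x) (u n x) (w x) (m n x) l0 l1 lp h1 mm => l p f g k l0 l1 lp h1 mm.
(* The weight is split as [l + (1 - l)]: the difference is kept under [l], and the two squares are
   bounded separately under [1 - l]. *)
apply: (@le_trans _ _ (l * (f - g) ^+ 2 + 2 * ((1 - l) * f ^+ 2 + (1 - l) * g ^+ 2))).
  have q : (f - g) ^+ 2 <= 2 * f ^+ 2 + 2 * g ^+ 2.
    by have := sqr_ge0 (f + g); rewrite sqrrB sqrrD; lra.
  rewrite -subr_ge0 (_ : _ - _ = (1 - l) * (2 * f ^+ 2 + 2 * g ^+ 2 - (f - g) ^+ 2)); last by ring.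
  by apply: mulr_ge0; rewrite subr_ge0.
apply: lerD.
  by rewrite mulrA; apply: ler_wpM2r => //; exact: sqr_ge0.
apply: ler_wpM2l => //; rewrite lerD2r.
apply: (@le_trans _ _ ((1 - l) * (1 + k))); first by apply: ler_wpM2l; rewrite ?subr_ge0.
by rewrite mulrDr mulr1 lerD2l ler_piMl//; lra.
Unshelve. all: by end_near.
Qed.

End global_convergence.

(** * Values and variation of the limit *)

Section limit_properties.
Context {R : realType}.
Local Notation plane := (R * R)%type.
Local Notation mplane := (measurableTypeR R * measurableTypeR R)%type.
Implicit Types (x y z : plane).

Lemma sqint_nrmp (f1 f2 : mplane -> R) : sqint leb2 f1 -> sqint leb2 f2 ->
  integ leb2 (fun x => nrmp (f1 x, f2 x)) /\
  \int[@leb2 R]_x nrmp (f1 x, f2 x) = \int[@leb2 R]_x (f1 x ^+ 2) + \int[@leb2 R]_x (f2 x ^+ 2).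
Proof.
move=> [_ i1] [_ i2]; split; first exact: integD i1 i2.
exact: (RintegralDT i1 i2).
Qed.

Lemma cvg_nrmp (f1 f2 : nat -> mplane -> R) : (forall n, sqint leb2 (f1 n)) ->
  (forall n, sqint leb2 (f2 n)) ->
  \int[@leb2 R]_x (f1 n x ^+ 2) @[n --> \oo] --> (0 : R) ->
  \int[@leb2 R]_x (f2 n x ^+ 2) @[n --> \oo] --> (0 : R) ->
  \int[@leb2 R]_x nrmp (f1 n x, f2 n x) @[n --> \oo] --> (0 : R).
Proof.
move=> s1 s2 c1 c2; under eq_fun => n do rewrite (sqint_nrmp (s1 n) (s2 n)).2.
by have := cvgD c1 c2; rewrite addr0; exact.
Qed.

Lemma dsq_eq0 z : dsq z = 0 -> ideal z.
Proof.
rewrite /dsq /ideal; case: leP => _; first by left.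
by move/eqP; rewrite sqrf_eq0 subr_eq0 => /eqP h; right; rewrite -euclid_sq h expr1n.
Qed.

(** The squared distance of the limit to the ideal set is at most twice that of the sequence plus
    [2 |u n - w|^2]; both have integrals tending to 0. *)
Lemma ideal_limit (u1 u2 : nat -> mplane -> R) (w1 w2 : mplane -> R) (theta : nat -> R) :
  (forall n, sqint leb2 (u1 n)) -> (forall n, sqint leb2 (u2 n)) ->
  sqint leb2 w1 -> sqint leb2 w2 ->
  (forall n, integ leb2 (fun x => mdist (nrm2 (u1 n x) (u2 n x))) /\
    \int[@leb2 R]_x mdist (nrm2 (u1 n x) (u2 n x)) <= theta n) ->
  theta n @[n --> \oo] --> (0 : R) ->
  \int[@leb2 R]_x ((u1 n x - w1 x) ^+ 2) @[n --> \oo] --> (0 : R) ->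
  \int[@leb2 R]_x ((u2 n x - w2 x) ^+ 2) @[n --> \oo] --> (0 : R) ->
  {ae leb2, forall x : mplane, ideal (w1 x, w2 x)}.
Proof.
move=> s1 s2 sw1 sw2 md th c1 c2.
have d1 n := sqintB (s1 n) sw1; have d2 n := sqintB (s2 n) sw2.
have cn := cvg_nrmp d1 d2 c1 c2.
have [iw _] := sqint_nrmp sw1 sw2.
have mw := measurable_comp2 continuous_dsq sw1.1 sw2.1.
have wi : integ leb2 (fun x => dsq (w1 x, w2 x)).
  by apply: le_integ iw => // x; rewrite ger0_norm ?dsq_ge0// ge_min lexx.
suff : \int[@leb2 R]_x dsq (w1 x, w2 x) = 0.
  by move/(Rintegral_eq0_ae wi (fun x => dsq_ge0 _)); apply: ae_mono => x; exact: dsq_eq0.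
apply/eqP; rewrite eq_le; apply/andP; split; last by apply: Rintegral_ge0 => x _; exact: dsq_ge0.
have cc : (2 * theta n + 2 * \int[@leb2 R]_x nrmp (u1 n x - w1 x, u2 n x - w2 x)) @[n --> \oo] --> (0 : R).
  have := cvgD (cvgMl_tmp (a := 2) th) (cvgMl_tmp (a := 2) cn).
  by rewrite !mulr0 addr0; exact.
apply: (cvgr_to_ge cc); apply: nearW => n.
have [im lm] := md n; have [ni _] := sqint_nrmp (d1 n) (d2 n).
apply: le_trans (le_RintegralT wi (integD (integZ 2 im) (integZ 2 ni)) _) _.
  move=> x; apply: le_trans (dsq_approx _ (u1 n x, u2 n x)) _.
  apply: lerD; apply: ler_wpM2l => //; first exact: (dsq_le_mdist (u1 n x, u2 n x)).
  by rewrite /nrmp /nrm2 /= -(sqrrN (u1 n x - w1 x)) -(sqrrN (u2 n x - w2 x)) !opprB.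
rewrite (RintegralDT (integZ 2 im) (integZ 2 ni)) (RintegralZT _ im) (RintegralZT _ ni).
by rewrite lerD2r; apply: ler_wpM2l.
Qed.

Lemma ramp00 : ramp 0 0 = 0 :> R.
Proof. by rewrite /ramp /entF /nrm2 expr0n /= addr0 expr0n /= mul0r mulr0. Qed.

Lemma ramp_ideal z : ideal z -> ramp z.1 z.2 = enorm z.
Proof.
rewrite /enorm -/(nrm2 z.1 z.2) -/(nrmp z) /ramp /entF -/(nrmp z) => -[->|->].
  by rewrite sqrtr0 expr0n /= mul0r mulr0.
have -> : cut (1 : R) = 1 / 2 by rewrite /cut div1r.
by rewrite sqrtr1 expr1n; lra.
Qed.

Lemma sqint_ramp (f1 f2 : mplane -> R) : sqint leb2 f1 -> sqint leb2 f2 ->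
  sqint leb2 (fun x => ramp (f1 x) (f2 x)).
Proof.
move=> s1 s2; have m : measurable_fun setT (fun x : mplane => ramp (f1 x) (f2 x)).
  exact: (measurable_comp2 continuous_ramp s1.1 s2.1).
split => //; have [i _] := sqint_nrmp s1 s2.
apply: le_integ (integZ (64 ^+ 2 * 2) i); first exact: measurable_funX.
move=> x; rewrite ger0_norm ?sqr_ge0//.
have := lip_ramp (f1 x, f2 x) 0; rewrite /= ramp00 !subr0 => h.
rewrite -(real_normK (num_real (ramp _ _))) -mulrA.
apply: (@le_trans _ _ ((64 * nrm1 (f1 x, f2 x)) ^+ 2)).
  by apply: lerXn2r => //; rewrite nnegrE mulr_ge0// nrm1_ge0.
by rewrite exprMn; apply: ler_wpM2l; [exact: sqr_ge0|exact: nrm1_sq].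
Qed.

(** Strong convergence is essential here: [ramp] is nonlinear but Lipschitz, so it preserves L2
    convergence. *)
Lemma ramp_cvg (v1 v2 : nat -> mplane -> R) (w1 w2 f : mplane -> R) :
  (forall n, sqint leb2 (v1 n)) -> (forall n, sqint leb2 (v2 n)) ->
  sqint leb2 w1 -> sqint leb2 w2 -> sqint leb2 f ->
  \int[@leb2 R]_x ((v1 n x - w1 x) ^+ 2) @[n --> \oo] --> (0 : R) ->
  \int[@leb2 R]_x ((v2 n x - w2 x) ^+ 2) @[n --> \oo] --> (0 : R) ->
  \int[@leb2 R]_x (ramp (v1 n x) (v2 n x) * f x) @[n --> \oo] -->
  \int[@leb2 R]_x (ramp (w1 x) (w2 x) * f x).
Proof.
move=> s1 s2 sw1 sw2 sf c1 c2.
have d1 n := sqintB (s1 n) sw1; have d2 n := sqintB (s2 n) sw2.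
have cn := cvg_nrmp d1 d2 c1 c2.
have rv n := sqint_ramp (s1 n) (s2 n); have rw := sqint_ramp sw1 sw2.
apply: (cvg_ip (sqint_semi_inner (@leb2 R)) (f := fun n x => ramp (v1 n x) (v2 n x)) rv rw sf).
apply: (@squeeze_cvgr _ _ _ _ (fun=> 0)
  (fun n => 64 ^+ 2 * 2 * \int[@leb2 R]_x nrmp (v1 n x - w1 x, v2 n x - w2 x))).
- apply: nearW => n; rewrite ip2E; apply/andP; split.
    by apply: Rintegral_ge0 => x _; exact: sqr_ge0.
  have [i _] := sqint_nrmp (d1 n) (d2 n).
  rewrite -(RintegralZT _ i); apply: le_RintegralT; [exact: (sqintB (rv n) rw).2|exact: integZ i|].
  move=> x; have := lip_ramp (v1 n x, v2 n x) (w1 x, w2 x) => /= h.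
  rewrite -(real_normK (num_real _)) -mulrA.
  apply: (@le_trans _ _ ((64 * nrm1 (v1 n x - w1 x, v2 n x - w2 x)) ^+ 2)).
    by apply: lerXn2r => //; rewrite nnegrE mulr_ge0// nrm1_ge0.
  by rewrite exprMn; apply: ler_wpM2l; [exact: sqr_ge0|exact: nrm1_sq].
- exact: cvg_cst.
- by have := cvgMl_tmp (a := 64 ^+ 2 * 2) cn; rewrite mulr0; exact.
Qed.

Variables (Omega : set plane) (K rd : R) (eps delta : nat -> R).
Variables (v1 v2 : nat -> plane -> R) (dens : nat -> mplane -> R).
Hypotheses (oOmega : open Omega) (bOmega : Omega `<=` square 0 rd) (eps0 : forall n, 0 < eps n).
Hypothesis (delta_cvg : delta n @[n --> \oo] --> (0 : R)).
Hypotheses (c1 : forall n, C1b (v1 n)) (c2 : forall n, C1b (v2 n)).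
Hypotheses (dens_ge0 : forall n x, 0 <= dens n x)
  (densI : forall n, integ leb2 (dens n) /\ \int[@leb2 R]_x dens n x <= K)
  (densE : forall n x, square x (delta n) `<=` Omega ->
    kap (v1 n x) (v2 n x) ^+ 2 / eps n + eps n * gradsq (v1 n) (v2 n) x = dens n x).

Lemma support_in (phi : plane -> R) : compact_support_in Omega phi ->
  supp_in rd phi /\ forall x, phi x != 0 -> closure [set x | phi x != 0] x.
Proof.
move=> [_ sub]; have cl x : phi x != 0 -> closure [set x | phi x != 0] x.
  by move=> h; exact: subset_closure.
split => // z nz; apply: contrapT => /eqP pz; apply: nz; apply: bOmega; apply: sub; exact: cl.
Qed.

(** The bound is the same for all test fields; only the rank from which it holds depends on them,
    since [delta n] must fit between their supports and the complement of [Omega]. *)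
Lemma variation_bound (phi1 phi2 : plane -> R) : C1c Omega phi1 -> C1c Omega phi2 ->
  (forall x, `|phi1 x| <= 1) -> (forall x, `|phi2 x| <= 1) ->
  \forall n \near \oo,
  \int[@leb2 R]_x (ramp (v1 n x) (v2 n x) * ('D_e1 phi1 x + 'D_e2 phi2 x)) <= 256 * K.
Proof.
move=> [C1 cs1] [C2 cs2] b1 b2.
have [sp1 cl1] := support_in cs1; have [sp2 cl2] := support_in cs2.
have f1 := C1b_supp C1 sp1; have f2 := C1b_supp C2 sp2.
have [r r0 hr] : exists2 r : R, 0 < r & forall x,
    (closure [set x | phi1 x != 0] `|` closure [set x | phi2 x != 0]) x -> square x r `<=` Omega.
  apply: compact_square => //; first by apply: compactU; [exact: cs1.1|exact: cs2.1].
  by move=> x []; [exact: cs1.2|exact: cs2.2].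
have dr : \forall n \near \oo, delta n <= r by exact: cvg0_near_le.
apply: filterS dr => n dn.
have cr := C1b_ramp (c1 n) (c2 n); pose F x := ramp (v1 n x) (v2 n x).
have iM (p q : plane -> R) : continuous p -> continuous q -> supp_in rd q -> integ leb2 (fun x => p x * q x).
  move=> cp cq sq; apply: (@integ_supp _ rd); first exact: continuousMf.
  by move=> z hz; rewrite (sq _ hz) mulr0.
have sD (p : plane -> R) v : supp_in rd p -> supp_in rd (fun z => 'D_v p z).
  by move=> sp; exact: supp_in_derive.
have cF := C1b_continuous cr.
have i1 := iM _ _ cF (C1b_continuous1 f1) (sD _ e1 sp1).
have i2 := iM _ _ cF (C1b_continuous2 f2) (sD _ e2 sp2).
have j1 := iM _ _ (C1b_continuous1 cr) (C1b_continuous f1) sp1.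
have j2 := iM _ _ (C1b_continuous2 cr) (C1b_continuous f2) sp2.
under eq_Rintegral => x _ do rewrite mulrDr.
rewrite (RintegralDT i1 i2).
have P1 := by_parts1 cr f1 sp1; have P2 := by_parts2 cr f2 sp2.
rewrite (_ : \int[@leb2 R]_x (F x * 'D_e1 phi1 x) = - \int[@leb2 R]_x ('D_e1 F x * phi1 x)); last by rewrite P1 opprK.
rewrite (_ : \int[@leb2 R]_x (F x * 'D_e2 phi2 x) = - \int[@leb2 R]_x ('D_e2 F x * phi2 x)); last by rewrite P2 opprK.
rewrite -opprD -(RintegralDT j1 j2).
have [di dl] := densI n.
apply: le_trans (ler_norm _) _; rewrite normrN.
apply: le_trans (norm_RintegralT (integD j1 j2)) _.
apply: (@le_trans _ _ (256 * \int[@leb2 R]_x dens n x)); last by apply: ler_wpM2l; [exact: ler0n|exact: dl].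
rewrite -(RintegralZT 256 di).
apply: le_RintegralT; [exact: integ_norm (integD j1 j2)|exact: integZ di|].
(* Where both components vanish the integrand is 0; elsewhere the square of radius [delta n] about
   [x] lies in [Omega] and [densE] applies. *)
move=> x; have [z1|nz1] := eqVneq (phi1 x) 0; have [z2|nz2] := eqVneq (phi2 x) 0.
  rewrite z1 z2 !mulr0 addr0 normr0; exact: mulr_ge0 (ler0n _ _) (dens_ge0 n x).
all: have sq : square x (delta n) `<=` Omega by
  apply: subset_trans (square_mono dn) (hr x _); by [left; exact: cl1|right; exact: cl2].
all: have := grad_ramp_le (c1 n) (c2 n) x (eps0 n); rewrite (densE sq); apply: le_trans.
all: apply: le_trans (ler_normD _ _) _; apply: lerD.
all: by rewrite normrM; apply: ler_piMr.
Qed.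

End limit_properties.

(** * Strong compactness of bounded energy sequences *)

Section compactness.
Context {R : realType}.
Local Notation plane := (R * R)%type.
Local Notation mplane := (measurableTypeR R * measurableTypeR R)%type.
Implicit Types (x y z a b : plane).

(** The energy bound after extension by 0: [g] is the divergence, [d1] and [d2] are the derivatives
    of [u1], [d3] and [d4] those of [u2], and [theta] is the rate at which the values approach the
    ideal set. *)
Record energy_data (Omega : set plane) (C M : R) (eps theta : nat -> R)
    (u1 u2 g d1 d2 d3 d4 : nat -> mplane -> R) : Prop := {
  ed_eps : forall n, 0 < eps n;
  ed_u1 : forall n, sqint leb2 (u1 n); ed_u2 : forall n, sqint leb2 (u2 n);
  ed_g : forall n, sqint leb2 (g n);
  ed_d1 : forall n, sqint leb2 (d1 n); ed_d2 : forall n, sqint leb2 (d2 n);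
  ed_d3 : forall n, sqint leb2 (d3 n); ed_d4 : forall n, sqint leb2 (d4 n);
  ed_out1 : forall n x, ~ Omega x -> u1 n x = 0;
  ed_out2 : forall n x, ~ Omega x -> u2 n x = 0;
  ed_w1 : forall n, weak_D Omega e1 (u1 n) (d1 n);
  ed_w2 : forall n, weak_D Omega e2 (u1 n) (d2 n);
  ed_w3 : forall n, weak_D Omega e1 (u2 n) (d3 n);
  ed_w4 : forall n, weak_D Omega e2 (u2 n) (d4 n);
  ed_wg : forall n, weak_dv Omega (u1 n) (u2 n) (g n);
  ed_kap : forall n, integ leb2 (fun x => kap (u1 n x) (u2 n x) ^+ 2) /\
    \int[@leb2 R]_x (kap (u1 n x) (u2 n x) ^+ 2) <= C * eps n;
  ed_mdist : forall n, integ leb2 (fun x => mdist (nrm2 (u1 n x) (u2 n x))) /\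
    \int[@leb2 R]_x (mdist (nrm2 (u1 n x) (u2 n x))) <= theta n;
  ed_e1 : forall n, eps n * \int[@leb2 R]_x (d1 n x ^+ 2) <= C;
  ed_e2 : forall n, eps n * \int[@leb2 R]_x (d2 n x ^+ 2) <= C;
  ed_e3 : forall n, eps n * \int[@leb2 R]_x (d3 n x ^+ 2) <= C;
  ed_e4 : forall n, eps n * \int[@leb2 R]_x (d4 n x ^+ 2) <= C;
  ed_eg : forall n, \int[@leb2 R]_x (g n x ^+ 2) <= C;
  ed_m1 : forall n, \int[@leb2 R]_x (u1 n x ^+ 2) <= M;
  ed_m2 : forall n, \int[@leb2 R]_x (u2 n x ^+ 2) <= M }.

Lemma ip2_small (f : nat -> mplane -> R) (h : mplane -> R) : (forall n, sqint leb2 (f n)) ->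
  sqint leb2 h -> \int[@leb2 R]_x (f n x ^+ 2) @[n --> \oo] --> (0 : R) ->
  ip2 leb2 (f n) h @[n --> \oo] --> (0 : R).
Proof.
move=> sf sh c.
have s0 : sqint leb2 (0 : mplane -> R).
  by split; [exact: measurable_cst|rewrite /integ; under eq_fun do rewrite expr0n /=; exact: integrable0].
have := cvg_ip (sqint_semi_inner (@leb2 R)) sf s0 sh.
have -> : ip2 leb2 (0 : mplane -> R) h = 0.
  by rewrite /ip2; under eq_Rintegral => x _ do rewrite mul0r; rewrite Rintegral_cst//= mul0r.
apply; under eq_fun => n do rewrite subr0 ip2E; exact: c.
Qed.

Lemma mdist_ge0 (s : R) : 0 <= s -> 0 <= mdist s.
Proof. by move=> s0; rewrite le_min s0 normr_ge0. Qed.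

Lemma le_mdist (s : R) : s <= 1 + mdist s.
Proof.
rewrite /mdist; have [_|_] := leP s `|1 - s|; first by rewrite lerDr.
have := ler_norm (- (1 - s)); rewrite normrN; lra.
Qed.

Lemma Cinfc_C1c (Omega : set plane) phi : Cinfc Omega phi -> C1c Omega phi.
Proof. by case=> h ?; split; [exact: h|]. Qed.

Lemma C1c_sqint (Omega : set plane) (rd : R) phi : Omega `<=` square 0 rd -> C1c Omega phi ->
  [/\ sqint leb2 (phi : mplane -> R), sqint leb2 ((fun x => 'D_e1 phi x) : mplane -> R) &
    sqint leb2 ((fun x => 'D_e2 phi x) : mplane -> R)].
Proof.
move=> bO Cphi.
have [sp _] := support_in bO Cphi.2.
have C1 := C1b_supp Cphi.1 sp.
have sq (f : plane -> R) : continuous f -> supp_in rd f -> sqint leb2 f.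
  move=> cf sf; split; first exact: measurable_continuous.
  apply: (@integ_supp _ rd) => [|z nz]; first exact: (continuousMf cf cf).
  by rewrite (sf _ nz) expr0n.
split; first exact: sq _ (C1b_continuous C1) sp.
  exact: sq _ (C1b_continuous1 C1) (@supp_in_derive _ rd phi e1 sp).
exact: sq _ (C1b_continuous2 C1) (@supp_in_derive _ rd phi e2 sp).
Qed.

Section strong.
Variables (Omega : set plane) (rd C M : R) (eps theta : nat -> R).
Variables (u1 u2 g d1 d2 d3 d4 : nat -> mplane -> R) (w1 w2 : mplane -> R).
Hypotheses (oOmega : open Omega) (bOmega : Omega `<=` square 0 rd).
Hypothesis E : energy_data Omega C M eps theta u1 u2 g d1 d2 d3 d4.
Hypotheses (eps_cvg : eps n @[n --> \oo] --> (0 : R)) (theta_cvg : theta n @[n --> \oo] --> (0 : R)).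
Hypotheses (sw1 : sqint leb2 w1) (sw2 : sqint leb2 w2).
Hypotheses (out1 : forall x, ~ Omega x -> w1 x = 0) (out2 : forall x, ~ Omega x -> w2 x = 0).
Hypotheses
  (weak1 : forall f : mplane -> R, sqint leb2 f -> ip2 leb2 (u1 n) f @[n --> \oo] --> ip2 leb2 w1 f)
  (weak2 : forall f : mplane -> R, sqint leb2 f -> ip2 leb2 (u2 n) f @[n --> \oo] --> ip2 leb2 w2 f).

Lemma close_local (v u : nat -> mplane -> R) (w : mplane -> R) a b :
  (forall n, sqint leb2 (v n)) -> (forall n, sqint leb2 (u n)) -> sqint leb2 w ->
  \int[@leb2 R]_x ((v n x - u n x) ^+ 2) @[n --> \oo] --> (0 : R) ->
  \int[@leb2 R]_x (bump 1 a b x * (v n x - w x) ^+ 2) @[n --> \oo] --> (0 : R) ->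
  \int[@leb2 R]_x (bump 1 a b x * (u n x - w x) ^+ 2) @[n --> \oo] --> (0 : R).
Proof.
move=> sv su sw c1 c2.
have chi01 x : 0 <= bump 1 a b x <= 1 by rewrite bump_ge0 bump_le1.
have mchi : measurable_fun setT (bump 1 a b : mplane -> R) := integ_measurable (bump_integ a b).
have bi (f : mplane -> R) : sqint leb2 f -> integ leb2 (fun x => bump 1 a b x * f x ^+ 2).
  move=> sf; apply: le_integ sf.2.
    by apply: measurable_funM => //; apply: integ_measurable; exact: sf.2.
  move=> x; have /andP[q0 q1] := chi01 x; have f0 := sqr_ge0 (f x).
  by rewrite ger0_norm; [exact: ler_piMl|exact: mulr_ge0].
apply: (@squeeze_cvgr _ _ _ _ (fun=> 0) (fun n => 2 * \int[@leb2 R]_x ((v n x - u n x) ^+ 2) +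
   2 * \int[@leb2 R]_x (bump 1 a b x * (v n x - w x) ^+ 2))).
- apply: nearW => n; apply/andP; split.
    by apply: Rintegral_ge0 => x _; apply: mulr_ge0; [exact: bump_ge0|exact: sqr_ge0].
  have i1 := (sqintB (sv n) (su n)).2; have i2 := bi _ (sqintB (sv n) sw).
  rewrite -(RintegralZT 2 i1) -(RintegralZT 2 i2) -(RintegralDT (integZ 2 i1) (integZ 2 i2)).
  apply: le_RintegralT; [exact: bi (sqintB (su n) sw)|exact: integD (integZ 2 i1) (integZ 2 i2)|].
  move=> x; have /andP[q0 q1] := chi01 x.
  move: (bump 1 a b x) (v n x) (u n x) (w x) q0 q1 => c p f q q0 q1.
  apply: (@le_trans _ _ (c * (2 * (p - f) ^+ 2 + 2 * (p - q) ^+ 2))).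
    apply: ler_wpM2l => //; rewrite -subr_ge0 (_ : _ - _ = (p - f + (p - q)) ^+ 2); last by ring.
    exact: sqr_ge0.
  rewrite mulrDr; apply: lerD; last by rewrite le_eqVlt; apply/orP; left; apply/eqP; ring.
  by apply: ler_piMl => //; apply: mulr_ge0 => //; exact: sqr_ge0.
- exact: cvg_cst.
- by have := cvgD (cvgMl_tmp (a := 2) c1) (cvgMl_tmp (a := 2) c2); rewrite !mulr0 addr0; exact.
Qed.

(** The entropies act on the mollified fields [V1], [V2], but the passage to global convergence is
    made for [u1], [u2], which vanish off [Omega] and satisfy [u ^+ 2 <= 1 + m]. *)
Lemma strong_limit : [/\
  \int[@leb2 R]_x ((u1 n x - w1 x) ^+ 2) @[n --> \oo] --> (0 : R),
  \int[@leb2 R]_x ((u2 n x - w2 x) ^+ 2) @[n --> \oo] --> (0 : R),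
  {ae leb2, forall x : mplane, ideal (w1 x, w2 x)} &
  forall phi1 phi2 : plane -> R, C1c Omega phi1 -> C1c Omega phi2 ->
    (forall x, `|phi1 x| <= 1) -> (forall x, `|phi2 x| <= 1) ->
    \int[@leb2 R]_x (ramp (w1 x) (w2 x) * ('D_e1 phi1 x + 'D_e2 phi2 x)) <= 256 * (6 * C + 288)].
Proof.
have [eps0 su1 su2 sg sd1 sd2 sd3 sd4 o1 o2 wd1 wd2 wd3 wd4 wg kE mE q1 q2 q3 q4 qg m1 m2] := E.
have [delta hd] := choice (fun n => exists_scale (eps0 n) (su1 n) (su2 n)).
have d0 n : 0 < delta n := delta_gt0 hd n.
have delta_cvg : delta n @[n --> \oo] --> (0 : R).
  apply: (@squeeze_cvgr _ _ _ _ (fun=> 0) eps) => //; last exact: cvg_cst.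
  by apply: nearW => n; have [/andP[/ltW -> _] -> _ _] := hd n.
pose V1 n : mplane -> R := moll (delta n) (u1 n); pose V2 n : mplane -> R := moll (delta n) (u2 n).
have sV1 n : sqint leb2 (V1 n) by exact: sqint_moll.
have sV2 n : sqint leb2 (V2 n) by exact: sqint_moll.
have cV1 n : C1b (V1 n) by exact: C1b_moll.
have cV2 n : C1b (V2 n) by exact: C1b_moll.
have zero_cvg (f : nat -> R) : (forall n, 0 <= f n <= eps n) -> f n @[n --> \oo] --> (0 : R).
  move=> h; apply: (@squeeze_cvgr _ _ _ _ (fun=> 0) eps) => //; last exact: cvg_cst.
  exact: nearW.
have a1 : \int[@leb2 R]_x ((V1 n x - u1 n x) ^+ 2) @[n --> \oo] --> (0 : R).
  apply: zero_cvg => n; have [_ _ -> _] := hd n; rewrite andbT.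
  by apply: Rintegral_ge0 => x _; exact: sqr_ge0.
have a2 : \int[@leb2 R]_x ((V2 n x - u2 n x) ^+ 2) @[n --> \oo] --> (0 : R).
  apply: zero_cvg => n; have [_ _ _ ->] := hd n; rewrite andbT.
  by apply: Rintegral_ge0 => x _; exact: sqr_ge0.
pose theta' n := 2 * theta n + 4 * eps n.
have th' : theta' n @[n --> \oo] --> (0 : R).
  by have := cvgD (cvgMl_tmp (a := 2) theta_cvg) (cvgMl_tmp (a := 4) eps_cvg); rewrite !mulr0 addr0; exact.
have DI n := density_integ eps0 su1 su2 sd1 sd2 sd3 sd4 kE q1 q2 q3 q4 hd n.
have DE n x := @densityE _ _ eps delta u1 u2 d1 d2 d3 d4 su1 su2 sd1 sd2 sd3 sd4 wd1 wd2 wd3 wd4 n x.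
have D0 n x := density_ge0 delta u1 u2 d1 d2 d3 d4 eps0 n x.
have dv n := dsq_v su1 su2 mE hd n.
have C0 : 0 <= C.
  apply: le_trans (qg 0%N); apply: Rintegral_ge0 => x _; exact: sqr_ge0.
pose K := 6 * C + 288.
have GI n : sqint leb2 (moll (delta n) (g n)) /\
    \int[@leb2 R]_x (moll (delta n) (g n) x ^+ 2) <= K.
  split; first exact: sqint_moll.
  apply: le_trans (moll_contract (d0 n) (sg n)) _; apply: le_trans (qg n) _; rewrite /K; lra.
have GE n x := @divf_v _ _ delta u1 u2 g su1 su2 sg wg n x.
(* Smoothing at vanishing L2 distance leaves the weak limit unchanged. *)
have weakV (u : nat -> mplane -> R) w (V := fun n => moll (delta n) (u n) : mplane -> R) :
    (forall n, sqint leb2 (u n)) ->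
    \int[@leb2 R]_x ((V n x - u n x) ^+ 2) @[n --> \oo] --> (0 : R) ->
    (forall f : mplane -> R, sqint leb2 f -> ip2 leb2 (u n) f @[n --> \oo] --> ip2 leb2 w f) ->
    forall f : mplane -> R, sqint leb2 f -> ip2 leb2 (V n) f @[n --> \oo] --> ip2 leb2 w f.
  move=> su c weak f sf.
  have sV n : sqint leb2 (V n) by exact: sqint_moll.
  have H := cvgD (ip2_small (fun n => sqintB (sV n) (su n)) sf c) (weak f sf).
  rewrite add0r in H.
  rewrite (_ : (fun n => ip2 leb2 (V n) f) =
    (fun n => ip2 leb2 (fun x => V n x - u n x) f + ip2 leb2 (u n) f)); first exact: H.
  apply/funext => n.
  have i := sqintM (sqintB (sV n) (su n)) sf; have j := sqintM (su n) sf.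
  rewrite /ip2 -(RintegralDT i j); apply: eq_Rintegral => x _.
  by rewrite -mulrDl subrK.
have mV (u : nat -> mplane -> R) n : (forall n, sqint leb2 (u n)) ->
    \int[@leb2 R]_x (u n x ^+ 2) <= M -> \int[@leb2 R]_x (moll (delta n) (u n) x ^+ 2) <= M.
  by move=> su; apply: le_trans; exact: moll_contract.
have loc a b : cbox a b `<=` Omega ->
    \int[@leb2 R]_x (bump 1 a b x * (V1 n x - w1 x) ^+ 2) @[n --> \oo] --> (0 : R) /\
    \int[@leb2 R]_x (bump 1 a b x * (V2 n x - w2 x) ^+ 2) @[n --> \oo] --> (0 : R).
  move=> sub.
  (* The bound on increments asks for ordered corners; with disordered ones the bump is identically
     0. *)
  have [ab|nab] := pselect (a.1 <= b.1 /\ a.2 <= b.2); last first.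
    have z x : bump 1 a b x = 0.
      apply: bump_eq0 => // -[/=]; rewrite !in_itv/= => /andP[x1 y1] /andP[x2 y2].
      by apply: nab; split; apply: ltW; [exact: lt_trans y1|exact: lt_trans y2].
    by split; apply: cvg_near_cst; apply: nearW => n;
      under eq_Rintegral => x _ do rewrite z mul0r; rewrite Rintegral_cst//= mul0r.
  have [r [A [r0 A0 near_inc]]] := local_increments oOmega eps0 delta_cvg cV1 cV2 dv D0 DI DE GI GE
    ab.1 ab.2 sub.
  have comp (v : nat -> mplane -> R) : (forall n, C1b (v n)) ->
      (forall n x h, (v n (x + h) - v n x) ^+ 2 <= nrmp ((V1 n (x + h), V2 n (x + h)) - (V1 n x, V2 n x))) ->
      \forall n \near \oo, forall h eta, `|h| <= r -> 0 < eta <= 1 ->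
    \int[@leb2 R]_x (bump 1 a b x * (v n (x + h) - v n x) ^+ 2) <=
    A * (eta + theta' n / eta ^+ 3 + `|h| / eta).
    move=> cv le; apply: filterS near_inc => n inc h eta hh he.
    apply: le_trans (inc h eta hh he); apply: le_RintegralT.
    - apply: (integ_bumpM a b (F := fun x => incr h (v n) x ^+ 2)).
      exact: C1b_continuous (C1bX 2 (C1b_incr h (cv n))).
    - apply: (integ_bumpM a b (F := fun x => nrmp ((V1 n (x + h), V2 n (x + h)) - (V1 n x, V2 n x)))).
      apply: C1b_continuous; exact: (C1b_nrm2 (C1b_incr h (cV1 n)) (C1b_incr h (cV2 n))).
    - by move=> x; apply: ler_wpM2l; [exact: bump_ge0|exact: le].
  split.
  - apply: (local_convergence r0 A0 sV1 sw1 _ (weakV _ _ su1 a1 weak1) th'); first by move=> n; exact: mV.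
    by apply: comp => // n x h; rewrite /nrmp /nrm2 /= lerDl sqr_ge0.
  - apply: (local_convergence r0 A0 sV2 sw2 _ (weakV _ _ su2 a2 weak2) th'); first by move=> n; exact: mV.
    by apply: comp => // n x h; rewrite /nrmp /nrm2 /= lerDr sqr_ge0.
pose m n x := mdist (nrm2 (u1 n x) (u2 n x)).
have m0 n x : 0 <= m n x by apply: mdist_ge0; exact: nrm2_ge0.
have um1 n x : u1 n x ^+ 2 <= 1 + m n x.
  by apply: le_trans (le_mdist _); rewrite lerDl sqr_ge0.
have um2 n x : u2 n x ^+ 2 <= 1 + m n x.
  by apply: le_trans (le_mdist _); rewrite lerDr sqr_ge0.
have G1 := global_convergence oOmega bOmega su1 sw1 o1 out1 m0 um1 mE theta_cvg
  (fun a b sub => close_local sV1 su1 sw1 a1 (loc a b sub).1).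
have G2 := global_convergence oOmega bOmega su2 sw2 o2 out2 m0 um2 mE theta_cvg
  (fun a b sub => close_local sV2 su2 sw2 a2 (loc a b sub).2).
split => //; first exact: (ideal_limit su1 su2 sw1 sw2 mE theta_cvg G1 G2).
move=> phi1 phi2 C1 C2 b1 b2.
have VB := variation_bound oOmega bOmega eps0 delta_cvg cV1 cV2 D0 DI DE C1 C2 b1 b2.
have G3 (v u : nat -> mplane -> R) w : (forall n, sqint leb2 (v n)) -> (forall n, sqint leb2 (u n)) ->
    sqint leb2 w ->
    \int[@leb2 R]_x ((v n x - u n x) ^+ 2) @[n --> \oo] --> (0 : R) ->
    \int[@leb2 R]_x ((u n x - w x) ^+ 2) @[n --> \oo] --> (0 : R) ->
    \int[@leb2 R]_x ((v n x - w x) ^+ 2) @[n --> \oo] --> (0 : R).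
  move=> sv su sw c1 c2.
  apply: (@squeeze_cvgr _ _ _ _ (fun=> 0) (fun n => 2 * \int[@leb2 R]_x ((v n x - u n x) ^+ 2) +
    2 * \int[@leb2 R]_x ((u n x - w x) ^+ 2))).
  - apply: nearW => n; apply/andP; split.
      by apply: Rintegral_ge0 => x _; exact: sqr_ge0.
    have i1 := (sqintB (sv n) (su n)).2; have i2 := (sqintB (su n) sw).2.
    rewrite -(RintegralZT 2 i1) -(RintegralZT 2 i2) -(RintegralDT (integZ 2 i1) (integZ 2 i2)).
    apply: le_RintegralT; [exact: (sqintB (sv n) sw).2|exact: integD (integZ 2 i1) (integZ 2 i2)|].
    move=> x; move: (v n x) (u n x) (w x) => p f q.
    rewrite -subr_ge0 (_ : _ - _ = (p - f - (f - q)) ^+ 2); last by ring.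
    exact: sqr_ge0.
  - exact: cvg_cst.
  - by have := cvgD (cvgMl_tmp (a := 2) c1) (cvgMl_tmp (a := 2) c2); rewrite !mulr0 addr0; exact.
have [_ p1 _] := C1c_sqint bOmega C1; have [_ _ p2] := C1c_sqint bOmega C2.
have sf := sqintD p1 p2.
have lim := ramp_cvg sV1 sV2 sw1 sw2 sf (G3 _ _ _ sV1 su1 sw1 a1 G1) (G3 _ _ _ sV2 su2 sw2 a2 G2).
exact: (cvgr_to_le lim VB).
Qed.

End strong.
End compactness.

(** * Extraction of the converging subsequence *)

Section extraction.
Context {R : realType}.
Local Notation plane := (R * R)%type.
Local Notation mplane := (measurableTypeR R * measurableTypeR R)%type.
Implicit Types (x y z a b : plane).

Lemma energy_data_comp (k : nat -> nat) (Omega : set plane) (C M : R) eps theta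
    (u1 u2 g d1 d2 d3 d4 : nat -> mplane -> R) :
  energy_data Omega C M eps theta u1 u2 g d1 d2 d3 d4 ->
  energy_data Omega C M (eps \o k) (theta \o k) (u1 \o k) (u2 \o k) (g \o k)
    (d1 \o k) (d2 \o k) (d3 \o k) (d4 \o k).
Proof. by case=> *; split=> n; match goal with H : _ |- _ => exact: (H (k n)) end. Qed.

Lemma sqint_indicM (Omega : set plane) (f : mplane -> R) : open Omega -> sqint leb2 f ->
  sqint leb2 (fun x => f x * \1_Omega x).
Proof.
move=> oO sf; apply: le_sqint (sf).
  apply: measurable_funM; first exact: sf.1.
  by apply: measurable_indic; exact: measurable_open.
by move=> x; rewrite normrM ler_piMr// indicE ger0_norm// lern1 leq_b1.
Qed.

(** A weak limit is determined only up to null sets; cutting it by the indicator makes it vanish at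
    every point off [Omega], as the global argument requires. *)
Lemma weak_cvg_restrict (Omega : set plane) (u : nat -> mplane -> R) (w : mplane -> R) :
  open Omega -> (forall n x, ~ Omega x -> u n x = 0) ->
  (forall f : mplane -> R, sqint leb2 f -> ip2 leb2 (u n) f @[n --> \oo] --> ip2 leb2 w f) ->
  forall f : mplane -> R, sqint leb2 f ->
    ip2 leb2 (u n) f @[n --> \oo] --> ip2 leb2 (fun x => w x * \1_Omega x) f.
Proof.
move=> oO out weak f sf; have := weak _ (sqint_indicM oO sf).
rewrite /ip2.
have -> : (fun n => \int[@leb2 R]_x (u n x * (f x * \1_Omega x))) =
    (fun n => \int[@leb2 R]_x (u n x * f x)).
  apply/funext => n; apply: eq_Rintegral => x _; rewrite indicE.
  by case: (pselect (Omega x)) => [/mem_set ->|nx]; rewrite ?mulr1// (out n x nx) !mul0r.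
have -> // : \int[@leb2 R]_x (w x * (f x * \1_Omega x)) = \int[@leb2 R]_x (w x * \1_Omega x * f x).
by apply: eq_Rintegral => x _; rewrite [f x * _]mulrC mulrA.
Qed.

Lemma weak_dv_limit (Omega : set plane) (rd : R) (u1 u2 g : nat -> mplane -> R)
    (w1 w2 h : mplane -> R) : Omega `<=` square 0 rd ->
  (forall n, sqint leb2 (u1 n)) -> (forall n, sqint leb2 (u2 n)) -> (forall n, sqint leb2 (g n)) ->
  sqint leb2 w1 -> sqint leb2 w2 -> sqint leb2 h ->
  (forall f : mplane -> R, sqint leb2 f -> ip2 leb2 (u1 n) f @[n --> \oo] --> ip2 leb2 w1 f) ->
  (forall f : mplane -> R, sqint leb2 f -> ip2 leb2 (u2 n) f @[n --> \oo] --> ip2 leb2 w2 f) ->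
  (forall f : mplane -> R, sqint leb2 f -> ip2 leb2 (g n) f @[n --> \oo] --> ip2 leb2 h f) ->
  (forall n, weak_dv Omega (u1 n) (u2 n) (g n)) -> weak_dv Omega w1 w2 h.
Proof.
move=> bO su1 su2 sg sw1 sw2 sh c1 c2 c3 wd phi Cphi.
have [p0 p1 p2] := C1c_sqint bO (Cinfc_C1c Cphi).
have L := cvgD (c1 _ p1) (c2 _ p2).
have E : (fun n => ip2 leb2 (u1 n) (fun z => 'D_e1 phi z) + ip2 leb2 (u2 n) (fun z => 'D_e2 phi z)) =
    (fun n => - ip2 leb2 (g n) phi).
  apply/funext => n; rewrite /ip2 -(wd n phi Cphi).
  by rewrite -(RintegralDT (sqintM (su1 n) p1) (sqintM (su2 n) p2)).
have L' : (fun n => ip2 leb2 (u1 n) (fun z => 'D_e1 phi z) + ip2 leb2 (u2 n) (fun z => 'D_e2 phi z)) n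
    @[n --> \oo] --> ip2 leb2 w1 (fun z => 'D_e1 phi z) + ip2 leb2 w2 (fun z => 'D_e2 phi z) := L _.
rewrite E in L'.
have := cvg_unique (@norm_hausdorff R R) (L' _) (cvgN (c3 _ p0)).
by move=> H; rewrite (RintegralDT (sqintM sw1 p1) (sqintM sw2 p2)); exact: H.
Qed.

Lemma energy_compactness (Omega : set plane) (rd C M : R) (eps theta : nat -> R)
    (u1 u2 g d1 d2 d3 d4 : nat -> mplane -> R) :
  open Omega -> Omega `<=` square 0 rd ->
  energy_data Omega C M eps theta u1 u2 g d1 d2 d3 d4 ->
  eps n @[n --> \oo] --> (0 : R) -> theta n @[n --> \oo] --> (0 : R) ->
  exists k w1 w2 h, [/\ extraction k, [/\ sqint leb2 w1, sqint leb2 w2 & sqint leb2 h],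
    (forall x, ~ Omega x -> w1 x = 0 /\ w2 x = 0), weak_dv Omega w1 w2 h &
    (forall f : mplane -> R, sqint leb2 f ->
        ip2 leb2 (g (k n)) f @[n --> \oo] --> ip2 leb2 h f) /\
    [/\ \int[@leb2 R]_x ((u1 (k n) x - w1 x) ^+ 2) @[n --> \oo] --> (0 : R),
      \int[@leb2 R]_x ((u2 (k n) x - w2 x) ^+ 2) @[n --> \oo] --> (0 : R),
      {ae leb2, forall x : mplane, ideal (w1 x, w2 x)} &
      forall phi1 phi2 : plane -> R, C1c Omega phi1 -> C1c Omega phi2 ->
        (forall x, `|phi1 x| <= 1) -> (forall x, `|phi2 x| <= 1) ->
        \int[@leb2 R]_x (ramp (w1 x) (w2 x) * ('D_e1 phi1 x + 'D_e2 phi2 x)) <= 256 * (6 * C + 288)]].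
Proof.
move=> oO bO E ec tc.
have b1 n : ip2 leb2 (u1 n) (u1 n) <= M by rewrite ip2E; exact: ed_m1 E n.
have b2 n : ip2 leb2 (u2 n) (u2 n) <= M by rewrite ip2E; exact: ed_m2 E n.
have b3 n : ip2 leb2 (g n) (g n) <= C by rewrite ip2E; exact: ed_eg E n.
(* Three successive extractions, for the two components and the divergence; weak limits persist
   along the later ones. *)
have [k1 [w1 [x1 s1 c1]]] := sqint_weak_compact (ed_u1 E) b1.
have [k2 [w2 [x2 s2 c2]]] := sqint_weak_compact (fun n => ed_u2 E (k1 n)) (fun n => b2 (k1 n)).
have [k3 [h [x3 s3 c3]]] := sqint_weak_compact (fun n => ed_g E (k1 (k2 n))) (fun n => b3 (k1 (k2 n))).
pose k := k1 \o (k2 \o k3).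
have xk : extraction k by apply: extraction_comp => //; exact: extraction_comp.
have Ek := energy_data_comp k E.
have weak1 := weak_cvg_restrict oO (ed_out1 Ek)
  (fun f sf => cvg_extraction (extraction_comp x2 x3) (c1 f sf)).
have weak2 := weak_cvg_restrict oO (ed_out2 Ek) (fun f sf => cvg_extraction x3 (c2 f sf)).
have s1' := sqint_indicM oO s1; have s2' := sqint_indicM oO s2.
have out (w : mplane -> R) x : ~ Omega x -> w x * \1_Omega x = 0.
  by move=> nx; rewrite indicE memNset// mulr0.
have [G1 G2 I V] := strong_limit oO bO Ek (cvg_extraction xk ec) (cvg_extraction xk tc) s1' s2'
  (out w1) (out w2) weak1 weak2.
exists k, (fun x => w1 x * \1_Omega x), (fun x => w2 x * \1_Omega x), h.
split => //; first by move=> x nx; split; exact: out.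
exact: (weak_dv_limit bO (ed_u1 Ek) (ed_u2 Ek) (ed_g Ek) s1' s2' s3 weak1 weak2 c3 (ed_wg Ek)).
Qed.

End extraction.

(** * Reduction to zero extensions *)

Section restriction.
Context {R : realType}.
Local Notation plane := (R * R)%type.
Local Notation mplane := (measurableTypeR R * measurableTypeR R)%type.
Implicit Types (x y z a b : plane).

Lemma restrictE (Omega : set plane) (f : plane -> R) x :
  (f \_ Omega) x = if x \in Omega then f x else 0.
Proof. by rewrite patchE. Qed.

Lemma restrict_in (Omega : set plane) (f : plane -> R) x : Omega x -> (f \_ Omega) x = f x.
Proof. by move=> ox; rewrite restrictE mem_set. Qed.

Lemma restrict_out (Omega : set plane) (f : plane -> R) x : ~ Omega x -> (f \_ Omega) x = 0.
Proof. by move=> ox; rewrite restrictE memNset. Qed.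

Lemma restrict_id (Omega : set plane) (f : plane -> R) :
  (forall x, ~ Omega x -> f x = 0) -> f \_ Omega = f.
Proof.
move=> h; apply/funext => x; case: (pselect (Omega x)) => ox; first by rewrite restrict_in.
by rewrite restrict_out// h.
Qed.

Lemma restrictM (Omega : set plane) (f g : plane -> R) :
  (fun x => f x * g x) \_ Omega = (fun x => (f \_ Omega) x * g x).
Proof.
apply/funext => x; case: (pselect (Omega x)) => ox; first by rewrite !restrict_in.
by rewrite !restrict_out// mul0r.
Qed.

Lemma LpP (Omega : set plane) (f : plane -> R) :
  Lp 2%:E Omega f <-> sqint leb2 (f \_ Omega : mplane -> R).
Proof. exact: sqintP. Qed.

Lemma is_weak_deriveP (Omega : set plane) v (f g : plane -> R) :
  is_weak_derive Omega v f g <->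
  sqint leb2 (g \_ Omega : mplane -> R) /\ weak_D Omega v (f \_ Omega) (g \_ Omega).
Proof.
have E (F G : plane -> R) : \int[@leb2 R]_(x in Omega) (F x * G x) =
    \int[@leb2 R]_x ((F \_ Omega) x * G x) by rewrite Rintegral_mkcond restrictM.
split=> -[sg h]; split; try exact/LpP.
  by move=> phi Cp; rewrite -!E; exact: h.
by move=> phi Cp; rewrite !E; exact: h.
Qed.

Lemma is_weak_divP (Omega : set plane) (u : plane -> plane) (g : plane -> R) :
  is_weak_div Omega u g <->
  sqint leb2 (g \_ Omega : mplane -> R) /\
  weak_dv Omega ((fst \o u) \_ Omega) ((snd \o u) \_ Omega) (g \_ Omega).
Proof.
have E (F G : plane -> R) : \int[@leb2 R]_(x in Omega) (F x * G x) =
    \int[@leb2 R]_x ((F \_ Omega) x * G x) by rewrite Rintegral_mkcond restrictM.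
have E2 phi : \int[@leb2 R]_(x in Omega) ((u x).1 * 'D_e1 phi x + (u x).2 * 'D_e2 phi x) =
    \int[@leb2 R]_x (((fst \o u) \_ Omega) x * 'D_e1 phi x + ((snd \o u) \_ Omega) x * 'D_e2 phi x).
  rewrite Rintegral_mkcond; apply: eq_Rintegral => x _.
  case: (pselect (Omega x)) => ox; first by rewrite !restrict_in.
  by rewrite !restrict_out// !mul0r addr0.
split=> -[sg h]; split; try exact/LpP.
  by move=> phi Cp; rewrite -E2 -E; exact: h.
by move=> phi Cp; rewrite E2 E; exact: h.
Qed.

Lemma cvg_bounded (f : nat -> R) (l : R) : f n @[n --> \oo] --> l -> exists B, forall n, f n <= B.
Proof.
move=> c; have /cvg_seq_bounded [B [_ /(_ (B + 1))]] : cvgn f by apply/cvg_ex; exists l.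
rewrite ltrDl ltr01 => /(_ isT) h; exists (B + 1) => n.
by apply: le_trans (ler_norm _) _; exact: h.
Qed.

Lemma bounded_in_square (Omega : set plane) : bounded_set Omega ->
  exists rd : R, Omega `<=` square 0 rd.
Proof.
case=> B [_ /(_ (B + 1))]; rewrite ltrDl ltr01 => /(_ isT) h.
by exists (B + 1) => x ox; apply/square_norm; rewrite subr0; exact: h.
Qed.

Lemma weak_deriveP (Omega : set plane) v (f : plane -> R) :
  (exists g, is_weak_derive Omega v f g) -> is_weak_derive Omega v f (weak_derive Omega v f).
Proof. by move=> h; exact: (xgetPex (cst 0) h). Qed.

Lemma weak_divP (Omega : set plane) (u : plane -> plane) :
  (exists g, is_weak_div Omega u g) -> is_weak_div Omega u (weak_div Omega u).
Proof. by move=> h; exact: (xgetPex (cst 0) h). Qed.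

Lemma H1vec_weak_div (Omega : set plane) (rd : R) (u : plane -> plane) :
  Omega `<=` square 0 rd -> H1vec Omega u -> exists g, is_weak_div Omega u g.
Proof.
move=> bO [[/LpP s1 [g1 /is_weak_deriveP [sg1 w1]] _] [/LpP s2 _ [g2 /is_weak_deriveP [sg2 w2]]]].
exists (fun x => g1 x + g2 x); apply/is_weak_divP.
have -> : (fun x => g1 x + g2 x) \_ Omega = (fun x => (g1 \_ Omega) x + (g2 \_ Omega) x).
  apply/funext => x; case: (pselect (Omega x)) => ox; first by rewrite !restrict_in.
  by rewrite !restrict_out// addr0.
split; first exact: sqintD.
move=> phi Cphi; have [p0 p1 p2] := C1c_sqint bO (Cinfc_C1c Cphi).
rewrite (RintegralDT (sqintM s1 p1) (sqintM s2 p2)) (w1 phi Cphi) (w2 phi Cphi).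
under [in RHS]eq_Rintegral => x _ do rewrite mulrDl.
by rewrite (RintegralDT (sqintM sg1 p0) (sqintM sg2 p0)) opprD.
Qed.

(** The difference of two weak divergences is orthogonal to all bumps. This is needed because
    [weak_div] is a chosen representative that must be compared with a weak limit. *)
Lemma weak_div_unique (Omega : set plane) (rd : R) (f1 f2 g h : mplane -> R) : open Omega ->
  Omega `<=` square 0 rd -> sqint leb2 g -> sqint leb2 h ->
  weak_dv Omega f1 f2 g -> weak_dv Omega f1 f2 h ->
  {ae leb2, forall x : mplane, Omega x -> g x = h x}.
Proof.
move=> oO bO sg sh wg wh.
apply: ae_mono (fundamental_lemma oO (sqintB sg sh) _).
  by move=> x H ox; apply/eqP; rewrite -subr_eq0; apply/eqP; exact: H.
move=> n a b sub.
have Cb : Cinfc Omega (bump n.+1%:R a b) by apply: Cinfc_bump.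
have [p0 _ _] := C1c_sqint bO (Cinfc_C1c Cb).
under eq_Rintegral => x _ do rewrite mulrBl.
rewrite (RintegralBT (sqintM sg p0) (sqintM sh p0)).
have := wg _ Cb; rewrite (wh _ Cb) => /eqP; rewrite eqr_opp => /eqP ->.
exact: subrr.
Qed.

End restriction.

(** * Consequences of the assumptions on the potential *)

Section potential.
Context {R : realType}.
Local Notation plane := (R * R)%type.
Local Notation mplane := (measurableTypeR R * measurableTypeR R)%type.
Implicit Types (x y z : plane).
Variables (V : R -> R) (hV : admissible_potential V).

Lemma potential_ge0 z : 0 <= V (enorm z).
Proof. by case: hV => _ h _ _; apply: h; exact: sqrtr_ge0. Qed.

Lemma potential0 : V (enorm (0, 0)) = 0.
Proof.
case: hV => _ _ h _; rewrite /enorm /= expr0n /= addr0 sqrtr0.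
by apply/(h 0 (lexx _)); left.
Qed.

Lemma continuous_potential : continuous (fun z => V (enorm z)).
Proof.
case: hV => /subspace_continuousP h _ _ _ z.
have ez : `[0, +oo[%classic (enorm z) by rewrite /= in_itv/= andbT sqrtr_ge0.
have hz := h _ ez.
move=> P /hz wP; have H := continuous_euclid (x := z) wP.
apply: (@filterS _ (nbhs z) _ _ _ _ H) => y /=; apply.
by rewrite in_itv/= andbT; exact: sqrtr_ge0.
Qed.

Lemma potential_coercive : exists2 c : R, 0 < c & forall z, mdist (nrmp z) <= c * Num.sqrt (V (enorm z)).
Proof.
case: hV => _ _ _ [c c0 h]; exists c => // z.
by rewrite /mdist -euclid_sq; exact: (h (enorm z) (sqrtr_ge0 _)).
Qed.

Lemma kap_le_mdist (a b : R) : kap a b ^+ 2 <= mdist (nrm2 a b) ^+ 2.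
Proof.
rewrite -(real_normK (num_real (kap _ _))) kap_om; apply: lerXn2r.
- by rewrite nnegrE om_ge0// nrm2_ge0.
- by rewrite nnegrE mdist_ge0// nrm2_ge0.
- by apply: om_le_mdist; exact: nrm2_ge0.
Qed.

Lemma mdist0 : mdist (0 : R) = 0.
Proof. by rewrite /mdist min_l. Qed.

End potential.

(** * Bounds extracted from the energy *)

Section from_energy.
Context {R : realType}.
Local Notation plane := (R * R)%type.
Local Notation mplane := (measurableTypeR R * measurableTypeR R)%type.
Implicit Types (x y z : plane).
Variables (Omega : set plane) (L : R) (V : R -> R) (rd : R).
Hypotheses (oOmega : open Omega) (bOmega : Omega `<=` square 0 rd).
Hypotheses (hL : 0 < L) (hV : admissible_potential V).

Definition total_density (e : R) (u1 u2 g d1 d2 d3 d4 : mplane -> R) x : R :=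
  e^-1 * V (enorm (u1 x, u2 x)) + e * (d1 x ^+ 2 + d2 x ^+ 2 + d3 x ^+ 2 + d4 x ^+ 2) +
  L * g x ^+ 2.

(** Extension by 0 does not change the energy, because [V] vanishes at 0. *)
Lemma energyE (e : R) (u : plane -> plane) :
  energy V L Omega e u = ((2^-1)%:E * \int[@leb2 R]_x
    (total_density e ((fst \o u) \_ Omega) ((snd \o u) \_ Omega) (weak_div Omega u \_ Omega)
      (weak_derive Omega e1 (fst \o u) \_ Omega) (weak_derive Omega e2 (fst \o u) \_ Omega)
      (weak_derive Omega e1 (snd \o u) \_ Omega) (weak_derive Omega e2 (snd \o u) \_ Omega) x)%:E)%E.
Proof.
rewrite /energy integral_mkcond; congr (_ * _)%E; apply: eq_integral => x _.
rewrite patchE /total_density.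
set f1 := fst \o u; set f2 := snd \o u; set g := weak_div Omega u.
have Ef : u x = (f1 x, f2 x) := surjective_pairing _.
rewrite /grad_sq -/f1 -/f2 -/g Ef; clearbody f1 f2 g.
move: (weak_derive Omega e1 f1) (weak_derive Omega e2 f1) => d1 d2.
move: (weak_derive Omega e1 f2) (weak_derive Omega e2 f2) => d3 d4.
case: (pselect (Omega x)) => ox.
  rewrite (mem_set ox).
  rewrite (restrict_in f1 ox) (restrict_in f2 ox) (restrict_in g ox).
  by rewrite (restrict_in d1 ox) (restrict_in d2 ox) (restrict_in d3 ox) (restrict_in d4 ox).
rewrite (memNset ox).
rewrite (restrict_out f1 ox) (restrict_out f2 ox) (restrict_out g ox).
rewrite (restrict_out d1 ox) (restrict_out d2 ox) (restrict_out d3 ox) (restrict_out d4 ox).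
by rewrite (potential0 hV) expr0n /= !addr0 !mulr0 !addr0.
Qed.

Section bounds.
Variables (e C : R) (u1 u2 g d1 d2 d3 d4 : mplane -> R).
Hypotheses (e0 : 0 < e) (su1 : sqint leb2 u1) (su2 : sqint leb2 u2) (sg : sqint leb2 g)
  (sd1 : sqint leb2 d1) (sd2 : sqint leb2 d2) (sd3 : sqint leb2 d3) (sd4 : sqint leb2 d4).
Hypothesis hE : ((2^-1)%:E * \int[@leb2 R]_x
  (total_density e u1 u2 g d1 d2 d3 d4 x)%:E <= C%:E)%E.
Let T := total_density e u1 u2 g d1 d2 d3 d4.
Let W x := V (enorm (u1 x, u2 x)).

Let mW : measurable_fun setT (W : mplane -> R).
Proof. exact: (measurable_comp2 (continuous_potential hV) su1.1 su2.1). Qed.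

Let W0 x : 0 <= W x. Proof. exact: potential_ge0. Qed.

Let T_parts x : [/\ 0 <= T x, W x <= e * T x, L * g x ^+ 2 <= T x &
  e * d1 x ^+ 2 <= T x /\ e * d2 x ^+ 2 <= T x /\ e * d3 x ^+ 2 <= T x /\ e * d4 x ^+ 2 <= T x].
Proof.
have V0 : 0 <= e^-1 * W x by apply: mulr_ge0 => //; rewrite invr_ge0 ltW.
have e_0 := ltW e0.
have q1 := mulr_ge0 e_0 (sqr_ge0 (d1 x)); have q2 := mulr_ge0 e_0 (sqr_ge0 (d2 x)).
have q3 := mulr_ge0 e_0 (sqr_ge0 (d3 x)); have q4 := mulr_ge0 e_0 (sqr_ge0 (d4 x)).
have qg := mulr_ge0 (ltW hL) (sqr_ge0 (g x)).
have TE : T x = e^-1 * W x + (e * d1 x ^+ 2 + e * d2 x ^+ 2 + e * d3 x ^+ 2 + e * d4 x ^+ 2) +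
  L * g x ^+ 2 by rewrite /T /total_density !mulrDr.
have W1 : e^-1 * W x <= T x by rewrite TE; lra.
split.
- by rewrite TE; lra.
- by rewrite -ler_pdivrMl.
- by rewrite TE; lra.
- by rewrite TE; split; [|split; [|split]]; lra.
Qed.

Let mT : measurable_fun setT (T : mplane -> R).
Proof.
apply: measurable_funD; last by apply: measurable_funM; [exact: measurable_cst|exact: integ_measurable sg.2].
apply: measurable_funD; apply: measurable_funM; try exact: measurable_cst.
  exact: mW.
by do ! apply: measurable_funD; apply: measurable_funX;
  [exact: sd1.1|exact: sd2.1|exact: sd3.1|exact: sd4.1].
Qed.

Lemma total_integ : integ leb2 (T : mplane -> R) /\ \int[@leb2 R]_x T x <= 2 * C.
Proof.
apply: Rintegral_ge0_le => //; first by move=> x; have [] := T_parts x.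
by move: hE; rewrite lee_pdivrMl// EFinM.
Qed.

Lemma energy_ge0 : 0 <= C.
Proof.
have [iT lT] := total_integ.
have : 0 <= 2 * C by apply: le_trans lT; apply: Rintegral_ge0 => x _; have [] := T_parts x.
by rewrite pmulr_rge0.
Qed.

Lemma gradient_bound (d : mplane -> R) : sqint leb2 d -> (forall x, e * d x ^+ 2 <= T x) ->
  e * \int[@leb2 R]_x (d x ^+ 2) <= 2 * C.
Proof.
move=> sd h; have [iT lT] := total_integ; apply: le_trans lT.
by rewrite -(RintegralZT e sd.2); apply: le_RintegralT => //; exact: integZ sd.2.
Qed.

Lemma gradient_bounds : [/\ e * \int[@leb2 R]_x (d1 x ^+ 2) <= 2 * C,
  e * \int[@leb2 R]_x (d2 x ^+ 2) <= 2 * C, e * \int[@leb2 R]_x (d3 x ^+ 2) <= 2 * C &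
  e * \int[@leb2 R]_x (d4 x ^+ 2) <= 2 * C].
Proof. by split; apply: gradient_bound => // x; have [_ _ _ [? [? []]]] := T_parts x. Qed.

Lemma div_bound : \int[@leb2 R]_x (g x ^+ 2) <= 2 * C / L.
Proof.
have [iT lT] := total_integ; rewrite ler_pdivlMr// mulrC; apply: le_trans lT.
rewrite -(RintegralZT L sg.2); apply: le_RintegralT => //; first exact: integZ sg.2.
by move=> x; have [] := T_parts x.
Qed.

Lemma potential_bound : integ leb2 (W : mplane -> R) /\ \int[@leb2 R]_x W x <= 2 * C * e.
Proof.
have [iT lT] := total_integ.
have [i l] := le_Rintegral_bound mW (fun x => let: And4 _ h _ _ := T_parts x in
  introT andP (conj (W0 x) h)) (integZ e iT).
split => //; apply: le_trans l _; rewrite (RintegralZT e iT) mulrC.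
by apply: ler_wpM2r => //; exact: ltW.
Qed.

Variable c : R.
Hypotheses (c0 : 0 < c) (hc : forall z, mdist (nrmp z) <= c * Num.sqrt (V (enorm z))).

Let mdW x : mdist (nrm2 (u1 x) (u2 x)) ^+ 2 <= c ^+ 2 * W x.
Proof.
rewrite -[W x]sqr_sqrtr// -exprMn; apply: lerXn2r.
- by rewrite nnegrE mdist_ge0// nrm2_ge0.
- by rewrite nnegrE; apply: mulr_ge0; [exact: ltW|exact: sqrtr_ge0].
- exact: (hc (u1 x, u2 x)).
Qed.

Lemma kap_bound : integ leb2 (fun x => kap (u1 x) (u2 x) ^+ 2) /\
  \int[@leb2 R]_x (kap (u1 x) (u2 x) ^+ 2) <= (2 * c ^+ 2 * C) * e.
Proof.
have [iW lW] := potential_bound.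
have mk : measurable_fun setT (fun x : mplane => kap (u1 x) (u2 x) ^+ 2).
  by apply: measurable_funX; exact: (measurable_comp2 continuous_kap su1.1 su2.1).
have H x : 0 <= kap (u1 x) (u2 x) ^+ 2 <= c ^+ 2 * W x.
  by rewrite sqr_ge0 /=; apply: le_trans (kap_le_mdist _ _) (mdW x).
have [i l] := le_Rintegral_bound mk H (integZ (c ^+ 2) iW).
split => //; apply: le_trans l _; rewrite (RintegralZT _ iW).
apply: le_trans (ler_wpM2l (sqr_ge0 c) lW) _.
by rewrite le_eqVlt; apply/orP; left; apply/eqP; ring.
Qed.

Hypotheses (out1 : forall x, ~ Omega x -> u1 x = 0) (out2 : forall x, ~ Omega x -> u2 x = 0).
Let A := \int[@leb2 R]_x (\1_Omega x).

(** On [Omega], [m <= s + m^2 / s] with [s = sqrt e], and [m^2 <= c^2 W]. The integral of [W] being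
    of order [e], both terms are of order [sqrt e]; off [Omega], [mdist 0 = 0]. *)
Lemma mdist_bound : integ leb2 (fun x => mdist (nrm2 (u1 x) (u2 x))) /\
  \int[@leb2 R]_x mdist (nrm2 (u1 x) (u2 x)) <= Num.sqrt e * (A + 2 * c ^+ 2 * C).
Proof.
have [iW lW] := potential_bound.
pose s := Num.sqrt e; have s0 : 0 < s by rewrite sqrtr_gt0.
have ss : s ^+ 2 = e by rewrite sqr_sqrtr// ltW.
have mm : measurable_fun setT (fun x : mplane => mdist (nrm2 (u1 x) (u2 x))).
  exact: (measurable_comp2 continuous_mdist su1.1 su2.1).
have iO := indic_integ oOmega bOmega.
have H x : 0 <= mdist (nrm2 (u1 x) (u2 x)) <= s * \1_Omega x + (c ^+ 2 / s) * W x.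
  rewrite mdist_ge0 ?nrm2_ge0//=.
  have w0 : 0 <= c ^+ 2 / s * W x.
    by apply: mulr_ge0 => //; apply: mulr_ge0; rewrite ?sqr_ge0// invr_ge0 ltW.
  rewrite indicE; case: (pselect (Omega x)) => ox; last first.
    rewrite (out1 ox) (out2 ox) /nrm2 expr0n /= addr0 mdist0.
    by rewrite memNset// mulr0 add0r.
  rewrite mem_set// mulr1; have := mdW x.
  move: (mdist _) (mdist_ge0 (nrm2_ge0 (u1 x) (u2 x))) => m m0 mW'.
  have i0 : 0 < s^-1 by rewrite invr_gt0.
  have si : s * s^-1 = 1 by rewrite mulfV// gt_eqF.
  have := ler_wpM2l (ltW i0) mW'; have := mulr_ge0 (ltW i0) (sqr_ge0 (s - m)).
  rewrite (_ : s^-1 * (s - m) ^+ 2 = (s * s^-1) * (s - 2 * m) + s^-1 * m ^+ 2); last by ring.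
  have -> : c ^+ 2 / s * W x = s^-1 * (c ^+ 2 * W x) by ring.
  by rewrite si mul1r; lra.
have [i l] := le_Rintegral_bound mm H (integD (integZ s iO) (integZ (c ^+ 2 / s) iW)).
split => //; apply: le_trans l _.
rewrite (RintegralDT (integZ s iO) (integZ (c ^+ 2 / s) iW)) (RintegralZT s iO) (RintegralZT _ iW).
rewrite -/A -/s mulrDr lerD2l.
have k0 : 0 <= c ^+ 2 / s by apply: mulr_ge0; rewrite ?sqr_ge0// invr_ge0 ltW.
apply: le_trans (ler_wpM2l k0 lW) _; rewrite -ss.
by rewrite le_eqVlt; apply/orP; left; apply/eqP; field; rewrite gt_eqF.
Qed.

Lemma L2_bound (u : mplane -> R) : sqint leb2 u -> (forall x, u x ^+ 2 <= nrm2 (u1 x) (u2 x)) ->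
  \int[@leb2 R]_x (u x ^+ 2) <= A + Num.sqrt e * (A + 2 * c ^+ 2 * C).
Proof.
move=> su le; have [im lm] := mdist_bound; have iO := indic_integ oOmega bOmega.
apply: le_trans (le_RintegralT su.2 (integD iO im) _) _.
  move=> x; apply: le_trans (le x) _; rewrite indicE.
  case: (pselect (Omega x)) => ox; first by rewrite mem_set//; exact: le_mdist.
  by rewrite memNset// (out1 ox) (out2 ox) /nrm2 expr0n /= !addr0 mdist0 addr0.
by rewrite (RintegralDT iO im) lerD2l.
Qed.

End bounds.

Variables (C : R) (eps : nat -> R) (u : nat -> plane -> plane).
Hypotheses (heps : forall n, 0 < eps n) (heps0 : eps n @[n --> \oo] --> (0 : R)).
Hypotheses (hu : forall n, H1vec Omega (u n))
  (hE : forall n, (energy V L Omega (eps n) (u n) <= C%:E)%E).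

Lemma energy_data_exists : exists C' M theta, theta n @[n --> \oo] --> (0 : R) /\
  energy_data Omega C' M eps theta (fun n => (fst \o u n) \_ Omega) (fun n => (snd \o u n) \_ Omega)
    (fun n => weak_div Omega (u n) \_ Omega)
    (fun n => weak_derive Omega e1 (fst \o u n) \_ Omega)
    (fun n => weak_derive Omega e2 (fst \o u n) \_ Omega)
    (fun n => weak_derive Omega e1 (snd \o u n) \_ Omega)
    (fun n => weak_derive Omega e2 (snd \o u n) \_ Omega).
Proof.
have [c c0 hc] := potential_coercive hV.
have s1 n : sqint leb2 ((fst \o u n) \_ Omega : mplane -> R) by apply/LpP; case: (hu n) => -[].
have s2 n : sqint leb2 ((snd \o u n) \_ Omega : mplane -> R) by apply/LpP; case: (hu n) => _ [].
have D1 n : is_weak_derive Omega e1 (fst \o u n) (weak_derive Omega e1 (fst \o u n)).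
  by apply: weak_deriveP; case: (hu n) => -[].
have D2 n : is_weak_derive Omega e2 (fst \o u n) (weak_derive Omega e2 (fst \o u n)).
  by apply: weak_deriveP; case: (hu n) => -[].
have D3 n : is_weak_derive Omega e1 (snd \o u n) (weak_derive Omega e1 (snd \o u n)).
  by apply: weak_deriveP; case: (hu n) => _ [].
have D4 n : is_weak_derive Omega e2 (snd \o u n) (weak_derive Omega e2 (snd \o u n)).
  by apply: weak_deriveP; case: (hu n) => _ [].
have Dg n : is_weak_div Omega (u n) (weak_div Omega (u n)).
  by apply: weak_divP; apply: (H1vec_weak_div bOmega).
have hE' n : (_ <= C%:E)%E := eq_ind _ (fun t => (t <= C%:E)%E) (hE n) _ (energyE (eps n) (u n)).
have o1 n x : ~ Omega x -> ((fst \o u n) \_ Omega) x = 0 by exact: restrict_out.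
have o2 n x : ~ Omega x -> ((snd \o u n) \_ Omega) x = 0 by exact: restrict_out.
have sd1 n := ((is_weak_deriveP _ _ _ _).1 (D1 n)).1; have w1 n := ((is_weak_deriveP _ _ _ _).1 (D1 n)).2.
have sd2 n := ((is_weak_deriveP _ _ _ _).1 (D2 n)).1; have w2 n := ((is_weak_deriveP _ _ _ _).1 (D2 n)).2.
have sd3 n := ((is_weak_deriveP _ _ _ _).1 (D3 n)).1; have w3 n := ((is_weak_deriveP _ _ _ _).1 (D3 n)).2.
have sd4 n := ((is_weak_deriveP _ _ _ _).1 (D4 n)).1; have w4 n := ((is_weak_deriveP _ _ _ _).1 (D4 n)).2.
have sg n := ((is_weak_divP _ _ _).1 (Dg n)).1; have wg n := ((is_weak_divP _ _ _).1 (Dg n)).2.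
have C0 := energy_ge0 (heps 0%N) (s1 0%N) (s2 0%N) (sg 0%N) (sd1 0%N) (sd2 0%N) (sd3 0%N) (sd4 0%N) (hE' 0%N).
have GB n := gradient_bounds (heps n) (s1 n) (s2 n) (sg n) (sd1 n) (sd2 n) (sd3 n) (sd4 n) (hE' n).
have DB n := div_bound (heps n) (s1 n) (s2 n) (sg n) (sd1 n) (sd2 n) (sd3 n) (sd4 n) (hE' n).
have KB n := kap_bound (heps n) (s1 n) (s2 n) (sg n) (sd1 n) (sd2 n) (sd3 n) (sd4 n) (hE' n) c0 hc.
have MB n := mdist_bound (heps n) (s1 n) (s2 n) (sg n) (sd1 n) (sd2 n) (sd3 n) (sd4 n) (hE' n) c0 hc (o1 n) (o2 n).
have LB n := L2_bound (heps n) (s1 n) (s2 n) (sg n) (sd1 n) (sd2 n) (sd3 n) (sd4 n) (hE' n) c0 hc (o1 n) (o2 n).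
pose A := \int[@leb2 R]_x (\1_Omega x).
pose theta n := Num.sqrt (eps n) * (A + 2 * c ^+ 2 * C).
have th : theta n @[n --> \oo] --> (0 : R).
  have S : Num.sqrt (eps n) @[n --> \oo] --> Num.sqrt (0 : R).
    exact: (continuous_cvg _ (@sqrt_continuous R 0) heps0).
  have := cvgMr_tmp (b := A + 2 * c ^+ 2 * C) S; by rewrite sqrtr0 mul0r; exact.
have [B hB] := cvg_bounded th.
have k1 : 0 <= 2 * C by apply: mulr_ge0.
have k2 : 0 <= 2 * c ^+ 2 * C by apply: mulr_ge0 => //; apply: mulr_ge0 => //; exact: sqr_ge0.
have k3 : 0 <= 2 * C / L by apply: mulr_ge0 => //; rewrite invr_ge0 ltW.
have l1 : 2 * C <= 2 * C + 2 * c ^+ 2 * C + 2 * C / L by lra.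
have l2 : 2 * c ^+ 2 * C <= 2 * C + 2 * c ^+ 2 * C + 2 * C / L by lra.
have l3 : 2 * C / L <= 2 * C + 2 * c ^+ 2 * C + 2 * C / L by lra.
(* One constant serves for the gradients, for [kap] and for the divergence, whose bounds are the
   three summands. *)
exists (2 * C + 2 * c ^+ 2 * C + 2 * C / L), (A + B), theta; split => //.
split => //.
- move=> n; have [? h] := KB n; split => //; apply: le_trans h _.
  by apply: ler_wpM2r => //; exact: ltW.
- by move=> n; have [h _ _ _] := GB n; exact: le_trans l1.
- by move=> n; have [_ h _ _] := GB n; exact: le_trans l1.
- by move=> n; have [_ _ h _] := GB n; exact: le_trans l1.
- by move=> n; have [_ _ _ h] := GB n; exact: le_trans l1.
- by move=> n; exact: le_trans l3.
- move=> n; apply: le_trans (LB n _ (s1 n) _) _; first by move=> x; rewrite /nrm2 lerDl sqr_ge0.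
  by rewrite lerD2l; exact: hB.
- move=> n; apply: le_trans (LB n _ (s2 n) _) _; first by move=> x; rewrite /nrm2 lerDr sqr_ge0.
  by rewrite lerD2l; exact: hB.
Qed.

End from_energy.

(** * Norms, inner products and the total variation *)

Section conclusion.
Context {R : realType}.
Local Notation plane := (R * R)%type.
Local Notation mplane := (measurableTypeR R * measurableTypeR R)%type.
Implicit Types (x y z : plane).

Lemma L2normE (Omega : set plane) (f : plane -> plane) :
  sqint leb2 ((fst \o f) \_ Omega : mplane -> R) -> sqint leb2 ((snd \o f) \_ Omega : mplane -> R) ->
  L2norm Omega f =
  (Num.sqrt (\int[@leb2 R]_x nrmp (((fst \o f) \_ Omega) x, ((snd \o f) \_ Omega) x)))%:E.
Proof.
move=> s1 s2; have [i _] := sqint_nrmp s1 s2.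
rewrite -powR12_sqrt; last by apply: Rintegral_ge0 => x _; exact: nrmp_ge0.
rewrite -poweR_EFin (integ_EFin i) /L2norm unlock /Lnorm; congr (_ `^ _)%E.
apply: eq_integral => x _ /=.
rewrite powR_mulrn// real_normK ?num_real//; congr EFin.
case: (pselect (Omega x)) => ox.
  by rewrite !restrict_in//= euclid_sq.
by rewrite !restrict_out// /nrmp /nrm2 /= expr0n addr0.
Qed.

Lemma L2_cvg_of_components (Omega : set plane) (un : nat -> plane -> plane) (u : plane -> plane) :
  (forall n, sqint leb2 ((fst \o un n) \_ Omega : mplane -> R)) ->
  (forall n, sqint leb2 ((snd \o un n) \_ Omega : mplane -> R)) ->
  sqint leb2 ((fst \o u) \_ Omega : mplane -> R) -> sqint leb2 ((snd \o u) \_ Omega : mplane -> R) ->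
  \int[@leb2 R]_x ((((fst \o un n) \_ Omega) x - ((fst \o u) \_ Omega) x) ^+ 2) @[n --> \oo] --> (0 : R) ->
  \int[@leb2 R]_x ((((snd \o un n) \_ Omega) x - ((snd \o u) \_ Omega) x) ^+ 2) @[n --> \oo] --> (0 : R) ->
  L2_cvg Omega un u.
Proof.
move=> s1 s2 t1 t2 c1 c2.
have E1 n : (fst \o (fun x => un n x - u x)) \_ Omega =
    (fun x => ((fst \o un n) \_ Omega) x - ((fst \o u) \_ Omega) x).
  apply/funext => x; case: (pselect (Omega x)) => ox; first by rewrite !restrict_in.
  by rewrite !restrict_out// subrr.
have E2 n : (snd \o (fun x => un n x - u x)) \_ Omega =
    (fun x => ((snd \o un n) \_ Omega) x - ((snd \o u) \_ Omega) x).
  apply/funext => x; case: (pselect (Omega x)) => ox; first by rewrite !restrict_in.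
  by rewrite !restrict_out// subrr.
have d1 n := sqintB (s1 n) t1; have d2 n := sqintB (s2 n) t2.
have cn := cvg_nrmp d1 d2 c1 c2.
rewrite /L2_cvg.
have -> : (fun n => L2norm Omega (fun x => un n x - u x)) = (fun n => (Num.sqrt
    (\int[@leb2 R]_x nrmp (((fst \o un n) \_ Omega) x - ((fst \o u) \_ Omega) x,
      ((snd \o un n) \_ Omega) x - ((snd \o u) \_ Omega) x)))%:E).
  apply/funext => n; rewrite L2normE; first by rewrite E1 E2.
    by rewrite E1; exact: d1.
  by rewrite E2; exact: d2.
apply: cvg_EFin; first exact: nearW.
have := continuous_cvg _ (@sqrt_continuous R 0) cn; rewrite sqrtr0; exact.
Qed.

Lemma Hdiv_innerE (Omega : set plane) (u v : plane -> plane) :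
  sqint leb2 ((fst \o u) \_ Omega : mplane -> R) -> sqint leb2 ((snd \o u) \_ Omega : mplane -> R) ->
  sqint leb2 (weak_div Omega u \_ Omega : mplane -> R) ->
  sqint leb2 ((fst \o v) \_ Omega : mplane -> R) -> sqint leb2 ((snd \o v) \_ Omega : mplane -> R) ->
  sqint leb2 (weak_div Omega v \_ Omega : mplane -> R) ->
  Hdiv_inner Omega u v = ip2 leb2 ((fst \o u) \_ Omega) ((fst \o v) \_ Omega) +
    ip2 leb2 ((snd \o u) \_ Omega) ((snd \o v) \_ Omega) +
    ip2 leb2 (weak_div Omega u \_ Omega) (weak_div Omega v \_ Omega).
Proof.
move=> s1 s2 s3 t1 t2 t3; have i1 := sqintM s1 t1; have i2 := sqintM s2 t2; have i3 := sqintM s3 t3.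
rewrite /ip2 -(RintegralDT i1 i2) -(RintegralDT (integD i1 i2) i3).
rewrite /Hdiv_inner Rintegral_mkcond; apply: eq_Rintegral => x _.
case: (pselect (Omega x)) => ox; first by rewrite !restrict_in.
by rewrite !restrict_out// !mul0r !addr0.
Qed.

Lemma sqint_weak_cvg (f : nat -> mplane -> R) (g h : mplane -> R) : (forall n, sqint leb2 (f n)) ->
  sqint leb2 g -> sqint leb2 h ->
  \int[@leb2 R]_x ((f n x - g x) ^+ 2) @[n --> \oo] --> (0 : R) ->
  ip2 leb2 (f n) h @[n --> \oo] --> ip2 leb2 g h.
Proof.
move=> sf sg sh c; apply: (cvg_ip (sqint_semi_inner (@leb2 R)) sf sg sh).
by under eq_fun => n do rewrite ip2E; exact: c.
Qed.

Lemma ideal_circle0 z : ideal z -> circle0 z.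
Proof.
case=> h; [right|left].
  by case: z h => a b h; have [/= -> ->] := nrmp_eq0 h.
by rewrite /= /enorm -[X in Num.sqrt X]/(nrmp z) h sqrtr1.
Qed.

Lemma circle0_enorm z : circle0 z -> enorm z = 0 \/ enorm z = 1.
Proof.
case=> [h|/= ->]; [by right|left].
by rewrite /enorm /= expr0n addr0 sqrtr0.
Qed.

Lemma enorm_component z : enorm z <= 1 -> `|z.1| <= 1 /\ `|z.2| <= 1.
Proof.
move=> h; have q : z.1 ^+ 2 + z.2 ^+ 2 <= 1.
  have := euclid_sq z; rewrite /nrmp /nrm2 => <-; rewrite expr_le1 ?sqrtr_ge0//.
by split; rewrite -(@expr_le1 _ 2)// real_normK ?num_real//;
  have := sqr_ge0 z.1; have := sqr_ge0 z.2; lra.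
Qed.

(** Almost everywhere the modulus equals the ramp, whose variation is already bounded, and a test
    field of Euclidean norm at most 1 has components at most 1. Integrability follows from
    [t <= 1 + t^2] on [Omega]. *)
Lemma BV_of_variation (Omega : set plane) (rd B : R) (w1 w2 : mplane -> R) : open Omega ->
  Omega `<=` square 0 rd -> sqint leb2 w1 -> sqint leb2 w2 ->
  (forall x, ~ Omega x -> w1 x = 0 /\ w2 x = 0) ->
  {ae leb2, forall x : mplane, ideal (w1 x, w2 x)} ->
  (forall phi1 phi2 : plane -> R, C1c Omega phi1 -> C1c Omega phi2 ->
    (forall x, `|phi1 x| <= 1) -> (forall x, `|phi2 x| <= 1) ->
    \int[@leb2 R]_x (ramp (w1 x) (w2 x) * ('D_e1 phi1 x + 'D_e2 phi2 x)) <= B) ->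
  BV Omega (enorm \o (fun x => (w1 x, w2 x))).
Proof.
move=> oO bO s1 s2 out ideal_ae var.
have E : (enorm \o (fun x => (w1 x, w2 x))) \_ Omega = (fun x => euclid (w1 x, w2 x)).
  apply: restrict_id => x nx; have [z1 z2] := out x nx.
  by rewrite /= z1 z2 /enorm /= expr0n addr0 sqrtr0.
have me : measurable_fun setT (fun x : mplane => euclid (w1 x, w2 x)).
  exact: (measurable_comp2 continuous_euclid s1.1 s2.1).
have [iN _] := sqint_nrmp s1 s2; have iO := indic_integ oO bO.
split.
  rewrite /Lp E; apply/Lfun1_integrable; apply: (le_integ me _ (integD iO iN)) => x.
  rewrite ger0_norm ?euclid_ge0// indicE; case: (pselect (Omega x)) => ox.
    rewrite mem_set// -euclid_sq; have := euclid_ge0 (w1 x, w2 x).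
    move: (euclid _) => t t0 /=; have := sqr_ge0 (t - 1); rewrite sqrrB1; lra.
  have [z1 z2] := out x ox.
  by rewrite memNset// add0r z1 z2 /euclid /nrmp /nrm2 /= expr0n /= addr0 sqrtr0.
apply: (@le_lt_trans _ _ B%:E); last exact: ltry.
apply: ge_ereal_sup => _ [phi [C1 C2 le1 ->]]; rewrite lee_fin.
have b x := enorm_component (le1 x).
apply: le_trans (var _ _ C1 C2 (fun x => (b x).1) (fun x => (b x).2)).
rewrite le_eqVlt; apply/orP; left; apply/eqP.
have f1 := C1b_supp C1.1 (support_in bO C1.2).1.
have f2 := C1b_supp C2.1 (support_in bO C2.2).1.
have mD : measurable_fun setT (fun x : mplane => 'D_e1 (fst \o phi) x + 'D_e2 (snd \o phi) x).
  apply: measurable_continuous; apply: continuousDf.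
    exact: C1b_continuous1 f1.
  exact: C1b_continuous2 f2.
rewrite Rintegral_mkcond restrictM E.
apply: Rintegral_ae.
- exact: measurable_funM me mD.
- apply: measurable_funM => //; exact: (measurable_comp2 continuous_ramp s1.1 s2.1).
apply: ae_mono ideal_ae => x /ramp_ideal /= ->.
by [].
Qed.

End conclusion.

Theorem theorem3p4 (R : realType) (Omega : set (R * R)) (L : R) (V : R -> R)
    (hOmega : bounded_domain Omega) (hL : 0 < L)
    (hV : admissible_potential V)
    (eps : nat -> R) (heps : forall n, 0 < eps n)
    (heps0 : eps n @[n --> \oo] --> (0 : R))
    (u : nat -> R * R -> R * R) (hu : forall n, H1vec Omega (u n))
    (C : R) (hE : forall n, (energy V L Omega (eps n) (u n) <= C%:E)%E) :
  exists (k : nat -> nat) (ulim : R * R -> R * R),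
    (forall m n, (m < n)%N -> (k m < k n)%N) /\
    Hdiv Omega ulim /\ ae_valued_in Omega ulim circle0 /\
    BV Omega (enorm \o ulim) /\
    ae_valued_in Omega (enorm \o ulim) [set 0; 1] /\
    Hdiv_weak_cvg Omega (u \o k) ulim /\
    L2_cvg Omega (u \o k) ulim.
Proof.
have [oO _ _ /bounded_in_square [rd bO]] := hOmega.
have [C' [M [theta [th D]]]] := energy_data_exists oO bO hL hV heps heps0 hu hE.
have [k [w1 [w2 [h [xk [s1 s2 sh] out wdiv [wg [c1 c2 id var]]]]]]] :=
  energy_compactness oO bO D heps0 th.
pose ulim (x : R * R) := (w1 x, w2 x).
have r1 : (fst \o ulim) \_ Omega = w1 by apply: restrict_id => x /out [].
have r2 : (snd \o ulim) \_ Omega = w2 by apply: restrict_id => x /out [].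
have t1 : sqint leb2 ((fst \o ulim) \_ Omega : measurableTypeR R * measurableTypeR R -> R) by rewrite r1.
have t2 : sqint leb2 ((snd \o ulim) \_ Omega : measurableTypeR R * measurableTypeR R -> R) by rewrite r2.
have su1 n := ed_u1 D n; have su2 n := ed_u2 D n; have sg n := ed_g D n.
(* As a weak limit [h] may be nonzero off [Omega]; the test functions vanish there, so its
   restriction is a divergence too. *)
have hdiv : is_weak_div Omega ulim h.
  apply/is_weak_divP; split.
    have -> : h \_ Omega = (fun x => h x * \1_Omega x); last exact: sqint_indicM.
    apply/funext => x; rewrite indicE; case: (pselect (Omega x)) => ox.
      by rewrite restrict_in// mem_set// mulr1.
    by rewrite restrict_out// memNset// mulr0.
  rewrite r1 r2 => phi Cphi; rewrite (wdiv phi Cphi); congr (- _).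
  apply: eq_Rintegral => x _; case: (pselect (Omega x)) => ox; first by rewrite restrict_in.
  have [_ cl] := support_in bO Cphi.2.
  have -> : phi x = 0; last by rewrite !mulr0.
  by apply: contrapT => /eqP /cl /Cphi.2.2.
have hd : is_weak_div Omega ulim (weak_div Omega ulim) by apply: weak_divP; exists h.
have [sd wd] := (is_weak_divP _ _ _).1 hd.
exists k, ulim; split; first exact: xk.
split; first by split; [split; apply/LpP|exists h].
have circ : ae_valued_in Omega ulim circle0.
  by apply: ae_mono id => x hx _; exact: ideal_circle0.
split; first exact: circ.
split; first exact: (BV_of_variation oO bO s1 s2 out id var).
split; first by apply: ae_mono circ => x hx ox; exact: circle0_enorm (hx ox).
split; last first.
  apply: L2_cvg_of_components => //; [by move=> n; exact: su1|by move=> n; exact: su2| |].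
    by rewrite r1; exact: c1.
  by rewrite r2; exact: c2.
move=> v [[/LpP q1 /LpP q2] /weak_divP /is_weak_divP [q3 _]].
have lim := cvgD (cvgD (sqint_weak_cvg (fun n => su1 (k n)) s1 q1 c1)
  (sqint_weak_cvg (fun n => su2 (k n)) s2 q2 c2)) (wg _ q3).
(* [weak_div] picks some representative, which agrees with [h] almost everywhere on [Omega]; the
   inner product does not see the difference. *)
have -> : Hdiv_inner Omega ulim v = ip2 leb2 w1 ((fst \o v) \_ Omega) +
    ip2 leb2 w2 ((snd \o v) \_ Omega) + ip2 leb2 h (weak_div Omega v \_ Omega).
  rewrite Hdiv_innerE// r1 r2; congr (_ + _).
  apply: Rintegral_ae.
  - exact: integ_measurable (sqintM sd q3).
  - exact: integ_measurable (sqintM sh q3).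
  rewrite r1 r2 in wd.
  apply: ae_mono (weak_div_unique oO bO sd sh wd wdiv) => x hx.
  case: (pselect (Omega x)) => ox; first by rewrite hx.
  by rewrite [(weak_div Omega v \_ Omega) x]restrict_out// !mulr0.
have E : (fun n => Hdiv_inner Omega ((u \o k) n) v) =
    (fun n => ip2 leb2 ((fst \o u (k n)) \_ Omega) ((fst \o v) \_ Omega) +
      ip2 leb2 ((snd \o u (k n)) \_ Omega) ((snd \o v) \_ Omega) +
      ip2 leb2 (weak_div Omega (u (k n)) \_ Omega) (weak_div Omega v \_ Omega)).
  by apply/funext => n; rewrite Hdiv_innerE//; [exact: su1|exact: su2|exact: sg].
rewrite E; exact: lim.
Qed.
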